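(* Let $k\ge 2$ and let $H\colon \mathbb{R}^2\to\mathbb{R}$ be a $C^\infty$-smooth (respectively, real-analytic) function having an $A_{k-1}$ singularity at the origin. Then there exists a $C^\infty$-smooth (respectively, real-analytic) local diffeomorphism $\varphi\colon(\mathbb{R}^2,0)\to(\mathbb{R}^2,0)$ preserving the canonical symplectic structure on $\mathbb{R}^2$ such that, near the origin, $$H\circ\varphi(\tilde x,\tilde\xi)=\tilde\xi^2+V(\tilde x)$$ for some $C^\infty$-smooth (respectively, real-analytic) function germ $V$ of one variable at $0$.
   Context: $\mathbb{R}^2$ has coordinates $(x,\xi)$ and canonical symplectic structure $d\xi\wedge dx$. A $C^\infty$-smooth (respectively, real-analytic) function $H$ has an $A_{k-1}$ singularity at the origin if in some $C^\infty$-smooth (respectively, real-analytic), generally non-canonical, local coordinates $(x,\xi)$ around the origin it has the form $H=\xi^2\pm x^k+\mathrm{const}$, for some choice of sign; by convention $\mathrm{const}=0$. *)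

(* Defs.v *)
From Stdlib Require Import Reals.
From Coquelicot Require Import Coquelicot.
Open Scope R_scope.

(* The pair (x, xi) : R * R is the point of R^2 with these coordinates. *)
Definition origin : R * R := (0, 0).

Inductive regularity := smooth | analytic.

(* [ex_diff_n g n x y] says that all iterated (mixed) partial derivatives of g
   of order at most n exist and are continuous at (x, y).  As [Derive] is total,
   it means "class C^n" only when required on a whole neighbourhood, whence
   [locally]. *)
Definition smooth_at2 (f : R * R -> R) (p : R * R) : Prop :=
  locally p (fun q =>
    forall n : nat, ex_diff_n (fun x y => f (x, y)) n (fst q) (snd q)).

(* f is, near p, the sum of an absolutely convergent double power series
   sum_(i,j) a i j h^i l^j; the terms are grouped by total degree i + j = n. *)
Definition analytic_at2 (f : R * R -> R) (p : R * R) : Prop :=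
  exists (a : nat -> nat -> R) (r : R), 0 < r /\
    forall h l : R, Rabs h < r -> Rabs l < r ->
      ex_series (fun n =>
        sum_n (fun i => Rabs (a i (n - i)%nat * h ^ i * l ^ (n - i))) n) /\
      is_series (fun n =>
        sum_n (fun i => a i (n - i)%nat * h ^ i * l ^ (n - i)) n)
        (f (fst p + h, snd p + l)).

Definition regular_at2 (r : regularity) : (R * R -> R) -> R * R -> Prop :=
  match r with smooth => smooth_at2 | analytic => analytic_at2 end.

Definition smooth_at1 (f : R -> R) (x : R) : Prop :=
  locally x (fun y => forall n : nat, ex_derive_n f n y).

Definition analytic_at1 (f : R -> R) (x : R) : Prop :=
  exists a : nat -> R, locally x (fun y => is_pseries a (y - x) (f y)).

Definition regular_at1 (r : regularity) : (R -> R) -> R -> Prop :=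
  match r with smooth => smooth_at1 | analytic => analytic_at1 end.

Definition regular_map_at (r : regularity) (phi : R * R -> R * R) (p : R * R)
  : Prop :=
  regular_at2 r (fun q => fst (phi q)) p /\
  regular_at2 r (fun q => snd (phi q)) p.

(* A germ at the origin of a diffeomorphism (R^2,0) -> (R^2,0), represented by
   a total map whose values far from the origin are irrelevant. *)
Definition local_diffeo (r : regularity) (phi : R * R -> R * R) : Prop :=
  phi origin = origin /\
  regular_map_at r phi origin /\
  exists psi : R * R -> R * R,
    psi origin = origin /\
    regular_map_at r psi origin /\
    locally origin (fun p => psi (phi p) = p) /\
    locally origin (fun p => phi (psi p) = p).

(* The bilinear form dxi /\ dx. *)
Definition omega (v w : R * R) : R := snd v * fst w - fst v * snd w.

Definition differential2 (f : R * R -> R) (p v : R * R) : R :=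
  Derive (fun x => f (x, snd p)) (fst p) * fst v +
  Derive (fun y => f (fst p, y)) (snd p) * snd v.

Definition tangent_map (phi : R * R -> R * R) (p v : R * R) : R * R :=
  (differential2 (fun q => fst (phi q)) p v,
   differential2 (fun q => snd (phi q)) p v).

Definition symplectic_at (phi : R * R -> R * R) (p : R * R) : Prop :=
  forall v w : R * R, omega (tangent_map phi p v) (tangent_map phi p w) = omega v w.

(* H has an A_(k-1) singularity at the origin, in the class r.  The map chi is
   the coordinate chart: chi p lists the new coordinates of the point p.  The
   additive constant of the normal form is 0 by convention. *)
Definition has_A_singularity (r : regularity) (k : nat) (H : R * R -> R) : Prop :=
  exists (chi : R * R -> R * R) (s : R),
    local_diffeo r chi /\ (s = 1 \/ s = -1) /\
    locally origin (fun p => H p = snd (chi p) ^ 2 + s * fst (chi p) ^ k).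

(* Main.v *)
Require Import Defs.
From Stdlib Require Import Reals Factorial Lra Lia ClassicalEpsilon.
From Coquelicot Require Import Coquelicot.
Open Scope R_scope.

(** Let [E = xi^2 + s x^k]. In the coordinates of the singularity the function is
    [E], but the canonical area form is [f dxi /\ dx] with some density [f] that
    vanishes nowhere. One has to find coordinates in which the form is canonical and
    [E] has the shape [xi^2 + V(x)]. If [f = z(x)] this is easy: replace [x] by a
    primitive of [z]. The general case is reduced to this one as follows.

    First, every [f] can be written as [f = z(x) + {E, h}], where [{E, h} = 2 xi
    dh/dx - s k x^(k-1) dh/dxi], see [ham]; this homological equation is solved by
    [smooth_homological] and [analytic_homological]. Secondly, the leaves of [E] are
    moved along themselves by a map which takes [z(x) dxi /\ dx] to [(z(x) + {E, h})
    dxi /\ dx]. The Hamiltonian flow of [E] is replaced by a discrete version,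
    defined by one implicit equation that conserves [E] exactly ([leaf_motion]);
    during this motion the form changes by [dE /\ dS] for an explicit primitive [S]
    ([leaf_bracket]), and each point is stopped when [S] reaches [h] ([leaf_map]).

    For the homological equation, a monomial [x^i xi^j] can be traded for a multiple
    of [x^(i+k) xi^(j-2)] by means of [h = x^(i+1) xi^(j-1)], up to constant
    factors; repeating this one arrives at a power of [x], which goes to [z], or at
    a multiple of [x^i xi], which is [{E, x^(i+1)}] up to a constant factor.
    Factorial estimates show that the solution for a convergent series converges,
    which settles the analytic case.

    In the smooth case the remainder is first made flat along the line [x = 0]: its
    leading coefficient [a(xi)] at [x = 0] is split as [a(0) + xi c(xi)], the first
    part is absorbed by [z] and the second by [h], and the corrections are damped,
    as in Borel's lemma, to have a convergent sum ([flatten_step]). For a flat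
    right-hand side the half-planes [x > 0] and [x < 0] are independent, and on each
    of them the substitution [y = x^k] is harmless and turns the leaves into
    parabolas [xi^2 + s y = H]. One then integrates along the leaves. For [s = -1]
    no leaf returns to [y <= 0], where the right-hand side vanishes, after leaving
    it, and nothing has to be corrected ([solve_open_parabolas]). For [s = 1] the
    leaves meet [y >= 0] in arcs, over which the integral has to vanish; this is
    Abel's equation for [z], which has an explicit solution ([solve_closed_arcs]).

    Smooth and analytic germs are handled in parallel: both are defined by bounds on
    all partial derivatives, without a condition in the first case and with
    majorants [c r^j j!] in the second case ([Reg]), and both satisfy the implicit
    function theorem ([implicit_function]). *)

(** * Derivatives of real functions *)

Lemma is_derive_cst (c x : R) : is_derive (fun _ => c) x 0.
Proof. apply is_derive_Reals, derivable_pt_lim_const. Qed.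

Lemma is_derive_var (x : R) : is_derive (fun y => y) x 1.
Proof. apply is_derive_Reals, derivable_pt_lim_id. Qed.

Lemma is_derive_add (f g : R -> R) x a b :
  is_derive f x a -> is_derive g x b -> is_derive (fun y => f y + g y) x (a + b).
Proof. intros. apply is_derive_Reals, derivable_pt_lim_plus; now apply is_derive_Reals. Qed.

Lemma is_derive_sub (f g : R -> R) x a b :
  is_derive f x a -> is_derive g x b -> is_derive (fun y => f y - g y) x (a - b).
Proof. intros. apply is_derive_Reals, derivable_pt_lim_minus; now apply is_derive_Reals. Qed.

Lemma is_derive_mul (f g : R -> R) x a b :
  is_derive f x a -> is_derive g x b -> is_derive (fun y => f y * g y) x (a * g x + f x * b).
Proof. intros. apply is_derive_Reals, derivable_pt_lim_mult; now apply is_derive_Reals. Qed.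

Lemma is_derive_compR (f g : R -> R) x a b :
  is_derive f (g x) a -> is_derive g x b -> is_derive (fun y => f (g y)) x (a * b).
Proof. intros. apply is_derive_Reals, (derivable_pt_lim_comp g f); now apply is_derive_Reals. Qed.

(** * Functions of four real variables and their partial derivatives *)

(** Two of the variables are the coordinates of the plane; the third one serves as a
    time, the fourth one as the unknown of an implicit equation. *)
Definition pt := (R * R * R * R)%type.

Inductive ix := X0 | X1 | X2 | X3.

Definition pr (i : ix) (p : pt) : R :=
  match i with
  | X0 => fst (fst (fst p)) | X1 => snd (fst (fst p))
  | X2 => snd (fst p) | X3 => snd p
  end.

Definition up (i : ix) (p : pt) (x : R) : pt :=
  match i with
  | X0 => (x, pr X1 p, pr X2 p, pr X3 p) | X1 => (pr X0 p, x, pr X2 p, pr X3 p)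
  | X2 => (pr X0 p, pr X1 p, x, pr X3 p) | X3 => (pr X0 p, pr X1 p, pr X2 p, x)
  end.

Definition orig : pt := (0, 0, 0, 0).

Definition box (d : R) (p : pt) : Prop := forall i, Rabs (pr i p) < d.

Definition D (i : ix) (f : pt -> R) (p : pt) : R :=
  Derive (fun x => f (up i p x)) (pr i p).

Lemma up_pr i p : up i p (pr i p) = p.
Proof. destruct p as [[[a b] c] e]; destruct i; reflexivity. Qed.

Lemma pr_up i p x : pr i (up i p x) = x.
Proof. destruct i; reflexivity. Qed.

Lemma pr_up_neq i j p x : i <> j -> pr j (up i p x) = pr j p.
Proof. destruct i, j; intros H; try reflexivity; now elim H. Qed.

Lemma up_up i p x y : up i (up i p x) y = up i p y.
Proof. destruct i; reflexivity. Qed.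

Lemma up_comm i j p x y : i <> j -> up i (up j p y) x = up j (up i p x) y.
Proof. destruct i, j; intros H; try reflexivity; now elim H. Qed.

Lemma ix_dec (i j : ix) : {i = j} + {i <> j}.
Proof. decide equality. Qed.

Lemma box_up d i p x : box d p -> Rabs x < d -> box d (up i p x).
Proof.
  intros H Hx j. destruct (ix_dec i j) as [<-|n].
  - now rewrite pr_up.
  - rewrite pr_up_neq; auto.
Qed.

Lemma box_le d d' p : d <= d' -> box d p -> box d' p.
Proof. intros H Hp i. specialize (Hp i). lra. Qed.

Lemma box_orig d : 0 < d -> box d orig.
Proof. intros H i. destruct i; simpl; rewrite Rabs_R0; exact H. Qed.

Lemma box_tuple d a b c e :
  Rabs a < d -> Rabs b < d -> Rabs c < d -> Rabs e < d -> box d (a, b, c, e).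
Proof. intros Ha Hb Hc He i; destruct i; assumption. Qed.

Lemma continuous_pair {U V W : UniformSpace} (f : U -> V) (g : U -> W) x :
  continuous f x -> continuous g x -> continuous (fun y => (f y, g y)) x.
Proof.
  intros Hf Hg. apply filterlim_locally. intros eps.
  generalize (proj1 (filterlim_locally _ _) Hf eps) (proj1 (filterlim_locally _ _) Hg eps).
  intros H1 H2. generalize (filter_and _ _ H1 H2). apply filter_imp. now intros y [A B]; split.
Qed.

Lemma continuous_tuple {U : UniformSpace} (a b c e : U -> R) x :
  continuous a x -> continuous b x -> continuous c x -> continuous e x ->
  continuous (fun y => (a y, b y, c y, e y)) x.
Proof. intros. repeat apply continuous_pair; assumption. Qed.

Lemma continuous_pr i p : continuous (pr i) p.
Proof.
  destruct p as [[[a b] c] e]. destruct i; simpl.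
  - apply (continuous_comp (fun p : pt => fst (fst p)) fst); [|apply continuous_fst].
    apply (continuous_comp (fun p : pt => fst p) fst); apply continuous_fst.
  - apply (continuous_comp (fun p : pt => fst (fst p)) snd); [|apply continuous_snd].
    apply (continuous_comp (fun p : pt => fst p) fst); apply continuous_fst.
  - apply (continuous_comp (fun p : pt => fst p) snd); [apply continuous_fst|apply continuous_snd].
  - apply continuous_snd.
Qed.

Lemma continuous_up i p x : continuous (up i p) x.
Proof.
  destruct i; simpl; apply continuous_tuple;
    (apply continuous_id || apply continuous_const).
Qed.

Lemma locally_box d p : box d p -> locally p (box d).
Proof.
  intros H.
  assert (L : forall i, locally p (fun q => Rabs (pr i q) < d)).
  { intros i. apply (continuous_comp (pr i) Rabs p (continuous_pr i p)
      (continuous_Rabs _) (fun y => y < d)).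
    apply (open_lt d). apply H. }
  generalize (filter_and _ _ (filter_and _ _ (L X0) (L X1)) (filter_and _ _ (L X2) (L X3))).
  apply filter_imp. intros q [[A B] [C' E']] i; destruct i; assumption.
Qed.

Lemma locally_box_curve {U : UniformSpace} d (g : U -> pt) x :
  continuous g x -> box d (g x) -> locally x (fun y => box d (g y)).
Proof. intros Hg H. exact (Hg _ (locally_box d _ H)). Qed.

Lemma locally_box_up d i p :
  box d p -> locally (pr i p) (fun x => box d (up i p x)).
Proof.
  intros H. apply locally_box_curve; [apply continuous_up|]. now rewrite up_pr.
Qed.

Lemma small_box P : locally orig P -> exists d, 0 < d /\ forall p, box d p -> P p.
Proof.
  intros [eps H]. exists eps. split; [apply cond_pos|].
  intros p Hp. apply H.
  assert (B : forall i, ball 0 eps (pr i p)).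
  { intros i. unfold ball; simpl; unfold AbsRing_ball, abs, minus, plus, opp; simpl.
    rewrite Ropp_0, Rplus_0_r. apply Hp. }
  exact (conj (conj (conj (B X0) (B X1)) (B X2)) (B X3)).
Qed.

Lemma D_ext d f g i p :
  (forall q, box d q -> f q = g q) -> box d p -> D i f p = D i g p.
Proof.
  intros H Hp. apply Derive_ext_loc.
  generalize (locally_box_up d i p Hp). apply filter_imp. intros x Hx. now apply H.
Qed.

(** ** Bounded differentiability of finite order *)

(** Smoothness and analyticity are both expressed through this predicate, so that
    each closure property is proved by one induction on [n] for the two classes.
    Analytic functions are those with [b = true] and majorants [M j] of the
    derivatives of order [j] that grow like [r^j j!]. *)
Fixpoint Bd (b : bool) (d : R) (M : nat -> R) (n : nat) (f : pt -> R) : Prop :=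
  (forall p, box d p -> continuous f p /\ (b = true -> Rabs (f p) <= M 0%nat)) /\
  match n with
  | O => True
  | S n => forall i,
      (forall p, box d p -> ex_derive (fun x => f (up i p x)) (pr i p)) /\
      Bd b d (fun j => M (S j)) n (D i f)
  end.

Lemma Bd_ext b d n : forall M f g,
  (forall p, box d p -> f p = g p) -> Bd b d M n f -> Bd b d M n g.
Proof.
  induction n as [|n IH]; intros M f g E [H0 H]; split; auto.
  1, 2: intros p Hp; destruct (H0 p Hp) as [C B]; split;
    [ apply (continuous_ext_loc _ f);
      [generalize (locally_box d p Hp); apply filter_imp; auto | exact C]
    | rewrite <- E; auto ].
  intros i. destruct (H i) as [A B]. split.
  - intros p Hp. generalize (A p Hp). apply ex_derive_ext_loc.
    generalize (locally_box_up d i p Hp). apply filter_imp. auto.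
  - apply (IH _ (D i f)); auto. intros p Hp. now apply (D_ext d).
Qed.

Lemma Bd_intro b d M n f (f' : ix -> pt -> R) :
  (forall p, box d p -> continuous f p) ->
  (b = true -> forall p, box d p -> Rabs (f p) <= M 0%nat) ->
  (forall i p, box d p -> is_derive (fun x => f (up i p x)) (pr i p) (f' i p)) ->
  (forall i, Bd b d (fun j => M (S j)) n (f' i)) ->
  Bd b d M (S n) f.
Proof.
  intros Hc Hb Hd HS. split; [split; auto|]. intros i. split.
  - intros p Hp. eexists. now apply Hd.
  - apply (Bd_ext b d n _ (f' i)); auto. intros p Hp. symmetry.
    now apply is_derive_unique, Hd.
Qed.

Lemma Bd_le b d M M' n f :
  (forall j, M j <= M' j) -> Bd b d M n f -> Bd b d M' n f.
Proof.
  revert M M' f. induction n as [|n IH]; intros M M' f E [H0 H]; split; auto.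
  1, 2: intros p Hp; destruct (H0 p Hp) as [C B]; split; auto;
    intros T; generalize (B T) (E 0%nat); lra.
  intros i. destruct (H i) as [A B]. split; auto. apply (IH (fun j => M (S j))); auto.
Qed.

Lemma Bd_box b d d' M n f : d' <= d -> Bd b d M n f -> Bd b d' M n f.
Proof.
  intros L. revert M f. induction n as [|n IH]; intros M f [H0 H]; split; auto.
  1, 2: intros p Hp; apply H0; now apply (box_le d').
  intros i. destruct (H i) as [A B]. split; auto. intros p Hp. apply A.
  now apply (box_le d').
Qed.

Lemma Bd_down b d M n f : Bd b d M (S n) f -> Bd b d M n f.
Proof.
  revert M f. induction n as [|n IH]; intros M f [H0 H]; split; auto.
  intros i. destruct (H i) as [A B]. split; auto.
Qed.

Lemma Bd_forget b d M M' n f : Bd b d M n f -> Bd false d M' n f.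
Proof.
  revert M M' f. induction n as [|n IH]; intros M M' f [H0 H]; split; auto.
  1, 2: intros p Hp; destruct (H0 p Hp); split; auto; discriminate.
  intros i. destruct (H i) as [A B]. split; eauto.
Qed.

Lemma Bd_cont b d M n f p : Bd b d M n f -> box d p -> continuous f p.
Proof. destruct n; intros [H _] Hp; now apply H. Qed.

Lemma Bd_bound d M n f p : Bd true d M n f -> box d p -> Rabs (f p) <= M 0%nat.
Proof. destruct n; intros [H _] Hp; now apply H. Qed.

Lemma Bd_deriv b d M n f i p :
  Bd b d M (S n) f -> box d p ->
  is_derive (fun x => f (up i p x)) (pr i p) (D i f p).
Proof. intros [_ H] Hp. apply Derive_correct. now apply H. Qed.

Lemma Bd_D b d M n f i : Bd b d M (S n) f -> Bd b d (fun j => M (S j)) n (D i f).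
Proof. intros [_ H]. apply H. Qed.

Lemma Bd_const b d M n c :
  Rabs c <= M 0%nat -> (forall j, 0 <= M j) -> Bd b d M n (fun _ => c).
Proof.
  revert M c. induction n as [|n IH]; intros M c H0 HM.
  - split; auto. intros p _. split; auto. apply continuous_const.
  - apply (Bd_intro _ _ _ _ _ (fun _ _ => 0)); auto.
    + intros p _. apply continuous_const.
    + intros i p _. apply is_derive_cst.
    + intros i. apply IH; auto. rewrite Rabs_R0. apply HM.
Qed.

Definition delta (i j : ix) : R := if ix_dec i j then 1 else 0.

Lemma is_derive_pr i j p : is_derive (fun x => pr i (up j p x)) (pr j p) (delta i j).
Proof.
  unfold delta. destruct (ix_dec i j) as [->|n].
  - apply (is_derive_ext (fun x => x)); [intros; now rewrite pr_up|].
    apply is_derive_var.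
  - apply (is_derive_ext (fun x => pr i p)).
    + intros; rewrite pr_up_neq; auto.
    + apply is_derive_cst.
Qed.

Lemma Bd_pr b d M n i :
  d <= M 0%nat -> 1 <= M 1%nat -> (forall j, 0 <= M j) -> Bd b d M n (pr i).
Proof.
  intros H0 H1 HM. destruct n as [|n].
  - split; auto. intros p Hp; split; [apply continuous_pr|intros _; specialize (Hp i); lra].
  - apply (Bd_intro _ _ _ _ _ (fun j _ => delta i j)).
    + intros p _. apply continuous_pr.
    + intros _ p Hp. specialize (Hp i); lra.
    + intros j p _. apply is_derive_pr.
    + intros j. apply Bd_const; auto. unfold delta.
      destruct ix_dec; rewrite ?Rabs_R1, ?Rabs_R0; auto; lra.
Qed.

Lemma Bd_plus b d n : forall M N f g, Bd b d M n f -> Bd b d N n g ->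
  Bd b d (fun j => M j + N j) n (fun p => f p + g p).
Proof.
  induction n as [|n IH]; intros M N f g Hf Hg.
  - split; auto. intros p Hp. split.
    + apply (continuous_plus f g); eapply Bd_cont; eauto.
    + intros ->. eapply Rle_trans; [apply Rabs_triang|].
      generalize (Bd_bound _ _ _ _ _ Hf Hp) (Bd_bound _ _ _ _ _ Hg Hp); lra.
  - apply (Bd_intro _ _ _ _ _ (fun i p => D i f p + D i g p)).
    + intros p Hp. apply (continuous_plus f g); eapply Bd_cont; eauto.
    + intros -> p Hp. eapply Rle_trans; [apply Rabs_triang|].
      generalize (Bd_bound _ _ _ _ _ Hf Hp) (Bd_bound _ _ _ _ _ Hg Hp); lra.
    + intros i p Hp. apply is_derive_add; eapply Bd_deriv; eauto.
    + intros i. apply (IH (fun j => M (S j)) (fun j => N (S j))); now apply Bd_D.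
Qed.

(** The Leibniz majorant of a product, in the recursive form in which the induction of
    [Bd_mult] meets it; [conv_sum] is the closed form. *)
Fixpoint conv (M N : nat -> R) (n : nat) : R :=
  match n with
  | O => M 0%nat * N 0%nat
  | S n => conv (fun j => M (S j)) N n + conv M (fun j => N (S j)) n
  end.

Lemma Bd_mult b d n : forall M N f g, Bd b d M n f -> Bd b d N n g ->
  Bd b d (conv M N) n (fun p => f p * g p).
Proof.
  assert (B0 : forall n M N f g p, b = true -> Bd b d M n f -> Bd b d N n g ->
    box d p -> Rabs (f p * g p) <= M 0%nat * N 0%nat).
  { intros m M N f g p -> Hf Hg Hp. rewrite Rabs_mult.
    apply Rmult_le_compat; auto using Rabs_pos; eapply Bd_bound; eauto. }
  induction n as [|n IH]; intros M N f g Hf Hg.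
  - split; auto. intros p Hp. split.
    + apply (continuous_mult f g); eapply Bd_cont; eauto.
    + intros T. eapply B0; eauto.
  - apply (Bd_intro _ _ _ _ _ (fun i p => D i f p * g p + f p * D i g p)).
    + intros p Hp. apply (continuous_mult f g); eapply Bd_cont; eauto.
    + intros T p Hp. simpl. eapply B0; eauto.
    + intros i p Hp.
      generalize (Bd_deriv _ _ _ _ _ i p Hf Hp) (Bd_deriv _ _ _ _ _ i p Hg Hp).
      intros A B.
      replace (D i f p * g p + f p * D i g p)
        with (D i f p * g (up i p (pr i p)) + f (up i p (pr i p)) * D i g p)
        by now rewrite up_pr.
      now apply (is_derive_mul (fun x => f (up i p x)) (fun x => g (up i p x))).
    + intros i. simpl. apply Bd_plus; apply IH; auto using Bd_D, Bd_down.
Qed.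

Lemma Bd_scal b d n c : forall M f, Bd b d M n f ->
  Bd b d (fun j => Rabs c * M j) n (fun p => c * f p).
Proof.
  assert (B0 : forall n M f p, b = true -> Bd b d M n f -> box d p ->
    Rabs (c * f p) <= Rabs c * M 0%nat).
  { intros m M f p -> Hf Hp. rewrite Rabs_mult.
    apply Rmult_le_compat_l; auto using Rabs_pos; eapply Bd_bound; eauto. }
  induction n as [|n IH]; intros M f Hf.
  - split; auto. intros p Hp. split; [|intros T; eapply B0; eauto].
    apply (continuous_mult (fun _ => c) f); [apply continuous_const|eapply Bd_cont; eauto].
  - apply (Bd_intro _ _ _ _ _ (fun i p => c * D i f p)).
    + intros p Hp. apply (continuous_mult (fun _ => c) f);
        [apply continuous_const|eapply Bd_cont; eauto].
    + intros T p Hp. eapply B0; eauto.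
    + intros i p Hp. apply (is_derive_scal (fun x => f (up i p x))). eapply Bd_deriv; eauto.
    + intros i. apply (IH (fun j => M (S j))). now apply Bd_D.
Qed.

Lemma Bd_opp b d M n f : Bd b d M n f -> Bd b d M n (fun p => - f p).
Proof.
  intros H. apply (Bd_ext b d n _ (fun p => (-1) * f p)); [intros; ring|].
  apply (Bd_le b d (fun j => Rabs (-1) * M j)); [|now apply Bd_scal].
  intros j. rewrite (Rabs_left (-1)); lra.
Qed.

Lemma Bd_minus b d n M N f g : Bd b d M n f -> Bd b d N n g ->
  Bd b d (fun j => M j + N j) n (fun p => f p - g p).
Proof. intros; apply Bd_plus; auto using Bd_opp. Qed.

(** ** The chain rule *)

(** One inner function at a time is made variable, so that the chain rule in four
    variables reduces to the differentiability of functions of two variables. *)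
Lemma chain_step (G dG : R -> R -> R) (a : R -> R) x a' l :
  locally (a x, x) (fun u : R * R => is_derive (fun z => G z (snd u)) (fst u) (dG (fst u) (snd u))) ->
  continuous (fun u : R * R => dG (fst u) (snd u)) (a x, x) ->
  is_derive a x a' -> is_derive (fun v => G (a x) v) x l ->
  is_derive (fun v => G (a v) v) x (dG (a x) x * a' + l).
Proof.
  intros H1 H2 Ha Hl.
  generalize (is_derive_filterdiff G (a x) x dG l H1 Hl H2). intros F.
  assert (E := filterdiff_comp'_2 (T := R_NormedModule) (U := R_NormedModule)
    (V := R_NormedModule) (W := R_NormedModule) a (fun v => v) G x
    (fun y => scal y a') (fun y => y)
    (fun u v => plus (scal u (dG (a x) x)) (scal v l)) Ha
    (filterdiff_id (V := R_NormedModule) (locally x)) F).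
  unfold is_derive. eapply filterdiff_ext_lin; [exact E|].
  intros y. unfold plus, scal; simpl; unfold mult; simpl. ring.
Qed.

Definition C1 (d : R) (f : pt -> R) : Prop := forall i p, box d p ->
  is_derive (fun x => f (up i p x)) (pr i p) (D i f p) /\ continuous (D i f) p.

Lemma Bd_C1 b d M n f : Bd b d M (S n) f -> C1 d f.
Proof.
  intros H i p Hp. split; [eapply Bd_deriv; eauto|].
  apply Bd_D with (i := i) in H. eapply Bd_cont; eauto.
Qed.

Lemma chain_rule d f (a b c e : R -> R) x a' b' c' e' :
  C1 d f -> box d (a x, b x, c x, e x) ->
  is_derive a x a' -> is_derive b x b' -> is_derive c x c' -> is_derive e x e' ->
  let P := (a x, b x, c x, e x) in
  is_derive (fun v => f (a v, b v, c v, e v)) x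
    (D X0 f P * a' + (D X1 f P * b' + (D X2 f P * c' + D X3 f P * e'))).
Proof.
  intros HC HP Ha Hb Hc He P.
  assert (Ca : continuous a x) by (apply (ex_derive_continuous a); eexists; eauto).
  assert (Cb : continuous b x) by (apply (ex_derive_continuous b); eexists; eauto).
  assert (Cc : continuous c x) by (apply (ex_derive_continuous c); eexists; eauto).
  assert (Ce : continuous e x) by (apply (ex_derive_continuous e); eexists; eauto).
  assert (K : forall (i : ix) (m : R * R -> pt) u0,
    continuous m u0 -> box d (m u0) ->
    locally u0 (fun u => is_derive (fun z => f (up i (m u) z)) (pr i (m u)) (D i f (m u)))
    /\ continuous (fun u => D i f (m u)) u0).
  { intros i m u0 Hm Hb0. split.
    - generalize (locally_box_curve d m u0 Hm Hb0). apply filter_imp.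
      intros u Hu. now apply HC.
    - apply (continuous_comp m (D i f)); auto. now apply HC. }
  assert (Cf : forall u : R * R, continuous (fun u : R * R => fst u) u)
    by (intros [? ?]; apply continuous_fst).
  assert (Cs : forall (g : R -> R) y, continuous g x ->
    continuous (fun u : R * R => g (snd u)) (y, x)).
  { intros g y Hg. apply (continuous_comp (fun u : R * R => snd u) g); auto.
    apply continuous_snd. }
  assert (Ck : forall (r : R) (u : R * R), continuous (fun _ : R * R => r) u)
    by (intros; apply continuous_const).
  destruct (K X0 (fun u => (fst u, b (snd u), c (snd u), e (snd u))) (a x, x)) as [L0 M0];
    [apply continuous_tuple; auto|exact HP|].
  apply (chain_step (fun u v => f (u, b v, c v, e v))
    (fun u v => D X0 f (u, b v, c v, e v))); auto.
  destruct (K X1 (fun u => (a x, fst u, c (snd u), e (snd u))) (b x, x)) as [L1 M1];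
    [apply continuous_tuple; auto|exact HP|].
  apply (chain_step (fun u v => f (a x, u, c v, e v))
    (fun u v => D X1 f (a x, u, c v, e v))); auto.
  destruct (K X2 (fun u => (a x, b x, fst u, e (snd u))) (c x, x)) as [L2 M2];
    [apply continuous_tuple; auto|exact HP|].
  apply (chain_step (fun u v => f (a x, b x, u, e v))
    (fun u v => D X2 f (a x, b x, u, e v))); auto.
  rewrite Rmult_comm.
  apply (is_derive_comp (fun v => f (a x, b x, c x, v)) e); auto.
  apply (HC X3 P HP).
Qed.

(** ** Factorial majorants *)

(** The shift [q] counts the derivatives already taken, see [shape_S]. *)
Definition shape (c r : R) (q j : nat) : R := c * r ^ j * INR (fact (j + q)).

Lemma shape_S c r q j : shape c r q (S j) = shape (c * r) r (S q) j.
Proof. unfold shape. simpl pow. replace (j + S q)%nat with (S j + q)%nat by lia. ring. Qed.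

Lemma fact_pos n : 0 < INR (fact n).
Proof. apply INR_fact_lt_0. Qed.

Lemma INR_le_pow2 n : INR (S n) <= 2 ^ n.
Proof.
  induction n as [|n IH]; [simpl; lra|]. rewrite S_INR. simpl pow.
  assert (1 <= 2 ^ n) by (apply pow_R1_Rle; lra). lra.
Qed.

Lemma shape_pos c r q j : 0 <= c -> 0 <= r -> 0 <= shape c r q j.
Proof.
  intros. unfold shape. apply Rmult_le_pos; [apply Rmult_le_pos; auto using pow_le|].
  left. apply fact_pos.
Qed.

Lemma shape_le c c' r r' q q' j : 0 <= c <= c' -> 0 <= r <= r' -> (q <= q')%nat ->
  shape c r q j <= shape c' r' q' j.
Proof.
  intros Hc Hr Hq. unfold shape. apply Rmult_le_compat.
  - apply Rmult_le_pos; [lra|apply pow_le; lra].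
  - left; apply fact_pos.
  - apply Rmult_le_compat; try lra. apply pow_le; lra. now apply pow_incr.
  - apply le_INR, fact_le. lia.
Qed.

Lemma conv_sum n : forall M N,
  conv M N n = sum_f_R0 (fun j => Binomial.C n j * (M (n - j)%nat * N j)) n.
Proof.
  assert (Z : forall (u v : nat -> R) m, sum_f_R0 (fun j => u j + v j) m =
    sum_f_R0 u m + sum_f_R0 v m) by (intros; apply sum_plus).
  induction n as [|n IH]; intros M N.
  - simpl. unfold Binomial.C; simpl. field.
  - simpl conv. rewrite !IH.
    assert (C0 : forall m, Binomial.C m 0 = 1).
    { intros m. unfold Binomial.C. rewrite Nat.sub_0_r. simpl. field. apply INR_fact_neq_0. }
    assert (Cn : forall m, Binomial.C m m = 1).
    { intros m. unfold Binomial.C. rewrite Nat.sub_diag. simpl. field. apply INR_fact_neq_0. }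
    destruct n as [|n].
    { simpl. rewrite !C0, (Cn 1%nat). ring. }
    cbv beta.
    rewrite (tech5 (fun j => Binomial.C (S (S n)) j * (M (S (S n) - j)%nat * N j)) (S n)).
    rewrite (decomp_sum (fun j => Binomial.C (S (S n)) j * (M (S (S n) - j)%nat * N j)) (S n))
      by lia.
    rewrite (decomp_sum (fun j => Binomial.C (S n) j * (M (S (S n - j)) * N j)) (S n)) by lia.
    rewrite (tech5 (fun j => Binomial.C (S n) j * (M (S n - j)%nat * N (S j))) n).
    simpl pred. rewrite !C0, !Cn.
    rewrite !Nat.sub_0_r, !Nat.sub_diag.
    rewrite (sum_eq (fun i => Binomial.C (S (S n)) (S i) * (M (S (S n) - S i)%nat * N (S i)))
      (fun i => Binomial.C (S n) (S i) * (M (S (S n - S i)) * N (S i)) +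
                Binomial.C (S n) i * (M (S n - i)%nat * N (S i))) n).
    + rewrite Z. ring.
    + intros i Hi. rewrite <- (pascal (S n) i) by lia.
      replace (S (S n) - S i)%nat with (S n - i)%nat by lia.
      replace (S (S n - S i)) with (S n - i)%nat by lia. ring.
Qed.

Lemma fact_shift n q j : (j <= n)%nat ->
  Binomial.C n j * (INR (fact (n - j + q)) * INR (fact j)) <= INR (fact (n + q)).
Proof.
  intros H. unfold Binomial.C.
  replace (INR (fact n) / (INR (fact j) * INR (fact (n - j))) *
    (INR (fact (n - j + q)) * INR (fact j)))
    with (INR (fact n) * INR (fact (n - j + q)) / INR (fact (n - j)))
    by (field; split; apply INR_fact_neq_0).
  apply Rle_div_l; [apply fact_pos|].
  rewrite <- !mult_INR. apply le_INR.
  assert (E : forall a b c, (b <= a)%nat ->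
    (fact a * fact (b + c) <= fact (a + c) * fact b)%nat).
  { clear. intros a b c H. induction c as [|c IH].
    - rewrite !Nat.add_0_r. lia.
    - rewrite !Nat.add_succ_r. change (fact (S (b + c))) with (S (b + c) * fact (b + c))%nat.
      change (fact (S (a + c))) with (S (a + c) * fact (a + c))%nat. nia. }
  apply E; lia.
Qed.

(** Halving the rate of the second factor turns the Leibniz sum into a geometric
    one, so that multiplication costs only a constant and keeps the rate. *)
Lemma conv_shape a b r s q n : 0 <= a -> 0 <= b -> 0 <= r -> 2 * r <= s ->
  conv (shape a s q) (shape b r 0) n <= shape (2 * a * b) s q n.
Proof.
  intros Ha Hb Hr Hs. rewrite conv_sum.
  apply Rle_trans with (sum_f_R0 (fun j => (/ 2) ^ j * (a * b * s ^ n * INR (fact (n + q)))) n).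
  - apply sum_Rle. intros j Hj. unfold shape. rewrite Nat.add_0_r.
    replace (Binomial.C n j * (a * s ^ (n - j) * INR (fact (n - j + q)) * (b * r ^ j * INR (fact j))))
      with ((a * b * (s ^ (n - j) * r ^ j)) *
            (Binomial.C n j * (INR (fact (n - j + q)) * INR (fact j)))) by ring.
    replace ((/ 2) ^ j * (a * b * s ^ n * INR (fact (n + q))))
      with ((a * b * (s ^ n * (/ 2) ^ j)) * INR (fact (n + q))) by ring.
    apply Rmult_le_compat.
    + repeat apply Rmult_le_pos; auto; apply pow_le; lra.
    + repeat apply Rmult_le_pos; try (left; apply fact_pos).
      left. apply Rinv_0_lt_compat, Rmult_lt_0_compat; apply fact_pos.
    + apply Rmult_le_compat_l; [now apply Rmult_le_pos|].
      replace n with (n - j + j)%nat at 2 by lia. rewrite pow_add, Rmult_assoc.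
      apply Rmult_le_compat_l; [apply pow_le; lra|].
      rewrite <- Rpow_mult_distr. apply pow_incr. lra.
    + now apply fact_shift.
  - rewrite <- scal_sum. rewrite tech3 by lra. unfold shape.
    assert (G : (1 - (/ 2) ^ S n) / (1 - / 2) <= 2).
    { assert (0 < (/ 2) ^ S n) by (apply pow_lt; lra). lra. }
    assert (0 <= a * b * s ^ n * INR (fact (n + q))).
    { repeat apply Rmult_le_pos; auto; [apply pow_le; lra|left; apply fact_pos]. }
    nra.
Qed.

(** ** Composition *)

Lemma Bd_shape_S b d c r q n f i :
  Bd b d (shape c r q) (S n) f -> Bd b d (shape (c * r) r (S q)) n (D i f).
Proof.
  intros H. apply Bd_D with (i := i) in H. revert H. apply Bd_le. intros j.
  rewrite shape_S. lra.
Qed.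

(** As [j + 1 <= 2^j], a shift of the factorial costs a factor [2] in the rate. *)
Lemma Bd_shape_0 b d c r n f : 0 <= c -> 0 <= r ->
  Bd b d (shape c r 1) n f -> Bd b d (shape c (2 * r) 0) n f.
Proof.
  intros Hc Hr. apply Bd_le. intros m. unfold shape. rewrite Nat.add_0_r, Nat.add_1_r.
  change (fact (S m)) with (S m * fact m)%nat. rewrite mult_INR, Rpow_mult_distr.
  replace (c * r ^ m * (INR (S m) * INR (fact m)))
    with ((c * r ^ m * INR (fact m)) * INR (S m)) by ring.
  replace (c * (2 ^ m * r ^ m) * INR (fact m))
    with ((c * r ^ m * INR (fact m)) * 2 ^ m) by ring.
  apply Rmult_le_compat_l; [|apply INR_le_pow2].
  apply Rmult_le_pos; [|left; apply fact_pos].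
  apply Rmult_le_pos; auto. now apply pow_le.
Qed.

(** The chain rule expresses each derivative of [f o g] through derivatives of
    [f] composed with [g]; the parameter [q] records how many times [f] has
    already been differentiated. *)
Lemma Bd_comp b d d' r s K n : 0 <= r -> 0 <= K -> 0 <= s ->
  forall c q f (g0 g1 g2 g3 : pt -> R), 0 <= c ->
  (forall p, box d' p -> box d (g0 p, g1 p, g2 p, g3 p)) ->
  Bd b d (shape c r q) n f ->
  Bd b d' (shape K s 0) n g0 -> Bd b d' (shape K s 0) n g1 ->
  Bd b d' (shape K s 0) n g2 -> Bd b d' (shape K s 0) n g3 ->
  Bd b d' (shape c (4 * s + 16 * K * s * r) q) n (fun p => f (g0 p, g1 p, g2 p, g3 p)).
Proof.
  intros Hr HK Hs. set (t := 4 * s + 16 * K * s * r).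
  assert (HKsr : 0 <= K * s * r) by (repeat apply Rmult_le_pos; auto).
  assert (Ht : 4 * s <= t) by (unfold t; nra).
  induction n as [|n IH]; intros c q f g0 g1 g2 g3 Hc Hbox Hf H0 H1 H2 H3.
  - split; auto. intros p Hp. split.
    + apply (continuous_comp (fun p => (g0 p, g1 p, g2 p, g3 p)) f).
      * apply continuous_tuple; eapply Bd_cont; eauto.
      * eapply Bd_cont; eauto.
    + intros ->. exact (Bd_bound _ _ _ _ _ Hf (Hbox p Hp)).
  - set (T := fun i (g : pt -> R) p => D i f (g0 p, g1 p, g2 p, g3 p) * g p).
    apply (Bd_intro _ _ _ _ _ (fun i p => T X0 (D i g0) p +
      (T X1 (D i g1) p + (T X2 (D i g2) p + T X3 (D i g3) p)))).
    + intros p Hp. apply (continuous_comp (fun p => (g0 p, g1 p, g2 p, g3 p)) f).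
      * apply continuous_tuple; eapply Bd_cont; eauto.
      * eapply Bd_cont; eauto.
    + intros -> p Hp. exact (Bd_bound _ _ _ _ _ Hf (Hbox p Hp)).
    + intros i p Hp. unfold T. generalize (Hbox p Hp). rewrite <- (up_pr i p) at 1 2 3 4 5 6 7 8.
      intros Hb.
      generalize (chain_rule d f (fun x => g0 (up i p x)) (fun x => g1 (up i p x))
        (fun x => g2 (up i p x)) (fun x => g3 (up i p x)) (pr i p) _ _ _ _
        (Bd_C1 _ _ _ _ _ Hf) Hb
        (Bd_deriv _ _ _ _ _ i p H0 Hp) (Bd_deriv _ _ _ _ _ i p H1 Hp)
        (Bd_deriv _ _ _ _ _ i p H2 Hp) (Bd_deriv _ _ _ _ _ i p H3 Hp)).
      simpl. rewrite !up_pr. auto.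
    + intros i.
      assert (U : forall j g, Bd b d' (shape K s 0) (S n) g ->
        Bd b d' (shape (4 * (c * r) * (K * s)) t (S q)) n (T j (D i g))).
      { intros j g Hg. apply (Bd_le b d' (conv (shape (c * r) t (S q)) (shape (K * s) (2 * s) 0))).
        - intros m. assert (0 <= c * r * (K * s)) by (repeat apply Rmult_le_pos; auto).
          assert (0 <= c * r) by now apply Rmult_le_pos.
          assert (0 <= K * s) by now apply Rmult_le_pos.
          apply Rle_trans with (shape (2 * (c * r) * (K * s)) t (S q) m).
          + apply conv_shape; lra.
          + apply shape_le; auto; lra.
        - unfold T. apply Bd_mult.
          + apply IH; auto using Bd_down; [now apply Rmult_le_pos|now apply Bd_shape_S].
          + apply Bd_shape_0; [now apply Rmult_le_pos|auto|]. now apply Bd_shape_S. }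
      eapply Bd_le; [|apply Bd_plus; [exact (U X0 _ H0)|apply Bd_plus; [exact (U X1 _ H1)|
        apply Bd_plus; [exact (U X2 _ H2)|exact (U X3 _ H3)]]]].
      intros j. simpl. rewrite shape_S.
      set (u := shape (4 * (c * r) * (K * s)) t (S q) j).
      apply Rle_trans with (4 * u); [lra|]. unfold u, shape.
      replace (4 * (4 * (c * r) * (K * s) * t ^ j * INR (fact (j + S q))))
        with ((16 * (c * r) * (K * s)) * (t ^ j * INR (fact (j + S q)))) by ring.
      rewrite (Rmult_assoc (c * t)).
      apply Rmult_le_compat_r.
      { apply Rmult_le_pos; [apply pow_le; nra|left; apply fact_pos]. }
      unfold t. nra.
Qed.

(** ** Primitives along a coordinate *)

Definition prim (i : ix) (f : pt -> R) (p : pt) : R :=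
  RInt (fun x => f (up i p x)) 0 (pr i p).

Lemma ball_pt (p q : pt) (e : posreal) :
  (forall i, Rabs (pr i q - pr i p) < e) <-> ball p e q.
Proof.
  split.
  - intros H. exact (conj (conj (conj (H X0) (H X1)) (H X2)) (H X3)).
  - intros [[[A B] C'] E'] i. destruct i; assumption.
Qed.

Lemma continuous_eps (f : pt -> R) p : continuous f p ->
  forall e : posreal, exists d : posreal, forall q,
  (forall i, Rabs (pr i q - pr i p) < d) -> Rabs (f q - f p) < e.
Proof.
  intros H e. destruct (proj1 (filterlim_locally _ _) H e) as [d Hd].
  exists d. intros q Hq. apply Hd. now apply ball_pt.
Qed.

Lemma eps_continuous (f : pt -> R) p :
  (forall e : posreal, exists d : posreal, forall q,
  (forall i, Rabs (pr i q - pr i p) < d) -> Rabs (f q - f p) < e) -> continuous f p.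
Proof.
  intros H. apply filterlim_locally. intros e. destruct (H e) as [d Hd].
  exists d. intros q Hq. apply Hd. now apply ball_pt.
Qed.

(** Uniform continuity transversally to a compact segment. *)
Lemma segment_uniform f i p A B : A <= B ->
  (forall x, A <= x <= B -> continuous f (up i p x)) ->
  forall e : posreal, exists d : posreal, forall q,
  (forall j, Rabs (pr j q - pr j p) < d) -> forall x, A <= x <= B ->
  Rabs (f (up i q x) - f (up i p x)) < e.
Proof.
  intros AB Hf e. assert (He : 0 < e / 2) by (generalize (cond_pos e); lra).
  assert (Ch : forall x, {d : posreal | A <= x <= B -> forall q,
    (forall j, Rabs (pr j q - pr j (up i p x)) < d) -> Rabs (f q - f (up i p x)) < e / 2}).
  { intros x. apply constructive_indefinite_description.
    destruct (classic (A <= x <= B)) as [Hx|Hx].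
    - destruct (continuous_eps f _ (Hf x Hx) (mkposreal _ He)) as [d Hd]. now exists d.
    - exists (mkposreal 1 Rlt_0_1). tauto. }
  destruct (compactness_value_1d A B (fun x => mkposreal _ (is_pos_div_2 (proj1_sig (Ch x)))))
    as [d Hd].
  exists d. intros q Hq x Hx. apply NNPP. intros N. apply (Hd x Hx). intros [t [Ht [H1 H2]]].
  simpl in H1, H2. apply N. clear N Hd. destruct (Ch t) as [dt Hdt]. simpl in *.
  specialize (Hdt Ht).
  assert (K : forall r, (forall j, Rabs (pr j r - pr j p) < d) ->
    Rabs (f (up i r x) - f (up i p t)) < e / 2).
  { intros r Hr. apply Hdt. intros j. destruct (ix_dec i j) as [<-|n].
    - rewrite !pr_up. generalize (cond_pos dt). lra.
    - rewrite !pr_up_neq by auto. generalize (Hr j) (cond_pos dt). lra. }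
  assert (K2 : Rabs (f (up i p x) - f (up i p t)) < e / 2).
  { apply K. intros j. rewrite Rminus_diag, Rabs_R0. apply cond_pos. }
  generalize (K q Hq). intros K1.
  replace (f (up i q x) - f (up i p x))
    with ((f (up i q x) - f (up i p t)) - (f (up i p x) - f (up i p t))) by ring.
  eapply Rle_lt_trans; [apply Rabs_triang|]. rewrite Rabs_Ropp. lra.
Qed.

Lemma ex_RInt_slice d f i p a b : (forall q, box d q -> continuous f q) -> box d p ->
  Rabs a < d -> Rabs b < d -> ex_RInt (V := R_NormedModule) (fun x => f (up i p x)) a b.
Proof.
  intros Hf Hp Ha Hb. apply (ex_RInt_continuous (V := R_CompleteNormedModule)).
  intros z Hz. apply (continuous_comp (up i p) f); [apply continuous_up|].
  apply Hf, box_up; auto. revert Hz Ha Hb. unfold Rmin, Rmax.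
  destruct Rle_dec; unfold Rabs; repeat destruct Rcase_abs; lra.
Qed.

Lemma prim_continuous d f i : (forall q, box d q -> continuous f q) ->
  forall p, box d p -> continuous (prim i f) p.
Proof.
  intros Hf p Hp.
  assert (d0 : 0 < d) by (eapply Rle_lt_trans; [apply Rabs_pos|apply (Hp i)]).
  set (A := (Rabs (pr i p) + d) / 2).
  assert (HA : Rabs (pr i p) < A < d) by (generalize (Hp i); unfold A; lra).
  assert (A0 : 0 < A) by (generalize (Rabs_pos (pr i p)); lra).
  (* the variation of the integrand over [- A, A] and that of the upper limit are
     each kept below half of [e] *)
  apply eps_continuous. intros e.
  assert (He : 0 < e / (2 * A)) by (apply Rdiv_lt_0_compat; [apply cond_pos|lra]).
  destruct (segment_uniform f i p (- A) A) with (e := mkposreal _ He) as [d1 H1].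
  { lra. }
  { intros x Hx. apply Hf, box_up; auto. apply Rabs_def1; lra. }
  assert (He2 : 0 < e / 2) by (generalize (cond_pos e); lra).
  assert (Hc : continuous (fun x => RInt (fun y => f (up i p y)) 0 x) (pr i p)).
  { apply (continuous_RInt_1 (V := R_NormedModule) (fun y => f (up i p y)) 0 (pr i p)
      (fun x => RInt (fun y => f (up i p y)) 0 x)).
    exists (mkposreal (d - Rabs (pr i p)) (proj2 (Rlt_0_minus _ _) (Hp i))). intros x Hx.
    apply (RInt_correct (V := R_CompleteNormedModule)).
    apply (ex_RInt_slice d); auto; [now rewrite Rabs_R0|].
    replace x with (pr i p + (x - pr i p)) by ring.
    eapply Rle_lt_trans; [apply Rabs_triang|].
    unfold ball in Hx; simpl in Hx; unfold AbsRing_ball, abs, minus, plus, opp in Hx;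
      simpl in Hx. unfold Rminus. lra. }
  destruct (proj1 (filterlim_locally _ _) Hc (mkposreal _ He2)) as [d2 H2].
  destruct (locally_box d p Hp) as [d4 H4].
  assert (d3 : 0 < Rmin (Rmin d1 (Rmin d2 d4)) (A - Rabs (pr i p))).
  { repeat apply Rmin_glb_lt; try apply cond_pos. lra. }
  exists (mkposreal _ d3). intros q Hq. simpl in Hq.
  assert (Hq1 : forall j, Rabs (pr j q - pr j p) < d1).
  { intros j. eapply Rlt_le_trans; [apply Hq|]. eapply Rle_trans; apply Rmin_l. }
  assert (Hq2 : Rabs (pr i q - pr i p) < d2).
  { eapply Rlt_le_trans; [apply Hq|]. eapply Rle_trans; [apply Rmin_l|].
    eapply Rle_trans; [apply Rmin_r|apply Rmin_l]. }
  assert (Hq4 : box d q).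
  { apply H4, ball_pt. intros j. eapply Rlt_le_trans; [apply Hq|].
    eapply Rle_trans; [apply Rmin_l|]. eapply Rle_trans; apply Rmin_r. }
  assert (Hq3 : Rabs (pr i q) < A).
  { replace (pr i q) with (pr i p + (pr i q - pr i p)) by ring.
    eapply Rle_lt_trans; [apply Rabs_triang|].
    assert (Rabs (pr i q - pr i p) < A - Rabs (pr i p))
      by (eapply Rlt_le_trans; [apply Hq|apply Rmin_r]). lra. }
  specialize (H2 (pr i q) Hq2).
  unfold ball in H2; simpl in H2; unfold AbsRing_ball, abs, minus, plus, opp in H2; simpl in H2.
  unfold prim.
  assert (E1 : ex_RInt (V := R_NormedModule) (fun x => f (up i p x)) 0 (pr i q)).
  { apply (ex_RInt_slice d); auto; rewrite ?Rabs_R0; lra. }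
  assert (E2 : ex_RInt (V := R_NormedModule) (fun x => f (up i q x)) 0 (pr i q)).
  { apply (ex_RInt_slice d); auto; rewrite ?Rabs_R0; lra. }
  replace (RInt (fun x => f (up i q x)) 0 (pr i q) - RInt (fun x => f (up i p x)) 0 (pr i p))
    with (RInt (fun x => f (up i q x) - f (up i p x)) 0 (pr i q)
     + (RInt (fun x => f (up i p x)) 0 (pr i q) - RInt (fun x => f (up i p x)) 0 (pr i p))).
  2: { rewrite (RInt_minus (V := R_CompleteNormedModule)
         (fun x => f (up i q x)) (fun x => f (up i p x))); auto.
       unfold minus, plus, opp; simpl. ring. }
  eapply Rle_lt_trans; [apply Rabs_triang|].
  assert (Hz : forall z, Rmin 0 (pr i q) <= z <= Rmax 0 (pr i q) -> - A <= z <= A).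
  { intros z Hz. revert Hz Hq3. unfold Rmin, Rmax.
    destruct Rle_dec; unfold Rabs; repeat destruct Rcase_abs; lra. }
  assert (B1 : Rabs (RInt (fun x => f (up i q x) - f (up i p x)) 0 (pr i q)) <= e / 2).
  { apply Rle_trans with (Rabs (pr i q - 0) * (e / (2 * A))).
    - rewrite Rmult_comm.
      destruct (Rle_dec 0 (pr i q)) as [L|L].
      + rewrite (Rabs_pos_eq (pr i q - 0)) by lra. rewrite Rmult_comm.
        apply abs_RInt_le_const; auto.
        * apply (ex_RInt_minus (V := R_CompleteNormedModule)); auto.
        * intros z Hz'. left. apply (H1 q Hq1). apply Hz.
          rewrite Rmin_left, Rmax_right; lra.
      + rewrite (Rabs_left (pr i q - 0)) by lra. rewrite Rmult_comm.
        rewrite <- (opp_RInt_swap (V := R_CompleteNormedModule)).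
        2: { apply ex_RInt_swap, (ex_RInt_minus (V := R_CompleteNormedModule)); auto. }
        unfold opp; simpl. rewrite Rabs_Ropp.
        replace (- (pr i q - 0)) with (0 - pr i q) by ring.
        apply abs_RInt_le_const; [lra| |].
        * apply ex_RInt_swap, (ex_RInt_minus (V := R_CompleteNormedModule)); auto.
        * intros z Hz'. left. apply (H1 q Hq1). apply Hz.
          rewrite Rmin_right, Rmax_left; lra.
    - rewrite Rminus_0_r. apply Rle_trans with (A * (e / (2 * A))).
      + apply Rmult_le_compat_r; lra.
      + right. field. lra. }
  assert (B2 : Rabs (RInt (fun x => f (up i p x)) 0 (pr i q)
    - RInt (fun x => f (up i p x)) 0 (pr i p)) < e / 2) by exact H2.
  lra.
Qed.

(** Differentiating a primitive either recovers the integrand or differentiates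
    under the integral sign, so primitives keep every majorant of the integrand. *)
Lemma is_derive_prim d f i j p : C1 d f -> (forall q, box d q -> continuous f q) ->
  box d p -> is_derive (fun x => prim i f (up j p x)) (pr j p)
    (if ix_dec i j then f p else prim i (D j f) p).
Proof.
  intros HC Hf Hp.
  assert (d0 : 0 < d) by (eapply Rle_lt_trans; [apply Rabs_pos|apply (Hp i)]).
  destruct ix_dec as [<-|n].
  - apply (is_derive_ext (fun x => RInt (fun y => f (up i p y)) 0 x)).
    { intros x. unfold prim. rewrite pr_up. apply RInt_ext. intros. now rewrite up_up. }
    rewrite <- (up_pr i p) at 2.
    apply (is_derive_RInt (V := R_CompleteNormedModule) (fun y => f (up i p y)) _ 0).
    + generalize (locally_box_up d i p Hp). apply filter_imp. intros x Hx.
      apply (RInt_correct (V := R_CompleteNormedModule)).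
      apply (ex_RInt_slice d); auto; [now rewrite Rabs_R0|].
      specialize (Hx i). now rewrite pr_up in Hx.
    + apply (continuous_comp (up i p) f); [apply continuous_up|]. apply Hf. now rewrite up_pr.
  - assert (S : forall t, Rmin 0 (pr i p) <= t <= Rmax 0 (pr i p) -> Rabs t < d).
    { generalize (Hp i). unfold Rmin, Rmax. intros H t.
      destruct Rle_dec; revert H; unfold Rabs; repeat destruct Rcase_abs; lra. }
    apply (is_derive_ext (fun x => RInt (fun t => f (up j (up i p t) x)) 0 (pr i p))).
    { intros x. unfold prim. rewrite (pr_up_neq j i) by auto.
      apply RInt_ext. intros t _. now rewrite up_comm by auto. }
    unfold prim.
    rewrite (RInt_ext (fun x => D j f (up i p x))
      (fun t => Derive (fun u => f (up j (up i p t) u)) (pr j p))).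
    2: { intros t _. unfold D. now rewrite (pr_up_neq i j). }
    assert (B : forall t u, Rabs t < d -> Rabs u < d -> box d (up j (up i p t) u)).
    { intros t u Ht Hu. apply box_up; auto. now apply box_up. }
    apply is_derive_RInt_param.
    + generalize (locally_box_up d j p Hp). apply filter_imp. intros u Hu t Ht.
      specialize (Hu j). rewrite pr_up in Hu.
      destruct (HC j (up j (up i p t) u)) as [A _]; auto.
      rewrite pr_up in A. eexists. eapply is_derive_ext; [|exact A].
      intros v. cbv beta. now rewrite up_up.
    + intros t Ht. apply continuity_2d_pt_filterlim.
      change (continuous (fun z : R * R => Derive (fun u => f (up j (up i p (snd z)) u)) (fst z))
        (pr j p, t)).
      apply (continuous_ext (fun z : R * R => D j f (up j (up i p (snd z)) (fst z)))).
      { intros z. unfold D. rewrite pr_up. apply Derive_ext. intros v. now rewrite up_up. }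
      apply (continuous_comp (fun z : R * R => up j (up i p (snd z)) (fst z)) (D j f)).
      * assert (Cf : continuous (fun u : R * R => fst u) (pr j p, t)) by apply continuous_fst.
        assert (Cs : continuous (fun u : R * R => snd u) (pr j p, t)) by apply continuous_snd.
        destruct i, j; simpl; try (now elim n); apply continuous_tuple;
          first [exact Cf|exact Cs|apply continuous_const].
      * apply HC. apply B; auto. apply Hp.
    + generalize (locally_box_up d j p Hp). apply filter_imp. intros u Hu.
      apply (ex_RInt_ext (fun t => f (up i (up j p u) t))).
      { intros t _. now rewrite up_comm by auto. }
      apply (ex_RInt_slice d); auto. now rewrite Rabs_R0. 
Qed.

Lemma prim_bound d f i p B : (forall q, box d q -> continuous f q) -> d <= 1 ->
  (forall q, box d q -> Rabs (f q) <= B) -> box d p -> Rabs (prim i f p) <= B.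
Proof.
  intros Hf Hd HB Hp.
  assert (d0 : 0 < d) by (eapply Rle_lt_trans; [apply Rabs_pos|apply (Hp i)]).
  assert (B0 : 0 <= B) by (eapply Rle_trans; [apply Rabs_pos|apply (HB p Hp)]).
  assert (E : ex_RInt (V := R_NormedModule) (fun x => f (up i p x)) 0 (pr i p)).
  { apply (ex_RInt_slice d); auto. now rewrite Rabs_R0. }
  assert (S : forall t, Rmin 0 (pr i p) <= t <= Rmax 0 (pr i p) -> Rabs (f (up i p t)) <= B).
  { intros t Ht. apply HB, box_up; auto. generalize (Hp i). revert Ht. unfold Rmin, Rmax.
    destruct Rle_dec; unfold Rabs; repeat destruct Rcase_abs; lra. }
  apply Rle_trans with (Rabs (pr i p) * B).
  2: { generalize (Hp i) (Rabs_pos (pr i p)). nra. }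
  unfold prim. destruct (Rle_dec 0 (pr i p)) as [L|L].
  - rewrite (Rabs_pos_eq (pr i p)) by lra. replace (pr i p * B) with ((pr i p - 0) * B) by ring.
    apply abs_RInt_le_const; auto. intros t Ht. apply S. rewrite Rmin_left, Rmax_right; lra.
  - rewrite (Rabs_left (pr i p)) by lra.
    rewrite <- (opp_RInt_swap (V := R_CompleteNormedModule)) by now apply ex_RInt_swap.
    unfold opp; simpl. rewrite Rabs_Ropp.
    replace (- pr i p * B) with ((0 - pr i p) * B) by ring.
    apply abs_RInt_le_const; [lra|now apply ex_RInt_swap|].
    intros t Ht. apply S. rewrite Rmin_right, Rmax_left; lra.
Qed.

Lemma Bd_prim b d r i n : d <= 1 -> 1 <= r -> forall c q f, 0 <= c ->
  Bd b d (shape c r q) (S n) f -> Bd b d (shape c r q) n (prim i f).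
Proof.
  intros Hd Hr. induction n as [|n IH]; intros c q f Hc Hf.
  - split; auto. intros p Hp. split.
    + apply (prim_continuous d); auto. intros; eapply Bd_cont; eauto.
    + intros ->. apply (prim_bound d); auto; intros; [eapply Bd_cont|eapply Bd_bound]; eauto.
  - apply (Bd_intro _ _ _ _ _ (fun j p => if ix_dec i j then f p else prim i (D j f) p)).
    + intros p Hp. apply (prim_continuous d); auto. intros; eapply Bd_cont; eauto.
    + intros -> p Hp. apply (prim_bound d); auto; intros; [eapply Bd_cont|eapply Bd_bound]; eauto.
    + intros j p Hp. apply (is_derive_prim d); auto.
      * eapply Bd_C1; eauto.
      * intros; eapply Bd_cont; eauto.
    + intros j. destruct ix_dec as [<-|N].
      * apply Bd_down, Bd_down in Hf. apply (Bd_le b d (shape c r q)); auto.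
        intros m. rewrite shape_S. apply shape_le; try lra; try nra; try lia.
      * apply (Bd_le b d (shape (c * r) r (S q))).
        { intros m. rewrite shape_S. lra. }
        apply IH; [nra|]. now apply Bd_shape_S.
Qed.

(** * Regular germs at the origin *)

Definition RB (b : bool) (d c r : R) (f : pt -> R) : Prop :=
  forall n, Bd b d (shape c r 0) n f.

(** For [b = true] these are the germs whose derivatives of order [j] are
    [O(r^j j!)], that is, the real-analytic ones; for [b = false], the smooth ones. *)
Definition Reg (b : bool) (f : pt -> R) : Prop :=
  exists d c r, 0 < d <= 1 /\ 0 <= c /\ 1 <= r /\ RB b d c r f.

Definition near (P : pt -> Prop) : Prop := exists d, 0 < d /\ forall p, box d p -> P p.

Lemma near_and P Q : near P -> near Q -> near (fun p => P p /\ Q p).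
Proof.
  intros [d [Hd HP]] [e [He HQ]]. exists (Rmin d e). split; [now apply Rmin_glb_lt|].
  intros p Hp. split; [apply HP|apply HQ]; apply (box_le (Rmin d e)); auto.
  apply Rmin_l. apply Rmin_r.
Qed.

Lemma near_imp (P Q : pt -> Prop) : (forall p, P p -> Q p) -> near P -> near Q.
Proof. intros H [d [Hd HP]]. exists d. auto. Qed.

Lemma near_box d : 0 < d -> near (box d).
Proof. intros H. now exists d. Qed.

Lemma near_orig P : near P -> P orig.
Proof. intros [d [Hd HP]]. apply HP. now apply box_orig. Qed.

Lemma near_D f g i : near (fun p => f p = g p) -> near (fun p => D i f p = D i g p).
Proof.
  intros [d [Hd H]]. exists d. split; auto. intros p Hp. now apply (D_ext d).
Qed.

Lemma near_cont (P : R -> Prop) (f : pt -> R) : near (fun p => continuous f p) -> locally (f orig) P ->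
  near (fun p => P (f p)).
Proof.
  intros Hf HP. apply near_orig in Hf. destruct (small_box _ (Hf _ HP)) as [d [Hd H]].
  exists d; auto.
Qed.

Lemma near_lt (f : pt -> R) d : near (fun p => continuous f p) -> Rabs (f orig) < d ->
  near (fun p => Rabs (f p) < d).
Proof.
  intros Hf H. apply (near_cont (fun y => Rabs y < d)); auto.
  apply (continuous_Rabs (f orig) (fun y => y < d)). now apply open_lt.
Qed.

Lemma near_neq (f : pt -> R) : near (fun p => continuous f p) -> f orig <> 0 -> near (fun p => f p <> 0).
Proof. intros Hf H. apply (near_cont (fun y => y <> 0)); auto. now apply open_neq. Qed.

Lemma RB_le b d c r d' c' r' f : d' <= d -> 0 <= c <= c' -> 0 <= r <= r' ->
  RB b d c r f -> RB b d' c' r' f.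
Proof.
  intros Hd Hc Hr H n. apply (Bd_box b d); auto. eapply Bd_le; [|apply H].
  intros j. apply shape_le; auto.
Qed.

Lemma Reg_2 b f g : Reg b f -> Reg b g ->
  exists d c r, 0 < d <= 1 /\ 0 <= c /\ 1 <= r /\ RB b d c r f /\ RB b d c r g.
Proof.
  intros (d & c & r & Hd & Hc & Hr & H) (d' & c' & r' & Hd' & Hc' & Hr' & H').
  exists (Rmin d d'), (c + c'), (r + r').
  assert (0 < Rmin d d') by (apply Rmin_glb_lt; lra).
  generalize (Rmin_l d d') (Rmin_r d d'). intros.
  repeat split; try lra.
  - eapply RB_le; [| | |exact H]; lra.
  - eapply RB_le; [| | |exact H']; lra.
Qed.

Lemma Reg_C1 b f : Reg b f -> exists d, 0 < d /\ C1 d f /\ forall p, box d p -> continuous f p.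
Proof.
  intros (d & c & r & Hd & _ & _ & H). exists d. split; [lra|]. split.
  - eapply Bd_C1, (H 1%nat).
  - intros p Hp. eapply Bd_cont; [apply (H 0%nat)|auto].
Qed.

Lemma Reg_cont b f : Reg b f -> near (fun p => continuous f p).
Proof. intros H. destruct (Reg_C1 _ _ H) as (d & Hd & _ & H'). exists d; auto. Qed.

Lemma Reg_ext b f g : near (fun p => f p = g p) -> Reg b f -> Reg b g.
Proof.
  intros [e [He E]] (d & c & r & Hd & Hc & Hr & H).
  assert (0 < Rmin d e) by (apply Rmin_glb_lt; lra).
  generalize (Rmin_l d e) (Rmin_r d e). intros.
  exists (Rmin d e), c, r. repeat split; try lra. intros n.
  apply (Bd_ext b _ n _ f); [intros p Hp; apply E; now apply (box_le (Rmin d e))|].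
  now apply (Bd_box b d).
Qed.

Lemma Reg_const b c : Reg b (fun _ => c).
Proof.
  exists 1, (Rabs c), 1. generalize (Rabs_pos c). intros. repeat split; try lra.
  intros n. apply Bd_const.
  - unfold shape; simpl. lra.
  - intros j. apply shape_pos; lra.
Qed.

Lemma Bd_pr_shape b d n i : d <= 1 -> Bd b d (shape 1 1 0) n (pr i).
Proof.
  intros Hd. apply Bd_pr; unfold shape; simpl; try lra.
  intros j. rewrite pow1. generalize (fact_pos (j + 0)). lra.
Qed.

Lemma Reg_pr b i : Reg b (pr i).
Proof. exists 1, 1, 1. repeat split; try lra. intros n. now apply Bd_pr_shape. Qed.

Lemma Reg_plus b f g : Reg b f -> Reg b g -> Reg b (fun p => f p + g p).
Proof.
  intros Hf Hg. destruct (Reg_2 b f g Hf Hg) as (d & c & r & Hd & Hc & Hr & H1 & H2).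
  exists d, (c + c), r. repeat split; try lra. intros n.
  eapply Bd_le; [|apply Bd_plus; [apply H1|apply H2]].
  intros j. unfold shape. simpl. lra.
Qed.

Lemma RB_mult b d c r f c' r' g : 0 <= c -> 0 <= c' -> 2 * r' <= r -> 0 <= r' ->
  RB b d c r f -> RB b d c' r' g -> RB b d (2 * c * c') r (fun p => f p * g p).
Proof.
  intros Hc Hc' Hr Hr' H1 H2 n. eapply Bd_le; [|apply Bd_mult; [apply H1|apply H2]].
  intros j. now apply conv_shape.
Qed.

Lemma Reg_mult b f g : Reg b f -> Reg b g -> Reg b (fun p => f p * g p).
Proof.
  intros Hf Hg. destruct (Reg_2 b f g Hf Hg) as (d & c & r & Hd & Hc & Hr & H1 & H2).
  exists d, (2 * c * c), (2 * r). repeat split; try nra.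
  apply RB_mult with (r' := r); auto; try lra. eapply RB_le; [| | |exact H1]; lra.
Qed.

Lemma Reg_opp b f : Reg b f -> Reg b (fun p => - f p).
Proof.
  intros (d & c & r & Hd & Hc & Hr & H). exists d, c, r. repeat split; try lra.
  intros n. now apply Bd_opp.
Qed.

Lemma Reg_minus b f g : Reg b f -> Reg b g -> Reg b (fun p => f p - g p).
Proof. intros. apply Reg_plus; auto. now apply Reg_opp. Qed.

Lemma Reg_pow b f n : Reg b f -> Reg b (fun p => f p ^ n).
Proof.
  intros H. induction n as [|n IH]; simpl; [apply Reg_const|now apply Reg_mult].
Qed.

Lemma Reg_D b f i : Reg b f -> Reg b (D i f).
Proof.
  intros (d & c & r & Hd & Hc & Hr & H). exists d, (c * r), (2 * r). repeat split; try nra.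
  intros n. apply Bd_shape_0; try nra. now apply Bd_shape_S.
Qed.

Lemma Reg_prim b f i : Reg b f -> Reg b (prim i f).
Proof.
  intros (d & c & r & Hd & Hc & Hr & H). exists d, c, r. repeat split; try lra.
  intros n. apply Bd_prim; auto; lra.
Qed.

Lemma Reg_comp b f g0 g1 g2 g3 : Reg b f ->
  Reg b g0 -> Reg b g1 -> Reg b g2 -> Reg b g3 ->
  g0 orig = 0 -> g1 orig = 0 -> g2 orig = 0 -> g3 orig = 0 ->
  Reg b (fun p => f (g0 p, g1 p, g2 p, g3 p)).
Proof.
  intros (d & c & r & Hd & Hc & Hr & H) G0 G1 G2 G3 Z0 Z1 Z2 Z3.
  destruct (Reg_2 b _ _ G0 G1) as (d0 & c0 & r0 & Hd0 & Hc0 & Hr0 & A0 & A1).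
  destruct (Reg_2 b _ _ G2 G3) as (d2 & c2 & r2 & Hd2 & Hc2 & Hr2 & A2 & A3).
  assert (N : near (fun p => box d (g0 p, g1 p, g2 p, g3 p))).
  { assert (L : forall g, Reg b g -> g orig = 0 -> near (fun p => Rabs (g p) < d)).
    { intros g Hg Hz. apply near_lt; [eapply Reg_cont; eauto|]. rewrite Hz, Rabs_R0; lra. }
    generalize (near_and _ _ (near_and _ _ (L _ G0 Z0) (L _ G1 Z1))
      (near_and _ _ (L _ G2 Z2) (L _ G3 Z3))).
    apply near_imp. intros p [[? ?] [? ?]]. now apply box_tuple. }
  destruct N as [e [He N]].
  set (d' := Rmin e (Rmin d0 d2)).
  assert (0 < d') by (repeat apply Rmin_glb_lt; lra).
  assert (d' <= e) by apply Rmin_l.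
  assert (d' <= d0) by (eapply Rle_trans; [apply Rmin_r|apply Rmin_l]).
  assert (d' <= d2) by (eapply Rle_trans; [apply Rmin_r|apply Rmin_r]).
  set (K := c0 + c2). set (s := r0 + r2).
  exists d', c, (4 * s + 16 * K * s * r).
  assert (0 <= K * s * r) by (repeat apply Rmult_le_pos; unfold K, s; lra).
  assert (1 <= s) by (unfold s; lra).
  repeat split; try lra.
  intros n. apply Bd_comp with (d := d); auto; try (unfold K, s; lra).
  - intros p Hp. apply N. now apply (box_le d').
  - apply (RB_le b d0 c0 r0); auto; unfold K, s; lra.
  - apply (RB_le b d0 c0 r0); auto; unfold K, s; lra.
  - apply (RB_le b d2 c2 r2); auto; unfold K, s; lra.
  - apply (RB_le b d2 c2 r2); auto; unfold K, s; lra.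
Qed.

(** The derivatives of [1 / (x + a)] are known in closed form. *)
Lemma Bd_recip b d a u : 0 < u -> (forall p, box d p -> u <= Rabs (pr X0 p + a)) ->
  forall n m, Bd b d (shape ((/ u) ^ S m) (/ u) m) n
    (fun p => INR (fact m) * (-1) ^ m * (/ (pr X0 p + a)) ^ S m).
Proof.
  intros Hu H.
  assert (NZ : forall p, box d p -> pr X0 p + a <> 0).
  { intros p Hp E. specialize (H p Hp). rewrite E, Rabs_R0 in H. lra. }
  assert (DV : forall m p i, box d p -> is_derive
    (fun x => INR (fact m) * (-1) ^ m * (/ (pr X0 (up i p x) + a)) ^ S m) (pr i p)
    (delta X0 i * (INR (fact (S m)) * (-1) ^ S m * (/ (pr X0 p + a)) ^ S (S m)))).
  { intros m p i Hp.
    assert (Q : is_derive (fun y => INR (fact m) * (-1) ^ m * (/ (y + a)) ^ S m)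
      (pr X0 (up i p (pr i p)))
      (INR (fact (S m)) * (-1) ^ S m * (/ (pr X0 p + a)) ^ S (S m))).
    { rewrite up_pr. auto_derive; [now apply NZ|].
      rewrite fact_simpl, mult_INR.
      change (match m with O => 1 | S _ => INR m + 1 end) with (INR (S m)).
      rewrite S_INR. cbn [Init.Nat.pred pow].
      field. now apply NZ. }
    rewrite (Rmult_comm (delta X0 i)).
    exact (is_derive_compR _ (fun x => pr X0 (up i p x)) _ _ _ Q (is_derive_pr X0 i p)). }
  assert (CT : forall m p, box d p ->
    continuous (fun p => INR (fact m) * (-1) ^ m * (/ (pr X0 p + a)) ^ S m) p).
  { intros m p Hp. apply (continuous_comp (pr X0)
      (fun y => INR (fact m) * (-1) ^ m * (/ (y + a)) ^ S m)); [apply continuous_pr|].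
    apply (ex_derive_continuous
      (fun y => INR (fact m) * (-1) ^ m * (/ (y + a)) ^ S m)). auto_derive. now apply NZ. }
  assert (BD : forall m p, box d p -> Rabs (INR (fact m) * (-1) ^ m * (/ (pr X0 p + a)) ^ S m)
    <= shape ((/ u) ^ S m) (/ u) m 0).
  { intros m p Hp. unfold shape. simpl plus. rewrite pow_O, Rmult_1_r.
    rewrite !Rabs_mult, (Rabs_pos_eq (INR (fact m))) by apply pos_INR.
    rewrite pow_1_abs, Rmult_1_r, <- RPow_abs, Rabs_inv, Rmult_comm.
    apply Rmult_le_compat_r; [apply pos_INR|]. apply pow_incr. split.
    - left. apply Rinv_0_lt_compat. specialize (H p Hp). lra.
    - apply Rinv_le_contravar; auto. }
  induction n as [|n IH]; intros m.
  - split; auto.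
  - apply (Bd_intro _ _ _ _ _ (fun i p => delta X0 i *
      (INR (fact (S m)) * (-1) ^ S m * (/ (pr X0 p + a)) ^ S (S m)))); auto.
    intros i. unfold delta. destruct ix_dec as [_|_].
    + apply (Bd_ext b d n _ (fun p => INR (fact (S m)) * (-1) ^ S m * (/ (pr X0 p + a)) ^ S (S m))).
      { intros; ring. }
      eapply Bd_le; [|apply IH]. intros j. rewrite shape_S. unfold shape. simpl. lra.
    + apply (Bd_ext b d n _ (fun p => 0)); [intros; ring|].
      apply Bd_const; [rewrite Rabs_R0|intros j]; apply shape_pos;
        try apply pow_le; left; now apply Rinv_0_lt_compat.
Qed.

Lemma Reg_recip b a : a <> 0 -> Reg b (fun p => / (pr X0 p + a)).
Proof.
  intros Ha. assert (0 < Rabs a) by now apply Rabs_pos_lt.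
  set (d := Rmin 1 (Rabs a / 2)).
  assert (0 < d) by (apply Rmin_glb_lt; lra).
  assert (d <= 1) by apply Rmin_l. assert (d <= Rabs a / 2) by apply Rmin_r.
  assert (0 < / (Rabs a / 2)) by (apply Rinv_0_lt_compat; lra).
  exists d, (/ (Rabs a / 2)), (1 + / (Rabs a / 2)). repeat split; try lra.
  intros n. apply (Bd_ext b d n _ (fun p => INR (fact 0) * (-1) ^ 0 * (/ (pr X0 p + a)) ^ 1)).
  { intros; simpl; ring. }
  eapply Bd_le; [|apply (Bd_recip b d a (Rabs a / 2)); [lra|]].
  - intros j. simpl pow. rewrite Rmult_1_r. apply shape_le; auto; lra.
  - intros p Hp. specialize (Hp X0).
    assert (Rabs a <= Rabs (pr X0 p + a) + Rabs (pr X0 p)); [|lra].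
    replace a with ((pr X0 p + a) + - pr X0 p) at 1 by ring.
    eapply Rle_trans; [apply Rabs_triang|]. rewrite Rabs_Ropp. lra.
Qed.

(** Composition with [1 / (x + a)], where [a] is the value of [f] at the origin,
    so that the inner function vanishes there. *)
Lemma Reg_inv b f : Reg b f -> f orig <> 0 -> Reg b (fun p => / f p).
Proof.
  intros Hf Hz.
  apply (Reg_ext b (fun p => (fun q => / (pr X0 q + f orig)) (f p - f orig, 0, 0, 0))).
  { exists 1. split; [lra|]. intros p _. simpl. f_equal. ring. }
  apply (Reg_comp b (fun q => / (pr X0 q + f orig))); try apply Reg_const; auto.
  - now apply Reg_recip.
  - apply Reg_minus; [exact Hf|apply Reg_const].
  - ring.
Qed.

Lemma Reg_div b f g : Reg b f -> Reg b g -> g orig <> 0 -> Reg b (fun p => f p / g p).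
Proof. intros. apply Reg_mult; auto. now apply Reg_inv. Qed.

(** ** Differentiation rules *)

Lemma D_val i f p l : is_derive (fun x => f (up i p x)) (pr i p) l -> D i f p = l.
Proof. apply is_derive_unique. Qed.

Definition dif (i : ix) (f : pt -> R) (p : pt) : Prop :=
  is_derive (fun x => f (up i p x)) (pr i p) (D i f p).

Lemma C1_dif d f i p : C1 d f -> box d p -> dif i f p.
Proof. intros H Hp. now apply H. Qed.

Lemma D_plus i f g p : dif i f p -> dif i g p ->
  D i (fun q => f q + g q) p = D i f p + D i g p.
Proof. intros F G. apply D_val. now apply is_derive_add. Qed.

Lemma D_mult i f g p : dif i f p -> dif i g p ->
  D i (fun q => f q * g q) p = D i f p * g p + f p * D i g p.
Proof.
  intros F G. apply D_val.
  generalize (is_derive_mul _ _ _ _ _ F G). now rewrite up_pr.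
Qed.

Lemma D_opp i f p : D i (fun q => - f q) p = - D i f p.
Proof. unfold D. apply Derive_opp. Qed.

Lemma dif_opp i f p : dif i f p -> dif i (fun q => - f q) p.
Proof. intros F. unfold dif. rewrite D_opp. apply (is_derive_opp (fun x => f (up i p x))), F. Qed.

Lemma D_minus i f g p : dif i f p -> dif i g p ->
  D i (fun q => f q - g q) p = D i f p - D i g p.
Proof.
  intros F G. unfold Rminus. rewrite (D_plus i f (fun q => - g q)), D_opp; auto.
  now apply dif_opp.
Qed.

Lemma D_scal i c f p : D i (fun q => c * f q) p = c * D i f p.
Proof. unfold D. apply Derive_scal. Qed.

Lemma D_const i c p : D i (fun _ => c) p = 0.
Proof. unfold D. apply Derive_const. Qed.

Lemma D_pr i j p : D i (pr j) p = delta j i.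
Proof. apply D_val, is_derive_pr. Qed.

Lemma D_indep i f p : (forall x, f (up i p x) = f p) -> D i f p = 0.
Proof.
  intros H. unfold D. rewrite (Derive_ext _ (fun _ => f p)); [apply Derive_const|auto].
Qed.

Lemma schwarz b d M n f i j p : Bd b d M (S (S n)) f -> box d p ->
  D i (D j f) p = D j (D i f) p.
Proof.
  intros H Hp. destruct (ix_dec i j) as [<-|N]; auto.
  set (F := fun u v => f (up j (up i p u) v)).
  assert (E1 : forall u v, Derive (fun t => F u t) v = D j f (up j (up i p u) v)).
  { intros u v. unfold D. rewrite pr_up. apply Derive_ext. intros t. now rewrite up_up. }
  assert (E2 : forall u v, Derive (fun t => F t v) u = D i f (up j (up i p u) v)).
  { intros u v. unfold D. rewrite pr_up_neq, pr_up by auto. apply Derive_ext. intros t.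
    unfold F. now rewrite (up_comm i j), up_up by auto. }
  assert (E3 : forall u v, Derive (fun z => Derive (fun t => F z t) v) u
     = D i (D j f) (up j (up i p u) v)).
  { intros u v. unfold D at 1. rewrite pr_up_neq, pr_up by auto. apply Derive_ext. intros t.
    rewrite E1. now rewrite (up_comm i j), up_up by auto. }
  assert (E4 : forall u v, Derive (fun z => Derive (fun t => F t z) u) v
     = D j (D i f) (up j (up i p u) v)).
  { intros u v. unfold D at 1. rewrite pr_up by auto. apply Derive_ext. intros t.
    rewrite E2. now rewrite up_up by auto. }
  assert (Ep : up j (up i p (pr i p)) (pr j p) = p) by now rewrite up_pr, up_pr.
  assert (CT : forall g, continuous g p ->
    continuity_2d_pt (fun u v => g (up j (up i p u) v)) (pr i p) (pr j p)).
  { intros g Hg. apply continuity_2d_pt_filterlim.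
    change (continuous (fun z : R * R => g (up j (up i p (fst z)) (snd z))) (pr i p, pr j p)).
    apply (continuous_comp (fun z : R * R => up j (up i p (fst z)) (snd z)) g).
    - assert (Cf : continuous (fun u : R * R => fst u) (pr i p, pr j p)) by apply continuous_fst.
      assert (Cs : continuous (fun u : R * R => snd u) (pr i p, pr j p)) by apply continuous_snd.
      destruct i, j; simpl; try (now elim N); apply continuous_tuple;
        first [exact Cf|exact Cs|apply continuous_const].
    - simpl. rewrite Ep. exact Hg. }
  rewrite <- Ep. rewrite <- E3, <- E4.
  assert (Hi := Bd_D _ _ _ _ _ i H). assert (Hj := Bd_D _ _ _ _ _ j H).
  apply Schwarz.
  - assert (L : locally_2d (fun u v => box d (up j (up i p u) v)) (pr i p) (pr j p)).
    { apply locally_2d_locally.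
      apply (locally_box_curve d (fun z : R * R => up j (up i p (fst z)) (snd z)) (pr i p, pr j p)).
      - assert (Cf : continuous (fun u : R * R => fst u) (pr i p, pr j p)) by apply continuous_fst.
        assert (Cs : continuous (fun u : R * R => snd u) (pr i p, pr j p)) by apply continuous_snd.
        destruct i, j; simpl; try (now elim N); apply continuous_tuple;
          first [exact Cf|exact Cs|apply continuous_const].
      - simpl. now rewrite Ep. }
    apply locally_2d_impl with (2 := L). apply locally_2d_forall. intros u v Hb.
    assert (XI : forall M m g, Bd b d M (S m) g ->
      ex_derive (fun z => g (up j (up i p z) v)) u).
    { intros M' m g Hg. eexists.
      generalize (Bd_deriv _ _ _ _ _ i _ Hg Hb). rewrite pr_up_neq, pr_up by auto.
      apply is_derive_ext. intros t. now rewrite (up_comm i j), up_up by auto. }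
    assert (XJ : forall M m g, Bd b d M (S m) g ->
      ex_derive (fun z => g (up j (up i p u) z)) v).
    { intros M' m g Hg. eexists.
      generalize (Bd_deriv _ _ _ _ _ j _ Hg Hb). rewrite pr_up.
      apply is_derive_ext. intros t. now rewrite up_up. }
    repeat split.
    + eapply XI, H.
    + eapply XJ, H.
    + eapply ex_derive_ext; [|eapply XI, Hj]. intros t. now rewrite E1.
    + eapply ex_derive_ext; [|eapply XJ, Hi]. intros t. now rewrite E2.
  - apply (continuity_2d_pt_ext (fun u v => D i (D j f) (up j (up i p u) v))).
    { intros. now rewrite E3. }
    apply CT. eapply Bd_cont; [eapply Bd_D, Hj|auto].
  - apply (continuity_2d_pt_ext (fun u v => D j (D i f) (up j (up i p u) v))).
    { intros. now rewrite E4. }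
    apply CT. eapply Bd_cont; [eapply Bd_D, Hi|auto].
Qed.

Lemma Reg_schwarz b f i j : Reg b f -> near (fun p => D i (D j f) p = D j (D i f) p).
Proof.
  intros (d & c & r & Hd & _ & _ & H). exists d. split; [lra|]. intros p Hp.
  eapply (schwarz b d _ 0); [apply (H 2%nat)|auto].
Qed.

Lemma D_comp d f g0 g1 g2 g3 i p : C1 d f -> box d (g0 p, g1 p, g2 p, g3 p) ->
  dif i g0 p -> dif i g1 p -> dif i g2 p -> dif i g3 p ->
  let P := (g0 p, g1 p, g2 p, g3 p) in
  is_derive (fun x => (fun q => f (g0 q, g1 q, g2 q, g3 q)) (up i p x)) (pr i p)
    (D X0 f P * D i g0 p + (D X1 f P * D i g1 p + (D X2 f P * D i g2 p + D X3 f P * D i g3 p))).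
Proof.
  intros HC Hb G0 G1 G2 G3 P.
  generalize (chain_rule d f (fun x => g0 (up i p x)) (fun x => g1 (up i p x))
    (fun x => g2 (up i p x)) (fun x => g3 (up i p x)) (pr i p)
    (D i g0 p) (D i g1 p) (D i g2 p) (D i g3 p) HC).
  rewrite !up_pr. intros K. exact (K Hb G0 G1 G2 G3).
Qed.

(** ** The implicit function theorem *)

(** The graph map of [Y] turns the partial derivatives into the vector fields
    [D i + Phi i * D X3]; iterating them on a majorized function costs one
    factorial and one geometric factor per step. *)
Lemma Bd_graph b d d' A s (Phi : ix -> pt -> R) (Y : pt -> R) n :
  0 <= A -> 1 <= s ->
  let G := fun p => (pr X0 p, pr X1 p, pr X2 p, Y p) in
  let e := fun i => match i with X3 => 0 | _ => 1 end in
  (forall i m, Bd b d (shape A (s / 2) 0) m (Phi i)) ->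
  (forall p, box d' p -> box d (G p) /\ continuous Y p) ->
  (forall i p, box d' p -> is_derive (fun x => Y (up i p x)) (pr i p) (Phi i (G p))) ->
  forall c q f, 0 <= c -> Bd b d (shape c s q) n f ->
  Bd b d' (shape c (s * (1 + 2 * A)) q) n (fun p => f (G p)).
Proof.
  intros HA Hs G e HPhi HG HY.
  assert (CG : forall p, box d' p -> continuous G p).
  { intros p Hp. apply continuous_tuple; try apply continuous_pr. now apply HG. }
  induction n as [|n IH]; intros c q f Hc Hf.
  - split; auto. intros p Hp. destruct (HG p Hp) as [B _]. split.
    + apply (continuous_comp G f); auto. eapply Bd_cont; eauto.
    + intros ->. exact (Bd_bound _ _ _ _ _ Hf B).
  - apply (Bd_intro _ _ _ _ _ (fun i p =>
      (fun q => e i * D i f q + D X3 f q * Phi i q) (G p))).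
    + intros p Hp. destruct (HG p Hp) as [B _].
      apply (continuous_comp G f); auto. eapply Bd_cont; eauto.
    + intros -> p Hp. destruct (HG p Hp) as [B _]. exact (Bd_bound _ _ _ _ _ Hf B).
    + intros i p Hp. destruct (HG p Hp) as [B _].
      generalize (chain_rule d f (fun x => pr X0 (up i p x)) (fun x => pr X1 (up i p x))
        (fun x => pr X2 (up i p x)) (fun x => Y (up i p x)) (pr i p)
        (delta X0 i) (delta X1 i) (delta X2 i) (Phi i (G p)) (Bd_C1 _ _ _ _ _ Hf)).
      rewrite !up_pr. intros K.
      specialize (K B (is_derive_pr X0 i p) (is_derive_pr X1 i p)
        (is_derive_pr X2 i p) (HY i p Hp)).
      cbv zeta in K. fold (G p) in K. cbv beta.
      replace (e i * D i f (G p) + D X3 f (G p) * Phi i (G p)) with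
        (D X0 f (G p) * delta X0 i + (D X1 f (G p) * delta X1 i +
         (D X2 f (G p) * delta X2 i + D X3 f (G p) * Phi i (G p)))); [exact K|].
      destruct i; unfold e, delta; repeat (destruct ix_dec; try easy); ring.
    + intros i. apply (Bd_le b d' (shape (c * (s * (1 + 2 * A))) (s * (1 + 2 * A)) (S q))).
      { intros j. rewrite shape_S. lra. }
      apply (IH _ _ (fun q => e i * D i f q + D X3 f q * Phi i q)).
      { assert (0 <= c * s) by (apply Rmult_le_pos; lra). nra. }
      apply (Bd_le b d (fun j => Rabs (e i) * shape (c * s) s (S q) j +
         conv (shape (c * s) s (S q)) (shape A (s / 2) 0) j)).
      * intros j. assert (0 <= c * s) by (apply Rmult_le_pos; lra).
        assert (S1 : conv (shape (c * s) s (S q)) (shape A (s / 2) 0) j <=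
          shape (2 * (c * s) * A) s (S q) j) by (apply conv_shape; lra).
        assert (S2 : Rabs (e i) * shape (c * s) s (S q) j <= shape (c * s) s (S q) j).
        { assert (0 <= shape (c * s) s (S q) j) by (apply shape_pos; lra).
          destruct i; simpl; rewrite ?Rabs_R0, ?Rabs_R1; lra. }
        eapply Rle_trans; [apply Rplus_le_compat; [exact S2|exact S1]|].
        right. unfold shape. ring.
      * apply Bd_plus; [apply Bd_scal|apply Bd_mult; [|apply HPhi]]; now apply Bd_shape_S.
Qed.

(** The solution exists because [F] is monotone in the last variable and changes
    sign; its difference quotients are quotients of values of the partial
    derivatives of [F], by the mean value theorem. *)
Section ImplicitFunction.

Variables (F : pt -> R) (d : R).
Hypothesis HC : C1 d F.
Hypothesis Hc : forall p, box d p -> continuous F p.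
Hypothesis Hpos : forall p, box d p -> 0 < D X3 F p.

Lemma last_increasing p x y : box d p -> Rabs x < d -> Rabs y < d -> x < y ->
  F (up X3 p x) < F (up X3 p y).
Proof.
  intros Hp Hx Hy L.
  assert (K : forall t, x <= t <= y -> box d (up X3 p t)).
  { intros t Ht. apply box_up; auto. apply Rabs_def2 in Hx. apply Rabs_def2 in Hy.
    apply Rabs_def1; lra. }
  destruct (MVT_gen (fun t => F (up X3 p t)) x y (fun t => D X3 F (up X3 p t))) as [c [Hc' E]].
  - rewrite Rmin_left, Rmax_right by lra. intros t Ht.
    apply (HC X3 (up X3 p t)). apply K; lra.
  - rewrite Rmin_left, Rmax_right by lra. intros t Ht.
    apply continuity_pt_filterlim.
    apply (continuous_comp (up X3 p) F); [apply continuous_up|apply Hc, K; lra].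
  - rewrite Rmin_left, Rmax_right in Hc' by lra.
    assert (0 < D X3 F (up X3 p c) * (y - x)).
    { apply Rmult_lt_0_compat; [apply Hpos, K; lra|lra]. }
    lra.
Qed.

Variables (e h : R).
Hypothesis He : 0 < e < d.
Hypothesis Hh : 0 < h <= e.
Hypothesis Hsign : forall p, box h p -> F (up X3 p (- e)) < 0 < F (up X3 p e).

Definition implicit (p : pt) : R :=
  epsilon (inhabits 0) (fun y => Rabs y < e /\ F (pr X0 p, pr X1 p, pr X2 p, y) = 0).

Lemma box_h_d p : box h p -> box d p.
Proof. apply box_le. lra. Qed.

Lemma implicit_spec p : box h p -> Rabs (implicit p) < e /\ F (up X3 p (implicit p)) = 0.
Proof.
  intros Hp. apply (epsilon_spec (inhabits 0)
    (fun y => Rabs y < e /\ F (pr X0 p, pr X1 p, pr X2 p, y) = 0)).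
  destruct (Hsign p Hp) as [S1 S2].
  destruct (Ranalysis5.IVT_interv (fun y => F (up X3 p y)) (- e) e) as [y [Hy Ey]]; auto.
  - intros t Ht. apply continuity_pt_filterlim.
    apply (continuous_comp (up X3 p) F); [apply continuous_up|].
    apply Hc, box_up; [now apply box_h_d|]. apply Rabs_def1; lra.
  - lra.
  - exists y. split; [|exact Ey]. apply Rabs_def1.
    + destruct (Rle_lt_or_eq_dec y e) as [L|L]; [lra|exact L|]. subst y. lra.
    + destruct (Rle_lt_or_eq_dec (- e) y) as [L|L]; [lra|exact L|]. subst y. lra.
Qed.

Lemma implicit_unique p y : box h p -> Rabs y < d -> F (up X3 p y) = 0 -> y = implicit p.
Proof.
  intros Hp Hy E. destruct (implicit_spec p Hp) as [L E'].
  destruct (Rtotal_order y (implicit p)) as [T|[T|T]]; auto.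
  - generalize (last_increasing p y (implicit p) (box_h_d p Hp) Hy ltac:(lra) T). lra.
  - generalize (last_increasing p (implicit p) y (box_h_d p Hp) ltac:(lra) Hy T). lra.
Qed.

Lemma implicit_continuous p : box h p -> continuous implicit p.
Proof.
  intros Hp. destruct (implicit_spec p Hp) as [L E].
  apply filterlim_locally. intros eps.
  set (u := Rmin (eps / 2) ((d - e) / 2)).
  assert (Hu : 0 < u) by (apply Rmin_glb_lt; [generalize (cond_pos eps)|]; lra).
  assert (u <= eps / 2) by apply Rmin_l. assert (u <= (d - e) / 2) by apply Rmin_r.
  set (y := implicit p) in *. generalize (Rabs_def2 _ _ L). intros L2.
  assert (By : forall t, y - u <= t <= y + u -> Rabs t < d) by (intros; apply Rabs_def1; lra).
  assert (S1 : F (up X3 p (y - u)) < 0).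
  { rewrite <- E. apply last_increasing; try apply By; try lra. now apply box_h_d. }
  assert (S2 : 0 < F (up X3 p (y + u))).
  { rewrite <- E. apply last_increasing; try apply By; try lra. now apply box_h_d. }
  assert (CF : forall t, y - u <= t <= y + u -> continuous (fun q => F (up X3 q t)) p).
  { intros t Ht. apply (continuous_comp (fun q => up X3 q t) F).
    - simpl. apply continuous_tuple; try apply continuous_const;
      [apply (continuous_pr X0)|apply (continuous_pr X1)|apply (continuous_pr X2)].
    - apply Hc, box_up; auto. now apply box_h_d. }
  assert (A1 := locally_box h p Hp).
  assert (A2 : locally p (fun q => 0 < F (up X3 q (y + u))))
    by exact (CF (y + u) ltac:(lra) (fun z => 0 < z) (open_gt 0 _ S2)).
  assert (A3 : locally p (fun q => F (up X3 q (y - u)) < 0))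
    by exact (CF (y - u) ltac:(lra) (fun z => z < 0) (open_lt 0 _ S1)).
  generalize (filter_and _ _ A1 (filter_and _ _ A2 A3)). apply filter_imp.
  intros q [B1 [B2 B3]]. destruct (implicit_spec q B1) as [Lq Eq].
  assert (T1 : y - u < implicit q).
  { apply Rnot_le_lt. intros T. destruct T as [T|T].
    - generalize (last_increasing q (implicit q) (y - u) (box_h_d q B1) ltac:(lra) (By (y - u) ltac:(lra)) T). lra.
    - rewrite <- T in B3. lra. }
  assert (T2 : implicit q < y + u).
  { apply Rnot_le_lt. intros T. destruct T as [T|T].
    - generalize (last_increasing q (y + u) (implicit q) (box_h_d q B1) (By (y + u) ltac:(lra)) ltac:(lra) T). lra.
    - rewrite T in B2. lra. }
  change (Rabs (implicit q - y) < eps). apply Rabs_def1; lra.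
Qed.

Lemma implicit_derive i p : i <> X3 -> box h p ->
  let P := up X3 p (implicit p) in
  is_derive (fun x => implicit (up i p x)) (pr i p) (- D i F P / D X3 F P).
Proof.
  intros Hi Hp P. destruct (implicit_spec p Hp) as [L E].
  assert (BP : box d P) by (apply box_up; [now apply box_h_d|lra]).
  apply is_derive_Reals. intros eps Heps.
  (* the difference quotient is a quotient of partial derivatives at two nearby points *)
  assert (Q : locally (P, P) (fun z : pt * pt =>
    Rabs (- D i F (fst z) / D X3 F (snd z) - (- D i F P / D X3 F P)) < eps)).
  { assert (CQ : continuous (fun z : pt * pt => - D i F (fst z) * / D X3 F (snd z)) (P, P)).
    { apply (continuous_mult (fun z : pt * pt => - D i F (fst z)) (fun z => / D X3 F (snd z))).
      - apply (continuous_opp (fun z : pt * pt => D i F (fst z))).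
        apply (continuous_comp (fun z : pt * pt => fst z) (D i F)); [apply continuous_fst|].
        now apply HC.
      - apply (continuous_comp (fun z : pt * pt => snd z) (fun q => / D X3 F q));
          [apply continuous_snd|]. simpl.
        apply (continuous_comp (D X3 F) Rinv); [now apply HC|].
        apply continuous_Rinv. generalize (Hpos P BP). lra. }
    apply (CQ (fun y => Rabs (y - (- D i F P / D X3 F P)) < eps)).
    exists (mkposreal eps Heps). intros y Hy. exact Hy. }
  destruct Q as [eta Heta].
  assert (CI : continuous (fun x => implicit (up i p x)) (pr i p)).
  { apply (continuous_comp (up i p) implicit); [apply continuous_up|]. rewrite up_pr.
    now apply implicit_continuous. }
  assert (CI2 := proj1 (filterlim_locally _ _) CI eta).
  generalize (filter_and _ _ (locally_box_up h i p Hp) CI2). intros [dl Hdl].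
  assert (Hm : 0 < Rmin dl eta) by (apply Rmin_glb_lt; apply cond_pos).
  exists (mkposreal _ Hm). intros t Ht0 Ht. simpl in Ht.
  assert (Ht1 : Rabs t < dl) by (eapply Rlt_le_trans; [exact Ht|apply Rmin_l]).
  assert (Ht2 : Rabs t < eta) by (eapply Rlt_le_trans; [exact Ht|apply Rmin_r]).
  assert (Hball : forall t', Rabs t' <= Rabs t -> ball (pr i p) dl (pr i p + t')).
  { intros t' Ht'. unfold ball; simpl; unfold AbsRing_ball, abs, minus, plus, opp; simpl.
    replace (pr i p + t' + - pr i p) with t' by ring. lra. }
  destruct (Hdl _ (Hball t (Rle_refl _))) as [Bt Yt].
  rewrite up_pr in *. set (Y0 := implicit p) in *. set (x1 := pr i p + t) in *.
  set (Y1 := implicit (up i p x1)) in *.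
  change (Rabs (Y1 - Y0) < eta) in Yt.
  destruct (implicit_spec (up i p x1) Bt) as [L1 E1]. fold Y1 in L1, E1.
  assert (Bx : forall x, Rmin (pr i p) x1 <= x <= Rmax (pr i p) x1 ->
    box h (up i p x) /\ Rabs (x - pr i p) < eta).
  { intros x Hx. assert (Rabs (x - pr i p) <= Rabs t).
    { revert Hx. unfold x1, Rmin, Rmax. destruct Rle_dec; unfold Rabs;
        repeat destruct Rcase_abs; lra. }
    split; [|lra].
    replace x with (pr i p + (x - pr i p)) by ring. now apply Hdl, Hball. }
  assert (By : forall y, Rmin Y0 Y1 <= y <= Rmax Y0 Y1 -> Rabs y < d /\ Rabs (y - Y0) < eta).
  { intros y. revert L L1 Yt. unfold Rmin, Rmax. destruct Rle_dec; unfold Rabs;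
      repeat destruct Rcase_abs; intros; lra. }
  destruct (MVT_gen (fun x => F (up X3 (up i p x) Y1)) (pr i p) x1
    (fun x => D i F (up X3 (up i p x) Y1))) as [c1 [Hc1 M1]].
  { intros x Hx. destruct (Bx x) as [B _]; [lra|].
    assert (B' : box d (up X3 (up i p x) Y1)) by (apply box_up; [now apply box_h_d|lra]).
    destruct (HC i _ B') as [Dx _]. rewrite pr_up_neq, pr_up in Dx by auto.
    eapply is_derive_ext; [|exact Dx]. intros z. cbv beta. now rewrite (up_comm i X3), up_up by auto. }
  { intros x Hx. destruct (Bx x Hx) as [B _].
    apply continuity_pt_filterlim.
    apply (continuous_comp (fun x => up X3 (up i p x) Y1) F).
    - apply (continuous_ext (fun x => up i (up X3 p Y1) x)); [|apply continuous_up].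
      intros z. now rewrite (up_comm i X3) by auto.
    - apply Hc, box_up; [now apply box_h_d|lra]. }
  destruct (MVT_gen (fun y => F (up X3 p y)) Y0 Y1 (fun y => D X3 F (up X3 p y)))
    as [c2 [Hc2 M2]].
  { intros y Hy. destruct (By y) as [B _]; [lra|].
    apply (HC X3 (up X3 p y)). apply box_up; auto. now apply box_h_d. }
  { intros y Hy. destruct (By y Hy) as [B _].
    apply continuity_pt_filterlim. apply (continuous_comp (up X3 p) F); [apply continuous_up|].
    apply Hc, box_up; auto. now apply box_h_d. }
  rewrite E1 in M1. rewrite up_pr in M1. rewrite E in M2.
  set (P1 := up X3 (up i p c1) Y1) in *. set (P2 := up X3 p c2) in *.
  destruct (Bx c1 Hc1) as [Bc1 Nc1]. destruct (By c2 Hc2) as [Bc2 Nc2].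
  assert (BP2 : box d P2) by (apply box_up; auto; now apply box_h_d).
  generalize (Hpos P2 BP2). intros NZ.
  replace ((Y1 - Y0) / t) with (- D i F P1 / D X3 F P2).
  2: { assert (Et : x1 - pr i p = t) by (unfold x1; ring). rewrite Et in M1.
       apply (Rmult_eq_reg_r (D X3 F P2 * t)); [|apply Rmult_integral_contrapositive; lra].
       field_simplify; [lra|lra|lra]. }
  apply (Heta (P1, P2)). split; apply ball_pt; simpl fst; simpl snd; unfold P1, P2, P.
  - intros j. destruct (ix_dec X3 j) as [<-|Nj].
    + rewrite !pr_up. exact Yt.
    + rewrite !(pr_up_neq X3 j) by auto. destruct (ix_dec i j) as [<-|Nij].
      * now rewrite pr_up.
      * rewrite pr_up_neq by auto. rewrite Rminus_diag, Rabs_R0. apply cond_pos.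
  - intros j. destruct (ix_dec X3 j) as [<-|Nj].
    + now rewrite !pr_up.
    + rewrite !(pr_up_neq X3 j) by auto. rewrite Rminus_diag, Rabs_R0. apply cond_pos.
Qed.

End ImplicitFunction.

Lemma near_C1_box b F : Reg b F -> 0 < D X3 F orig -> exists d, 0 < d /\ C1 d F /\
  (forall p, box d p -> continuous F p) /\ (forall p, box d p -> 0 < D X3 F p).
Proof.
  intros HF H3. destruct (Reg_C1 _ _ HF) as (d1 & Hd1 & HC & Hc).
  assert (N : near (fun p => 0 < D X3 F p)).
  { apply (near_cont (fun y => 0 < y)); [apply Reg_cont with b, Reg_D, HF|].
    now apply open_gt. }
  destruct N as [d2 [Hd2 N]]. exists (Rmin d1 d2).
  split; [now apply Rmin_glb_lt|]. generalize (Rmin_l d1 d2) (Rmin_r d1 d2). intros A B.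
  split; [|split].
  - intros i p Hp. apply HC. now apply (box_le (Rmin d1 d2)).
  - intros p Hp. apply Hc. now apply (box_le (Rmin d1 d2)).
  - intros p Hp. apply N. now apply (box_le (Rmin d1 d2)).
Qed.

(** The partial derivatives of the solution are [- D i F / D X3 F] evaluated on its
    own graph, so that [Bd_graph] bounds all its derivatives. *)
Lemma implicit_function_pos b F : Reg b F -> F orig = 0 -> 0 < D X3 F orig ->
  exists Y, Reg b Y /\ Y orig = 0 /\ (forall p x, Y (up X3 p x) = Y p) /\
    near (fun p => F (up X3 p (Y p)) = 0) /\ near (fun p => F p = 0 -> pr X3 p = Y p).
Proof.
  intros HF F0 H3.
  destruct (near_C1_box b F HF H3) as (d & Hd & HC & Hc & Hpos).
  set (e := d / 2). assert (He : 0 < e < d) by (unfold e; lra).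
  assert (Ab : Rabs (- e) < d /\ Rabs e < d) by (split; apply Rabs_def1; unfold e; lra).
  assert (S0 : F (up X3 orig (- e)) < 0 < F (up X3 orig e)).
  { change orig with (up X3 orig 0) in F0. rewrite <- F0 at 1 2.
    assert (Rabs 0 < d) by (rewrite Rabs_R0; lra).
    split; apply (last_increasing F d); auto; try apply box_orig; lra. }
  assert (CF : forall t, Rabs t < d -> continuous (fun q => F (up X3 q t)) orig).
  { intros t Ht. apply (continuous_comp (fun q => up X3 q t) F).
    - simpl. apply continuous_tuple; try apply continuous_const;
      [apply (continuous_pr X0)|apply (continuous_pr X1)|apply (continuous_pr X2)].
    - apply Hc, box_up; auto. now apply box_orig. }
  assert (L1 : locally orig (fun q => F (up X3 q (- e)) < 0))
    by exact (CF _ (proj1 Ab) (fun z => z < 0) (open_lt 0 _ (proj1 S0))).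
  assert (L2 : locally orig (fun q => 0 < F (up X3 q e)))
    by exact (CF _ (proj2 Ab) (fun z => 0 < z) (open_gt 0 _ (proj2 S0))).
  destruct (small_box _ (filter_and _ _ L1 L2)) as [h0 [Hh0 Hs]].
  set (h := Rmin h0 e).
  assert (Hh : 0 < h <= e) by (split; [apply Rmin_glb_lt; lra|apply Rmin_r]).
  assert (Hsign : forall p, box h p -> F (up X3 p (- e)) < 0 < F (up X3 p e)).
  { intros p Hp. apply Hs. apply (box_le h); auto. apply Rmin_l. }
  set (Y := implicit F e).
  assert (IP : forall p x, Y (up X3 p x) = Y p) by reflexivity.
  assert (Y0 : Y orig = 0).
  { symmetry. apply (implicit_unique F d HC Hc Hpos e h He Hh Hsign orig 0).
    apply box_orig; lra. rewrite Rabs_R0; lra. exact F0. }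
  exists Y. split; [|split; [exact Y0|split; [exact IP|split]]].
  - set (Phi := fun i => match i with X3 => fun _ : pt => 0
      | _ => fun p => - D i F p / D X3 F p end).
    assert (RPhi : forall i, Reg b (Phi i)).
    { intros i. assert (Q : forall j, Reg b (fun p => - D j F p / D X3 F p)).
      { intros j. apply Reg_div; [apply Reg_opp|..]; try apply Reg_D; auto. lra. }
      destruct i; [apply (Q X0)|apply (Q X1)|apply (Q X2)|apply (Reg_const b 0)]. }
    destruct (Reg_2 b _ _ (RPhi X0) (RPhi X1)) as (d1 & c1 & r1 & Hd1 & Hc1 & Hr1 & P0 & P1).
    destruct (RPhi X2) as (d2 & c2 & r2 & Hd2 & Hc2 & Hr2 & P2).
    set (dd := Rmin d1 d2). set (A := c1 + c2). set (s := 2 * (r1 + r2)).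
    assert (Hdd : 0 < dd) by (apply Rmin_glb_lt; lra).
    assert (dd <= d1) by apply Rmin_l. assert (dd <= d2) by apply Rmin_r.
    assert (NY : near (fun p => Rabs (Y p) < dd)).
    { assert (CY : continuous Y orig).
      { apply (implicit_continuous F d HC Hc Hpos e h He Hh Hsign). apply box_orig; lra. }
      assert (0 < dd) by lra.
      assert (LY : locally orig (fun p => Rabs (Y p) < dd)).
      { apply (CY (fun y => Rabs y < dd)). rewrite Y0.
        apply (continuous_Rabs 0 (fun y => y < dd)), open_lt. now rewrite Rabs_R0. }
      destruct (small_box _ LY) as [x [Hx Kx]]. now exists x. }
    destruct NY as [d3 [Hd3 NY]].
    set (d' := Rmin (Rmin d3 h) dd).
    assert (Hd' : 0 < d') by (repeat apply Rmin_glb_lt; lra).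
    assert (D1 : d' <= d3) by (eapply Rle_trans; apply Rmin_l).
    assert (D2 : d' <= h) by (eapply Rle_trans; [apply Rmin_l|apply Rmin_r]).
    assert (D3 : d' <= dd) by apply Rmin_r.
    assert (HA : 0 <= A) by (unfold A; lra). assert (Hs1 : 1 <= s) by (unfold s; lra).
    exists d', 1, (s * (1 + 2 * A)). repeat split; try lra; try nra.
    intros n. apply (Bd_ext b d' n _ (fun p => pr X3 (pr X0 p, pr X1 p, pr X2 p, Y p)));
      [reflexivity|].
    apply (Bd_graph b dd d' A s Phi Y n HA Hs1).
    + intros i m. destruct i.
      * apply (RB_le b d1 c1 r1); auto; unfold A, s; lra.
      * apply (RB_le b d1 c1 r1); auto; unfold A, s; lra.
      * apply (RB_le b d2 c2 r2); auto; unfold A, s; lra.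
      * apply (Bd_const b dd _ m 0); [rewrite Rabs_R0|intros j]; apply shape_pos; lra.
    + intros p Hp. split.
      * apply box_tuple; try (eapply Rlt_le_trans; [apply Hp|exact D3]).
        apply NY. now apply (box_le d').
      * apply (implicit_continuous F d HC Hc Hpos e h He Hh Hsign). now apply (box_le d').
    + intros i p Hp. destruct i; try (apply (implicit_derive F d HC Hc Hpos e h He Hh Hsign);
        [discriminate|now apply (box_le d')]).
      apply (is_derive_ext (fun _ => Y p)); [reflexivity|]. apply is_derive_cst.
    + lra.
    + eapply Bd_le; [|apply (Bd_pr_shape b dd n X3); lra].
      intros j. apply shape_le; auto; lra.
  - exists h. split; [lra|]. intros p Hp.
    now apply (implicit_spec F d Hc e h He Hh Hsign).
  - exists h. split; [lra|]. intros p Hp Fp.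
    apply (implicit_unique F d HC Hc Hpos e h He Hh Hsign); auto.
    + eapply Rlt_trans; [apply Hp|lra].
    + now rewrite up_pr.
Qed.

Lemma implicit_function b F : Reg b F -> F orig = 0 -> D X3 F orig <> 0 ->
  exists Y, Reg b Y /\ Y orig = 0 /\ (forall p x, Y (up X3 p x) = Y p) /\
    near (fun p => F (up X3 p (Y p)) = 0) /\ near (fun p => F p = 0 -> pr X3 p = Y p).
Proof.
  intros HF F0 H3. destruct (Rlt_dec 0 (D X3 F orig)) as [L|L].
  - now apply implicit_function_pos.
  - destruct (implicit_function_pos b (fun p => - F p)) as (Y & HY & Y0 & IP & N1 & N2).
    + now apply Reg_opp.
    + lra.
    + rewrite D_opp. lra.
    + exists Y. repeat split; auto.
      * revert N1. apply near_imp. intros; lra.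
      * revert N2. apply near_imp. intros p H E. apply H. lra.
Qed.

(** * Series of functions *)

Lemma series_tail (m : nat -> R) : ex_series m -> forall eps, 0 < eps ->
  exists N, Rabs (Series (fun n => m (S N + n)%nat)) < eps.
Proof.
  intros Hm eps He. assert (S := Series_correct m Hm).
  destruct (proj1 (filterlim_locally _ _) S (mkposreal eps He)) as [N HN].
  exists N. specialize (HN N (le_n N)).
  change (Rabs (sum_n m N - Series m) < eps) in HN.
  assert (E := Series_incr_n m (Datatypes.S N) ltac:(lia) Hm).
  simpl pred in E. rewrite <- sum_n_Reals in E. rewrite E in HN.
  set (t := Series (fun n => m (Datatypes.S N + n)%nat)) in *.
  replace (sum_n m N - (sum_n m N + t)) with (- t) in HN by ring. now rewrite Rabs_Ropp in HN.
Qed.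

Lemma series_abs_le (a m : nat -> R) : (forall n, Rabs (a n) <= m n) -> ex_series m ->
  ex_series a /\ Rabs (Series a) <= Series m.
Proof.
  intros H Hm. assert (Ha : ex_series (fun n => Rabs (a n))).
  { apply (ex_series_le (V := R_CompleteNormedModule) _ m); auto. intros n.
    unfold norm; simpl; unfold abs; simpl. now rewrite Rabs_Rabsolu. }
  split; [now apply ex_series_Rabs|].
  eapply Rle_trans; [now apply Series_Rabs|]. apply Series_le; auto.
  intros n. split; auto using Rabs_pos.
Qed.

Lemma series_continuous {U : UniformSpace} (f : nat -> U -> R) (m : nat -> R) x :
  locally x (fun y => forall n, Rabs (f n y) <= m n) ->
  (forall n, continuous (f n) x) -> ex_series m ->
  continuous (fun y => Series (fun n => f n y)) x.
Proof.
  intros Hb Hc Hm. apply filterlim_locally. intros eps.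
  assert (He : 0 < eps / 3) by (generalize (cond_pos eps); lra).
  destruct (series_tail m Hm _ He) as [N HN].
  assert (HmN : ex_series (fun n => m (S N + n)%nat)) by now apply (ex_series_incr_n m (S N)).
  assert (CN : continuous (fun y => sum_n (fun n => f n y) N) x).
  { clear HN HmN. induction N as [|N IH].
    - apply (continuous_ext (f 0%nat)); [intros; now rewrite sum_O|auto].
    - apply (continuous_ext (fun y => sum_n (fun n => f n y) N + f (S N) y)).
      + intros y. now rewrite sum_Sn.
      + now apply (continuous_plus (fun y => sum_n (fun n => f n y) N) (f (S N))). }
  assert (C2 := proj1 (filterlim_locally _ _) CN (mkposreal _ He)).
  generalize (filter_and _ _ Hb C2). apply filter_imp. intros y [By Cy].
  assert (Bx := locally_singleton _ _ Hb). simpl in Bx.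
  change (Rabs (sum_n (fun n => f n y) N - sum_n (fun n => f n x) N) < eps / 3) in Cy.
  change (Rabs (Series (fun n => f n y) - Series (fun n => f n x)) < eps).
  destruct (series_abs_le _ _ By Hm) as [Ey _]. destruct (series_abs_le _ _ Bx Hm) as [Ex _].
  rewrite (Series_incr_n (fun n => f n y) (S N)) by (auto; lia).
  rewrite (Series_incr_n (fun n => f n x) (S N)) by (auto; lia).
  simpl pred. rewrite <- !sum_n_Reals.
  destruct (series_abs_le (fun n => f (S N + n)%nat y) _ (fun n => By (S N + n)%nat) HmN) as [_ Ty].
  destruct (series_abs_le (fun n => f (S N + n)%nat x) _ (fun n => Bx (S N + n)%nat) HmN) as [_ Tx].
  set (ty := Series (fun n => f (S N + n)%nat y)) in *.
  set (tx := Series (fun n => f (S N + n)%nat x)) in *.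
  set (t := Series (fun n => m (S N + n)%nat)) in *.
  assert (t <= Rabs t) by apply Rle_abs.
  replace (sum_n (fun n => f n y) N + ty - (sum_n (fun n => f n x) N + tx))
    with ((sum_n (fun n => f n y) N - sum_n (fun n => f n x) N) + (ty + - tx)) by ring.
  eapply Rle_lt_trans; [apply Rabs_triang|].
  assert (Rabs (ty + - tx) <= Rabs ty + Rabs tx)
    by (eapply Rle_trans; [apply Rabs_triang|rewrite Rabs_Ropp; lra]).
  lra.
Qed.

(** The difference quotients extended by the derivative form a uniformly
    convergent series of functions continuous at [0]. *)
Lemma series_derive (u u' : nat -> R -> R) (M m : nat -> R) x r : 0 < r ->
  (forall n y, Rabs (y - x) < r -> is_derive (u n) y (u' n y) /\ Rabs (u' n y) <= m n) ->
  (forall n y, Rabs (y - x) < r -> Rabs (u n y) <= M n) ->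
  ex_series m -> ex_series M ->
  is_derive (fun y => Series (fun n => u n y)) x (Series (fun n => u' n x)).
Proof.
  intros Hr Hu HM Em EM.
  set (q := fun n h => if Req_EM_T h 0 then u' n x else (u n (x + h) - u n x) / h).
  assert (Hx : Rabs (x - x) < r) by (rewrite Rminus_diag, Rabs_R0; lra).
  assert (CQ : continuous (fun h => Series (fun n => q n h)) 0).
  { apply (series_continuous q m); auto.
    - exists (mkposreal r Hr). intros h Hh n. change (Rabs (h - 0) < r) in Hh.
      rewrite Rminus_0_r in Hh. unfold q. destruct Req_EM_T as [->|N]; [now apply Hu|].
      destruct (MVT_gen (u n) x (x + h) (u' n)) as [c [Hc E]].
      + intros y Hy. apply Hu. revert Hy Hh. unfold Rmin, Rmax. destruct Rle_dec; 
          unfold Rabs; repeat destruct Rcase_abs; lra.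
      + intros y Hy. apply continuity_pt_filterlim.
        apply (ex_derive_continuous (u n)). eexists. apply Hu. revert Hy Hh.
        unfold Rmin, Rmax. destruct Rle_dec; unfold Rabs; repeat destruct Rcase_abs; lra.
      + replace ((u n (x + h) - u n x) / h) with (u' n c) by (rewrite E; field; auto).
        apply Hu. revert Hc Hh. unfold Rmin, Rmax. destruct Rle_dec; 
          unfold Rabs; repeat destruct Rcase_abs; lra.
    - intros n. apply filterlim_locally. intros eps.
      destruct (Hu n x Hx) as [D0 _]. apply is_derive_Reals in D0.
      destruct (D0 eps (cond_pos eps)) as [dl Hdl]. exists dl. intros h Hh.
      change (Rabs (h - 0) < dl) in Hh. rewrite Rminus_0_r in Hh.
      change (Rabs (q n h - q n 0) < eps). unfold q at 2. destruct (Req_EM_T 0 0); [|easy].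
      unfold q. destruct Req_EM_T as [->|N]; [|now apply Hdl].
      rewrite Rminus_diag, Rabs_R0. apply cond_pos. }
  apply is_derive_Reals. intros eps He.
  destruct (proj1 (filterlim_locally _ _) CQ (mkposreal eps He)) as [dl Hdl].
  assert (Hd : 0 < Rmin dl r) by (apply Rmin_glb_lt; auto; apply cond_pos).
  exists (mkposreal _ Hd). intros h Hh0 Hh. simpl in Hh.
  assert (H1 : ball 0 dl h).
  { change (Rabs (h - 0) < dl). rewrite Rminus_0_r. eapply Rlt_le_trans; [exact Hh|apply Rmin_l]. }
  specialize (Hdl h H1).
  change (Rabs (Series (fun n => q n h) - Series (fun n => q n 0)) < eps) in Hdl.
  rewrite (Series_ext (fun n => q n 0) (fun n => u' n x)) in Hdl.
  2: { intros n. unfold q. now destruct (Req_EM_T 0 0). }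
  replace ((Series (fun n => u n (x + h)) - Series (fun n => u n x)) / h)
    with (Series (fun n => q n h)); auto.
  assert (Hxh : Rabs (x + h - x) < r).
  { replace (x + h - x) with h by ring. eapply Rlt_le_trans; [exact Hh|apply Rmin_r]. }
  rewrite <- Series_minus.
  2: { apply (series_abs_le _ M); auto. }
  2: { apply (series_abs_le _ M); auto. }
  unfold Rdiv. rewrite <- Series_scal_r. apply Series_ext. intros n.
  unfold q. destruct Req_EM_T; [easy|reflexivity].
Qed.

Lemma D_series d (M : nat -> nat -> R) f i p : 
  (forall n, Bd true d (M n) 1 (f n)) -> (forall j, ex_series (fun n => M n j)) -> box d p ->
  is_derive (fun x => Series (fun n => f n (up i p x))) (pr i p) (Series (fun n => D i (f n) p)).
Proof.
  intros Hf HM Hp. destruct (locally_box_up d i p Hp) as [r Hr].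
  assert (E : forall x, Rabs (x - pr i p) < r -> box d (up i p x)) by (intros; now apply Hr).
  rewrite (Series_ext _ (fun n => D i (f n) (up i p (pr i p)))) by (intros; now rewrite up_pr).
  apply (series_derive (fun n x => f n (up i p x)) (fun n x => D i (f n) (up i p x))
    (fun n => M n 0%nat) (fun n => M n 1%nat) (pr i p) r); auto; try apply cond_pos.
  - intros n y Hy. specialize (E y Hy). split.
    + generalize (Bd_deriv _ _ _ _ _ i _ (Hf n) E). rewrite pr_up. apply is_derive_ext.
      intros t. now rewrite up_up.
    + exact (Bd_bound _ _ _ _ _ (Bd_D _ _ _ _ _ i (Hf n)) E).
  - intros n y Hy. eapply Bd_bound; eauto.
Qed.

Lemma Bd_series d N : forall (M : nat -> nat -> R) f,
  (forall n, Bd true d (M n) N (f n)) -> (forall j, ex_series (fun n => M n j)) ->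
  Bd true d (fun j => Series (fun n => M n j)) N (fun p => Series (fun n => f n p)).
Proof.
  assert (CT : forall N M f, (forall n, Bd true d (M n) N (f n)) ->
    (forall j, ex_series (fun n => M n j)) -> forall p, box d p ->
    continuous (fun p => Series (fun n => f n p)) p /\
    Rabs (Series (fun n => f n p)) <= Series (fun n => M n 0%nat)).
  { intros m M f Hf HM p Hp. split.
    - apply (series_continuous f (fun n => M n 0%nat)); auto.
      + generalize (locally_box d p Hp). apply filter_imp. intros q Hq n. eapply Bd_bound; eauto.
      + intros n. eapply Bd_cont; eauto.
    - apply series_abs_le; auto. intros n. eapply Bd_bound; eauto. }
  induction N as [|N IH]; intros M f Hf HM.
  - split; auto. intros p Hp. destruct (CT 0%nat M f Hf HM p Hp). auto.
  - apply (Bd_intro _ _ _ _ _ (fun i p => Series (fun n => D i (f n) p))).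
    + intros p Hp. now apply (CT (S N) M f).
    + intros _ p Hp. now apply (CT (S N) M f).
    + intros i p Hp. apply (D_series d M); auto.
      intros n. specialize (Hf n). clear - Hf. induction N; auto. now apply IHN, Bd_down.
    + intros i. apply (IH (fun n j => M n (S j)) (fun n => D i (f n))).
      * intros n. apply (Bd_D _ _ _ _ _ i (Hf n)).
      * intros j. apply HM.
Qed.

(** * Smooth functions on a box *)

Definition Sm (d : R) (f : pt -> R) : Prop := forall n, Bd false d (fun _ => 0) n f.

Definition F1 (z : R -> R) : pt -> R := fun p => z (pr X0 p).
Definition F2 (f : R -> R -> R) : pt -> R := fun p => f (pr X0 p) (pr X1 p).

Lemma Sm_ext d f g : (forall p, box d p -> f p = g p) -> Sm d f -> Sm d g.
Proof. intros E H n. now apply (Bd_ext _ _ _ _ f). Qed.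

Lemma Sm_box d d' f : d' <= d -> Sm d f -> Sm d' f.
Proof. intros L H n. now apply (Bd_box _ d). Qed.

Lemma Sm_of_RB b d c r f : RB b d c r f -> Sm d f.
Proof. intros H n. eapply Bd_forget, H. Qed.

Lemma RB_of_Sm d c r f : Sm d f -> RB false d c r f.
Proof. intros H n. eapply Bd_forget, H. Qed.

Lemma Reg_of_Sm d f : 0 < d -> Sm d f -> Reg false f.
Proof.
  intros Hd H. assert (0 < Rmin d 1) by (apply Rmin_glb_lt; lra).
  exists (Rmin d 1), 0, 1. generalize (Rmin_r d 1). intros. repeat split; try lra.
  apply RB_of_Sm, (Sm_box d); auto. apply Rmin_l.
Qed.

Lemma Sm_of_Reg f : Reg false f -> exists d, 0 < d <= 1 /\ Sm d f.
Proof. intros (d & c & r & Hd & _ & _ & H). exists d. split; auto. eapply Sm_of_RB; eauto. Qed.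

Lemma Sm_cont d f p : Sm d f -> box d p -> continuous f p.
Proof. intros H. eapply Bd_cont, (H 0%nat). Qed.

Lemma Sm_C1 d f : Sm d f -> C1 d f.
Proof. intros H. eapply Bd_C1, (H 1%nat). Qed.

Lemma Sm_dif d f i p : Sm d f -> box d p -> dif i f p.
Proof. intros H. apply C1_dif. now apply Sm_C1. Qed.

Lemma Sm_D d f i : Sm d f -> Sm d (D i f).
Proof. intros H n. apply (Bd_D _ _ (fun _ => 0) _ _ i (H (S n))). Qed.

Lemma Sm_schwarz d f i j p : Sm d f -> box d p -> D i (D j f) p = D j (D i f) p.
Proof. intros H. eapply (schwarz _ _ _ 0), (H 2%nat). Qed.

Lemma Sm_const d c : Sm d (fun _ => c).
Proof.
  intros n. apply (Bd_forget true d (fun _ => Rabs c)), Bd_const; try lra.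
  intros; apply Rabs_pos.
Qed.

Lemma Sm_pr d i : Sm d (pr i).
Proof.
  intros n. apply (Bd_forget false d (fun _ => Rabs d + 1)), Bd_pr;
    generalize (Rabs_pos d) (Rle_abs d); intros; lra.
Qed.

Lemma Sm_plus d f g : Sm d f -> Sm d g -> Sm d (fun p => f p + g p).
Proof. intros F G n. eapply Bd_forget, Bd_plus; [apply F|apply G]. Qed.

Lemma Sm_mult d f g : Sm d f -> Sm d g -> Sm d (fun p => f p * g p).
Proof. intros F G n. eapply Bd_forget, Bd_mult; [apply F|apply G]. Qed.

Lemma Sm_scal d c f : Sm d f -> Sm d (fun p => c * f p).
Proof. intros; now apply Sm_mult; [apply Sm_const|]. Qed.

Lemma Sm_opp d f : Sm d f -> Sm d (fun p => - f p).
Proof. intros F n. apply Bd_opp, F. Qed.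

Lemma Sm_minus d f g : Sm d f -> Sm d g -> Sm d (fun p => f p - g p).
Proof. intros; apply Sm_plus; auto using Sm_opp. Qed.

Lemma Sm_pow d f n : Sm d f -> Sm d (fun p => f p ^ n).
Proof. intros H. induction n; simpl; [apply Sm_const|now apply Sm_mult]. Qed.

Lemma Sm_prim d f i : d <= 1 -> Sm d f -> Sm d (prim i f).
Proof.
  intros Hd H n. apply (Bd_forget false d (shape 0 1 0)), Bd_prim; try lra.
  apply RB_of_Sm, H.
Qed.

Lemma Sm_comp d d' f g0 g1 g2 g3 : Sm d f ->
  Sm d' g0 -> Sm d' g1 -> Sm d' g2 -> Sm d' g3 ->
  (forall p, box d' p -> box d (g0 p, g1 p, g2 p, g3 p)) ->
  Sm d' (fun p => f (g0 p, g1 p, g2 p, g3 p)).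
Proof.
  intros F G0 G1 G2 G3 Hb n.
  eapply Bd_forget, (Bd_comp false d d' 0 0 0) with (c := 0) (q := 0%nat); auto; try lra;
   apply RB_of_Sm; auto.
Qed.

Lemma Sm_inv d f : Sm d f -> (forall p, box d p -> f p <> 0) -> Sm d (fun p => / f p).
Proof.
  intros F Hz. assert (CT : forall p, box d p -> continuous (fun p => / f p) p).
  { intros p Hp. apply (continuous_comp f Rinv); [eapply Sm_cont; eauto|].
    apply continuous_Rinv. auto. }
  intros n. induction n as [|n IH].
  - split; auto. intros p Hp. split; auto. discriminate.
  - apply (Bd_intro _ _ _ _ _ (fun i p => - (D i f p * (/ f p * / f p)))); auto.
    + discriminate.
    + intros i p Hp. generalize (Sm_dif d f i p F Hp). intros Hd.
      replace (- (D i f p * (/ f p * / f p))) with (- D i f p / (f (up i p (pr i p)))^2).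
      2: { rewrite up_pr. field. auto. }
      apply (is_derive_inv (fun x => f (up i p x))); auto. rewrite up_pr; auto.
    + intros i. apply Bd_opp.
      apply (Bd_forget false d (conv (fun _ => 0) (conv (fun _ => 0) (fun _ => 0)))).
      apply Bd_mult; [apply Sm_D, F|]. apply Bd_mult; apply IH.
Qed.

Lemma box_F2 d x y : Rabs x < d -> Rabs y < d -> box d (x, y, 0, 0).
Proof.
  intros Hx Hy. apply box_tuple; auto; rewrite Rabs_R0;
    eapply Rle_lt_trans; try apply Rabs_pos; eauto.
Qed.

Lemma Sm_F2_comp d d' f g0 g1 : 0 < d -> Sm d (F2 f) -> Sm d' g0 -> Sm d' g1 ->
  (forall p, box d' p -> Rabs (g0 p) < d /\ Rabs (g1 p) < d) ->
  Sm d' (fun p => f (g0 p) (g1 p)).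
Proof.
  intros Hd F G0 G1 Hb.
  apply (Sm_ext d' (fun p => F2 f (g0 p, g1 p, 0, 0))); [reflexivity|].
  apply (Sm_comp d d' (F2 f)); auto; try apply Sm_const.
  intros p Hp. destruct (Hb p Hp). now apply box_F2.
Qed.

(** ** Integration along the parabolas [xi^2 + s y = const] *)

Lemma Rabs_sqr_lt x e : Rabs x < e -> x ^ 2 < e ^ 2.
Proof. intros H. rewrite <- (pow2_abs x). assert (0 <= Rabs x) by apply Rabs_pos. nra. Qed.

(** The values of [w] on the parabola through [(X0, X1)], parametrized by the
    ordinate [X2]. *)
Definition parabola (w : R -> R -> R) (s : R) (p : pt) : R :=
  w (pr X0 p + s * (pr X1 p ^ 2 - pr X2 p ^ 2)) (pr X2 p).

(** The integral from [c] to [xi], written as a difference of two primitives because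
    these are known to be smooth in all variables. *)
Definition leafint (w : R -> R -> R) (s c y xi : R) : R :=
  - s * (prim X2 (parabola w s) (y, xi, xi, 0) - prim X2 (parabola w s) (y, xi, c, 0)).

Lemma parabola_range s d e : s = 1 \/ s = -1 -> 0 < e -> e <= 1 -> 2 * e <= d ->
  forall p, box e p ->
    Rabs (pr X0 p + s * (pr X1 p ^ 2 - pr X2 p ^ 2)) < d /\ Rabs (pr X2 p) < d.
Proof.
  intros Hs He He1 Hd p Hp.
  generalize (Rabs_sqr_lt _ _ (Hp X1)) (Rabs_sqr_lt _ _ (Hp X2)).
  generalize (Rabs_def2 _ _ (Hp X0)) (pow2_ge_0 (pr X1 p)) (pow2_ge_0 (pr X2 p)).
  intros A1 A2 A3 A4 A5. split; [|generalize (Hp X2); lra].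
  assert (e ^ 2 <= e) by nra.
  apply Rabs_def1; destruct Hs as [-> | ->]; lra.
Qed.

Lemma Sm_parabola w s d e : s = 1 \/ s = -1 -> 0 < e -> e <= 1 -> 2 * e <= d ->
  Sm d (F2 w) -> Sm e (parabola w s).
Proof.
  intros Hs He He1 Hd Hw.
  apply (Sm_F2_comp d e w); auto; try lra.
  - apply Sm_plus; [apply Sm_pr|]. apply Sm_scal. apply Sm_minus; apply Sm_pow, Sm_pr.
  - apply Sm_pr.
  - now apply parabola_range.
Qed.

(** The field [2 xi d/dy - s d/dxi] is tangent to the parabolas and moves the ordinate
    with speed [- s], so that integration in the ordinate inverts it. *)
Lemma leaf_primitive w s d e c : s = 1 \/ s = -1 -> 0 < e -> e <= 1 -> 2 * e <= d ->
  Sm d (F2 w) -> Rabs c < e ->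
  Sm e (F2 (leafint w s c)) /\
  forall p, box e p ->
    2 * pr X1 p * D X0 (F2 (leafint w s c)) p - s * D X1 (F2 (leafint w s c)) p
    = w (pr X0 p) (pr X1 p).
Proof.
  intros Hs He He1 Hd Hw Hc.
  assert (Bw := parabola_range s d e Hs He He1 Hd).
  assert (SG := Sm_parabola w s d e Hs He He1 Hd Hw).
  assert (G0 : Sm e (fun p => pr X0 p + s * (pr X1 p ^ 2 - pr X2 p ^ 2))).
  { apply Sm_plus; [apply Sm_pr|]. apply Sm_scal. apply Sm_minus; apply Sm_pow, Sm_pr. }
  set (I := prim X2 (parabola w s)).
  assert (SI : Sm e I) by now apply Sm_prim.
  assert (Zc : Rabs 0 < e) by now rewrite Rabs_R0.
  assert (SL : Sm e (F2 (leafint w s c))).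
  { apply (Sm_scal e (- s)). apply Sm_minus.
    - apply (Sm_comp e e I (pr X0) (pr X1) (pr X1) (fun _ => 0)); auto using Sm_pr, Sm_const.
      intros p Hp. apply box_tuple; auto.
    - apply (Sm_comp e e I (pr X0) (pr X1) (fun _ => c) (fun _ => 0)); auto using Sm_pr, Sm_const.
      intros p Hp. apply box_tuple; auto. }
  split; auto. intros p Hp.
  set (P := (pr X0 p, pr X1 p, pr X1 p, 0)). set (Q := (pr X0 p, pr X1 p, c, 0)).
  assert (BP : box e P) by (apply box_tuple; auto).
  assert (BQ : box e Q) by (apply box_tuple; auto).
  assert (DL : forall i, i = X0 \/ i = X1 -> D i (F2 (leafint w s c)) p =
    - s * ((D i I P + delta X1 i * D X2 I P) - D i I Q)).
  { intros i Hi. unfold F2, leafint. rewrite D_scal. f_equal.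
    assert (T := fun j => Sm_dif e (pr j) i p (Sm_pr e j) Hp).
    assert (Tc := fun c => Sm_dif e (fun _ => c) i p (Sm_const e c) Hp).
    assert (A1 := D_comp e I (pr X0) (pr X1) (pr X1) (fun _ => 0) i p (Sm_C1 _ _ SI) BP
      (T X0) (T X1) (T X1) (Tc 0)).
    assert (A2 := D_comp e I (pr X0) (pr X1) (fun _ => c) (fun _ => 0) i p (Sm_C1 _ _ SI) BQ
      (T X0) (T X1) (Tc c) (Tc 0)).
    cbv zeta in A1, A2. rewrite !D_pr, !D_const in A1, A2. rewrite ?(D_const i 0) in A2.
    rewrite (D_minus i (fun q => I (pr X0 q, pr X1 q, pr X1 q, 0))
      (fun q => I (pr X0 q, pr X1 q, c, 0))).
    - rewrite (D_val i (fun q => I (pr X0 q, pr X1 q, pr X1 q, 0)) p _ A1).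
      rewrite (D_val i (fun q => I (pr X0 q, pr X1 q, c, 0)) p _ A2).
      destruct Hi as [-> | ->]; unfold delta; repeat (destruct ix_dec; try easy); unfold P, Q; ring.
    - unfold dif. rewrite (D_val i (fun q => I (pr X0 q, pr X1 q, pr X1 q, 0)) p _ A1). exact A1.
    - unfold dif. rewrite (D_val i (fun q => I (pr X0 q, pr X1 q, c, 0)) p _ A2). exact A2. }
  assert (CG := fun q => Sm_cont e _ q SG).
  assert (DI : forall q, box e q -> D X1 I q = 2 * s * pr X1 q * D X0 I q).
  { intros q Hq.
    rewrite (D_val X1 I q _ (is_derive_prim e _ X2 X1 q (Sm_C1 _ _ SG) CG Hq)).
    rewrite (D_val X0 I q _ (is_derive_prim e _ X2 X0 q (Sm_C1 _ _ SG) CG Hq)).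
    destruct (ix_dec X2 X1); [easy|]. destruct (ix_dec X2 X0); [easy|]. unfold prim.
    rewrite <- (RInt_scal (V := R_CompleteNormedModule)).
    2: { apply (ex_RInt_slice e); auto. intros; eapply Sm_cont; [apply Sm_D, SG|auto]. }
    apply RInt_ext. intros t Ht. unfold scal; simpl; unfold mult; simpl.
    assert (Bt : box e (up X2 q t)).
    { apply box_up; auto. generalize (Hq X2). revert Ht. unfold Rmin, Rmax.
      destruct Rle_dec; unfold Rabs; repeat destruct Rcase_abs; lra. }
    set (q' := up X2 q t) in *. change (snd (fst (fst q))) with (pr X1 q').
    destruct (Bw q' Bt) as [W1 W2].
    assert (Bw' := box_F2 _ _ _ W1 W2).
    assert (K : forall i, i = X0 \/ i = X1 -> D i (parabola w s) q' =
      D X0 (F2 w) (pr X0 q' + s * (pr X1 q' ^ 2 - pr X2 q' ^ 2), pr X2 q', 0, 0) *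
      D i (fun p => pr X0 p + s * (pr X1 p ^ 2 - pr X2 p ^ 2)) q').
    { intros i Hi. apply D_val.
      assert (A := D_comp d (F2 w) (fun p => pr X0 p + s * (pr X1 p ^ 2 - pr X2 p ^ 2)) (pr X2)
        (fun _ => 0) (fun _ => 0) i q' (Sm_C1 _ _ Hw) Bw' (Sm_dif _ _ _ _ G0 Bt)
        (Sm_dif _ _ _ _ (Sm_pr e X2) Bt) (Sm_dif _ _ _ _ (Sm_const e 0) Bt)
        (Sm_dif _ _ _ _ (Sm_const e 0) Bt)).
      cbv zeta in A. rewrite !D_const, D_pr in A.
      match type of A with is_derive _ _ ?v => match goal with |- is_derive _ _ ?u =>
        replace u with v; [exact A|] end end.
      destruct Hi as [-> | ->]; unfold delta; repeat (destruct ix_dec; try easy); ring. }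
    rewrite !K by auto.
    assert (E0 : D X0 (fun p => pr X0 p + s * (pr X1 p ^ 2 - pr X2 p ^ 2)) q' = 1).
    { apply D_val. simpl. auto_derive; auto. }
    assert (E1 : D X1 (fun p => pr X0 p + s * (pr X1 p ^ 2 - pr X2 p ^ 2)) q' = 2 * s * pr X1 q').
    { apply D_val. simpl. auto_derive; auto. ring. }
    rewrite E0, E1. ring. }
  rewrite !DL by auto. rewrite !DI by auto.
  assert (D2 : D X2 I P = w (pr X0 p) (pr X1 p)).
  { rewrite (D_val X2 I P _ (is_derive_prim e _ X2 X2 P (Sm_C1 _ _ SG) CG BP)).
    destruct ix_dec; [|easy]. unfold parabola, P. simpl. f_equal. ring. }
  rewrite D2. change (pr X1 P) with (pr X1 p). change (pr X1 Q) with (pr X1 p).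
  unfold delta. destruct (ix_dec X1 X0); [easy|]. destruct (ix_dec X1 X1); [|easy].
  assert (s * s = 1) by (destruct Hs as [-> | ->]; ring). 
  set (W := w (pr X0 p) (pr X1 p)). set (u := D X0 I P). set (v := D X0 I Q).
  set (x := pr X1 p).
  replace (2 * x * (- s * (u + 0 * W - v)) - s * (- s * (2 * s * x * u + 1 * W - 2 * s * x * v)))
   with (2 * x * s * (s * s - 1) * (u - v) + s * s * W) by ring.
  rewrite H. ring.
Qed.

(** ** Abel inversion for functions vanishing on the negative half-line *)

Lemma Sm_F1_comp d d' z g : 0 < d -> Sm d (F1 z) -> Sm d' g ->
  (forall p, box d' p -> Rabs (g p) < d) -> Sm d' (fun p => z (g p)).
Proof.
  intros Hd F G Hb.
  apply (Sm_ext d' (fun p => F1 z (g p, 0, 0, 0))); [reflexivity|].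
  assert (Rabs 0 < d) by now rewrite Rabs_R0.
  apply (Sm_comp d d' (F1 z)); auto; try apply Sm_const.
  intros p Hp. apply box_tuple; auto.
Qed.

Lemma Sm_F1_derive d z : Sm d (F1 z) -> Sm d (F1 (Derive z)).
Proof. intros H. apply (Sm_ext d (D X0 (F1 z))); [reflexivity|now apply Sm_D]. Qed.

Lemma Sm_F1_dif d z x : Sm d (F1 z) -> Rabs x < d -> is_derive z x (Derive z x).
Proof.
  intros H Hx. assert (Rabs 0 < d) by (rewrite Rabs_R0; eapply Rle_lt_trans; [apply Rabs_pos|eauto]).
  exact (Sm_dif d (F1 z) X0 (x, 0, 0, 0) H ltac:(now apply box_tuple)).
Qed.

Lemma derive_flat_left d (f : R -> R) x : (forall y, y <= 0 -> Rabs y < d -> f y = 0) ->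
  ex_derive f x -> x <= 0 -> Rabs x < d -> Derive f x = 0.
Proof.
  intros Hf Hd Hx Hxd. apply Derive_correct, is_derive_Reals in Hd.
  set (l := Derive f x) in *. apply NNPP. intros Hl. apply Rabs_pos_lt in Hl.
  destruct (Hd _ Hl) as [dl H].
  set (h := - (Rmin dl (d - Rabs x) / 2)).
  assert (0 < Rmin dl (d - Rabs x)) by (apply Rmin_glb_lt; [apply cond_pos|lra]).
  generalize (Rmin_l dl (d - Rabs x)) (Rmin_r dl (d - Rabs x)). intros A B.
  specialize (H h). rewrite (Hf x Hx Hxd), (Hf (x + h)) in H.
  - unfold Rdiv in H. rewrite Rminus_diag, Rmult_0_l, Rminus_0_l, Rabs_Ropp in H.
    apply (Rlt_irrefl (Rabs l)), H; unfold h; [lra|]. rewrite Rabs_Ropp, Rabs_pos_eq; lra.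
  - unfold h; lra.
  - assert (Ex : Rabs x = - x) by now apply Rabs_left1.
    rewrite Rabs_left1; unfold h; lra.
Qed.

Lemma RInt_even (f : R -> R) a : ex_RInt (V := R_NormedModule) f 0 a ->
  (forall x, f (- x) = f x) ->
  ex_RInt (V := R_NormedModule) f (- a) a /\ RInt f (- a) a = 2 * RInt f 0 a.
Proof.
  intros Hf E.
  assert (I := RInt_correct (V := R_CompleteNormedModule) f 0 a Hf).
  assert (J : is_RInt (V := R_NormedModule) f (- a) 0 (RInt f 0 a)).
  { assert (J1 : is_RInt (V := R_NormedModule) (fun y => - f (- y)) 0 (- a) (RInt f 0 a)).
    { apply (is_RInt_comp_opp (V := R_NormedModule)).
      now rewrite Ropp_0, Ropp_involutive. }
    apply (is_RInt_swap (V := R_NormedModule)), (is_RInt_opp (V := R_NormedModule)) in J1.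
    unfold opp in J1; simpl in J1. rewrite Ropp_involutive in J1.
    revert J1. apply (is_RInt_ext (V := R_NormedModule)). intros x _. now rewrite Ropp_involutive. }
  assert (K := is_RInt_Chasles _ _ _ _ _ _ J I).
  split; [eexists; exact K|]. rewrite (is_RInt_unique _ _ _ _ K).
  unfold plus; simpl. ring.
Qed.

Section Abel.

Variables (P : R -> R) (eta a H : R).
Hypothesis Heta : 0 < eta <= 1.
Hypothesis HP : Sm eta (F1 P).
Hypothesis P0 : forall x, x <= 0 -> Rabs x < eta -> P x = 0.
Hypothesis Ha : 0 < a.
Hypothesis Hae : 25 * a <= eta.
Hypothesis HH : Rabs H < a ^ 2.

(** The substitution [y = x u / a] in the triangle [0 <= y <= x] of a square makes the
    integral in [x] explicit, since then [H - x^2 - y^2 = H - x^2 (1 + (u / a)^2)];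
    [slope_kernel] is its result, up to a constant factor. *)
Definition square_kernel (p : pt) : R := Derive P (H - pr X0 p ^ 2 - pr X1 p ^ 2).

Definition slope_kernel (p : pt) : R :=
  (P H - P (H - pr X0 p ^ 2 * (1 + (/ a * pr X1 p) ^ 2))) / (1 + (/ a * pr X1 p) ^ 2).

Lemma abel_range u : - (21 * a ^ 2) <= u <= a ^ 2 -> Rabs u < eta.
Proof. intros Hu. apply Rabs_def1; nra. Qed.

Lemma box_sqr p i : box (2 * a) p -> 0 <= pr i p ^ 2 < 4 * a ^ 2.
Proof. intros Hp. generalize (Rabs_sqr_lt _ _ (Hp i)) (pow2_ge_0 (pr i p)). lra. Qed.

Lemma slope_range p : box (2 * a) p ->
  1 <= 1 + (/ a * pr X1 p) ^ 2 < 5 /\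
  Rabs (H - pr X0 p ^ 2 * (1 + (/ a * pr X1 p) ^ 2)) < eta.
Proof.
  intros Hp. generalize (box_sqr p X0 Hp) (box_sqr p X1 Hp). intros B0 B1.
  assert (Q : (/ a * pr X1 p) ^ 2 < 4).
  { rewrite Rpow_mult_distr. rewrite pow_inv. apply (Rmult_lt_reg_l (a ^ 2)); [nra|].
    rewrite <- Rmult_assoc, Rinv_r by nra. lra. }
  generalize (pow2_ge_0 (/ a * pr X1 p)). intros Q0.
  split; [lra|]. apply abel_range. apply Rabs_def2 in HH. split; [|nra].
  assert (pr X0 p ^ 2 * (1 + (/ a * pr X1 p) ^ 2) <= 4 * a ^ 2 * 5).
  { apply Rmult_le_compat; lra. }
  lra.
Qed.

Lemma Sm_square_kernel : Sm (2 * a) square_kernel.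
Proof.
  apply (Sm_F1_comp eta _ (Derive P)); [lra|now apply Sm_F1_derive| |].
  - repeat apply Sm_minus; [apply Sm_const|apply Sm_pow, Sm_pr|apply Sm_pow, Sm_pr].
  - intros p Hp. generalize (box_sqr p X0 Hp) (box_sqr p X1 Hp). intros B0 B1.
    apply abel_range. apply Rabs_def2 in HH. lra.
Qed.

Lemma Sm_slope_kernel : Sm (2 * a) slope_kernel.
Proof.
  assert (Q : Sm (2 * a) (fun p => 1 + (/ a * pr X1 p) ^ 2)).
  { apply Sm_plus; [apply Sm_const|]. apply Sm_pow, Sm_scal, Sm_pr. }
  apply Sm_mult.
  - apply Sm_minus; [apply Sm_const|].
    apply (Sm_F1_comp eta _ P); [lra|auto| |intros; now apply slope_range].
    apply Sm_minus; [apply Sm_const|]. apply Sm_mult; [apply Sm_pow, Sm_pr|exact Q].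
  - apply Sm_inv; auto. intros p Hp. destruct (slope_range p Hp). lra.
Qed.

(** Both sides are primitives in [m] of the same function: the integral over the
    square of side [m] in Cartesian coordinates, and in the coordinates
    [(x, y / x)], in which the integration along rays is explicit. *)
Lemma square_integral_polar m : 0 <= m <= a ->
  prim X0 (prim X1 square_kernel) (m, m, 0, 0) = / a * prim X1 slope_kernel (m, a, 0, 0).
Proof.
  intros Hm.
  assert (H2a : 2 * a <= 1) by lra.
  assert (Zc : Rabs 0 < 2 * a) by (rewrite Rabs_R0; lra).
  assert (Hpt : forall x y, 0 <= x <= a -> 0 <= y <= a -> box (2 * a) (x, y, 0, 0)).
  { intros x y Hx Hy. apply box_tuple; auto; apply Rabs_def1; lra. }
  assert (SK := Sm_square_kernel). assert (SL := Sm_slope_kernel).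
  assert (S1 := Sm_prim _ _ X1 H2a SK). assert (S2 := Sm_prim _ _ X0 H2a S1).
  assert (S3 := Sm_prim _ _ X1 H2a SL).
  set (half := fun m => RInt (fun y => Derive P (H - m ^ 2 - y ^ 2)) 0 m).
  assert (DE : forall x, 0 <= x <= a ->
    is_derive (fun m => prim X0 (prim X1 square_kernel) (m, m, 0, 0)) x (2 * half x)).
  { intros x Hx. assert (Bx := Hpt x x Hx Hx).
    assert (A := chain_rule (2 * a) (prim X0 (prim X1 square_kernel)) (fun m => m) (fun m => m)
      (fun _ => 0) (fun _ => 0) x 1 1 0 0 (Sm_C1 _ _ S2) Bx (is_derive_var x) (is_derive_var x)
      (is_derive_cst 0 x) (is_derive_cst 0 x)).
    cbv zeta beta in A.
    rewrite (D_val X0 _ _ _ (is_derive_prim (2 * a) _ X0 X0 _ (Sm_C1 _ _ S1)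
      (fun q => Sm_cont _ _ q S1) Bx)) in A.
    rewrite (D_val X1 _ _ _ (is_derive_prim (2 * a) _ X0 X1 _ (Sm_C1 _ _ S1)
      (fun q => Sm_cont _ _ q S1) Bx)) in A.
    destruct (ix_dec X0 X0); [|easy]. destruct (ix_dec X0 X1); [easy|].
    replace (2 * half x) with (prim X1 square_kernel (x, x, 0, 0) * 1 +
      (prim X0 (D X1 (prim X1 square_kernel)) (x, x, 0, 0) * 1 +
       (D X2 (prim X0 (prim X1 square_kernel)) (x, x, 0, 0) * 0 +
        D X3 (prim X0 (prim X1 square_kernel)) (x, x, 0, 0) * 0))); [exact A|].
    assert (E1 : prim X1 square_kernel (x, x, 0, 0) = half x) by reflexivity.
    assert (E2 : prim X0 (D X1 (prim X1 square_kernel)) (x, x, 0, 0) = half x).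
    { unfold prim at 1, half. simpl pr. apply RInt_ext.
      rewrite Rmin_left, Rmax_right by lra. intros t Ht.
      assert (Bt : box (2 * a) (t, x, 0, 0)) by (apply Hpt; lra).
      change (up X0 (x, x, 0, 0) t) with (t, x, 0, 0).
      rewrite (D_val X1 _ _ _ (is_derive_prim (2 * a) _ X1 X1 _ (Sm_C1 _ _ SK)
        (fun q => Sm_cont _ _ q SK) Bt)).
      destruct (ix_dec X1 X1); [|easy]. unfold square_kernel. simpl. f_equal. ring. }
    rewrite E1, E2. ring. }
  assert (DS : forall x, 0 <= x <= a ->
    is_derive (fun m => / a * prim X1 slope_kernel (m, a, 0, 0)) x (2 * half x)).
  { intros x Hx. assert (Bx : box (2 * a) (x, a, 0, 0)) by (apply Hpt; lra).
    assert (A := is_derive_prim (2 * a) _ X1 X0 _ (Sm_C1 _ _ SL)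
      (fun q => Sm_cont _ _ q SL) Bx).
    destruct (ix_dec X1 X0); [easy|].
    apply (is_derive_scal (fun m => prim X1 slope_kernel (m, a, 0, 0)) x (/ a)) in A.
    replace (2 * half x) with (/ a * prim X1 (D X0 slope_kernel) (x, a, 0, 0)); [exact A|].
    unfold half. unfold prim. simpl pr.
    rewrite (RInt_ext _ (fun y => 2 * a * (/ a * x * Derive P (H - x ^ 2 - (/ a * x * y + 0) ^ 2)))).
    2: { rewrite Rmin_left, Rmax_right by lra. intros y Hy.
      assert (By : box (2 * a) (x, y, 0, 0)) by (apply Hpt; lra).
      assert (NZ := slope_range _ By). simpl pr in NZ.
      apply D_val. simpl. unfold slope_kernel. simpl pr.
      assert (Dp := Sm_F1_dif eta P _ HP (proj2 NZ)).
      auto_derive.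
      - eexists; exact Dp.
      - replace (/ a * x * y + 0) with (x * (/ a * y)) by ring.
        match goal with |- context [Derive ?f ?z] => change (Derive f z) with (Derive P z) end.
        simpl in NZ.
        match goal with |- - (- _ * ?u) * _ = _ * (_ * ?v) => replace v with u end.
        2: { f_equal. ring. }
        field. split; nra. }
    assert (EX : ex_RInt (V := R_NormedModule) (fun y => Derive P (H - x ^ 2 - y ^ 2)) 0 x).
    { apply (ex_RInt_slice (2 * a) square_kernel X1 (x, x, 0, 0)); auto.
      - intros q Hq. eapply Sm_cont; eauto.
      - apply Rabs_def1; lra. }
    assert (EY : ex_RInt (V := R_NormedModule) (fun y => Derive P (H - x ^ 2 - y ^ 2))
      (/ a * x * 0 + 0) (/ a * x * a + 0)).
    { replace (/ a * x * 0 + 0) with 0 by ring.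
      replace (/ a * x * a + 0) with x by (field; lra). exact EX. }
    set (g := fun y => / a * x * Derive P (H - x ^ 2 - (/ a * x * y + 0) ^ 2)).
    assert (EG : ex_RInt (V := R_NormedModule) g 0 a).
    { exact (ex_RInt_comp_lin (V := R_NormedModule)
           (fun y => Derive P (H - x ^ 2 - y ^ 2)) (/ a * x) 0 0 a EY). }
    assert (SC : RInt (fun y => 2 * a * g y) 0 a = 2 * a * RInt g 0 a)
      by exact (RInt_scal (V := R_CompleteNormedModule) g 0 a (2 * a) EG).
    assert (CL : RInt g 0 a = RInt (fun y => Derive P (H - x ^ 2 - y ^ 2))
      (/ a * x * 0 + 0) (/ a * x * a + 0))
      by exact (RInt_comp_lin (V := R_CompleteNormedModule)
        (fun y => Derive P (H - x ^ 2 - y ^ 2)) (/ a * x) 0 0 a EY).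
    change (/ a * RInt (fun y => 2 * a * g y) 0 a
      = 2 * RInt (fun y => Derive P (H - x ^ 2 - y ^ 2)) 0 x).
    rewrite SC.
    rewrite CL. replace (/ a * x * 0 + 0) with 0 by ring.
    replace (/ a * x * a + 0) with x by (field; lra).
    rewrite <- Rmult_assoc. f_equal. field. lra. }
  destruct (Rle_lt_or_eq_dec 0 m (proj1 Hm)) as [Lm|<-].
  2: { unfold prim at 1. simpl pr. rewrite RInt_point.
       unfold prim. rewrite (RInt_ext _ (fun _ => 0)).
       - rewrite RInt_const. unfold scal, zero; simpl. unfold mult; simpl. ring.
       - intros y _. unfold slope_kernel. simpl.
         replace (H - 0 * (0 * 1) * (1 + / a * y * (/ a * y * 1))) with H by ring.
         unfold Rdiv. ring. }
  assert (EQ := eq_is_derive (V := R_NormedModule)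
    (fun m => prim X0 (prim X1 square_kernel) (m, m, 0, 0) - / a * prim X1 slope_kernel (m, a, 0, 0))
    0 m).
  assert (E : prim X0 (prim X1 square_kernel) (0, 0, 0, 0) - / a * prim X1 slope_kernel (0, a, 0, 0)
    = prim X0 (prim X1 square_kernel) (m, m, 0, 0) - / a * prim X1 slope_kernel (m, a, 0, 0)).
  { apply EQ; auto. intros t Ht. unfold zero; simpl.
    assert (L : 0 <= t <= a) by lra.
    assert (DD := is_derive_sub _ _ _ _ _ (DE t L) (DS t L)).
    now rewrite Rminus_diag in DD. }
  assert (Z1 : prim X0 (prim X1 square_kernel) (0, 0, 0, 0) = 0).
  { unfold prim at 1. simpl pr. apply (RInt_point (V := R_CompleteNormedModule)). }
  assert (Z2 : prim X1 slope_kernel (0, a, 0, 0) = 0).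
  { unfold prim. rewrite (RInt_ext _ (fun _ => 0)).
    - rewrite RInt_const. unfold scal; simpl. unfold mult; simpl. ring.
    - intros y _. unfold slope_kernel. simpl.
      replace (H - 0 * (0 * 1) * (1 + / a * y * (/ a * y * 1))) with H by ring.
      unfold Rdiv. ring. }
  rewrite Z1, Z2 in E. lra.
Qed.

(** Inversion of Abel's equation: [z y = 1/PI * int_(-a)^a P'(y - t^2) dt] solves
    [int_(-a)^a z (H - x^2) dx = P H].  The double integral of [P'] runs over a square
    rather than a disc because [P'] vanishes outside the disc anyway. *)
Lemma abel_identity :
  RInt (fun x => RInt (fun y => Derive P (H - x ^ 2 - y ^ 2)) 0 a) 0 a = PI / 4 * P H.
Proof.
  change (prim X0 (prim X1 square_kernel) (a, a, 0, 0) = PI / 4 * P H).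
  rewrite square_integral_polar by lra. unfold prim. simpl pr.
  assert (I : is_RInt (V := R_NormedModule)
    (fun x => slope_kernel (up X1 (a, a, 0, 0) x)) 0 a
    (minus (a * P H * atan (/ a * a)) (a * P H * atan (/ a * 0)))).
  { apply (is_RInt_ext (fun x => a * P H * (/ a * / (1 + (/ a * x) ^ 2)))).
    - rewrite Rmin_left, Rmax_right by lra. intros x Hx. unfold slope_kernel. simpl pr.
      assert (Bx : box (2 * a) (a, x, 0, 0)).
      { apply box_tuple; apply Rabs_def1; lra. }
      destruct (slope_range _ Bx) as [S1 S2]. simpl pr in S1, S2.
      rewrite (P0 (H - a ^ 2 * (1 + (/ a * x) ^ 2))); auto.
      + match goal with |- ?u = ?v => change (@eq R u v) end. field. split; nra.
      + apply Rabs_def2 in HH. nra.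
    - apply (is_RInt_derive (V := R_CompleteNormedModule) (fun x => a * P H * atan (/ a * x))).
      + intros x _. apply (is_derive_scal (fun x => atan (/ a * x))).
        rewrite Rmult_comm. apply (is_derive_compR atan (fun x => / a * x)).
        * apply is_derive_Reals. generalize (derivable_pt_lim_atan (/ a * x)).
          unfold Rsqr. simpl. now rewrite Rmult_1_r.
        * auto_derive; auto. ring.
      + intros x _. apply (ex_derive_continuous
          (fun x => a * P H * (/ a * / (1 + (/ a * x) ^ 2)))).
        auto_derive. generalize (pow2_ge_0 (/ a * x)). simpl. lra. }
  rewrite (is_RInt_unique _ _ _ _ I).
  rewrite Rinv_l, atan_1, Rmult_0_r, atan_0 by lra.
  unfold minus, plus, opp; simpl. field. lra.
Qed.

End Abel.

Lemma RInt_slice_diff d f i p a b : Sm d f -> box d p -> Rabs a < d -> Rabs b < d ->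
  prim i f (up i p b) - prim i f (up i p a) = RInt (fun x => f (up i p x)) a b.
Proof.
  intros Hf Hp Ha Hb. unfold prim. rewrite !pr_up.
  rewrite (RInt_ext (fun x => f (up i (up i p b) x)) (fun x => f (up i p x)))
    by (intros; now rewrite up_up).
  rewrite (RInt_ext (fun x => f (up i (up i p a) x)) (fun x => f (up i p x)))
    by (intros; now rewrite up_up).
  assert (Z : Rabs 0 < d) by (rewrite Rabs_R0; eapply Rle_lt_trans; [apply Rabs_pos|eauto]).
  assert (CT := fun q => Sm_cont _ _ q Hf).
  assert (X := RInt_Chasles (V := R_CompleteNormedModule) (fun x => f (up i p x)) 0 a b
    (ex_RInt_slice d f i p 0 a CT Hp Z Ha) (ex_RInt_slice d f i p a b CT Hp Ha Hb)).
  unfold plus in X; simpl in X. rewrite <- X. ring.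
Qed.

Lemma leafint_RInt w s c y xi e : Sm e (parabola w s) -> Rabs y < e -> Rabs xi < e ->
  Rabs c < e -> leafint w s c y xi =
  - s * RInt (fun t => w (y + s * (xi ^ 2 - t ^ 2)) t) c xi.
Proof.
  intros HG Hy Hx Hc. unfold leafint. f_equal.
  assert (Bp : box e (y, xi, 0, 0)) by now apply box_F2.
  exact (RInt_slice_diff e (parabola w s) X2 (y, xi, 0, 0) c xi HG Bp Hc Hx).
Qed.

Lemma RInt_zero (f : R -> R) a b :
  (forall x, Rmin a b < x < Rmax a b -> f x = 0) -> RInt f a b = 0.
Proof.
  intros H. rewrite (RInt_ext _ (fun _ => 0)); [|auto]. rewrite RInt_const.
  unfold scal; simpl; unfold mult; simpl. ring.
Qed.

(** The homological equation in the coordinate [y = x^k].  Both unknowns are to be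
    supported in [y >= 0], in order to be flat functions of [x]. *)
Definition parabola_solution (rho : R -> R -> R) (s : R) (h : R -> R -> R) (z : R -> R) (e : R) :=
  0 < e /\ Sm e (F2 h) /\ Sm e (F1 z) /\
  (forall y xi, y <= 0 -> Rabs y < e -> Rabs xi < e -> h y xi = 0) /\
  (forall y, y <= 0 -> Rabs y < e -> z y = 0) /\
  (forall p, box e p -> rho (pr X0 p) (pr X1 p) =
     z (pr X0 p) + (2 * pr X1 p * D X0 (F2 h) p - s * D X1 (F2 h) p)).

(** The parabolas [xi^2 - y = const] leave the half-plane [y <= 0] towards both
    sides without coming back, so that no compatibility condition arises. *)
Lemma solve_open_parabolas rho d : 0 < d -> Sm d (F2 rho) ->
  (forall y xi, y <= 0 -> rho y xi = 0) ->
  exists h z e, parabola_solution rho (-1) h z e.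
Proof.
  intros Hd Hr Z. set (e := Rmin d 1 / 2).
  assert (M0 : 0 < Rmin d 1) by (apply Rmin_glb_lt; lra).
  generalize (Rmin_l d 1) (Rmin_r d 1). intros.
  assert (Z0 : Rabs 0 < e) by (rewrite Rabs_R0; unfold e; lra).
  exists (leafint rho (-1) 0), (fun _ => 0), e.
  destruct (leaf_primitive rho (-1) d e 0) as [SL EQ]; auto; try (unfold e; lra).
  assert (SP : Sm e (parabola rho (-1))) by (apply (Sm_parabola rho (-1) d); auto; unfold e; lra).
  split; [unfold e; lra|]. split; [exact SL|]. split; [apply (Sm_const e 0)|].
  split; [|split; auto].
  - intros y xi Hy Hye Hxe. rewrite (leafint_RInt _ _ _ _ _ e) by auto.
    rewrite RInt_zero; [ring|]. intros t Ht. apply Z.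
    assert (t ^ 2 <= xi ^ 2); [|lra].
    revert Ht. unfold Rmin, Rmax. destruct Rle_dec; intros; nra.
  - intros p Hp. rewrite EQ by auto. ring.
Qed.

(** On the closed arcs [xi^2 + y = H > 0] the integral of [rho - z] has to
    vanish, which is Abel's equation for [z]. *)
Lemma solve_closed_arcs rho d : 0 < d -> Sm d (F2 rho) ->
  (forall y xi, y <= 0 -> rho y xi = 0) ->
  exists h z e, parabola_solution rho 1 h z e.
Proof.
  intros Hd Hr Z. set (eta := Rmin d 1 / 2).
  assert (M0 : 0 < Rmin d 1) by (apply Rmin_glb_lt; lra).
  generalize (Rmin_l d 1) (Rmin_r d 1). intros M1 M2.
  assert (He : 0 < eta <= 1 / 2) by (unfold eta; lra). assert (Hed : 2 * eta <= d) by (unfold eta; lra).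
  set (a := eta / 100). assert (Ha : 0 < a) by (unfold a; lra). assert (Ea : eta = 100 * a) by (unfold a; lra).
  assert (Ra : Rabs a < eta / 4) by (rewrite Rabs_pos_eq; lra).
  assert (Rna : Rabs (- a) < eta / 4) by now rewrite Rabs_Ropp.
  assert (R0 : Rabs 0 < eta) by (rewrite Rabs_R0; lra).
  (* the integral of [rho] over the arc of level [H] *)
  set (G0 := fun p => rho (pr X0 p - pr X2 p ^ 2) (pr X2 p)).
  assert (SG0 : Sm eta G0).
  { apply (Sm_F2_comp d eta rho); auto; try apply Sm_pr.
    - apply Sm_minus; [apply Sm_pr|apply Sm_pow, Sm_pr].
    - intros p Hp. generalize (Rabs_sqr_lt _ _ (Hp X2)) (Rabs_def2 _ _ (Hp X0)) (pow2_ge_0 (pr X2 p)).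
      intros A1 A2 A3. split; [|generalize (Hp X2); lra]. apply Rabs_def1; nra. }
  set (P := fun H => prim X2 G0 (H, 0, a, 0) - prim X2 G0 (H, 0, - a, 0)).
  assert (PR : forall H, Rabs H < eta -> P H = RInt (fun t => rho (H - t ^ 2) t) (- a) a).
  { intros H HH. apply (RInt_slice_diff eta G0 X2 (H, 0, 0, 0) (- a) a); auto; try lra.
    apply box_F2; auto. }
  assert (SP : Sm eta (F1 P)).
  { assert (K : forall c, Rabs c < eta -> Sm eta (fun p => prim X2 G0 (pr X0 p, 0, c, 0))).
    { intros c Hc. apply (Sm_comp eta eta (prim X2 G0)); auto using Sm_pr, Sm_const.
      - apply Sm_prim; auto; lra.
      - intros p Hp. apply box_tuple; auto. }
    apply Sm_minus; apply K; lra. }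
  assert (P0 : forall x, x <= 0 -> Rabs x < eta -> P x = 0).
  { intros x Hx Hxe. rewrite PR by auto. apply RInt_zero. intros t _. apply Z.
    generalize (pow2_ge_0 t). lra. }
  (* the solution of Abel's equation *)
  set (G1 := fun p => Derive P (pr X0 p - pr X2 p ^ 2)).
  assert (RG : forall p, box (eta / 2) p -> Rabs (pr X0 p - pr X2 p ^ 2) < eta).
  { intros p Hp. generalize (Rabs_sqr_lt _ _ (Hp X2)) (Rabs_def2 _ _ (Hp X0)) (pow2_ge_0 (pr X2 p)).
    intros A1 A2 A3. apply Rabs_def1; nra. }
  assert (SG1 : Sm (eta / 2) G1).
  { apply (Sm_F1_comp eta _ (Derive P)); auto; try lra.
    - now apply Sm_F1_derive.
    - apply Sm_minus; [apply Sm_pr|apply Sm_pow, Sm_pr]. }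
  set (z := fun y => / PI * (prim X2 G1 (y, 0, a, 0) - prim X2 G1 (y, 0, - a, 0))).
  assert (ZR : forall y, Rabs y < eta / 2 ->
    z y = / PI * RInt (fun t => Derive P (y - t ^ 2)) (- a) a).
  { intros y Hy. unfold z. f_equal.
    apply (RInt_slice_diff (eta / 2) G1 X2 (y, 0, 0, 0) (- a) a); auto; try lra.
    apply box_F2; auto. rewrite Rabs_R0; lra. }
  assert (SZ : Sm (eta / 2) (F1 z)).
  { assert (K : forall c, Rabs c < eta / 2 ->
      Sm (eta / 2) (fun p => prim X2 G1 (pr X0 p, 0, c, 0))).
    { intros c Hc. apply (Sm_comp (eta / 2) (eta / 2) (prim X2 G1)); auto using Sm_pr, Sm_const.
      - apply Sm_prim; auto; lra.
      - intros p Hp. apply box_tuple; auto; rewrite Rabs_R0; lra. }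
    apply Sm_scal. apply Sm_minus; apply K; lra. }
  assert (Z0 : forall y, y <= 0 -> Rabs y < eta / 2 -> z y = 0).
  { intros y Hy Hye. rewrite ZR, RInt_zero; auto; [ring|]. intros t Ht.
    rewrite Rmin_left, Rmax_right in Ht by lra.
    assert (Q : 0 <= t ^ 2 <= a ^ 2) by nra.
    assert (Rabs (y - t ^ 2) < eta) by (apply Rabs_def2 in Hye; apply Rabs_def1; nra).
    apply (derive_flat_left eta); auto; try nra.
    eexists. apply (Sm_F1_dif eta); auto. }
  set (w := fun y xi => rho y xi - z y).
  assert (SW : Sm (eta / 2) (F2 w)).
  { apply Sm_minus; [apply (Sm_box d); [lra|exact Hr]|exact SZ]. }
  assert (W0 : forall y xi, y <= 0 -> Rabs y < eta / 2 -> w y xi = 0).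
  { intros y xi Hy Hye. unfold w. rewrite Z, Z0; auto. ring. }
  destruct (leaf_primitive w 1 (eta / 2) (eta / 4) (- a)) as [SL EQ]; auto; try lra.
  assert (SPar : Sm (eta / 4) (parabola w 1)) by (apply (Sm_parabola w 1 (eta / 2)); auto; lra).
  assert (Abel : forall H, Rabs H < a ^ 2 -> RInt (fun t => w (H - t ^ 2) t) (- a) a = 0).
  { intros H HH.
    assert (HHe : Rabs H < eta / 4) by nra.
    assert (E1 : ex_RInt (V := R_NormedModule) (fun t => rho (H - t ^ 2) t) (- a) a).
    { apply (ex_RInt_slice eta G0 X2 (H, 0, 0, 0)); auto; try lra.
      - intros q Hq. eapply Sm_cont; eauto.
      - apply box_F2; auto; lra. }
    assert (SF : Sm (eta / 4) (fun p => z (pr X0 p - pr X1 p ^ 2))).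
    { apply (Sm_F1_comp (eta / 2)); auto; try lra.
      - apply Sm_minus; [apply Sm_pr|apply Sm_pow, Sm_pr].
      - intros p Hp. generalize (Rabs_sqr_lt _ _ (Hp X1)) (Rabs_def2 _ _ (Hp X0)) (pow2_ge_0 (pr X1 p)).
        intros A1 A2 A3. apply Rabs_def1; nra. }
    assert (Bp : box (eta / 4) (H, 0, 0, 0)) by (apply box_F2; auto; rewrite Rabs_R0; lra).
    assert (E2' : ex_RInt (V := R_NormedModule) (fun t => z (H - t ^ 2)) 0 a).
    { apply (ex_RInt_slice (eta / 4) _ X1 (H, 0, 0, 0) 0 a (fun q => Sm_cont _ _ q SF) Bp); auto.
      rewrite Rabs_R0; lra. }
    destruct (RInt_even (fun t => z (H - t ^ 2)) a E2') as [E2 RE2].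
    { intros x. f_equal. ring. }
    assert (X := RInt_minus (V := R_CompleteNormedModule) (fun t => rho (H - t ^ 2) t)
      (fun t => z (H - t ^ 2)) (- a) a E1 E2).
    change (RInt (fun t => w (H - t ^ 2) t) (- a) a = RInt (fun t => rho (H - t ^ 2) t) (- a) a
      - RInt (fun t => z (H - t ^ 2)) (- a) a) in X.
    rewrite X, <- PR, RE2 by lra.
    assert (AI := abel_identity P eta a H ltac:(lra) SP P0 Ha ltac:(lra) HH).
    set (f := fun x => RInt (fun y => Derive P (H - x ^ 2 - y ^ 2)) 0 a) in AI.
    assert (ZF : forall x, 0 < x < a -> z (H - x ^ 2) = 2 / PI * f x).
    { intros x Hx. assert (Hx2 : Rabs (H - x ^ 2) < eta / 2).
      { apply Rabs_def2 in HHe. apply Rabs_def1; nra. }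
      rewrite ZR by exact Hx2.
      destruct (RInt_even (fun t => Derive P (H - x ^ 2 - t ^ 2)) a) as [_ RE].
      - apply (ex_RInt_slice (eta / 2) G1 X2 (H - x ^ 2, 0, 0, 0)); auto; try lra.
        + intros q Hq. eapply Sm_cont; eauto.
        + apply box_F2; auto; rewrite ?Rabs_R0; lra.
        + rewrite Rabs_R0; lra.
      - intros t. f_equal. ring.
      - rewrite RE. unfold f. field. apply PI_neq0. }
    rewrite (RInt_ext _ (fun x => scal (2 / PI) (f x)))
      by (rewrite Rmin_left, Rmax_right by lra; exact ZF).
    assert (EF : ex_RInt (V := R_NormedModule) f 0 a).
    { apply (ex_RInt_ext (V := R_NormedModule) (fun x => PI / 2 * z (H - x ^ 2))).
      - rewrite Rmin_left, Rmax_right by lra. intros x Hx. rewrite ZF by auto.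
        match goal with |- ?u = ?v => change (@eq R u v) end. field. apply PI_neq0.
      - now apply (ex_RInt_scal (V := R_NormedModule)). }
    rewrite (RInt_scal (V := R_CompleteNormedModule)) by exact EF.
    unfold scal; simpl; unfold mult; simpl. rewrite AI. field. apply PI_neq0. }
  exists (leafint w 1 (- a)), z, (a ^ 2 / 2).
  assert (Hsm : 0 < a ^ 2 / 2 < eta / 4) by nra.
  split; [lra|]. split; [apply (Sm_box (eta / 4)); [lra|exact SL]|].
  split; [apply (Sm_box (eta / 2)); [lra|exact SZ]|].
  split; [|split].
  - intros y xi Hy Hye Hxe. rewrite (leafint_RInt _ _ _ _ _ (eta / 4)) by (auto; lra).
    assert (Hy' := Rabs_def2 _ _ Hye). assert (Hx' := Rabs_def2 _ _ Hxe).
    assert (Hx2 : 0 <= xi ^ 2 <= a ^ 2 / 2) by nra.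
    assert (Zt : forall t, - a <= t <= a -> xi ^ 2 <= t ^ 2 -> w (y + 1 * (xi ^ 2 - t ^ 2)) t = 0).
    { intros t Ht L. apply W0; [lra|]. assert (t ^ 2 <= a ^ 2) by nra.
      apply Rabs_def1; nra. }
    destruct (Rle_dec xi 0) as [L|L].
    + rewrite RInt_zero; [ring|]. intros t Ht.
      rewrite Rmin_left, Rmax_right in Ht by nra. apply Zt; nra.
    + assert (T : RInt (fun t => w (y + 1 * (xi ^ 2 - t ^ 2)) t) (- a) a = 0).
      { rewrite (RInt_ext _ (fun t => w ((y + xi ^ 2) - t ^ 2) t)).
        - apply Abel. apply Rabs_def1; lra.
        - intros t _. f_equal. ring. }
      assert (T2 : RInt (fun t => w (y + 1 * (xi ^ 2 - t ^ 2)) t) xi a = 0).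
      { apply RInt_zero. intros t Ht. rewrite Rmin_left, Rmax_right in Ht by nra. apply Zt; nra. }
      assert (CTP := fun q => Sm_cont _ _ q SPar).
      assert (Bp : box (eta / 4) (y, xi, 0, 0)) by (apply box_F2; lra).
      assert (X := RInt_Chasles (V := R_CompleteNormedModule)
        (fun t => w (y + 1 * (xi ^ 2 - t ^ 2)) t) (- a) xi a
        (ex_RInt_slice (eta / 4) (parabola w 1) X2 (y, xi, 0, 0) (- a) xi CTP Bp Rna ltac:(lra))
        (ex_RInt_slice (eta / 4) (parabola w 1) X2 (y, xi, 0, 0) xi a CTP Bp ltac:(lra) Ra)).
      unfold plus in X; simpl in X, T, T2. simpl. rewrite T, T2 in X. lra.
  - intros y Hy Hye. apply Z0; auto; lra.
  - intros p Hp. rewrite EQ by (apply (box_le (a ^ 2 / 2)); auto; lra). unfold w. ring.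
Qed.

(** ** Vanishing order along the line [x = 0] *)

Fixpoint Van (d : R) (m : nat) (f : pt -> R) : Prop :=
  match m with
  | O => True
  | S m => (forall p, box d p -> pr X0 p = 0 -> f p = 0) /\ Van d m (D X0 f)
  end.

Definition Flat (d : R) (f : pt -> R) : Prop := forall m, Van d m f.

Lemma Van_ext d m : forall f g, (forall p, box d p -> f p = g p) -> Van d m f -> Van d m g.
Proof.
  induction m as [|m IH]; intros f g E; cbn [Van]; auto. intros [A B]. split.
  - intros p Hp Zp. rewrite <- E; auto.
  - apply (IH (D X0 f)); auto. intros p Hp. now apply (D_ext d).
Qed.

Lemma Van_down d m : forall f, Van d (S m) f -> Van d m f.
Proof.
  induction m as [|m IH]; intros f [A B]; simpl; auto.
Qed.

Lemma Van_le d m m' f : (m' <= m)%nat -> Van d m f -> Van d m' f.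
Proof. induction 1; auto. intros H1. now apply IHle, Van_down. Qed.

Lemma Van_box d d' m : d' <= d -> forall f, Van d m f -> Van d' m f.
Proof.
  intros L. induction m as [|m IH]; intros f; cbn [Van]; auto. intros [A B]. split; auto.
  intros p Hp. apply A. now apply (box_le d').
Qed.

Lemma Van_D_other d m i : i <> X0 -> forall f, Sm d f -> Van d m f -> Van d m (D i f).
Proof.
  intros Hi. induction m as [|m IH]; intros f Hf; cbn [Van]; auto. intros [A B]. split.
  - intros p Hp Zp. apply D_val. apply (is_derive_ext_loc (fun _ => 0)); [|apply is_derive_cst].
    generalize (locally_box_up d i p Hp). apply filter_imp. intros x Hx. symmetry.
    apply A; auto. now rewrite pr_up_neq.
  - apply (Van_ext d m (D i (D X0 f))).
    + intros p Hp. symmetry. now apply (Sm_schwarz d).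
    + apply IH; auto. now apply Sm_D.
Qed.

Lemma Van_plus d m : forall f g, Sm d f -> Sm d g -> Van d m f -> Van d m g ->
  Van d m (fun p => f p + g p).
Proof.
  induction m as [|m IH]; intros f g Hf Hg; cbn [Van]; auto. intros [A B] [A' B']. split.
  - intros p Hp Zp. rewrite A, A'; auto. ring.
  - apply (Van_ext d m (fun p => D X0 f p + D X0 g p)).
    + intros p Hp. symmetry. apply D_plus; now apply (Sm_dif d).
    + apply IH; auto using Sm_D.
Qed.

Lemma Van_mult d m : forall f g, Sm d f -> Sm d g -> Van d m f -> Van d m (fun p => f p * g p).
Proof.
  induction m as [|m IH]; intros f g Hf Hg V; cbn [Van]; auto. split.
  - intros p Hp Zp. rewrite (proj1 V); auto. ring.
  - apply (Van_ext d m (fun p => D X0 f p * g p + f p * D X0 g p)).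
    + intros p Hp. symmetry. apply D_mult; now apply (Sm_dif d).
    + apply Van_plus; auto using Sm_D, Sm_mult.
      * apply IH; auto using Sm_D. apply V.
      * apply IH; auto using Sm_D, Van_down.
Qed.

Lemma Van_opp d m f : Sm d f -> Van d m f -> Van d m (fun p => - f p).
Proof.
  intros Hf V. apply (Van_ext d m (fun p => f p * -1)); [intros; ring|].
  apply Van_mult; auto using Sm_const.
Qed.

Lemma Van_minus d m f g : Sm d f -> Sm d g -> Van d m f -> Van d m g ->
  Van d m (fun p => f p - g p).
Proof. intros; apply Van_plus; auto using Sm_opp, Van_opp. Qed.

Lemma Flat_D d f i : Sm d f -> Flat d f -> Flat d (D i f).
Proof.
  intros Hf H m. destruct (ix_dec i X0) as [->|n].
  - exact (proj2 (H (S m))).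
  - now apply Van_D_other.
Qed.

(** Flatness is used through this estimate near a point of the line [x = 0], which
    comes from the mean value theorem in [x]. *)
Lemma Flat_small d f j : Sm d f -> Flat d f -> forall p, box d p -> pr X0 p = 0 ->
  forall eps : posreal, exists dl : posreal, forall q,
  (forall i, Rabs (pr i q - pr i p) < dl) -> 0 < pr X0 q ->
  Rabs (f q) <= eps * pr X0 q ^ j.
Proof.
  revert f. induction j as [|j IH]; intros f Hf HF p Hp Zp eps.
  - destruct (continuous_eps f p (Sm_cont d f p Hf Hp) eps) as [dl Hdl].
    exists dl. intros q Hq _. specialize (Hdl q Hq).
    rewrite (proj1 (HF 1%nat) p Hp Zp), Rminus_0_r in Hdl. rewrite pow_O. lra.
  - destruct (IH (D X0 f) (Sm_D d f X0 Hf) (Flat_D d f X0 Hf HF) p Hp Zp eps) as [d1 H1].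
    destruct (locally_box d p Hp) as [d2 H2].
    assert (Hd : 0 < Rmin d1 d2) by (apply Rmin_glb_lt; apply cond_pos).
    exists (mkposreal _ Hd). cbn [pos]. intros q Hq Lq.
    assert (B : forall x, 0 <= x <= pr X0 q ->
      box d (up X0 q x) /\ forall i, Rabs (pr i (up X0 q x) - pr i p) < d1).
    { intros x Hx. assert (Hx' : forall i, Rabs (pr i (up X0 q x) - pr i p) < Rmin d1 d2).
      { intros i. destruct (ix_dec X0 i) as [<-|n].
        - rewrite pr_up. assert (Hq0 := Hq X0). rewrite Zp, Rminus_0_r in Hq0 |- *.
          rewrite Rabs_pos_eq in Hq0 by lra. rewrite Rabs_pos_eq; lra.
        - rewrite pr_up_neq; auto. }
      split.
      - apply H2, ball_pt. intros i. eapply Rlt_le_trans; [apply Hx'|apply Rmin_r].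
      - intros i. eapply Rlt_le_trans; [apply Hx'|apply Rmin_l]. }
    destruct (MVT_gen (fun x => f (up X0 q x)) 0 (pr X0 q) (fun x => D X0 f (up X0 q x)))
      as [c [Hc Ec]].
    + rewrite Rmin_left, Rmax_right by lra. intros x Hx. destruct (B x) as [Bx _]; [lra|].
      exact (Sm_dif d f X0 (up X0 q x) Hf Bx).
    + rewrite Rmin_left, Rmax_right by lra. intros x Hx. destruct (B x) as [Bx _]; [lra|].
      apply continuity_pt_filterlim. apply (continuous_comp (up X0 q) f); [apply continuous_up|].
      eapply Sm_cont; eauto.
    + rewrite Rmin_left, Rmax_right in Hc by lra.
      assert (Z0 : f (up X0 q 0) = 0).
      { apply (proj1 (HF 1%nat)); [apply B; lra|apply pr_up]. }
      rewrite up_pr, Z0, !Rminus_0_r in Ec. rewrite Ec, Rabs_mult, (Rabs_pos_eq (pr X0 q)) by lra.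
      rewrite <- tech_pow_Rmult, (Rmult_comm (pr X0 q)), <- Rmult_assoc. apply Rmult_le_compat_r; [lra|].
      destruct (B c Hc) as [Bc Nc]. generalize (cond_pos eps). intros He.
      assert (Hp0 : 0 <= pr X0 q ^ j) by (apply pow_le; lra).
      destruct (Rle_lt_or_eq_dec 0 c (proj1 Hc)) as [L|<-].
      * eapply Rle_trans; [apply (H1 _ Nc); now rewrite pr_up|]. rewrite pr_up.
        apply Rmult_le_compat_l; [lra|]. apply pow_incr. lra.
      * rewrite (proj1 (Flat_D d f X0 Hf HF 1%nat) _ Bc (pr_up X0 q 0)), Rabs_R0. nra.
Qed.

(** ** Flat functions of the k-th root *)

Definition root (k : nat) (y : R) : R := Rpower y (/ INR k).

Lemma root_pos k y : 0 < root k y.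
Proof. apply exp_pos. Qed.

Lemma root_pow k y : (1 <= k)%nat -> 0 < y -> root k y ^ k = y.
Proof.
  intros Hk Hy. rewrite <- Rpower_pow by apply root_pos. unfold root.
  rewrite Rpower_mult, Rinv_l, Rpower_1; auto. apply not_0_INR. lia.
Qed.

Lemma pow_root k x : (1 <= k)%nat -> 0 < x -> root k (x ^ k) = x.
Proof.
  intros Hk Hx. unfold root. rewrite <- Rpower_pow by auto.
  rewrite Rpower_mult, Rinv_r, Rpower_1; auto. apply not_0_INR. lia.
Qed.

Lemma root_lt k y d : (1 <= k)%nat -> 0 < d -> 0 < y < d ^ k -> root k y < d.
Proof.
  intros Hk Hd Hy. apply Rnot_le_lt. intros L.
  assert (d ^ k <= root k y ^ k) by (apply pow_incr; lra).
  rewrite root_pow in H by (auto; lra). lra.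
Qed.

Lemma root_derive k y : (1 <= k)%nat -> 0 < y ->
  is_derive (root k) y (/ (INR k * root k y ^ (k - 1))).
Proof.
  intros Hk Hy. assert (Hk0 : INR k <> 0) by (apply not_0_INR; lia).
  assert (Q : is_derive (root k) y (/ INR k * Rpower y (/ INR k - 1))).
  { apply is_derive_Reals. now apply derivable_pt_lim_power. }
  replace (/ (INR k * root k y ^ (k - 1))) with (/ INR k * Rpower y (/ INR k - 1)); auto.
  rewrite Rinv_mult. f_equal. unfold Rminus at 1. rewrite Rpower_plus.
  rewrite Rpower_Ropp, Rpower_1 by auto. fold (root k y).
  generalize (root_pow k y Hk Hy) (root_pos k y). intros E L.
  destruct k as [|k]; [lia|]. replace (S k - 1)%nat with k by lia.
  rewrite <- E at 2. simpl. field. split; [apply pow_nonzero|]; lra.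
Qed.

(** Functions of the [k]-th root, cut off at [y <= 0].  The exponent [j] makes this
    family stable under differentiation. *)
Definition Rt (k j : nat) (f : pt -> R) (p : pt) : R :=
  if Rlt_dec 0 (pr X0 p)
  then f (up X0 p (root k (pr X0 p))) / root k (pr X0 p) ^ j else 0.

Lemma Rt_pos k j f p : 0 < pr X0 p ->
  Rt k j f p = f (up X0 p (root k (pr X0 p))) / root k (pr X0 p) ^ j.
Proof. intros H. unfold Rt. destruct Rlt_dec; [reflexivity|lra]. Qed.

Lemma Rt_neg k j f p : pr X0 p <= 0 -> Rt k j f p = 0.
Proof. intros H. unfold Rt. destruct Rlt_dec; [lra|reflexivity]. Qed.

Lemma box_root k d p : (1 <= k)%nat -> 0 < d <= 1 -> box (d ^ k) p -> 0 < pr X0 p ->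
  box d (up X0 p (root k (pr X0 p))).
Proof.
  intros Hk Hd Hp L. assert (d ^ k <= d).
  { destruct k as [|k]; [lia|]. simpl. assert (d ^ k <= 1).
    { rewrite <- (pow1 k). apply pow_incr. lra. } nra. }
  apply box_up; [now apply (box_le (d ^ k))|].
  rewrite Rabs_pos_eq by (left; apply root_pos). apply root_lt; auto; try lra.
  specialize (Hp X0). rewrite Rabs_pos_eq in Hp; lra.
Qed.

Lemma Rt_small k j l d f p : (1 <= k)%nat -> 0 < d <= 1 -> Sm d f -> Flat d f ->
  box (d ^ k) p -> pr X0 p = 0 -> forall eps : posreal, exists dl : posreal, forall q,
  (forall i, Rabs (pr i q - pr i p) < dl) -> 0 < pr X0 q ->
  Rabs (Rt k j f q) <= eps * pr X0 q ^ l.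
Proof.
  intros Hk Hd Hf HF Hp Zp eps.
  assert (Hdk : d ^ k <= d).
  { destruct k as [|k]; [lia|]. simpl. assert (d ^ k <= 1).
    { rewrite <- (pow1 k). apply pow_incr. lra. } nra. }
  destruct (Flat_small d f (j + k * l) Hf HF p (box_le _ _ p Hdk Hp) Zp eps) as [d1 H1].
  assert (Hd1 : 0 < Rmin d1 (d1 ^ k)).
  { apply Rmin_glb_lt; [apply cond_pos|apply pow_lt, cond_pos]. }
  exists (mkposreal _ Hd1). cbn [pos]. intros q Hq Lq. rewrite Rt_pos by auto.
  set (r := root k (pr X0 q)). assert (Hr : 0 < r) by apply root_pos.
  assert (Ek : r ^ k = pr X0 q) by (apply root_pow; auto).
  assert (Hrd : r < d1).
  { apply root_lt; auto; [apply cond_pos|]. split; auto. specialize (Hq X0).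
    rewrite Zp, Rminus_0_r, Rabs_pos_eq in Hq by lra.
    eapply Rlt_le_trans; [exact Hq|apply Rmin_r]. }
  unfold Rdiv. rewrite Rabs_mult, Rabs_inv, (Rabs_pos_eq (r ^ j)) by (left; now apply pow_lt).
  apply Rle_div_l; [now apply pow_lt|].
  assert (K := H1 (up X0 q r)). rewrite pr_up in K. rewrite pow_add, pow_mult, Ek in K.
  replace (eps * pr X0 q ^ l * r ^ j) with (eps * (r ^ j * pr X0 q ^ l)) by ring.
  apply K; auto. intros i. destruct (ix_dec X0 i) as [<-|n].
  - rewrite pr_up, Zp, Rminus_0_r, Rabs_pos_eq; lra.
  - rewrite pr_up_neq by auto. eapply Rlt_le_trans; [apply Hq|apply Rmin_l].
Qed.

(** A flat function is divisible by every power of [x], which compensates the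
    negative powers produced by differentiating the k-th root. *)
Lemma Sm_Rt k d : (1 <= k)%nat -> 0 < d <= 1 -> forall j f, Sm d f -> Flat d f ->
  Sm (d ^ k) (Rt k j f).
Proof.
  intros Hk Hd j f Hf HF n. revert j f Hf HF.
  assert (LP : forall p, 0 < pr X0 p -> locally p (fun q => 0 < pr X0 q)).
  { intros p Hp. apply (continuous_pr X0 p (fun x => 0 < x)). now apply open_gt. }
  assert (LN : forall p, pr X0 p < 0 -> locally p (fun q => pr X0 q < 0)).
  { intros p Hp. apply (continuous_pr X0 p (fun x => x < 0)). now apply open_lt. }
  assert (Cr : forall p, 0 < pr X0 p -> continuous (fun q => root k (pr X0 q)) p).
  { intros p Hp. apply (continuous_comp (pr X0) (root k)); [apply continuous_pr|].
    apply (ex_derive_continuous (root k)). eexists. now apply root_derive. }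
  assert (CT : forall j f, Sm d f -> Flat d f -> forall p, box (d ^ k) p ->
    continuous (Rt k j f) p).
  { intros j f Hf HF p Hp. destruct (Rtotal_order 0 (pr X0 p)) as [L|[L|L]].
    - apply (continuous_ext_loc _ (fun q => f (up X0 q (root k (pr X0 q))) / root k (pr X0 q) ^ j)).
      { generalize (LP p L). apply filter_imp. intros q Hq. now rewrite Rt_pos. }
      apply (continuous_mult (fun q => f (up X0 q (root k (pr X0 q))))
        (fun q => / root k (pr X0 q) ^ j)).
      + apply (continuous_comp (fun q => up X0 q (root k (pr X0 q))) f).
        * simpl. apply continuous_tuple; auto;
          [apply (continuous_pr X1)|apply (continuous_pr X2)|apply (continuous_pr X3)].
        * eapply Sm_cont; eauto. now apply box_root with (k := k).
      + apply (continuous_comp (fun q => root k (pr X0 q)) (fun x => / x ^ j)); auto.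
        apply (ex_derive_continuous (fun x => / x ^ j)). auto_derive.
        apply pow_nonzero. generalize (root_pos k (pr X0 p)). lra.
    - apply eps_continuous. intros eps.
      destruct (Rt_small k j 0 d f p Hk Hd Hf HF Hp (eq_sym L) (mkposreal _ (is_pos_div_2 eps)))
        as [dl Hdl].
      exists dl. intros q Hq. rewrite (Rt_neg k j f p) by lra. rewrite Rminus_0_r.
      generalize (cond_pos eps). intros He.
      destruct (Rlt_dec 0 (pr X0 q)) as [Lq|Lq].
      + specialize (Hdl q Hq Lq). cbn [pos] in Hdl. lra.
      + rewrite Rt_neg, Rabs_R0; lra.
    - apply (continuous_ext_loc _ (fun _ => 0)); [|apply continuous_const].
      generalize (LN p L). apply filter_imp. intros q Hq. rewrite Rt_neg; lra. }
  induction n as [|n IH]; intros j f Hf HF.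
  - split; auto. intros p Hp. split; auto. discriminate.
  - apply (Bd_intro _ _ _ _ _ (fun i => match i with
      | X0 => fun p => / INR k * (Rt k (j + (k - 1)) (D X0 f) p - INR j * Rt k (j + k) f p)
      | _ => Rt k j (D i f) end)); auto.
    + discriminate.
    + intros i p Hp. destruct (ix_dec i X0) as [->|Ni].
      * destruct (Rtotal_order 0 (pr X0 p)) as [L|[L|L]].
        -- apply (is_derive_ext_loc (fun x => f (up X0 p (root k x)) * / root k x ^ j)).
           { apply (open_gt 0 (pr X0 p)) in L. revert L. apply filter_imp. intros x Hx.
             rewrite Rt_pos; rewrite pr_up; auto. }
           assert (Hr := root_pos k (pr X0 p)). set (r := root k (pr X0 p)) in *.
           assert (Bp := box_root k d p Hk Hd Hp L). fold r in Bp.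
           assert (Dr := root_derive k (pr X0 p) Hk L). fold r in Dr.
           assert (Df := Sm_dif d f X0 _ Hf Bp). unfold dif in Df. rewrite pr_up in Df.
           assert (A1 := is_derive_compR (fun x => f (up X0 p x)) (root k) (pr X0 p) _ _ Df Dr).
           assert (A2 : is_derive (fun x => / root k x ^ j) (pr X0 p)
             (- INR j / r ^ S j * / (INR k * r ^ (k - 1)))).
           { apply (is_derive_compR (fun x => / x ^ j) (root k)); auto.
             fold r. auto_derive; [apply pow_nonzero; lra|].
             destruct j as [|j]; [simpl; field; repeat split; lra|].
             cbn [Init.Nat.pred pow]. field. split; [apply pow_nonzero|]; lra. }
           assert (A := is_derive_mul _ _ _ _ _ A1 A2). fold r in A.
           rewrite !Rt_pos by auto. fold r.
           assert (Hk0 : INR k <> 0) by (apply not_0_INR; lia).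
           match type of A with is_derive _ _ ?v => match goal with |- is_derive _ _ ?u =>
             replace u with v; [exact A|] end end.
           rewrite !pow_add. replace (r ^ k) with (r * r ^ (k - 1)).
           2: { change (r * r ^ (k - 1)) with (r ^ S (k - 1)). f_equal. lia. }
           change (root k (pr X0 p)) with r. simpl pow. field. repeat split; auto; try apply pow_nonzero; lra.
        -- rewrite !Rt_neg by lra. rewrite Rmult_0_r, Rminus_diag, Rmult_0_r.
           apply is_derive_Reals. intros eps He.
           destruct (Rt_small k j 1 d f p Hk Hd Hf HF Hp (eq_sym L)
             (mkposreal _ (is_pos_div_2 (mkposreal eps He)))) as [dl Hdl]. cbn [pos] in Hdl.
           exists dl. intros h Hh Hhd. rewrite (Rt_neg k j f (up X0 p (pr X0 p))) by (rewrite pr_up; lra).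
           rewrite !Rminus_0_r. rewrite <- L, Rplus_0_l.
           destruct (Rlt_dec 0 h) as [Lh|Lh].
           ++ assert (K := Hdl (up X0 p h)). rewrite pr_up, pow_1 in K.
              unfold Rdiv. rewrite Rabs_mult, Rabs_inv, (Rabs_pos_eq h) in * by lra.
              apply Rle_lt_trans with (eps / 2); [|lra].
              apply Rle_div_l; [lra|]. apply K; auto. intros i.
              destruct (ix_dec X0 i) as [<-|n'].
              ** rewrite pr_up, <- L, Rminus_0_r, Rabs_pos_eq; lra.
              ** rewrite pr_up_neq, Rminus_diag, Rabs_R0 by auto. apply cond_pos.
           ++ rewrite Rt_neg by (rewrite pr_up; lra). unfold Rdiv. rewrite Rmult_0_l, Rabs_R0. lra.
        -- rewrite !Rt_neg by lra. rewrite Rmult_0_r, Rminus_diag, Rmult_0_r.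
           apply (is_derive_ext_loc (fun _ => 0)); [|apply is_derive_cst].
           apply (open_lt 0 (pr X0 p)) in L. revert L. apply filter_imp. intros x Hx.
           rewrite Rt_neg; auto. rewrite pr_up. lra.
      * assert (Q : is_derive (fun x => Rt k j f (up i p x)) (pr i p) (Rt k j (D i f) p)).
        { destruct (Rlt_dec 0 (pr X0 p)) as [L|L].
          - rewrite Rt_pos by auto. set (r := root k (pr X0 p)).
            apply (is_derive_ext (fun x => / r ^ j * f (up i (up X0 p r) x))).
            { intros x. rewrite Rt_pos; rewrite pr_up_neq; auto. fold r.
              rewrite up_comm by auto. apply Rmult_comm. }
            unfold Rdiv. rewrite Rmult_comm. apply (is_derive_scal (fun x => f (up i (up X0 p r) x))).
            assert (Bp := box_root k d p Hk Hd Hp L). fold r in Bp.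
            generalize (Sm_dif d f i _ Hf Bp). unfold dif. rewrite pr_up_neq; auto.
          - rewrite Rt_neg by lra. apply (is_derive_ext (fun _ => 0)); [|apply is_derive_cst].
            intros x. rewrite Rt_neg; auto. rewrite pr_up_neq; auto; lra. }
        destruct i; [easy|exact Q|exact Q|exact Q].
    + intros i. destruct i; try (apply IH; auto using Sm_D, Flat_D).
      apply (Bd_forget false (d ^ k) (fun j => Rabs (/ INR k) * (0 + Rabs (INR j) * 0))).
      eapply Bd_forget. apply Bd_scal. apply Bd_minus; [apply IH|apply Bd_scal; apply IH];
        auto using Sm_D, Flat_D.
Qed.

(** ** The homological equation with flat right-hand side *)

(** The derivative along the Hamiltonian field of [xi^2 + s x^k]. *)
Definition ham (s : R) (k : nat) (h : pt -> R) (p : pt) : R :=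
  2 * pr X1 p * D X0 h p - s * INR k * pr X0 p ^ (k - 1) * D X1 h p.

Lemma pow_small x e k : (1 <= k)%nat -> Rabs x < e -> e <= 1 -> Rabs (x ^ k) < e.
Proof.
  intros Hk Hx He. destruct k as [|k]; [lia|]. rewrite <- RPow_abs. simpl.
  assert (Rabs x ^ k <= 1).
  { rewrite <- (pow1 k). apply pow_incr. generalize (Rabs_pos x). lra. }
  generalize (Rabs_pos x). nra.
Qed.

(** At the boundary [x = 0] the difference quotients from the left decide. *)
Lemma D_vanish_left e f i p : Sm e f -> (forall q, box e q -> pr X0 q <= 0 -> f q = 0) ->
  box e p -> pr X0 p <= 0 -> D i f p = 0.
Proof.
  intros Hf H Hp Lp. destruct (ix_dec X0 i) as [<-|n].
  - apply (derive_flat_left e (fun x => f (up X0 p x))); auto.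
    + intros y Hy Hye. apply H; [now apply box_up|now rewrite pr_up].
    + eexists. apply (Sm_dif e f X0 p Hf Hp).
  - apply D_val. apply (is_derive_ext_loc (fun _ => 0)); [|apply is_derive_cst].
    generalize (locally_box_up e i p Hp). apply filter_imp. intros x Hx. symmetry.
    apply H; auto. now rewrite pr_up_neq by auto.
Qed.

(** A smooth function supported in [y >= 0] is flat at [y = 0], and remains so after
    the substitution [y = x^k]. *)
Lemma Van_power k e m : (1 <= k)%nat -> 0 < e <= 1 -> forall F, Sm e F ->
  (forall q, box e q -> pr X0 q <= 0 -> F q = 0) ->
  Sm e (fun p => F (pr X0 p ^ k, pr X1 p, pr X2 p, pr X3 p)) /\
  Van e m (fun p => F (pr X0 p ^ k, pr X1 p, pr X2 p, pr X3 p)).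
Proof.
  intros Hk He. 
  assert (Bk : forall p, box e p -> box e (pr X0 p ^ k, pr X1 p, pr X2 p, pr X3 p)).
  { intros p Hp. apply box_tuple; try apply Hp. apply pow_small; auto; lra. }
  assert (SC : forall F, Sm e F -> Sm e (fun p => F (pr X0 p ^ k, pr X1 p, pr X2 p, pr X3 p))).
  { intros F HF. apply (Sm_comp e e F); auto using Sm_pr, Sm_pow. }
  intros F HF HZ. split; auto. revert F HF HZ.
  induction m as [|m IH]; intros F HF HZ; cbn [Van]; auto. split.
  - intros p Hp Zp. rewrite Zp. apply HZ.
    + rewrite <- Zp at 1. now apply Bk.
    + simpl. rewrite pow_i by lia. lra.
  - apply (Van_ext e m (fun p => D X0 F (pr X0 p ^ k, pr X1 p, pr X2 p, pr X3 p) *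
      D X0 (fun q => pr X0 q ^ k) p)).
    + intros p Hp. symmetry. apply D_val.
      assert (T := fun j => Sm_dif e (pr j) X0 p (Sm_pr e j) Hp).
      assert (A := D_comp e F (fun q => pr X0 q ^ k) (pr X1) (pr X2) (pr X3) X0 p
        (Sm_C1 _ _ HF) (Bk p Hp) (Sm_dif e _ X0 p (Sm_pow e _ k (Sm_pr e X0)) Hp)
        (T X1) (T X2) (T X3)).
      cbv zeta in A. rewrite !D_pr in A.
      match type of A with is_derive _ _ ?v => match goal with |- is_derive _ _ ?u =>
        replace u with v; [exact A|] end end.
      unfold delta. repeat (destruct ix_dec; try easy). ring.
    + apply Van_mult; auto using Sm_D, Sm_pow, Sm_pr.
      apply IH; auto using Sm_D. intros q Hq Lq. now apply (D_vanish_left e).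
Qed.

Lemma parabola_solvable rho s d : s = 1 \/ s = -1 -> 0 < d -> Sm d (F2 rho) ->
  (forall y xi, y <= 0 -> rho y xi = 0) -> exists h z e, parabola_solution rho s h z e.
Proof.
  intros [-> | ->]; [apply solve_closed_arcs|apply solve_open_parabolas].
Qed.

(** In the coordinate [y = x^k] the level curves become parabolas; the
    substitution is harmless for flat functions. *)
Lemma solve_half_line r s k d : s = 1 \/ s = -1 -> (1 <= k)%nat -> 0 < d <= 1 ->
  Sm d (F2 r) -> Flat d (F2 r) ->
  exists h z e, 0 < e /\ Sm e (F2 h) /\ Sm e (F1 z) /\
    (forall p, box e p -> pr X0 p <= 0 -> F2 h p = 0 /\ z (pr X0 p) = 0) /\
    (forall p, box e p -> 0 < pr X0 p -> F2 r p = z (pr X0 p) + ham s k (F2 h) p).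
Proof.
  intros Hs Hk Hd Hr HF.
  set (rho := fun y xi => / INR k * Rt k (k - 1) (F2 r) (y, xi, 0, 0)).
  assert (SR : Sm (d ^ k) (F2 rho)).
  { apply (Sm_ext _ (fun p => / INR k * Rt k (k - 1) (F2 r) p)).
    - intros p _. unfold rho, F2, Rt. cbn. reflexivity.
    - apply Sm_scal. now apply Sm_Rt. }
  destruct (parabola_solvable rho s (d ^ k) Hs) as (h & z & e0 & He0 & Sh & Sz & Vh & Vz & EQ); auto.
  { apply pow_lt; lra. }
  { intros y xi Hy. unfold rho. rewrite Rt_neg by exact Hy. ring. }
  set (e := Rmin e0 d). assert (He : 0 < e) by (apply Rmin_glb_lt; lra).
  assert (e <= e0) by apply Rmin_l. assert (e <= d) by apply Rmin_r.
  apply (Sm_box e0 e) in Sh; auto. apply (Sm_box e0 e) in Sz; auto.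
  set (g := fun p => F2 h (pr X0 p ^ k, pr X1 p, pr X2 p, pr X3 p)).
  set (gz := fun p => F1 z (pr X0 p ^ k, pr X1 p, pr X2 p, pr X3 p)).
  assert (Hg : Sm e g /\ Flat e g).
  { split; [apply (Van_power k e 0 Hk ltac:(lra) (F2 h) Sh)|
      intros m; apply (Van_power k e m Hk ltac:(lra) (F2 h) Sh)];
    intros q Hq Lq; (apply Vh; auto; eapply Rlt_le_trans; try apply Hq; auto). }
  assert (Hgz : Sm e gz /\ Flat e gz).
  { split; [apply (Van_power k e 0 Hk ltac:(lra) (F1 z) Sz)|
      intros m; apply (Van_power k e m Hk ltac:(lra) (F1 z) Sz)];
    intros q Hq Lq; (apply Vz; auto; eapply Rlt_le_trans; try apply Hq; auto). }
  assert (R1 : forall y, 0 < y -> root 1 y = y).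
  { intros y Hy. generalize (root_pow 1 y (le_n 1) Hy). simpl. lra. }
  (* flat functions can be replaced by zero on the left, which is what [Rt 1 0] does *)
  assert (cut : forall f, Sm e f -> Flat e f -> Sm e (Rt 1 0 f) /\
    forall p, 0 < pr X0 p -> Rt 1 0 f p = f p).
  { intros f Hf Ff. split.
    - apply (Sm_box (e ^ 1)); [simpl; lra|]. apply Sm_Rt; auto; lra.
    - intros p Lp. rewrite Rt_pos, R1, up_pr by auto. simpl. field. }
  destruct Hg as [Sg Fg]. destruct Hgz as [Sgz Fgz].
  destruct (cut g Sg Fg) as [Scg Ecg].
  assert (SX : Sm e (fun p => INR k * pr X0 p ^ (k - 1))) by (apply Sm_scal, Sm_pow, Sm_pr).
  set (gz' := fun p => gz p * (INR k * pr X0 p ^ (k - 1))).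
  destruct (cut gz') as [Scz Ecz].
  { now apply Sm_mult. }
  { intros m. apply Van_mult; auto. }
  exists (fun x xi => Rt 1 0 g (x, xi, 0, 0)), (fun x => Rt 1 0 gz' (x, 0, 0, 0)), e.
  assert (Eh : forall p, F2 (fun x xi => Rt 1 0 g (x, xi, 0, 0)) p = Rt 1 0 g p) by reflexivity.
  assert (Ez : forall p, F1 (fun x => Rt 1 0 gz' (x, 0, 0, 0)) p = Rt 1 0 gz' p) by reflexivity.
  split; [exact He|]. split; [exact Scg|]. split; [exact Scz|]. split.
  - intros p Hp Lp. split; [rewrite Eh|]; now apply Rt_neg.
  - intros p Hp Lp. unfold ham.
    assert (DL : forall i, D i (F2 (fun x xi => Rt 1 0 g (x, xi, 0, 0))) p = D i g p).
    { intros i. apply Derive_ext_loc.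
      assert (L : locally (pr i p) (fun x => 0 < pr X0 (up i p x))).
      { apply (continuous_comp (up i p) (pr X0) (pr i p) (continuous_up i p _)
          (continuous_pr _ _) (fun x => 0 < x)). rewrite up_pr. now apply open_gt. }
      revert L. apply filter_imp. intros x Lx. rewrite Eh. now apply Ecg. }
    rewrite !DL. change (Rt 1 0 gz' (pr X0 p, 0, 0, 0)) with (Rt 1 0 gz' p).
    rewrite Ecz by auto. unfold gz', gz.
    set (q := (pr X0 p ^ k, pr X1 p, pr X2 p, pr X3 p)).
    assert (Bq : box e q).
    { apply box_tuple; try apply Hp. apply pow_small; auto; lra. }
    assert (Dg : forall i, D i g p = D X0 (F2 h) q * D i (fun p => pr X0 p ^ k) p +
      D X1 (F2 h) q * delta X1 i).
    { intros i. apply D_val.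
      assert (T := fun j => Sm_dif e (pr j) i p (Sm_pr e j) Hp).
      assert (A := D_comp e (F2 h) (fun q => pr X0 q ^ k) (pr X1) (pr X2) (pr X3) i p
        (Sm_C1 _ _ Sh) Bq (Sm_dif e _ i p (Sm_pow e _ k (Sm_pr e X0)) Hp)
        (T X1) (T X2) (T X3)).
      cbv zeta in A. rewrite !D_pr in A. fold q in A.
      rewrite (D_indep X2 (F2 h) q), (D_indep X3 (F2 h) q) in A by reflexivity.
      match type of A with is_derive _ _ ?v => match goal with |- is_derive _ _ ?u =>
        replace u with v; [exact A|ring] end end. }
    rewrite !Dg.
    assert (D0 : D X0 (fun p => pr X0 p ^ k) p = INR k * pr X0 p ^ (k - 1)).
    { apply D_val. cbn. auto_derive; auto. rewrite <- Nat.sub_1_r. ring. }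
    assert (D1 : D X1 (fun p => pr X0 p ^ k) p = 0) by (now apply D_indep).
    rewrite D0, D1. unfold delta. destruct (ix_dec X1 X0); [easy|]. destruct (ix_dec X1 X1); [|easy].
    assert (E := EQ q (box_le e e0 q ltac:(lra) Bq)).
    change (pr X1 q) with (pr X1 p) in E. change (pr X0 q) with (pr X0 p ^ k) in E.
    unfold rho in E.
    assert (Hk0 : INR k <> 0) by (apply not_0_INR; lia).
    rewrite Rt_pos in E by (cbn; now apply pow_lt).
    change (pr X0 (pr X0 p ^ k, pr X1 p, 0, 0)) with (pr X0 p ^ k) in E.
    rewrite pow_root in E by auto.
    change (F2 r (up X0 (pr X0 p ^ k, pr X1 p, 0, 0) (pr X0 p))) with (F2 r p) in E.
    change (F1 z q) with (z (pr X0 p ^ k)).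
    assert (Px : pr X0 p ^ (k - 1) <> 0) by (apply pow_nonzero; lra).
    replace (F2 r p) with (INR k * pr X0 p ^ (k - 1) *
      (/ INR k * (F2 r p / pr X0 p ^ (k - 1)))) by (field; auto).
    rewrite E. ring.
Qed.

Lemma Sm_mirror d f : Sm d f -> Sm d (fun p => f (- pr X0 p, pr X1 p, pr X2 p, pr X3 p)).
Proof.
  intros Hf. apply (Sm_comp d d f); auto using Sm_pr, Sm_opp.
  intros p Hp. apply box_tuple; try apply Hp. rewrite Rabs_Ropp. apply Hp.
Qed.

Lemma D_mirror d f i p : Sm d f -> box d p ->
  D i (fun p => f (- pr X0 p, pr X1 p, pr X2 p, pr X3 p)) p =
  (match i with X0 => -1 | _ => 1 end) * D i f (- pr X0 p, pr X1 p, pr X2 p, pr X3 p).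
Proof.
  intros Hf Hp. apply D_val.
  assert (Bq : box d (- pr X0 p, pr X1 p, pr X2 p, pr X3 p)).
  { apply box_tuple; try apply Hp. rewrite Rabs_Ropp. apply Hp. }
  assert (T := fun j => Sm_dif d (pr j) i p (Sm_pr d j) Hp).
  assert (A := D_comp d f (fun q => - pr X0 q) (pr X1) (pr X2) (pr X3) i p
    (Sm_C1 _ _ Hf) Bq (dif_opp _ _ _ (T X0)) (T X1) (T X2) (T X3)).
  cbv zeta in A. rewrite D_opp, !D_pr in A.
  match type of A with is_derive _ _ ?v => match goal with |- is_derive _ _ ?u =>
    replace u with v; [exact A|] end end.
  destruct i; unfold delta; repeat (destruct ix_dec; try easy); ring.
Qed.

Lemma Flat_mirror d f : Sm d f -> Flat d f ->
  Flat d (fun p => f (- pr X0 p, pr X1 p, pr X2 p, pr X3 p)).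
Proof.
  intros Hf HF m. revert f Hf HF. induction m as [|m IH]; intros f Hf HF; cbn [Van]; auto. split.
  - intros p Hp Zp. apply (proj1 (HF 1%nat)).
    + apply box_tuple; try apply Hp. rewrite Rabs_Ropp. apply Hp.
    + cbn. change (- pr X0 p = 0). rewrite Zp. ring.
  - apply (Van_ext d m (fun p => D X0 f (- pr X0 p, pr X1 p, pr X2 p, pr X3 p) * -1)).
    + intros p Hp. rewrite (D_mirror d) by auto. ring.
    + apply Van_mult; auto using Sm_const.
      * now apply Sm_mirror, Sm_D.
      * apply IH; auto using Sm_D, Flat_D.
Qed.

(** The two half-planes are treated separately: reflection in [x] turns [x < 0] into
    [x > 0] and [s] into [s (-1)^k], and the two solutions can be added because each
    of them vanishes on the other side. *)
Lemma solve_flat r s k d : s = 1 \/ s = -1 -> (1 <= k)%nat -> 0 < d <= 1 ->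
  Sm d (F2 r) -> Flat d (F2 r) ->
  exists h z e, 0 < e /\ Sm e (F2 h) /\ Sm e (F1 z) /\
    (forall p, box e p -> F2 r p = z (pr X0 p) + ham s k (F2 h) p).
Proof.
  intros Hs Hk Hd Hr HF.
  destruct (solve_half_line r s k d Hs Hk Hd Hr HF) as (h1 & z1 & e1 & He1 & Sh1 & Sz1 & V1 & Q1).
  assert (Hs' : s * (-1) ^ k = 1 \/ s * (-1) ^ k = -1).
  { destruct (Nat.Even_or_Odd k) as [[j ->]|[j ->]].
    - rewrite pow_1_even. destruct Hs as [-> | ->]; lra.
    - rewrite Nat.add_1_r, pow_1_odd. destruct Hs as [-> | ->]; lra. }
  destruct (solve_half_line (fun x xi => r (- x) xi) (s * (-1) ^ k) k d Hs' Hk Hd)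
    as (h2 & z2 & e2 & He2 & Sh2 & Sz2 & V2 & Q2).
  { exact (Sm_mirror d (F2 r) Hr). }
  { exact (Flat_mirror d (F2 r) Hr HF). }
  set (e := Rmin (Rmin e1 e2) d). assert (He : 0 < e) by (repeat apply Rmin_glb_lt; lra).
  assert (L1 : e <= e1) by (eapply Rle_trans; apply Rmin_l).
  assert (L2 : e <= e2) by (eapply Rle_trans; [apply Rmin_l|apply Rmin_r]).
  assert (L3 : e <= d) by apply Rmin_r.
  apply (Sm_box _ e) in Sh1, Sz1, Sh2, Sz2; auto.
  set (m := fun p : pt => (- pr X0 p, pr X1 p, pr X2 p, pr X3 p)).
  assert (Bm : forall p, box e p -> box e (m p)).
  { intros p Hp. apply box_tuple; try apply Hp. rewrite Rabs_Ropp. apply Hp. }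
  assert (Sm2 := Sm_mirror e _ Sh2).
  exists (fun x xi => h1 x xi - h2 (- x) xi), (fun x => z1 x + z2 (- x)), e.
  split; auto. split; [exact (Sm_minus e _ _ Sh1 Sm2)|].
  split; [exact (Sm_plus e _ _ Sz1 (Sm_mirror e _ Sz2))|].
  intros p Hp. specialize (Bm p Hp).
  assert (DH : forall i, D i (F2 (fun x xi => h1 x xi - h2 (- x) xi)) p =
    D i (F2 h1) p - (match i with X0 => -1 | _ => 1 end) * D i (F2 h2) (m p)).
  { intros i. unfold m. rewrite <- (D_mirror e _ _ _ Sh2 Hp).
    exact (D_minus i (F2 h1) (fun p => F2 h2 (m p)) p
      (Sm_dif e _ i p Sh1 Hp) (Sm_dif e _ i p Sm2 Hp)). }
  unfold ham. rewrite !DH.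
  assert (Bp1 := box_le _ _ p L1 Hp). assert (Bm2 := box_le _ _ _ L2 Bm).
  assert (DV1 : pr X0 p <= 0 -> forall i, D i (F2 h1) p = 0).
  { intros L i. apply (D_vanish_left e); auto. intros q Hq Lq. apply V1; auto.
    now apply (box_le e). }
  assert (DV2 : pr X0 (m p) <= 0 -> forall i, D i (F2 h2) (m p) = 0).
  { intros L i. apply (D_vanish_left e); auto. intros q Hq Lq. apply V2; auto.
    now apply (box_le e). }
  change (pr X0 (m p)) with (- pr X0 p) in DV2.
  destruct (Rtotal_order (pr X0 p) 0) as [L|[L|L]].
  - rewrite !DV1 by lra. assert (Q := Q2 (m p) Bm2 ltac:(cbn; change (0 < - pr X0 p); lra)).
    unfold ham in Q. change (pr X0 (m p)) with (- pr X0 p) in Q.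
    change (pr X1 (m p)) with (pr X1 p) in Q.
    assert (Er : F2 (fun x xi => r (- x) xi) (m p) = F2 r p).
    { unfold F2. cbn. now rewrite Ropp_involutive. }
    rewrite Er in Q. rewrite Q. destruct (V1 p Bp1 ltac:(lra)) as [_ ->].
    assert (Ek : (-1) ^ k * (- pr X0 p) ^ (k - 1) = - pr X0 p ^ (k - 1)).
    { replace (- pr X0 p) with ((-1) * pr X0 p) by ring. rewrite Rpow_mult_distr.
      destruct k as [|j]; [lia|]. replace (S j - 1)%nat with j by lia.
      change ((-1) ^ S j) with (-1 * (-1) ^ j).
      assert (Ej : (-1) ^ j * (-1) ^ j = 1).
      { rewrite <- Rpow_mult_distr. replace (-1 * -1) with 1 by ring. apply pow1. }
      set (u := (-1) ^ j) in *. set (v := pr X0 p ^ j).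
      transitivity (- (u * u) * v); [unfold v; ring|rewrite Ej; unfold v; ring]. }
    replace (s * (-1) ^ k * INR k * (- pr X0 p) ^ (k - 1))
      with (s * INR k * ((-1) ^ k * (- pr X0 p) ^ (k - 1))) by ring.
    rewrite Ek. ring.
  - rewrite DV1, DV1, DV2, DV2 by lra.
    rewrite (proj2 (V1 p Bp1 ltac:(lra))).
    assert (Z2 := proj2 (V2 (m p) Bm2 ltac:(change (- pr X0 p <= 0); lra))).
    change (z2 (- pr X0 p) = 0) in Z2. rewrite Z2.
    rewrite (proj1 (HF 1%nat) p (box_le _ _ p L3 Hp) L). ring.
  - rewrite !DV2 by lra. rewrite (Q1 p Bp1 L). unfold ham.
    assert (Z2 := proj2 (V2 (m p) Bm2 ltac:(change (- pr X0 p <= 0); lra))).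
    change (z2 (- pr X0 p) = 0) in Z2. rewrite Z2. ring.
Qed.

(** ** Smooth functions of [xi] alone *)

Definition Fxi (c : R -> R) : pt -> R := fun p => c (pr X1 p).

Lemma Sm_Fxi_derive d c : Sm d (Fxi c) -> Sm d (Fxi (Derive c)).
Proof. intros H. apply (Sm_ext d (D X1 (Fxi c))); [reflexivity|now apply Sm_D]. Qed.

Lemma Fxi_derive d c x : Sm d (Fxi c) -> Rabs x < d -> is_derive c x (Derive c x).
Proof.
  intros H Hx. assert (R0 : Rabs 0 < d) by (rewrite Rabs_R0; eapply Rle_lt_trans; [apply Rabs_pos|eauto]).
  exact (Sm_dif d (Fxi c) X1 (0, x, 0, 0) H ltac:(now apply box_tuple)).
Qed.

Lemma Bd_Fxi b d n (c c' : R -> R) M : (forall x, Rabs x < d -> is_derive c x (c' x)) ->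
  (b = true -> forall x, Rabs x < d -> Rabs (c x) <= M 0%nat) -> (forall j, 0 <= M j) ->
  Bd b d (fun j => M (S j)) n (Fxi c') -> Bd b d M (S n) (Fxi c).
Proof.
  intros Hc Hb HM H.
  assert (CT : forall p, box d p -> continuous (Fxi c) p).
  { intros p Hp. apply (continuous_comp (pr X1) c); [apply continuous_pr|].
    apply (ex_derive_continuous c). eexists. now apply Hc. }
  apply (Bd_intro _ _ _ _ _ (fun i => match i with X1 => Fxi c' | _ => fun _ => 0 end)); auto.
  - intros Hbt p Hp. now apply Hb.
  - intros i p Hp. destruct i; try (apply (is_derive_ext (fun _ => Fxi c p));
      [reflexivity|apply is_derive_cst]). now apply Hc.
  - intros i. destruct i; auto; (apply (Bd_const b d (fun j => M (S j)) n 0);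
      [rewrite Rabs_R0|intros]; apply HM).
Qed.

(** For [j = 0] and [g] the derivative of [a], this is the quotient [(a x - a 0) / x];
    the weights [t^j] appear when it is differentiated. *)
Definition hadamard (j : nat) (g : R -> R) (x : R) : R := RInt (fun t => t ^ j * g (t * x)) 0 1.

Lemma scaled_lt t x d : 0 <= t <= 1 -> Rabs x < d -> Rabs (t * x) < d.
Proof.
  intros Ht Hx. rewrite Rabs_mult, (Rabs_pos_eq t) by lra.
  generalize (Rabs_pos x). nra.
Qed.

Lemma hadamard_derive d j g x : Sm d (Fxi g) -> Rabs x < d ->
  is_derive (hadamard j g) x (hadamard (S j) (Derive g) x).
Proof.
  intros Hg Hx.
  assert (DD : forall t u, Rabs (t * u) < d ->
    is_derive (fun z => t ^ j * g (t * z)) u (t ^ S j * Derive g (t * u))).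
  { intros t u Htu.
    replace (t ^ S j * Derive g (t * u)) with (t ^ j * (Derive g (t * u) * t)) by (simpl; ring).
    apply (is_derive_scal (fun z => g (t * z))).
    apply (is_derive_compR g (fun z => t * z)); [now apply (Fxi_derive d)|].
    auto_derive; auto. ring. }
  assert (Cm : forall c, Sm d (Fxi c) -> forall y, Rabs y < d -> continuous c y).
  { intros c Hc y Hy. apply (ex_derive_continuous c). eexists. now apply (Fxi_derive d). }
  unfold hadamard.
  rewrite (RInt_ext (fun t => t ^ S j * Derive g (t * x))
    (fun t => Derive (fun z => t ^ j * g (t * z)) x)).
  2: { rewrite Rmin_left, Rmax_right by lra. intros t Ht. symmetry.
       apply is_derive_unique, DD. apply scaled_lt; auto; lra. }
  assert (Lx : locally x (fun y => Rabs y < d)).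
  { apply (continuous_Rabs x (fun y => y < d)). now apply open_lt. }
  apply is_derive_RInt_param.
  - revert Lx. apply filter_imp. intros u Hu t Ht.
    rewrite Rmin_left, Rmax_right in Ht by lra. eexists. apply DD. now apply scaled_lt.
  - rewrite Rmin_left, Rmax_right by lra. intros t Ht.
    assert (Cmul : continuous (fun z : R * R => snd z * fst z) (x, t)).
    { apply (continuous_mult (fun z : R * R => snd z) (fun z : R * R => fst z));
        [apply continuous_snd|apply continuous_fst]. }
    assert (L2 : locally (x, t) (fun z : R * R => Rabs (snd z * fst z) < d)).
    { apply (Cmul (fun y => Rabs y < d)). apply (continuous_Rabs _ (fun y => y < d)).
      apply open_lt. now apply scaled_lt. }
    apply (continuity_2d_pt_ext_loc (fun u v => v ^ S j * Derive g (v * u))).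
    { apply locally_2d_locally. revert L2. apply filter_imp. intros [u v] Huv. symmetry.
      now apply is_derive_unique, DD. }
    apply continuity_2d_pt_filterlim.
    apply (continuous_mult (fun z : R * R => snd z ^ S j) (fun z => Derive g (snd z * fst z))).
    + apply (continuous_comp (fun z : R * R => snd z) (fun y => y ^ S j)); [apply continuous_snd|].
      apply (ex_derive_continuous (fun y => y ^ S j)). auto_derive; auto.
    + apply (continuous_comp (fun z : R * R => snd z * fst z) (Derive g)); auto.
      apply Cm; [now apply Sm_Fxi_derive|]. now apply scaled_lt.
  - revert Lx. apply filter_imp. intros u Hu.
    apply (ex_RInt_continuous (V := R_CompleteNormedModule)).
    rewrite Rmin_left, Rmax_right by lra. intros t Ht.
    apply (continuous_mult (fun t => t ^ j) (fun t => g (t * u))).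
    + apply (ex_derive_continuous (fun y => y ^ j)). auto_derive; auto.
    + apply (continuous_comp (fun t => t * u) g).
      * apply (ex_derive_continuous (fun t => t * u)). auto_derive; auto.
      * apply (Cm g Hg). now apply scaled_lt.
Qed.

Lemma Sm_hadamard d j g : Sm d (Fxi g) -> Sm d (Fxi (hadamard j g)).
Proof.
  assert (K : forall n j g, Sm d (Fxi g) -> Bd false d (fun _ => 0) (S n) (Fxi (hadamard j g))).
  { induction n as [|n IH]; intros i f Hf;
    (apply (Bd_Fxi _ _ _ _ (hadamard (S i) (Derive f))); [|discriminate|intros; lra|]).
    - intros x Hx. now apply (hadamard_derive d).
    - apply (Bd_down _ _ (fun _ => 0)).
      apply (Bd_Fxi _ _ _ _ (hadamard (S (S i)) (Derive (Derive f)))); [|discriminate|intros; lra|].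
      + intros x Hx. apply (hadamard_derive d); auto. now apply Sm_Fxi_derive.
      + split; auto. intros p Hp. split; [|discriminate].
        apply (continuous_comp (pr X1) (hadamard (S (S i)) (Derive (Derive f)))); [apply continuous_pr|].
        apply (ex_derive_continuous (hadamard (S (S i)) (Derive (Derive f)))).
        eexists. apply (hadamard_derive d); [now apply Sm_Fxi_derive, Sm_Fxi_derive|apply Hp].
    - intros x Hx. now apply (hadamard_derive d).
    - apply IH. now apply Sm_Fxi_derive. }
  intros Hg n. now apply (Bd_down _ _ (fun _ => 0)), K.
Qed.

Lemma hadamard_quotient d a x : Sm d (Fxi a) -> Rabs x < d ->
  a x - a 0 = x * hadamard 0 (Derive a) x.
Proof.
  intros Ha Hx.
  assert (I : is_RInt (V := R_NormedModule) (fun t => x * Derive a (t * x)) 0 1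
    (minus (a (1 * x)) (a (0 * x)))).
  { apply (is_RInt_derive (V := R_CompleteNormedModule) (fun t => a (t * x))).
    - rewrite Rmin_left, Rmax_right by lra. intros t Ht. rewrite Rmult_comm.
      apply (is_derive_compR a (fun t => t * x)).
      + apply (Fxi_derive d); auto. now apply scaled_lt.
      + auto_derive; auto. ring.
    - rewrite Rmin_left, Rmax_right by lra. intros t Ht.
      apply (continuous_mult (fun _ => x) (fun t => Derive a (t * x))); [apply continuous_const|].
      apply (continuous_comp (fun t => t * x) (Derive a)).
      + apply (ex_derive_continuous (fun t => t * x)). auto_derive; auto.
      + apply (ex_derive_continuous (Derive a)). eexists. apply (Fxi_derive d).
        * now apply Sm_Fxi_derive.
        * now apply scaled_lt. }
  apply (is_RInt_unique (V := R_CompleteNormedModule)) in I. unfold minus, plus, opp in I; simpl in I.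
  rewrite Rmult_1_l, Rmult_0_l in I. unfold Rminus. rewrite <- I. unfold hadamard.
  rewrite (RInt_ext (fun t => x * Derive a (t * x)) (fun t => scal x (t ^ 0 * Derive a (t * x)))).
  - apply (RInt_scal (V := R_CompleteNormedModule)).
    apply (ex_RInt_continuous (V := R_CompleteNormedModule)).
    rewrite Rmin_left, Rmax_right by lra. intros t Ht.
    apply (continuous_mult (fun t => t ^ 0) (fun t => Derive a (t * x))); [apply continuous_const|].
    apply (continuous_comp (fun t => t * x) (Derive a)).
    + apply (ex_derive_continuous (fun t => t * x)). auto_derive; auto.
    + apply (ex_derive_continuous (Derive a)). eexists. apply (Fxi_derive d).
      * now apply Sm_Fxi_derive.
      * now apply scaled_lt.
  - intros t _. unfold scal; simpl; unfold mult; simpl.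
    match goal with |- ?u = ?v => change (@eq R u v) end. ring.
Qed.

(** The innermost derivative is taken first, as in the recursion of [Bd]. *)
Fixpoint iter_derive (j : nat) (c : R -> R) : R -> R :=
  match j with O => c | S j => iter_derive j (Derive c) end.

Definition sup_bound (e : R) (g : R -> R) : R :=
  epsilon (inhabits 0) (fun K => 0 <= K /\ forall x, Rabs x <= e -> Rabs (g x) <= K).

Lemma sup_bound_spec d e c : 0 < e < d -> Sm d (Fxi c) ->
  0 <= sup_bound e c /\ forall x, Rabs x <= e -> Rabs (c x) <= sup_bound e c.
Proof.
  intros He Hc. apply (epsilon_spec (inhabits 0)
    (fun K => 0 <= K /\ forall x, Rabs x <= e -> Rabs (c x) <= K)).
  destruct (continuity_ab_maj (fun x => Rabs (c x)) (- e) e) as [M [HM _]]; [lra| |].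
  - intros x Hx. apply continuity_pt_filterlim.
    apply (continuous_comp c Rabs); [|apply continuous_Rabs].
    apply (ex_derive_continuous c). eexists. apply (Fxi_derive d); auto. apply Rabs_def1; lra.
  - exists (Rabs (c M)). split; [apply Rabs_pos|]. intros x Hx. apply HM.
    generalize (Rle_abs x) (Rle_abs (- x)). rewrite Rabs_Ropp. lra.
Qed.

Lemma Bd_iter_derive d e c : 0 < e < d -> Sm d (Fxi c) ->
  (forall j, 0 <= sup_bound e (iter_derive j c)) /\
  forall n, Bd true e (fun j => sup_bound e (iter_derive j c)) n (Fxi c).
Proof.
  intros He Hc.
  assert (Pos : forall j c, Sm d (Fxi c) -> 0 <= sup_bound e (iter_derive j c)).
  { induction j as [|j IH]; intros f Hf; simpl.
    - now apply (sup_bound_spec d).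
    - apply IH. now apply Sm_Fxi_derive. }
  split; auto. intros n. revert c Hc. induction n as [|n IH]; intros c Hc.
  - split; auto. intros p Hp. split.
    + apply (Sm_cont d (Fxi c)); auto. apply (box_le e); auto; lra.
    + intros _. apply (sup_bound_spec d); auto. left. apply Hp.
  - apply (Bd_Fxi _ _ _ _ (Derive c)).
    + intros x Hx. apply (Fxi_derive d); auto; lra.
    + intros _ x Hx. apply (sup_bound_spec d); auto. lra.
    + auto.
    + apply (IH (Derive c)). now apply Sm_Fxi_derive.
Qed.

(** ** Damped monomials *)

(** For [j <= m] the [j]-th derivative of [x^m / (1 + b x^2)^l] is bounded on
    [|x| < 1] independently of [b]; the majorants [dampM] record this. *)
Definition damp (b : R) (m l : nat) (p : pt) : R :=
  pr X0 p ^ m * (/ (1 + b * pr X0 p ^ 2)) ^ l.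

Fixpoint dampM (b : R) (m l j : nat) : R :=
  match j with
  | O => 1
  | S j => match m with
    | O => Rabs (- 2 * INR l * b) * dampM b 1 (S l) j
    | S m' => Rabs (INR m - 2 * INR l) * dampM b m' l j + Rabs (2 * INR l) * dampM b m' (S l) j
    end
  end.

Lemma dampM_pos b j : forall m l, 0 <= dampM b m l j.
Proof.
  induction j as [|j IH]; intros m l; simpl; [lra|].
  destruct m as [|m].
  - apply Rmult_le_pos; auto using Rabs_pos.
  - generalize (IH m l) (IH m (S l)). intros.
    apply Rplus_le_le_0_compat; apply Rmult_le_pos; auto using Rabs_pos.
Qed.

Lemma dampM_indep b b' j : forall m l, (j <= m)%nat -> dampM b m l j = dampM b' m l j.
Proof.
  induction j as [|j IH]; intros m l Hm; auto. destruct m as [|m]; [lia|].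
  simpl. rewrite (IH m l), (IH m (S l)) by lia. reflexivity.
Qed.

Lemma damp_D b m l i p : 0 <= b -> is_derive (fun x => damp b m l (up i p x)) (pr i p)
  (match i with
   | X0 => match m with
     | O => - 2 * INR l * b * damp b 1 (S l) p
     | S m' => (INR m - 2 * INR l) * damp b m' l p + 2 * INR l * damp b m' (S l) p end
   | _ => 0 end).
Proof.
  intros Hb. destruct i; try (apply (is_derive_ext (fun _ => damp b m l p));
    [reflexivity|apply is_derive_cst]).
  set (x := pr X0 p). assert (U : 0 < 1 + b * x ^ 2) by (generalize (pow2_ge_0 x); nra).
  assert (A2 : is_derive (fun x => (/ (1 + b * x ^ 2)) ^ l) x
    (- 2 * INR l * b * x * (/ (1 + b * x ^ 2)) ^ S l)).
  { auto_derive; [simpl in U; lra|].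
    destruct l as [|l]; [simpl; ring|]. cbn [Init.Nat.pred].
    change (match l with O => 1 | S _ => INR l + 1 end) with (INR (S l)).
    simpl pow. simpl in U. field. lra. }
  destruct m as [|m].
  - apply (is_derive_ext (fun x => (/ (1 + b * x ^ 2)) ^ l)).
    { intros t. unfold damp. rewrite pr_up. simpl. ring. }
    replace (- 2 * INR l * b * damp b 1 (S l) p)
      with (- 2 * INR l * b * x * (/ (1 + b * x ^ 2)) ^ S l); auto.
    unfold damp. fold x. simpl. ring.
  - assert (A1 : is_derive (fun x => x ^ S m) x (INR (S m) * x ^ m)).
    { auto_derive; auto. cbn [Init.Nat.pred]. 
      change (match m with O => 1 | S _ => INR m + 1 end) with (INR (S m)). ring. }
    assert (A := is_derive_mul _ _ _ _ _ A1 A2).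
    apply (is_derive_ext (fun x => x ^ S m * (/ (1 + b * x ^ 2)) ^ l)).
    { intros t. unfold damp. now rewrite pr_up. }
    match type of A with is_derive _ _ ?v => match goal with |- is_derive _ _ ?u =>
      replace u with v; [exact A|] end end.
    unfold damp. fold x. set (u := / (1 + b * x ^ 2)).
    assert (Eu : b * x ^ 2 * u = 1 - u) by (unfold u; field; lra).
    rewrite <- !(tech_pow_Rmult u l).
    rewrite <- (tech_pow_Rmult x m).
    replace (x * x ^ m * (-2 * INR l * b * x * (u * u ^ l)))
      with (- 2 * INR l * (x ^ m * u ^ l) * (b * x ^ 2 * u)) by ring.
    rewrite Eu. ring.
Qed.

Lemma damp_continuous b m l p : 0 <= b -> continuous (damp b m l) p.
Proof.
  intros Hb. apply (continuous_comp (pr X0) (fun x => x ^ m * (/ (1 + b * x ^ 2)) ^ l));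
    [apply continuous_pr|].
  apply (ex_derive_continuous (fun x => x ^ m * (/ (1 + b * x ^ 2)) ^ l)). auto_derive.
  generalize (pow2_ge_0 (pr X0 p)). simpl. nra.
Qed.

Lemma Bd_damp b : 0 <= b -> forall n m l, Bd true 1 (dampM b m l) n (damp b m l).
Proof.
  intros Hb.
  assert (B0 : forall m l p, box 1 p -> Rabs (damp b m l p) <= 1).
  { intros m l p Hp. unfold damp. specialize (Hp X0). set (x := pr X0 p) in *.
    assert (U : 1 <= 1 + b * x ^ 2) by (generalize (pow2_ge_0 x); nra).
    rewrite Rabs_mult, <- !RPow_abs. apply Rle_trans with (1 ^ m * 1 ^ l).
    2: rewrite !pow1; lra.
    apply Rmult_le_compat; try (apply pow_le, Rabs_pos).
    - apply pow_incr. split; [apply Rabs_pos|lra].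
    - apply pow_incr. split; [apply Rabs_pos|].
      rewrite Rabs_inv, Rabs_pos_eq by lra. 
      apply Rle_trans with (/ 1); [apply Rinv_le_contravar; lra|rewrite Rinv_1; lra]. }
  induction n as [|n IH]; intros m l.
  - split; auto. intros p Hp. split; [now apply damp_continuous|]. intros _. now apply B0.
  - apply (Bd_intro _ _ _ _ _ (fun i p => match i with
     | X0 => match m with
       | O => - 2 * INR l * b * damp b 1 (S l) p
       | S m' => (INR m - 2 * INR l) * damp b m' l p + 2 * INR l * damp b m' (S l) p end
     | _ => 0 end)).
    + intros p Hp. now apply damp_continuous.
    + intros _ p Hp. now apply B0.
    + intros i p Hp. now apply damp_D.
    + assert (Z : Bd true 1 (fun j => dampM b m l (S j)) n (fun _ => 0)).
      { apply Bd_const; [rewrite Rabs_R0|intros]; apply dampM_pos. }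
      intros i. destruct i; auto. destruct m as [|m].
      * eapply Bd_le; [|apply Bd_scal, (IH 1%nat (S l))]. intros j. simpl. lra.
      * eapply Bd_le; [|apply Bd_plus; [apply Bd_scal, (IH m l)|apply Bd_scal, (IH m (S l))]].
        intros j. apply Rle_refl.
Qed.

(** Since [b x^2 / (1 + b x^2) = 1 - 1 / (1 + b x^2)], a monomial damped with a
    large [b] has small derivatives up to two orders below its degree. *)
Lemma damp_small n eps : 0 < eps -> exists b M, 0 <= b /\ (forall j, 0 <= M j) /\
  (forall N, Bd true 1 M N (damp b n 1)) /\ (forall j, (j + 2 <= n)%nat -> M j <= eps).
Proof.
  intros He. destruct (Compare_dec.le_lt_dec 2 n) as [Hn|Hn].
  - set (m := (n - 2)%nat). 
    set (S0 := sum_f_R0 (fun j => dampM 1 m 0 j + dampM 1 m 1 j) m).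
    set (b := 1 + S0 / eps).
    assert (HS : forall j, (j <= m)%nat -> dampM 1 m 0 j + dampM 1 m 1 j <= S0).
    { intros j Hj. unfold S0. clear -Hj. set (w := fun j => dampM 1 m 0 j + dampM 1 m 1 j).
      assert (Hw : forall j, 0 <= w j) by (intros; apply Rplus_le_le_0_compat; apply dampM_pos).
      change (w j <= sum_f_R0 w m). clearbody w. revert Hj. generalize m. intros q Hj.
      induction q as [|q IH].
      - replace j with 0%nat by lia. simpl; lra.
      - simpl. destruct (Nat.eq_dec j (S q)) as [->|N].
        + assert (0 <= sum_f_R0 w q) by (apply cond_pos_sum; auto). lra.
        + generalize (IH ltac:(lia)) (Hw (S q)). lra. }
    assert (S0p : 0 <= S0).
    { eapply Rle_trans; [|apply (HS 0%nat); lia]. simpl. lra. }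
    assert (Hb : 1 <= b).
    { unfold b. assert (0 <= S0 / eps) by (apply Rdiv_le_0_compat; lra). lra. }
    exists b, (fun j => / b * (dampM b m 0 j + dampM b m 1 j)).
    assert (Hib : 0 < / b) by (apply Rinv_0_lt_compat; lra).
    split; [lra|]. split; [|split].
    + intros j. apply Rmult_le_pos; [lra|]. apply Rplus_le_le_0_compat; apply dampM_pos.
    + intros N. apply (Bd_ext true 1 N _ (fun p => / b * (damp b m 0 p - damp b m 1 p))).
      * intros p _. unfold damp. set (x := pr X0 p).
        assert (0 < 1 + b * x ^ 2) by (generalize (pow2_ge_0 x); nra).
        replace n with (m + 2)%nat by (unfold m; lia). rewrite pow_add. simpl.
        simpl in H. field. lra.
      * eapply Bd_le; [|apply Bd_scal, Bd_minus; apply Bd_damp; lra].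
        intros j. rewrite Rabs_pos_eq; lra.
    + intros j Hj. rewrite (dampM_indep b 1 j m 0), (dampM_indep b 1 j m 1) by (unfold m; lia).
      rewrite Rmult_comm. apply Rle_div_l; [lra|].
      apply Rle_trans with S0; [apply HS; unfold m; lia|].
      unfold b. apply Rle_trans with (eps * (S0 / eps)); [right; field; lra|].
      apply Rmult_le_compat_l; lra.
  - exists 0, (dampM 0 n 1). split; [lra|]. split; [intros; apply dampM_pos|].
    split; [intros; apply Bd_damp; lra|]. intros j Hj. lia.
Qed.

Lemma conv_linear_bound : forall j M N eps, 0 <= eps -> (forall i, 0 <= N i) ->
  (forall i, (i <= j)%nat -> M i <= eps) -> conv M N j <= eps * conv (fun _ => 1) N j.
Proof.
  induction j as [|j IH]; intros M N eps He HN HM; simpl.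
  - rewrite Rmult_1_l. apply Rmult_le_compat_r; auto.
  - rewrite Rmult_plus_distr_l. apply Rplus_le_compat; apply IH; auto.
    intros i Hi. apply HM. lia.
Qed.

Lemma conv_pos j : forall M N, (forall i, 0 <= M i) -> (forall i, 0 <= N i) -> 0 <= conv M N j.
Proof.
  induction j as [|j IH]; intros M N HM HN; simpl.
  - now apply Rmult_le_pos.
  - apply Rplus_le_le_0_compat; apply IH; auto.
Qed.

(** ** The smooth homological equation *)

(** Like [Van], iterated from the inside. *)
Fixpoint Dn (m : nat) (f : pt -> R) : pt -> R :=
  match m with O => f | S m => Dn m (D X0 f) end.

Lemma Sm_Dn d m : forall f, Sm d f -> Sm d (Dn m f).
Proof. induction m; simpl; auto using Sm_D. Qed.

Lemma Dn_ext d m : forall f g, (forall p, box d p -> f p = g p) ->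
  forall p, box d p -> Dn m f p = Dn m g p.
Proof.
  induction m as [|m IH]; intros f g E p Hp; simpl; auto.
  apply IH; auto. intros q Hq. now apply (D_ext d).
Qed.

Lemma Dn_minus d m : forall f g, Sm d f -> Sm d g -> forall p, box d p ->
  Dn m (fun p => f p - g p) p = Dn m f p - Dn m g p.
Proof.
  induction m as [|m IH]; intros f g Hf Hg p Hp; simpl; auto.
  rewrite <- IH by auto using Sm_D. apply (Dn_ext d); auto.
  intros q Hq. apply D_minus; now apply (Sm_dif d).
Qed.

(** The leading coefficient at [x = 0] decides about one more order of vanishing. *)
Lemma Van_lead d m : forall f, Van d m f ->
  (forall p, box d p -> pr X0 p = 0 -> Dn m f p = 0) -> Van d (S m) f.
Proof.
  induction m as [|m IH]; intros f V H.
  - split; cbn [Van]; auto.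
  - destruct V as [V0 V]. split; auto.
Qed.

Lemma xpow_lead d m : forall g, Sm d g -> Van d m (fun p => pr X0 p ^ m * g p) /\
  forall p, box d p -> pr X0 p = 0 -> Dn m (fun p => pr X0 p ^ m * g p) p = INR (fact m) * g p.
Proof.
  induction m as [|m IH]; intros g Hg.
  - split; [exact I|intros p _ _; cbn; ring].
  - set (g' := fun p => INR (S m) * g p + pr X0 p * D X0 g p).
    assert (Hg' : Sm d g').
    { apply Sm_plus; [now apply Sm_scal|]. apply Sm_mult; [apply Sm_pr|now apply Sm_D]. }
    assert (E : forall p, box d p -> D X0 (fun p => pr X0 p ^ S m * g p) p = pr X0 p ^ m * g' p).
    { intros p Hp. rewrite (D_mult X0 (fun p => pr X0 p ^ S m)).
      - rewrite (D_val X0 (fun p => pr X0 p ^ S m) p (INR (S m) * pr X0 p ^ m)).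
        + unfold g'. rewrite <- !tech_pow_Rmult. ring.
        + apply (is_derive_ext (fun x => x ^ S m)); [intros; now rewrite pr_up|].
          auto_derive; auto. cbn [Init.Nat.pred].
          change (match m with O => 1 | S _ => INR m + 1 end) with (INR (S m)). ring.
      - apply (Sm_dif d); auto. apply Sm_pow, Sm_pr.
      - now apply (Sm_dif d). }
    destruct (IH g' Hg') as [V L]. split.
    + split; [intros p _ Zp; rewrite Zp; simpl; ring|].
      apply (Van_ext d m (fun p => pr X0 p ^ m * g' p)); auto. intros. now rewrite E.
    + intros p Hp Zp. cbn [Dn].
      rewrite (Dn_ext d m _ (fun p => pr X0 p ^ m * g' p)) by auto.
      rewrite L by auto. unfold g'. rewrite Zp. rewrite fact_simpl, mult_INR. ring.
Qed.

Lemma Dn_F2 m : forall f p, Dn m (F2 f) p = Dn m (F2 f) (pr X0 p, pr X1 p, 0, 0).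
Proof.
  induction m as [|m IH]; intros f p; [reflexivity|].
  exact (IH (fun x xi => Derive (fun x => f x xi) x) p).
Qed.

Lemma Sm_damp d b m l : d <= 1 -> 0 <= b -> Sm d (damp b m l).
Proof. intros Hd Hb n. eapply Bd_forget, (Bd_box true 1); [exact Hd|]. now apply Bd_damp. Qed.

Lemma Sm_ham d s k h : Sm d h -> Sm d (ham s k h).
Proof.
  intros Hh. apply Sm_minus.
  - apply Sm_mult; [apply Sm_scal, Sm_pr|now apply Sm_D].
  - apply Sm_mult; [|now apply Sm_D].
    apply (Sm_mult d (fun _ => s * INR k)); [apply Sm_const|apply Sm_pow, Sm_pr].
Qed.

(** The leading coefficient [a] of the remainder at [x = 0] is split as
    [a 0 + xi * c xi]; the first part is absorbed by [z], the second by [h].  The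
    damping makes the corrections summable without affecting the leading order. *)
Lemma flatten_step s k d m rem : 0 < d <= 1 -> Sm d (F2 rem) -> Van d m (F2 rem) ->
  exists h z M, Sm d (F2 h) /\ Sm d (F1 z) /\ Van d (S m) (F2 h) /\ Van d m (F1 z) /\
   (forall N, Bd true (d / 2) M N (F2 h)) /\ (forall N, Bd true (d / 2) M N (F1 z)) /\
   (forall j, 0 <= M j) /\ (forall j, (j + 2 <= m)%nat -> M j <= (/ 2) ^ m) /\
   Van d (S m) (fun p => F2 rem p - z (pr X0 p) - ham s k (F2 h) p).
Proof.
  intros Hd Hr V.
  set (a := fun xi => / INR (fact m) * Dn m (F2 rem) (0, xi, 0, 0)).
  assert (R0 : Rabs 0 < d) by (rewrite Rabs_R0; lra).
  assert (Sa : Sm d (Fxi a)).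
  { apply Sm_scal. apply (Sm_comp d d (Dn m (F2 rem)) (fun _ => 0) (pr X1) (fun _ => 0) (fun _ => 0));
      auto using Sm_const, Sm_pr, Sm_Dn. intros p Hp. apply box_tuple; auto. }
  set (c := hadamard 0 (Derive a)).
  assert (Sc : Sm d (Fxi c)) by now apply Sm_hadamard, Sm_Fxi_derive.
  assert (Ec : forall x, Rabs x < d -> a x = a 0 + x * c x).
  { intros x Hx. unfold c. rewrite <- (hadamard_quotient d) by auto. ring. }
  set (kap := / (2 * INR (S m))).
  assert (Hm1 : 1 <= INR (S m)) by (apply (le_INR 1); lia).
  assert (Hk : 0 < kap <= 1).
  { unfold kap. split; [apply Rinv_0_lt_compat; lra|].
    apply Rle_trans with (/ 1); [apply Rinv_le_contravar; lra|rewrite Rinv_1; lra]. }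
  destruct (Bd_iter_derive d (d / 2) c ltac:(lra) Sc) as [Mcp Mcb].
  set (Mc := fun j => sup_bound (d / 2) (iter_derive j c)) in *.
  set (Q := sum_f_R0 (fun j => conv (fun _ => 1) Mc j) m).
  assert (Qj : forall j, (j <= m)%nat -> conv (fun _ => 1) Mc j <= Q).
  { assert (P : forall j, 0 <= conv (fun _ => 1) Mc j) by (intros; apply conv_pos; auto; intros; lra).
    unfold Q. set (w := conv (fun _ => 1) Mc) in *. clearbody w. intros j. generalize m.
    induction m0 as [|q IH]; intros Hj.
    - replace j with 0%nat by lia. simpl; lra.
    - simpl sum_f_R0. cbv beta. destruct (Nat.eq_dec j (S q)) as [->|N].
      + assert (0 <= sum_f_R0 w q) by (apply cond_pos_sum; auto). lra.
      + generalize (IH ltac:(lia)) (P (S q)). lra. }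
  assert (Q0 : 0 <= Q).
  { apply cond_pos_sum. intros; apply conv_pos; auto; intros; lra. }
  assert (A0 := Rabs_pos (a 0)).
  set (eps := (/ 2) ^ m / (1 + Q + Rabs (a 0))).
  assert (He : 0 < eps) by (apply Rdiv_lt_0_compat; [apply pow_lt|]; lra).
  destruct (damp_small m eps He) as (b1 & M1 & Hb1 & P1 & B1 & L1).
  destruct (damp_small (S m) eps He) as (b2 & M2 & Hb2 & P2 & B2 & L2).
  exists (fun x xi => kap * (damp b2 (S m) 1 (x, 0, 0, 0) * c xi)),
    (fun x => a 0 * damp b1 m 1 (x, 0, 0, 0)),
    (fun j => kap * conv M2 Mc j + Rabs (a 0) * M1 j).
  set (h := fun x xi => kap * (damp b2 (S m) 1 (x, 0, 0, 0) * c xi)).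
  set (z := fun x => a 0 * damp b1 m 1 (x, 0, 0, 0)).
  set (hp := fun p => kap * (damp b2 (S m) 1 p * Fxi c p)).
  set (zp := fun p => a 0 * damp b1 m 1 p).
  change (F2 h) with hp. change (F1 z) with zp.
  assert (Shp : Sm d hp).
  { apply Sm_scal, Sm_mult; auto. apply Sm_damp; lra. }
  assert (Szp : Sm d zp) by (apply Sm_scal, Sm_damp; lra).
  assert (CP : forall j, 0 <= conv M2 Mc j) by (intros; now apply conv_pos).
  assert (MP : forall j, 0 <= kap * conv M2 Mc j /\ 0 <= Rabs (a 0) * M1 j).
  { intros j. split; apply Rmult_le_pos; auto; lra. }
  set (u := fun b => damp b 0 1).
  assert (Su : forall b, 0 <= b -> Sm d (u b)) by (intros; apply Sm_damp; lra).
  split; [exact Shp|]. split; [exact Szp|]. split; [|split; [|split; [|split; [|split; [|split]]]]].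
  - apply (Van_ext d (S m) (fun p => pr X0 p ^ S m * (kap * (u b2 p * Fxi c p)))).
    { intros p _. unfold hp, u, damp. rewrite pow_O. ring. }
    apply xpow_lead. apply Sm_scal, Sm_mult; auto.
  - apply (Van_ext d m (fun p => pr X0 p ^ m * (a 0 * u b1 p))).
    { intros p _. unfold zp, u, damp. rewrite pow_O. ring. }
    apply xpow_lead. apply Sm_scal; auto.
  - intros N. apply (Bd_le _ _ (fun j => Rabs kap * conv M2 Mc j)).
    { intros j. destruct (MP j). rewrite (Rabs_pos_eq kap) by lra. lra. }
    apply Bd_scal, Bd_mult; auto. apply (Bd_box _ 1); [lra|apply B2].
  - intros N. apply (Bd_le _ _ (fun j => Rabs (a 0) * M1 j)).
    { intros j. destruct (MP j). lra. }
    apply Bd_scal. apply (Bd_box _ 1); [lra|apply B1].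
  - intros j. destruct (MP j). lra.
  - intros j Hj.
    assert (T1 : conv M2 Mc j <= eps * conv (fun _ => 1) Mc j).
    { apply conv_linear_bound; auto; [lra|]. intros i Hi. apply L2. lia. }
    generalize (Qj j ltac:(lia)) (L1 j Hj) (CP j). intros T2 T3 T4.
    apply Rle_trans with (eps * (Q + Rabs (a 0))).
    + assert (eps * conv (fun _ => 1) Mc j <= eps * Q) by (apply Rmult_le_compat_l; lra).
      assert (Rabs (a 0) * M1 j <= Rabs (a 0) * eps) by (apply Rmult_le_compat_l; lra).
      nra.
    + unfold eps. assert (0 < (/ 2) ^ m) by (apply pow_lt; lra).
      unfold Rdiv. rewrite Rmult_assoc. rewrite <- (Rmult_1_r ((/ 2) ^ m)) at 2.
      apply Rmult_le_compat_l; [lra|]. rewrite Rmult_comm. apply Rle_div_l; lra.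
  - set (g1 := fun p => a 0 * u b1 p + 2 * (pr X1 p * (kap * (Fxi c p *
      ((INR (S m) - 2) * u b2 p + 2 * damp b2 0 2 p))))).
    set (g2 := fun p => (s * INR k * kap) * (pr X0 p ^ (k - 1) * (u b2 p * Fxi (Derive c) p))).
    assert (Sg1 : Sm d g1).
    { apply Sm_plus; [apply Sm_scal; auto|]. apply Sm_scal, Sm_mult; [apply Sm_pr|].
      apply Sm_scal, Sm_mult; auto. apply Sm_plus; apply Sm_scal; auto. apply Sm_damp; lra. }
    assert (Sg2 : Sm d g2).
    { apply Sm_scal, Sm_mult; [apply Sm_pow, Sm_pr|]. apply Sm_mult; auto.
      now apply Sm_Fxi_derive. }
    apply (Van_ext d (S m) (fun p => (F2 rem p - pr X0 p ^ m * g1 p) + pr X0 p ^ S m * g2 p)).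
    { intros p Hp. unfold ham.
      assert (D0 : D X0 hp p = kap * (((INR (S m) - 2) * damp b2 m 1 p + 2 * damp b2 m 2 p) * Fxi c p)).
      { unfold hp. rewrite D_scal. f_equal. rewrite (D_mult X0 (damp b2 (S m) 1)).
        - rewrite (D_indep X0 (Fxi c)) by reflexivity.
          rewrite (D_val X0 _ _ _ (damp_D b2 (S m) 1 X0 p Hb2)).
          change (INR 1) with 1. ring.
        - apply (Sm_dif d); auto. apply Sm_damp; lra.
        - now apply (Sm_dif d). }
      assert (D1 : D X1 hp p = kap * (damp b2 (S m) 1 p * Fxi (Derive c) p)).
      { unfold hp. rewrite D_scal. f_equal. rewrite (D_mult X1 (damp b2 (S m) 1)).
        - rewrite (D_indep X1 (damp b2 (S m) 1)) by reflexivity.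
          change (D X1 (Fxi c) p) with (Fxi (Derive c) p). ring.
        - apply (Sm_dif d); auto. apply Sm_damp; lra.
        - now apply (Sm_dif d). }
      rewrite D0, D1. change (z (pr X0 p)) with (zp p). unfold g1, g2, zp, u, damp. rewrite pow_O.
      rewrite <- (tech_pow_Rmult (pr X0 p) m). 
      change (pr X0 (pr X0 p, 0, 0, 0)) with (pr X0 p). ring. }
    apply Van_plus.
    + apply Sm_minus; auto. apply Sm_mult; auto. apply Sm_pow, Sm_pr.
    + apply Sm_mult; auto. apply Sm_pow, Sm_pr.
    + assert (SX : Sm d (fun p => pr X0 p ^ m * g1 p)) by (apply Sm_mult; auto; apply Sm_pow, Sm_pr).
      destruct (xpow_lead d m g1 Sg1) as [V1 LD].
      apply Van_lead; [now apply Van_minus|].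
      intros p Hp Zp. rewrite (Dn_minus d) by auto. rewrite LD by auto.
      rewrite Dn_F2, Zp.
      assert (Ea : Dn m (F2 rem) (0, pr X1 p, 0, 0) = INR (fact m) * a (pr X1 p)).
      { unfold a. field. apply INR_fact_neq_0. }
      rewrite Ea. rewrite (Ec (pr X1 p)) by apply Hp.
      unfold g1, u, damp, Fxi. rewrite Zp. unfold kap. simpl pow.
      assert (E1 : / (1 + b2 * (0 * (0 * 1))) = 1) by (rewrite !Rmult_0_l, Rmult_0_r, Rplus_0_r; apply Rinv_1).
      assert (E2 : / (1 + b1 * (0 * (0 * 1))) = 1) by (rewrite !Rmult_0_l, Rmult_0_r, Rplus_0_r; apply Rinv_1).
      rewrite E1, E2. field. lra.
    + apply xpow_lead; auto.
Qed.

Lemma dependent_choice {A : Type} (P : nat -> A -> Prop) (T : nat -> A -> A -> Prop) a0 :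
  P 0%nat a0 -> (forall m a, P m a -> exists a', P (S m) a' /\ T m a a') ->
  exists f : nat -> A, f 0%nat = a0 /\ forall m, P m (f m) /\ T m (f m) (f (S m)).
Proof.
  intros H0 H.
  set (f := nat_rect (fun _ => A) a0
    (fun m a => epsilon (inhabits a0) (fun a' => P (S m) a' /\ T m a a'))).
  assert (K : forall m, P m (f m) -> P (S m) (f (S m)) /\ T m (f m) (f (S m))).
  { intros m Hm. exact (epsilon_spec (inhabits a0) _ (H m (f m) Hm)). }
  assert (PK : forall m, P m (f m)) by (induction m; auto; now apply K).
  exists f. split; auto. intros m. split; auto. now apply K.
Qed.

Lemma Van_series e m : forall (M : nat -> nat -> R) f, (forall n, Van e m (f n)) ->
  (forall n N, Bd true e (M n) N (f n)) -> (forall j, ex_series (fun n => M n j)) ->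
  Van e m (fun p => Series (fun n => f n p)).
Proof.
  induction m as [|m IH]; intros M f V B EM; cbn [Van]; auto. split.
  - intros p Hp Zp. rewrite (Series_ext _ (fun n => 0 * f n p)).
    + rewrite Series_scal_l. ring.
    + intros n. rewrite (proj1 (V n) p) by auto. ring.
  - apply (Van_ext e m (fun p => Series (fun n => D X0 (f n) p))).
    + intros p Hp. symmetry. apply D_val. apply (D_series e M); auto.
    + apply (IH (fun n j => M n (S j))); auto.
      * intros n. apply (V n).
      * intros n N. apply (Bd_D _ _ _ _ _ X0 (B n (S N))).
Qed.

(** Flattening order by order, and summing up the corrections, leaves a remainder
    which is flat along [x = 0]. *)
Lemma smooth_homological s k f : s = 1 \/ s = -1 -> (1 <= k)%nat -> Reg false (F2 f) ->
  exists h z, Reg false (F2 h) /\ Reg false (F1 z) /\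
    near (fun p => F2 f p = z (pr X0 p) + ham s k (F2 h) p).
Proof.
  intros Hs Hk Hf. destruct (Sm_of_Reg _ Hf) as (d & Hd & Sf). clear Hf.
  set (e := d / 2).
  set (T := fun (m : nat) (rem rem' : R -> R -> R) => exists t : (R -> R -> R) * (R -> R) * (nat -> R),
    let h := fst (fst t) in let z := snd (fst t) in let M := snd t in
    Sm d (F2 h) /\ Sm d (F1 z) /\ Van d (S m) (F2 h) /\ Van d m (F1 z) /\
    (forall N, Bd true e M N (F2 h)) /\ (forall N, Bd true e M N (F1 z)) /\
    (forall j, 0 <= M j) /\ (forall j, (j + 2 <= m)%nat -> M j <= (/ 2) ^ m) /\
    forall x xi, rem' x xi = rem x xi - z x - ham s k (F2 h) (x, xi, 0, 0)).
  destruct (dependent_choice (fun m rem => Sm d (F2 rem) /\ Van d m (F2 rem)) T f)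
    as (rem & R0 & HR).
  { split; cbn [Van]; auto. }
  { intros m rem [Sr Vr].
    destruct (flatten_step s k d m rem Hd Sr Vr) as (h & z & M & H1 & H2 & H3 & H4 & H5 & H6 & H7 & H8 & H9).
    exists (fun x xi => rem x xi - z x - ham s k (F2 h) (x, xi, 0, 0)). split; [split|].
    - exact (Sm_minus d _ _ (Sm_minus d _ _ Sr H2) (Sm_ham d s k _ H1)).
    - exact H9.
    - exists (h, z, M). exact (conj H1 (conj H2 (conj H3 (conj H4 (conj H5 (conj H6 (conj H7
        (conj H8 (fun _ _ => eq_refl))))))))). }
  set (t := fun m => proj1_sig (constructive_indefinite_description _ (proj2 (HR m)))).
  assert (Ht := fun m => proj2_sig (constructive_indefinite_description _ (proj2 (HR m)))).
  set (h := fun m => fst (fst (t m))). set (z := fun m => snd (fst (t m))).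
  set (M := fun m => snd (t m)).
  assert (He : 0 < e) by (unfold e; lra). assert (Hed : e <= d) by (unfold e; lra).
  assert (EM : forall j, ex_series (fun n => M n j)).
  { intros j. apply (ex_series_incr_n _ (j + 2)).
    apply (ex_series_le (V := R_CompleteNormedModule) _ (fun n => (/ 2) ^ (j + 2 + n))).
    - intros n. destruct (Ht (j + 2 + n)%nat) as (_ & _ & _ & _ & _ & _ & P & L & _).
      unfold norm; simpl; unfold abs; simpl.
      rewrite Rabs_pos_eq by apply P. apply L. lia.
    - apply (ex_series_incr_n (fun n => (/ 2) ^ n)). apply ex_series_geom.
      rewrite Rabs_pos_eq; lra. }
  assert (EMm : forall m j, ex_series (fun n => M (m + n)%nat j)).
  { intros m j. now apply (ex_series_incr_n (fun n => M n j)). }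
  set (hh := fun m x xi => Series (fun n => h (m + n)%nat x xi)).
  set (zz := fun m x => Series (fun n => z (m + n)%nat x)).
  assert (Bh : forall n N, Bd true e (M n) N (F2 (h n))) by (intros n; apply (Ht n)).
  assert (Bz : forall n N, Bd true e (M n) N (F1 (z n))) by (intros n; apply (Ht n)).
  assert (Shh : forall m, Sm e (F2 (hh m))).
  { intros m n. eapply Bd_forget.
    exact (Bd_series e n (fun q => M (m + q)%nat) (fun q => F2 (h (m + q)%nat))
      (fun q => Bh (m + q)%nat n) (EMm m)). }
  assert (Szz : forall m, Sm e (F1 (zz m))).
  { intros m n. eapply Bd_forget.
    exact (Bd_series e n (fun q => M (m + q)%nat) (fun q => F1 (z (m + q)%nat))
      (fun q => Bz (m + q)%nat n) (EMm m)). }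
  set (r := fun m p => F2 (rem m) p - F1 (zz m) p - ham s k (F2 (hh m)) p).
  assert (Sr : forall m, Sm e (r m)).
  { intros m. apply Sm_minus; [apply Sm_minus|apply Sm_ham]; auto.
    apply (Sm_box d); auto. apply HR. }
  (* peeling off the first terms of the series does not change the remainder *)
  assert (Er : forall m p, box e p -> r m p = r (S m) p).
  { intros m p Hp. destruct (Ht m) as (Sh & Sz & _ & _ & _ & _ & _ & _ & E).
    fold (t m) in Sh, Sz, E. fold (h m) in Sh, E. fold (z m) in Sz, E.
    unfold r. change (F2 (rem (S m)) p) with (rem (S m) (pr X0 p) (pr X1 p)). rewrite E.
    assert (Eh : forall q, box e q -> F2 (hh m) q = F2 (h m) q + F2 (hh (S m)) q).
    { intros q Hq. unfold F2, hh. rewrite Series_incr_1.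
      - rewrite Nat.add_0_r. f_equal. apply Series_ext. intros n. now rewrite Nat.add_succ_r.
      - apply (series_abs_le _ (fun n => M (m + n)%nat 0%nat)); auto.
        intros n. exact (Bd_bound _ _ _ _ _ (Bh (m + n)%nat 0%nat) Hq). }
    assert (Ez : F1 (zz m) p = F1 (z m) p + F1 (zz (S m)) p).
    { unfold F1, zz. rewrite Series_incr_1.
      - rewrite Nat.add_0_r. f_equal. apply Series_ext. intros n. now rewrite Nat.add_succ_r.
      - apply (series_abs_le _ (fun n => M (m + n)%nat 0%nat)); auto.
        intros n. exact (Bd_bound _ _ _ _ _ (Bz (m + n)%nat 0%nat) Hp). }
    assert (DH : forall i, D i (F2 (hh m)) p = D i (F2 (h m)) p + D i (F2 (hh (S m))) p).
    { intros i. rewrite (D_ext e _ _ i p Eh Hp). apply D_plus.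
      - apply (Sm_dif d); auto. now apply (box_le e).
      - now apply (Sm_dif e). }
    unfold ham. rewrite Ez, !DH.
    change (D X0 (F2 (h m)) (pr X0 p, pr X1 p, 0, 0)) with (D X0 (F2 (h m)) p).
    change (D X1 (F2 (h m)) (pr X0 p, pr X1 p, 0, 0)) with (D X1 (F2 (h m)) p).
    change (pr X0 (pr X0 p, pr X1 p, 0, 0)) with (pr X0 p).
    change (pr X1 (pr X0 p, pr X1 p, 0, 0)) with (pr X1 p).
    unfold F1, F2. ring. }
  assert (FL : Flat e (r 0%nat)).
  { intros m. assert (E0 : forall p, box e p -> r m p = r 0%nat p).
    { induction m as [|m IH]; auto. intros p Hp. now rewrite <- Er, IH. }
    apply (Van_ext e m (r m)); auto.
    assert (Vh : Van e (S m) (F2 (hh m))).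
    { apply (Van_series e (S m) (fun q => M (m + q)%nat) (fun q => F2 (h (m + q)%nat))); auto.
      intros q. destruct (Ht (m + q)%nat) as (_ & _ & V & _).
      apply (Van_le e (S (m + q))); [lia|]. now apply (Van_box d). }
    assert (Vz : Van e m (F1 (zz m))).
    { apply (Van_series e m (fun q => M (m + q)%nat) (fun q => F1 (z (m + q)%nat))); auto.
      intros q. destruct (Ht (m + q)%nat) as (_ & _ & _ & V & _).
      apply (Van_le e (m + q)); [lia|]. now apply (Van_box d). }
    destruct (HR m) as [[Srm Vrm] _]. apply (Sm_box d e) in Srm; auto.
    apply Van_minus; auto using Sm_ham; [now apply Sm_minus| |].
    - apply Van_minus; auto. now apply (Van_box d).
    - unfold ham. apply Van_minus.
      + apply Sm_mult; [apply Sm_scal, Sm_pr|now apply Sm_D].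
      + apply Sm_mult; [|now apply Sm_D].
        apply (Sm_mult e (fun _ => s * INR k)); [apply Sm_const|apply Sm_pow, Sm_pr].
      + apply (Van_ext e m (fun p => D X0 (F2 (hh m)) p * (2 * pr X1 p))); [intros; ring|].
        apply Van_mult; auto using Sm_D, Sm_scal, Sm_pr. apply Vh.
      + apply (Van_ext e m (fun p => D X1 (F2 (hh m)) p * (s * INR k * pr X0 p ^ (k - 1))));
          [intros; ring|].
        apply Van_mult; auto using Sm_D.
        * apply (Sm_mult e (fun _ => s * INR k)); [apply Sm_const|apply Sm_pow, Sm_pr].
        * apply Van_D_other; auto; [discriminate|]. now apply Van_down. }
  destruct (solve_flat (fun x xi => f x xi - zz 0%nat x - ham s k (F2 (hh 0%nat)) (x, xi, 0, 0))
    s k e Hs Hk ltac:(lra)) as (h1 & z1 & e1 & He1 & Sh1 & Sz1 & Q).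
  { rewrite <- R0. exact (Sr 0%nat). }
  { rewrite <- R0. exact FL. }
  exists (fun x xi => hh 0%nat x xi + h1 x xi), (fun x => zz 0%nat x + z1 x).
  assert (Hm : 0 < Rmin e e1) by now apply Rmin_glb_lt.
  assert (S1 := Sm_box _ _ _ (Rmin_l e e1) (Shh 0%nat)).
  assert (S2 := Sm_box _ _ _ (Rmin_r e e1) Sh1).
  assert (S3 := Sm_box _ _ _ (Rmin_l e e1) (Szz 0%nat)).
  assert (S4 := Sm_box _ _ _ (Rmin_r e e1) Sz1).
  split; [|split].
  - apply (Reg_of_Sm (Rmin e e1)); auto. exact (Sm_plus _ _ _ S1 S2).
  - apply (Reg_of_Sm (Rmin e e1)); auto. exact (Sm_plus _ _ _ S3 S4).
  - exists (Rmin e e1). split; auto. intros p Hp.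
    assert (Qp := Q p (box_le _ _ _ (Rmin_r e e1) Hp)). unfold F2 at 1 in Qp.
    assert (DH : forall i, D i (F2 (fun x xi => hh 0%nat x xi + h1 x xi)) p =
      D i (F2 (hh 0%nat)) p + D i (F2 h1) p).
    { intros i. exact (D_plus i (F2 (hh 0%nat)) (F2 h1) p (Sm_dif _ _ i p S1 Hp) (Sm_dif _ _ i p S2 Hp)). }
    unfold ham in Qp |- *. rewrite !DH.
    change (D X0 (F2 (hh 0%nat)) (pr X0 p, pr X1 p, 0, 0)) with (D X0 (F2 (hh 0%nat)) p) in Qp.
    change (D X1 (F2 (hh 0%nat)) (pr X0 p, pr X1 p, 0, 0)) with (D X1 (F2 (hh 0%nat)) p) in Qp.
    change (pr X0 (pr X0 p, pr X1 p, 0, 0)) with (pr X0 p) in Qp.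
    change (pr X1 (pr X0 p, pr X1 p, 0, 0)) with (pr X1 p) in Qp.
    unfold F2 at 1. lra.
Qed.

(** * Power series graded by total degree *)

Lemma fact_plus_le n m : INR (fact (n + m)) <= 2 ^ (n + m) * (INR (fact n) * INR (fact m)).
Proof.
  remember (n + m)%nat as t eqn:E. revert n m E.
  induction t as [|t IH]; intros n m E.
  - replace n with 0%nat by lia. replace m with 0%nat by lia. simpl. lra.
  - destruct n as [|n].
    + replace m with (S t) by lia. simpl (fact 0). change (INR 1) with 1.
      generalize (fact_pos (S t)). intros. assert (1 <= 2 ^ S t) by (apply pow_R1_Rle; lra). nra.
    + destruct m as [|m].
      * replace (S n) with (S t) by lia. simpl (fact 0). change (INR 1) with 1.
        generalize (fact_pos (S t)). intros. assert (1 <= 2 ^ S t) by (apply pow_R1_Rle; lra). nra.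
      * assert (I1 := IH n (S m) ltac:(lia)). assert (I2 := IH (S n) m ltac:(lia)).
        rewrite (fact_simpl t), mult_INR. replace (S t) with (S n + S m)%nat at 1 by lia.
        rewrite plus_INR. rewrite (fact_simpl n), (fact_simpl m) in *. rewrite !mult_INR in *.
        assert (P1 : 0 < INR (S n)) by (apply lt_0_INR; lia).
        assert (P2 : 0 < INR (S m)) by (apply lt_0_INR; lia).
        apply Rle_trans with (INR (S n) * (2 ^ t * (INR (fact n) * (INR (S m) * INR (fact m)))) +
          INR (S m) * (2 ^ t * (INR (S n) * INR (fact n) * INR (fact m)))).
        -- rewrite Rmult_plus_distr_r. apply Rplus_le_compat; apply Rmult_le_compat_l; lra.
        -- simpl. right. ring.
Qed.

Lemma pow_le_fact n m : INR n ^ m <= 2 ^ (n + m) * INR (fact m).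
Proof.
  assert (K : INR n ^ m * INR (fact n) <= INR (fact (n + m))).
  { induction m as [|m IH].
    - rewrite Nat.add_0_r. simpl. lra.
    - rewrite Nat.add_succ_r, fact_simpl, mult_INR. simpl pow. rewrite Rmult_assoc.
      apply Rmult_le_compat; auto using pos_INR.
      + apply Rmult_le_pos; [apply pow_le, pos_INR|apply pos_INR].
      + apply le_INR. lia. }
  assert (H := fact_plus_le n m). assert (P := fact_pos n).
  apply (Rmult_le_reg_r (INR (fact n))); auto. lra.
Qed.

(** A family of functions whose derivatives on small boxes grow like those of
    polynomials of degree at most [k (i + j)] and valuation at least [i + j]. *)
Definition graded (k : nat) (E : R) (P : nat -> nat -> pt -> R) : Prop :=
  forall i j d N, 0 < d <= 1 ->
    Bd true d (fun m => E ^ (i + j) * d ^ (i + j) * (INR (k * (i + j)) / d) ^ m) N (P i j).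

Definition hsum (a : nat -> nat -> R) (P : nat -> nat -> pt -> R) (n : nat) (p : pt) : R :=
  sum_n (fun i => a i (n - i)%nat * P i (n - i)%nat p) n.

Lemma Bd_sum b d N n : forall (M : R) (G : nat -> R) f, 0 <= M -> (forall j, 0 <= G j) ->
  (forall i, (i <= n)%nat -> Bd b d (fun j => M * G j) N (f i)) ->
  Bd b d (fun j => INR (S n) * M * G j) N (fun p => sum_n (fun i => f i p) n).
Proof.
  intros M G f HM HG. induction n as [|n IH]; intros H.
  - apply (Bd_ext b d N _ (f 0%nat)); [intros; now rewrite sum_O|].
    eapply Bd_le; [|apply H; lia]. intros j. simpl. lra.
  - apply (Bd_ext b d N _ (fun p => sum_n (fun i => f i p) n + f (S n) p)).
    { intros. now rewrite sum_Sn. }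
    eapply Bd_le; [|apply Bd_plus; [apply IH; intros; apply H; lia|apply H; lia]].
    intros j. cbv beta. rewrite (S_INR (S n)). lra.
Qed.

Section Graded.

Variables (k : nat) (E : R) (a : nat -> nat -> R) (M Ra d : R).
Hypothesis Hk : (1 <= k)%nat.
Hypothesis HE : 1 <= E.
Hypothesis HM : 0 <= M.
Hypothesis HR : 1 <= Ra.
Hypothesis Ha : forall i j, Rabs (a i j) <= M * Ra ^ (i + j).
Hypothesis Hd : d = / (8 * Ra * E).

(** The radius [d] is such that the terms of degree [n] cost [2^(-n)]; a derivative
    costs [n k / d], and [n^m <= 2^(n + m) m!] makes this an analytic majorant. *)
Definition gradedM (n m : nat) : R := M * (/ 2) ^ n * shape 1 (2 * INR k / d) 0 m.

Lemma graded_d : 0 < d <= 1.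
Proof.
  rewrite Hd. assert (1 <= 8 * Ra * E) by nra.
  split; [apply Rinv_0_lt_compat; lra|].
  apply Rle_trans with (/ 1); [apply Rinv_le_contravar; lra|rewrite Rinv_1; lra].
Qed.

Lemma Bd_hsum P n N : graded k E P -> Bd true d (gradedM n) N (hsum a P n).
Proof.
  intros HP. assert (Dd := graded_d).
  set (G := fun m => (INR (k * n) / d) ^ m).
  assert (G0 : forall m, 0 <= G m).
  { intros m. apply pow_le. apply Rdiv_le_0_compat; [apply pos_INR|lra]. }
  apply (Bd_le _ _ (fun m => INR (S n) * (M * Ra ^ n * (E ^ n * d ^ n)) * G m)).
  - intros m. unfold gradedM, shape, G. rewrite Nat.add_0_r, Rmult_1_l.
    assert (Eq : (Ra * E * d) = / 8) by (rewrite Hd; field; lra).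
    replace (INR (S n) * (M * Ra ^ n * (E ^ n * d ^ n)) * (INR (k * n) / d) ^ m)
      with (M * (INR (S n) * (Ra * E * d) ^ n) * (INR n ^ m * (INR k / d) ^ m)).
    2: { rewrite !Rpow_mult_distr. unfold Rdiv. rewrite mult_INR, !Rpow_mult_distr. ring. }
    rewrite Eq. replace (M * (/ 2) ^ n * ((2 * INR k / d) ^ m * INR (fact m)))
      with (M * (2 ^ n * (/ 8) ^ n) * (2 ^ (n + m) * INR (fact m) * (INR k / d) ^ m)).
    2: { rewrite pow_add. unfold Rdiv. rewrite !Rpow_mult_distr.
         replace (/ 2) with (2 * / 8 * 2) by field. rewrite !Rpow_mult_distr. ring. }
    assert (0 < (/ 8) ^ n) by (apply pow_lt; lra).
    assert (0 <= (INR k / d) ^ m) by (apply pow_le; apply Rdiv_le_0_compat; [apply pos_INR|lra]).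
    apply Rmult_le_compat.
    + apply Rmult_le_pos; auto. apply Rmult_le_pos; [apply pos_INR|lra].
    + apply Rmult_le_pos; auto. apply pow_le, pos_INR.
    + apply Rmult_le_compat_l; auto. apply Rmult_le_compat_r; [lra|]. apply INR_le_pow2.
    + apply Rmult_le_compat_r; auto. apply pow_le_fact.
  - apply (Bd_sum true d N n (M * Ra ^ n * (E ^ n * d ^ n)) G
      (fun i p => a i (n - i)%nat * P i (n - i)%nat p)); auto.
    + repeat apply Rmult_le_pos; auto; apply pow_le; lra.
    + intros i Hi. assert (HPi := HP i (n - i)%nat d N Dd).
      eapply Bd_le; [|apply Bd_scal, HPi]. intros m. cbv beta.
      replace (i + (n - i))%nat with n by lia. fold (G m).
      specialize (Ha i (n - i)%nat). replace (i + (n - i))%nat with n in Ha by lia.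
      replace (M * Ra ^ n * (E ^ n * d ^ n) * G m) with (M * Ra ^ n * (E ^ n * d ^ n * G m)) by ring.
      apply Rmult_le_compat_r; auto. repeat apply Rmult_le_pos; auto; apply pow_le; lra.
Qed.

Lemma ex_series_gradedM m : ex_series (fun n => gradedM n m).
Proof.
  unfold gradedM. apply (ex_series_ext (fun n => (M * shape 1 (2 * INR k / d) 0 m) * (/ 2) ^ n)).
  { intros n. match goal with |- ?u = ?v => change (@eq R u v) end. ring. }
  apply (ex_series_scal_l (V := R_NormedModule)). apply ex_series_geom.
  rewrite Rabs_pos_eq; lra.
Qed.

Lemma RB_graded P : graded k E P ->
  RB true d (2 * M) (2 * INR k / d) (fun p => Series (fun n => hsum a P n p)).
Proof.
  intros HP N. eapply Bd_le; [|apply (Bd_series d N gradedM)].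
  - intros m. cbv beta. unfold gradedM.
    rewrite (Series_ext _ (fun n => (M * shape 1 (2 * INR k / d) 0 m) * (/ 2) ^ n))
      by (intros; ring).
    rewrite Series_scal_l, Series_geom by (rewrite Rabs_pos_eq; lra).
    unfold shape. replace (/ (1 - / 2)) with 2 by field. right. ring.
  - intros n. now apply Bd_hsum.
  - apply ex_series_gradedM.
Qed.

Lemma Reg_graded P : graded k E P -> Reg true (fun p => Series (fun n => hsum a P n p)).
Proof.
  intros HP. assert (T := graded_d). exists d, (2 * M), (2 * INR k / d).
  assert (1 <= INR k) by (apply (le_INR 1); auto).
  repeat split; try lra.
  - apply Rle_div_r; lra.
  - now apply RB_graded.
Qed.

Lemma D_graded P i p : graded k E P -> box d p ->
  D i (fun p => Series (fun n => hsum a P n p)) p = Series (fun n => D i (hsum a P n) p) /\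
  ex_series (fun n => D i (hsum a P n) p).
Proof.
  intros HP Hp. split.
  - apply D_val. apply (D_series d gradedM); auto.
    + intros n. now apply Bd_hsum.
    + apply ex_series_gradedM.
  - apply (series_abs_le _ (fun n => gradedM n 1%nat)); [|apply ex_series_gradedM].
    intros n. exact (Bd_bound _ _ _ _ _ (Bd_D _ _ _ _ _ i (Bd_hsum P n 1 HP)) Hp).
Qed.

Lemma ex_series_graded P p : graded k E P -> box d p -> ex_series (fun n => hsum a P n p).
Proof.
  intros HP Hp. apply (series_abs_le _ (fun n => gradedM n 0%nat)); [|apply ex_series_gradedM].
  intros n. exact (Bd_bound _ _ _ _ _ (Bd_hsum P n 0 HP) Hp).
Qed.

End Graded.

Lemma D_hsum a P n i p : (forall u v, dif i (P u v) p) ->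
  D i (hsum a P n) p = hsum a (fun u v => D i (P u v)) n p.
Proof.
  intros H. unfold hsum.
  assert (K : forall m, is_derive (fun x => sum_n (fun u => a u (n - u)%nat * P u (n - u)%nat (up i p x)) m)
    (pr i p) (sum_n (fun u => a u (n - u)%nat * D i (P u (n - u)%nat) p) m)).
  { induction m as [|m IH].
    - rewrite sum_O. apply (is_derive_ext (fun x => a 0%nat (n - 0)%nat * P 0%nat (n - 0)%nat (up i p x))).
      { intros; now rewrite sum_O. }
      apply (is_derive_scal (fun x => P 0%nat (n - 0)%nat (up i p x))), H.
    - rewrite sum_Sn. apply (is_derive_ext (fun x =>
        sum_n (fun u => a u (n - u)%nat * P u (n - u)%nat (up i p x)) m +
        a (S m) (n - S m)%nat * P (S m) (n - S m)%nat (up i p x))).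
      { intros; now rewrite sum_Sn. }
      apply is_derive_add; auto.
      apply (is_derive_scal (fun x => P (S m) (n - S m)%nat (up i p x))), H. }
  apply D_val, K.
Qed.

Definition monom (i j : nat) (x y : R) : R := x ^ i * y ^ j.

Lemma is_derive_pow_id x n : is_derive (fun x => x ^ n) x (INR n * x ^ (n - 1)).
Proof.
  auto_derive; auto. rewrite Nat.sub_1_r. ring.
Qed.

Lemma D_monom i j l p : is_derive (fun x => F2 (monom i j) (up l p x)) (pr l p)
  (match l with X0 => INR i * F2 (monom (i - 1) j) p
    | X1 => INR j * F2 (monom i (j - 1)) p | _ => 0 end).
Proof.
  destruct l; try (apply (is_derive_ext (fun _ => F2 (monom i j) p));
    [reflexivity|apply is_derive_cst]).
  - unfold F2, monom. rewrite <- Rmult_assoc. 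
    apply (is_derive_ext (fun x => pr X1 p ^ j * x ^ i)); [intros; apply Rmult_comm|].
    rewrite Rmult_comm. apply (is_derive_scal (fun x => x ^ i)), is_derive_pow_id.
  - unfold F2, monom. replace (INR j * (pr X0 p ^ i * pr X1 p ^ (j - 1)))
      with (pr X0 p ^ i * (INR j * pr X1 p ^ (j - 1))) by ring.
    apply (is_derive_scal (fun x => x ^ j)), is_derive_pow_id.
Qed.

Lemma Bd_monom d K N : 0 < d <= 1 -> forall i j, INR (i + j) <= K ->
  Bd true d (fun m => d ^ (i + j) * (K / d) ^ m) N (F2 (monom i j)).
Proof.
  intros Hd.
  assert (K0 : forall i j, INR (i + j) <= K -> 0 <= K / d).
  { intros i j H. apply Rdiv_le_0_compat; [|lra]. generalize (pos_INR (i + j)). lra. }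
  assert (CT : forall i j p, continuous (F2 (monom i j)) p).
  { intros i j p. unfold F2, monom.
    apply (continuous_mult (fun p => pr X0 p ^ i) (fun p => pr X1 p ^ j)).
    - apply (continuous_comp (pr X0) (fun x => x ^ i)); [apply (continuous_pr X0)|].
      apply (ex_derive_continuous (fun x => x ^ i)). eexists. apply is_derive_pow_id.
    - apply (continuous_comp (pr X1) (fun x => x ^ j)); [apply (continuous_pr X1)|].
      apply (ex_derive_continuous (fun x => x ^ j)). eexists. apply is_derive_pow_id. }
  assert (B0 : forall i j p, box d p -> Rabs (F2 (monom i j) p) <= d ^ (i + j) * (K / d) ^ 0).
  { intros i j p Hp. rewrite pow_O, Rmult_1_r. unfold F2, monom.
    rewrite Rabs_mult, <- !RPow_abs, pow_add.
    apply Rmult_le_compat; try (apply pow_le, Rabs_pos); apply pow_incr; split;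
      try apply Rabs_pos; left; apply Hp. }
  induction N as [|N IH]; intros i j HK.
  - split; auto.
  - apply (Bd_intro _ _ _ _ _ (fun l p => match l with X0 => INR i * F2 (monom (i - 1) j) p
     | X1 => INR j * F2 (monom i (j - 1)) p | _ => 0 end)); auto.
    + intros l p Hp. apply D_monom.
    + assert (PP : forall m, 0 <= d ^ (i + j) * (K / d) ^ S m).
      { intros m. apply Rmult_le_pos; apply pow_le; [lra|now apply (K0 i j)]. }
      assert (Z : Bd true d (fun m => d ^ (i + j) * (K / d) ^ S m) N (fun _ => 0)).
      { apply Bd_const; [rewrite Rabs_R0|]; auto. }
      assert (ST : forall c u v, INR c <= K -> (u + v + 1 = i + j)%nat ->
        Bd true d (fun m => d ^ (i + j) * (K / d) ^ S m) N (fun p => INR c * F2 (monom u v) p)).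
      { intros c u v Hc Huv. eapply Bd_le; [|apply Bd_scal, IH].
        - intros m. cbv beta. rewrite (Rabs_pos_eq (INR c)) by apply pos_INR.
          rewrite <- Huv, (pow_add d (u + v) 1), pow_1. simpl pow.
          replace (d ^ (u + v) * d * (K / d * (K / d) ^ m)) with (K * (d ^ (u + v) * (K / d) ^ m))
            by (field; lra).
          apply Rmult_le_compat_r; auto. apply Rmult_le_pos; apply pow_le; [lra|now apply (K0 i j)].
        - eapply Rle_trans; [|exact HK]. apply le_INR. lia. }
      intros l. destruct l; auto.
      * destruct i as [|i].
        -- eapply Bd_ext; [|exact Z]. intros. simpl. ring.
        -- apply ST; [|lia]. eapply Rle_trans; [|exact HK]. apply le_INR. lia.
      * destruct j as [|j].
        -- eapply Bd_ext; [|exact Z]. intros. simpl. ring.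
        -- apply ST; [|lia]. eapply Rle_trans; [|exact HK]. apply le_INR. lia.
Qed.

Lemma graded_monom k E : (1 <= k)%nat -> 1 <= E -> graded k E (fun i j => F2 (monom i j)).
Proof.
  intros Hk HE i j d N Hd.
  eapply Bd_le; [|apply (Bd_monom d (INR (k * (i + j)))); auto].
  - intros m. cbv beta.
    assert (1 <= E ^ (i + j)) by now apply pow_R1_Rle.
    assert (0 <= d ^ (i + j)) by (apply pow_le; lra).
    assert (0 <= (INR (k * (i + j)) / d) ^ m).
    { apply pow_le. apply Rdiv_le_0_compat; [apply pos_INR|lra]. }
    assert (0 <= d ^ (i + j) * (INR (k * (i + j)) / d) ^ m) by now apply Rmult_le_pos.
    rewrite Rmult_assoc. nra.
  - apply le_INR. nia.
Qed.

(** ** Taylor expansion of analytic germs *)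

(** [dcoef n f i] collects, in the [n]-th directional derivative of [f] at the
    origin along [(x, y)], the words of derivations in which [D X0] occurs [i]
    times: it is the coefficient of [x^i y^(n - i)]. *)
Fixpoint dcoef (n : nat) (f : pt -> R) (i : nat) : R :=
  match n with
  | O => match i with O => f orig | S _ => 0 end
  | S n => match i with O => 0 | S i => dcoef n (D X0 f) i end + dcoef n (D X1 f) i
  end.

Lemma dcoef_out n : forall f i, (n < i)%nat -> dcoef n f i = 0.
Proof.
  induction n as [|n IH]; intros f i H; destruct i as [|i]; try lia; simpl; auto.
  rewrite !IH by lia. ring.
Qed.

Lemma dcoef_bound d r n : 0 < d -> 0 <= r -> forall c q f i, 0 <= c ->
  (forall N, Bd true d (shape c r q) N f) -> Rabs (dcoef n f i) <= 2 ^ n * shape c r q n.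
Proof.
  intros Hd Hr. induction n as [|n IH]; intros c q f i Hc H.
  - simpl. assert (0 <= shape c r q 0) by now apply shape_pos.
    destruct i as [|i]; [|rewrite Rabs_R0; lra].
    rewrite Rmult_1_l. apply (Bd_bound d _ 0 f); auto. now apply box_orig.
  - assert (K : forall l i, Rabs (dcoef n (D l f) i) <= 2 ^ n * shape c r q (S n)).
    { intros l u. rewrite shape_S. apply IH; [now apply Rmult_le_pos|].
      intros N. now apply Bd_shape_S. }
    simpl dcoef. eapply Rle_trans; [apply Rabs_triang|].
    assert (P : 0 <= 2 ^ n * shape c r q (S n))
      by (apply Rmult_le_pos; [apply pow_le; lra|now apply shape_pos]).
    assert (Rabs (match i with O => 0 | S i => dcoef n (D X0 f) i end) <= 2 ^ n * shape c r q (S n)).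
    { destruct i; [rewrite Rabs_R0; lra|apply K]. }
    generalize (K X1 i). simpl pow. lra.
Qed.

Section Directional.

Variables x y : R.

Definition dird (f : pt -> R) (p : pt) : R := x * D X0 f p + y * D X1 f p.

Fixpoint dirn (n : nat) (f : pt -> R) : pt -> R :=
  match n with O => f | S n => dirn n (dird f) end.

Lemma dirn_S n : forall f, dirn (S n) f = dird (dirn n f).
Proof. induction n as [|n IH]; intros f; [reflexivity|]. exact (IH (dird f)). Qed.

Lemma Sm_dird d f : Sm d f -> Sm d (dird f).
Proof. intros H. apply Sm_plus; apply Sm_scal, Sm_D, H. Qed.

Lemma Sm_dirn d n : forall f, Sm d f -> Sm d (dirn n f).
Proof. induction n; simpl; auto using Sm_dird. Qed.

Lemma dirn_linear d n u v : forall f g h, Sm d f -> Sm d g ->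
  (forall p, box d p -> h p = u * f p + v * g p) ->
  forall p, box d p -> dirn n h p = u * dirn n f p + v * dirn n g p.
Proof.
  induction n as [|n IH]; intros f g h Hf Hg Hh p Hp; simpl; auto.
  apply IH; auto using Sm_dird. intros q Hq. unfold dird.
  assert (K : forall i, D i h q = u * D i f q + v * D i g q).
  { intros i. rewrite (D_ext d h (fun p => u * f p + v * g p)) by auto.
    rewrite (D_plus i (fun p => u * f p) (fun p => v * g p)).
    - now rewrite !D_scal.
    - now apply (Sm_dif d), Hq; apply Sm_scal.
    - now apply (Sm_dif d), Hq; apply Sm_scal. }
  rewrite !K. ring.
Qed.

Lemma dirn_coef d n : 0 < d -> forall f, Sm d f ->
  dirn n f orig = sum_n (fun i => dcoef n f i * x ^ i * y ^ (n - i)) n.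
Proof.
  intros Hd. induction n as [|n IH]; intros f Hf.
  - rewrite sum_O. simpl. ring.
  - cbn [dirn]. rewrite (dirn_linear d n x y (D X0 f) (D X1 f)); auto using Sm_D, box_orig.
    rewrite !IH by auto using Sm_D.
    rewrite !sum_n_Reals.
    assert (E0 : x * sum_f_R0 (fun i => dcoef n (D X0 f) i * x ^ i * y ^ (n - i)) n =
      sum_f_R0 (fun i => match i with O => 0 | S i => dcoef n (D X0 f) i end * x ^ i * y ^ (S n - i)) (S n)).
    { rewrite (decomp_sum _ (S n)) by lia. simpl pred. rewrite !Rmult_0_l, Rplus_0_l.
      rewrite scal_sum. apply sum_eq. intros i Hi. rewrite Nat.sub_succ. simpl pow. ring. }
    assert (E1 : y * sum_f_R0 (fun i => dcoef n (D X1 f) i * x ^ i * y ^ (n - i)) n =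
      sum_f_R0 (fun i => dcoef n (D X1 f) i * x ^ i * y ^ (S n - i)) (S n)).
    { rewrite tech5. rewrite (dcoef_out n _ (S n)) by lia. rewrite !Rmult_0_l, Rplus_0_r.
      rewrite scal_sum. apply sum_eq. intros i Hi. rewrite Nat.sub_succ_l by lia. simpl pow. ring. }
    rewrite E0, E1, <- sum_plus. apply sum_eq. intros i _. cbn [dcoef]. ring.
Qed.

Lemma Bd_dird d r c q f : 0 <= r -> 0 <= c -> (forall N, Bd true d (shape c r q) N f) ->
  forall N, Bd true d (shape ((Rabs x + Rabs y) * (c * r)) r (S q)) N (dird f).
Proof.
  intros Hr Hc H N. eapply Bd_le; [|apply Bd_plus; apply Bd_scal, Bd_shape_S, H].
  intros j. cbv beta. unfold shape. right. ring.
Qed.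

Lemma dirn_bound d r n p : 0 <= r -> box d p -> forall c q f, 0 <= c ->
  (forall N, Bd true d (shape c r q) N f) ->
  Rabs (dirn n f p) <= (Rabs x + Rabs y) ^ n * shape c r q n.
Proof.
  intros Hr Hp. induction n as [|n IH]; intros c q f Hc H.
  - simpl. rewrite Rmult_1_l. apply (Bd_bound d _ 0 f); auto.
  - assert (0 <= Rabs x + Rabs y) by (generalize (Rabs_pos x) (Rabs_pos y); lra).
    cbn [dirn]. eapply Rle_trans; [apply (IH ((Rabs x + Rabs y) * (c * r)) (S q))|].
    + apply Rmult_le_pos; auto. now apply Rmult_le_pos.
    + now apply Bd_dird.
    + rewrite shape_S. unfold shape. simpl pow. right. ring.
Qed.

Lemma dirn_derive d f : Sm d f -> Rabs x < d / 2 -> Rabs y < d / 2 ->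
  forall n t, Rabs t < 2 ->
  Derive_n (fun t => f (t * x, t * y, 0, 0)) n t = dirn n f (t * x, t * y, 0, 0) /\
  ex_derive_n (fun t => f (t * x, t * y, 0, 0)) n t.
Proof.
  intros Hf Hx Hy.
  assert (Hd : 0 < d) by (generalize (Rabs_pos x); lra).
  assert (Bt : forall t, Rabs t < 2 -> box d (t * x, t * y, 0, 0)).
  { intros t Ht. apply box_tuple; try (rewrite Rabs_R0; lra); rewrite Rabs_mult;
    generalize (Rabs_pos t) (Rabs_pos x) (Rabs_pos y); nra. }
  assert (DD : forall n t, Rabs t < 2 ->
    is_derive (fun t => dirn n f (t * x, t * y, 0, 0)) t (dirn (S n) f (t * x, t * y, 0, 0))).
  { intros n t Ht. rewrite dirn_S. unfold dird.
    assert (A := chain_rule d (dirn n f) (fun t => t * x) (fun t => t * y) (fun _ => 0) (fun _ => 0)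
      t x y 0 0 (Sm_C1 _ _ (Sm_dirn d n f Hf)) (Bt t Ht)).
    cbv zeta beta in A.
    replace (x * D X0 (dirn n f) (t * x, t * y, 0, 0) + y * D X1 (dirn n f) (t * x, t * y, 0, 0))
     with (D X0 (dirn n f) (t * x, t * y, 0, 0) * x + (D X1 (dirn n f) (t * x, t * y, 0, 0) * y +
       (D X2 (dirn n f) (t * x, t * y, 0, 0) * 0 + D X3 (dirn n f) (t * x, t * y, 0, 0) * 0))) by ring.
    apply A; try apply is_derive_cst; auto_derive; auto; ring. }
  assert (Lt : forall t, Rabs t < 2 -> locally t (fun t => Rabs t < 2)).
  { intros t Ht. apply (continuous_Rabs t (fun u => u < 2)). now apply open_lt. }
  assert (E : forall n t, Rabs t < 2 ->
    Derive_n (fun t => f (t * x, t * y, 0, 0)) n t = dirn n f (t * x, t * y, 0, 0)).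
  { induction n as [|n IH]; intros t Ht; [reflexivity|]. simpl Derive_n.
    rewrite (Derive_ext_loc _ (fun t => dirn n f (t * x, t * y, 0, 0))).
    - now apply is_derive_unique, DD.
    - generalize (Lt t Ht). apply filter_imp. intros u Hu. now apply IH. }
  intros n t Ht. split; auto. destruct n as [|n]; [exact I|]. simpl.
  apply (ex_derive_ext_loc (fun t => dirn n f (t * x, t * y, 0, 0))).
  - generalize (Lt t Ht). apply filter_imp. intros u Hu. now rewrite E.
  - eexists. now apply DD.
Qed.

End Directional.

(** Taylor's formula along the segment from the origin to [(x, y)]; the majorants of
    [f] make the remainder of order [N] at most [c / 2^N]. *)
Lemma taylor_series f : Reg true f -> exists a M Ra d, 0 < d /\ 0 <= M /\ 1 <= Ra /\
  (forall i j, Rabs (a i j) <= M * Ra ^ (i + j)) /\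
  forall x y, Rabs x < d -> Rabs y < d ->
    is_series (fun n => sum_n (fun i => a i (n - i)%nat * x ^ i * y ^ (n - i)) n) (f (x, y, 0, 0)).
Proof.
  intros (d & c & r & Hd & Hc & Hr & H).
  assert (Hdm : 0 < Rmin (d / 2) (/ (4 * r))).
  { apply Rmin_glb_lt; [lra|]. apply Rinv_0_lt_compat. lra. }
  exists (fun i j => dcoef (i + j) f i / INR (fact (i + j))), c, (2 * r), (Rmin (d / 2) (/ (4 * r))).
  split; auto. split; auto. split; [lra|]. split.
  - intros i j. unfold Rdiv. rewrite Rabs_mult, Rabs_inv, (Rabs_pos_eq (INR _)) by apply pos_INR.
    apply Rle_div_l; [apply fact_pos|].
    eapply Rle_trans; [apply (dcoef_bound d r (i + j)) with (c := c) (q := 0%nat); auto; lra|].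
    unfold shape. rewrite Nat.add_0_r, Rpow_mult_distr. right. ring.
  - intros x y Hx Hy. assert (Sf := Sm_of_RB _ _ _ _ _ H).
    generalize (Rmin_l (d / 2) (/ (4 * r))) (Rmin_r (d / 2) (/ (4 * r))). intros L1 L2.
    assert (DR := dirn_derive x y d f Sf ltac:(lra) ltac:(lra)).
    set (w := (Rabs x + Rabs y) * r).
    assert (Hw : 0 <= w <= / 2).
    { unfold w. split.
      - apply Rmult_le_pos; [generalize (Rabs_pos x) (Rabs_pos y)|]; lra.
      - apply Rle_trans with (2 * / (4 * r) * r); [apply Rmult_le_compat_r; lra|].
        right. field. lra. }
    assert (LIM : is_lim_seq (fun N => c * (/ 2) ^ S N) 0).
    { replace (Finite 0) with (Rbar_mult c 0) by (simpl; f_equal; ring).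
      apply is_lim_seq_scal_l. apply (is_lim_seq_incr_1 (fun n => (/ 2) ^ n)).
      apply is_lim_seq_geom. rewrite Rabs_pos_eq; lra. }
    unfold is_series. apply filterlim_locally. intros eps.
    destruct (proj1 (filterlim_locally _ _) LIM eps) as [N0 HN0].
    exists N0. intros N HN. specialize (HN0 N HN).
    change (Rabs (c * (/ 2) ^ S N - 0) < eps) in HN0. rewrite Rminus_0_r in HN0.
    match goal with |- ball _ _ ?u => change (Rabs (u - f (x, y, 0, 0)) < eps) end.
    destruct (Taylor_Lagrange (fun t => f (t * x, t * y, 0, 0)) N 0 1) as [z [Hz E]]; [lra| |].
    { intros t Ht m _. apply DR. apply Rabs_def1; lra. }
    rewrite !Rmult_1_l in E. rewrite E.
    rewrite (sum_n_ext _ (fun n => (1 - 0) ^ n / INR (fact n) *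
      Derive_n (fun t => f (t * x, t * y, 0, 0)) n 0)).
    2: { intros n. rewrite Rminus_0_r, pow1.
      rewrite (proj1 (DR n 0 ltac:(rewrite Rabs_R0; lra))). rewrite !Rmult_0_l.
      change (0, 0, 0, 0) with orig. rewrite (dirn_coef x y d n ltac:(lra) f Sf).
      rewrite !sum_n_Reals. unfold Rdiv. rewrite Rmult_1_l, scal_sum.
      apply sum_eq. intros i Hi. replace (i + (n - i))%nat with n by lia. ring. }
    rewrite <- sum_n_Reals. 
    match goal with |- Rabs (?A - (?A' + ?B)) < _ =>
      replace (A - (A' + B)) with (- B) by (change A' with A; ring) end.
    rewrite Rabs_Ropp. eapply Rle_lt_trans; [|eapply Rle_lt_trans; [apply Rle_abs|exact HN0]].
    rewrite Rminus_0_r, pow1. unfold Rdiv. rewrite Rmult_1_l.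
    rewrite (proj1 (DR (S N) z ltac:(apply Rabs_def1; lra))).
    rewrite Rabs_mult, Rabs_inv, (Rabs_pos_eq (INR _)) by apply pos_INR.
    rewrite Rmult_comm. apply Rle_div_l; [apply fact_pos|].
    eapply Rle_trans; [apply (dirn_bound x y d r (S N)) with (c := c) (q := 0%nat); auto; try lra|].
    + apply box_tuple; try (rewrite Rabs_R0; lra); rewrite Rabs_mult, (Rabs_pos_eq z) by lra;
      generalize (Rabs_pos x) (Rabs_pos y); nra.
    + unfold shape. rewrite Nat.add_0_r.
      replace ((Rabs x + Rabs y) ^ S N * (c * r ^ S N * INR (fact (S N))))
        with (c * w ^ S N * INR (fact (S N))) by (unfold w; rewrite Rpow_mult_distr; ring).
      apply Rmult_le_compat_r; [left; apply fact_pos|]. apply Rmult_le_compat_l; auto.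
      apply pow_incr. exact Hw.
Qed.

(** ** The analytic homological equation *)

Definition hstep (s : R) (k i j : nat) : R := s * INR k * INR (S j) / (2 * INR (S i)).

(** Solution of the homological equation for the monomial [x^i xi^j]: the
    derivative of [x^(i+1) xi^(j-1) / (2 (i+1))] along the Hamiltonian field equals
    [x^i xi^j] up to a multiple of [x^(i+k) xi^(j-2)]. *)
Fixpoint hmon (s : R) (k i j : nat) : R -> R -> R :=
  match j with
  | O => fun _ _ => 0
  | S O => fun x y => / (2 * INR (S i)) * monom (S i) 0 x y
  | S (S j) => fun x y => / (2 * INR (S i)) * monom (S i) (S j) x y +
      hstep s k i j * hmon s k (i + k) j x y
  end.

Fixpoint zmon (s : R) (k i j : nat) : R -> R :=
  match j with
  | O => fun x => x ^ i
  | S O => fun _ => 0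
  | S (S j) => fun x => hstep s k i j * zmon s k (i + k) j x
  end.

Lemma two_step (P : nat -> Prop) : P 0%nat -> P 1%nat -> (forall j, P j -> P (S (S j))) ->
  forall j, P j.
Proof.
  intros H0 H1 H2 j. assert (P j /\ P (S j)); [|tauto].
  induction j as [|j [A B]]; auto.
Qed.

Lemma dif_monom i j l p : dif l (F2 (monom i j)) p.
Proof. unfold dif. rewrite (D_val _ _ _ _ (D_monom i j l p)). apply D_monom. Qed.

Lemma dif_scal c f l p : dif l f p -> dif l (fun q => c * f q) p.
Proof. intros H. unfold dif. rewrite D_scal. apply (is_derive_scal (fun x => f (up l p x))), H. Qed.

Lemma dif_plus f g l p : dif l f p -> dif l g p -> dif l (fun q => f q + g q) p.
Proof. intros H H'. unfold dif. rewrite D_plus; auto. now apply is_derive_add. Qed.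

Lemma dif_hmon s k j : forall i l p, dif l (F2 (hmon s k i j)) p.
Proof.
  induction j as [| |j IH] using two_step; intros i l p.
  - change (dif l (fun _ => 0) p). unfold dif. rewrite D_const. apply is_derive_cst.
  - apply (dif_scal _ (F2 (monom (S i) 0))), dif_monom.
  - apply (dif_plus (fun q => / (2 * INR (S i)) * F2 (monom (S i) (S j)) q)
      (fun q => hstep s k i j * F2 (hmon s k (i + k) j) q)); apply dif_scal;
      [apply dif_monom|apply IH].
Qed.

Lemma hmon_spec s k j : (1 <= k)%nat -> forall i p,
  F2 (monom i j) p = zmon s k i j (pr X0 p) + ham s k (F2 (hmon s k i j)) p.
Proof.
  intros Hk. assert (NZ : forall i, INR (S i) <> 0) by (intros; apply not_0_INR; lia).
  induction j as [| |j IH] using two_step; intros i p.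
  - unfold ham. change (F2 (hmon s k i 0)) with (fun _ : pt => 0).
    rewrite !D_const. unfold F2, monom. simpl. ring.
  - unfold ham.
    assert (DE : forall l, D l (F2 (hmon s k i 1)) p = / (2 * INR (S i)) * D l (F2 (monom (S i) 0)) p)
      by (intros l; apply (D_scal l _ (F2 (monom (S i) 0)))).
    rewrite !DE, (D_val _ _ _ _ (D_monom (S i) 0 X0 p)), (D_val _ _ _ _ (D_monom (S i) 0 X1 p)).
    rewrite Nat.sub_succ, Nat.sub_0_r. change (INR 0) with 0. simpl zmon.
    unfold F2, monom. rewrite pow_1, pow_O. field. apply NZ.
  - assert (DE : forall l, D l (F2 (hmon s k i (S (S j)))) p =
      / (2 * INR (S i)) * D l (F2 (monom (S i) (S j))) p +
      hstep s k i j * D l (F2 (hmon s k (i + k) j)) p).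
    { intros l. rewrite <- !D_scal.
      apply (D_plus l (fun q => / (2 * INR (S i)) * F2 (monom (S i) (S j)) q)
        (fun q => hstep s k i j * F2 (hmon s k (i + k) j) q)); apply dif_scal;
      [apply dif_monom|apply dif_hmon]. }
    unfold ham. rewrite !DE.
    rewrite (D_val _ _ _ _ (D_monom (S i) (S j) X0 p)), (D_val _ _ _ _ (D_monom (S i) (S j) X1 p)).
    rewrite !Nat.sub_succ, !Nat.sub_0_r. cbn [zmon].
    assert (Q := IH (i + k)%nat p). unfold ham in Q.
    transitivity (F2 (monom i (S (S j))) p - hstep s k i j * F2 (monom (i + k) j) p +
      hstep s k i j * (zmon s k (i + k) j (pr X0 p) + (2 * pr X1 p * D X0 (F2 (hmon s k (i + k) j)) p -
       s * INR k * pr X0 p ^ (k - 1) * D X1 (F2 (hmon s k (i + k) j)) p))).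
    { rewrite <- Q. ring. }
    unfold F2, monom. rewrite pow_add. rewrite <- !(tech_pow_Rmult (pr X1 p)).
    replace (pr X0 p ^ k) with (pr X0 p * pr X0 p ^ (k - 1)).
    2: { rewrite tech_pow_Rmult. f_equal. lia. }
    rewrite <- (tech_pow_Rmult (pr X0 p) i). unfold hstep. field. apply NZ.
Qed.

(** A bound of the sum of the absolute values of the coefficients of [hmon] and
    [zmon].  Each step of the recursion multiplies by about [k J / (q + 1)] and moves
    one unit from [J] to [q]; the weight [q! J!] absorbs this factor, and division by
    [(q + J)! / 2^(q + J)], which does not change, makes the bound geometric. *)
Definition hbound (k q J : nat) : R :=
  INR (S J) * INR k ^ J * (2 ^ (q + J) * (INR (fact q) * INR (fact J)) / INR (fact (q + J))).

Lemma binom_weight_ge q J : 1 <= 2 ^ (q + J) * (INR (fact q) * INR (fact J)) / INR (fact (q + J)).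
Proof. apply Rle_div_r; [apply fact_pos|]. rewrite Rmult_1_l. apply fact_plus_le. Qed.

Lemma binom_weight_le q J :
  2 ^ (q + J) * (INR (fact q) * INR (fact J)) / INR (fact (q + J)) <= 2 ^ (q + J).
Proof.
  apply Rle_div_l; [apply fact_pos|]. apply Rmult_le_compat_l; [apply pow_le; lra|].
  rewrite <- mult_INR. apply le_INR.
  induction J as [|J IH]; [rewrite Nat.add_0_r; simpl; lia|].
  rewrite Nat.add_succ_r. change (fact (S J)) with (S J * fact J)%nat.
  change (fact (S (q + J))) with (S (q + J) * fact (q + J))%nat. nia.
Qed.

Lemma hbound_ge_1 k q J : (1 <= k)%nat -> 1 <= hbound k q J.
Proof.
  intros Hk. unfold hbound. assert (B := binom_weight_ge q J).
  assert (1 <= INR (S J)) by (apply (le_INR 1); lia).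
  assert (1 <= INR k ^ J) by (apply pow_R1_Rle, (le_INR 1); auto).
  assert (1 <= INR (S J) * INR k ^ J) by nra. nra.
Qed.

Lemma hbound_step k q J : (1 <= k)%nat ->
  1 + INR k * INR (S J) / INR (S q) * hbound k (S q) J <= hbound k q (S J).
Proof.
  intros Hk. assert (NZ : forall i, INR (S i) <> 0) by (intros; apply not_0_INR; lia).
  assert (B := binom_weight_ge q (S J)).
  assert (E : INR k * INR (S J) / INR (S q) * hbound k (S q) J = INR (S J) * INR k ^ S J *
    (2 ^ (q + S J) * (INR (fact q) * INR (fact (S J))) / INR (fact (q + S J)))).
  { unfold hbound. replace (S q + J)%nat with (q + S J)%nat by lia.
    rewrite (fact_simpl q), (fact_simpl J), !mult_INR. simpl pow. field.
    repeat split; auto; apply INR_fact_neq_0. }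
  rewrite E. unfold hbound. rewrite (S_INR (S J)).
  assert (1 <= INR k ^ S J) by (apply pow_R1_Rle, (le_INR 1); auto).
  set (u := 2 ^ (q + S J) * (INR (fact q) * INR (fact (S J))) / INR (fact (q + S J))) in *. nra.
Qed.

Lemma hstep_bound s k i j q : s = 1 \/ s = -1 -> (q <= i)%nat ->
  Rabs (hstep s k i j) <= INR k * INR (S (Nat.div2 j)) / INR (S q).
Proof.
  intros Hs Hq. assert (Hi : 0 < INR (S i)) by (apply lt_0_INR; lia).
  assert (Hq0 : 0 < INR (S q)) by (apply lt_0_INR; lia).
  unfold hstep, Rdiv. rewrite !Rabs_mult, Rabs_inv, Rabs_mult, (Rabs_pos_eq 2) by lra.
  replace (Rabs s) with 1 by (destruct Hs as [-> | ->]; [rewrite Rabs_R1|rewrite Rabs_left]; lra).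
  rewrite !(Rabs_pos_eq (INR _)) by apply pos_INR.
  assert (L : INR (S j) <= 2 * INR (S (Nat.div2 j))).
  { rewrite <- (mult_INR 2). apply le_INR. generalize (Nat.div2_odd j). destruct (Nat.odd j); simpl; lia. }
  assert (Li : / INR (S i) <= / INR (S q)).
  { apply Rinv_le_contravar; auto. apply le_INR. lia. }
  assert (0 < / INR (S i)) by now apply Rinv_0_lt_compat.
  rewrite Rinv_mult, Rmult_1_l.
  replace (INR k * INR (S j) * (/ 2 * / INR (S i))) with (INR k * ((INR (S j) * / 2) * / INR (S i))) by ring.
  rewrite (Rmult_assoc (INR k) (INR (S (Nat.div2 j)))).
  apply Rmult_le_compat_l; [apply pos_INR|].
  apply Rmult_le_compat; auto; try lra. 
  apply Rmult_le_pos; [apply pos_INR|lra].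
Qed.

Lemma Bd_hmon_zmon s k d K n N : s = 1 \/ s = -1 -> (2 <= k)%nat -> 0 < d <= 1 -> 0 <= K ->
  forall j i q, (q <= i)%nat -> (n <= i + j)%nat -> INR (i + k * j) <= K ->
  Bd true d (fun m => hbound k q (Nat.div2 j) * (d ^ n * (K / d) ^ m)) N (F2 (hmon s k i j)) /\
  Bd true d (fun m => hbound k q (Nat.div2 j) * (d ^ n * (K / d) ^ m)) N (F1 (zmon s k i j)).
Proof.
  intros Hs Hk Hd HK.
  set (G := fun m => d ^ n * (K / d) ^ m).
  assert (GP : forall m, 0 <= G m).
  { intros m. apply Rmult_le_pos; apply pow_le; [lra|apply Rdiv_le_0_compat; lra]. }
  assert (MN : forall u v, (n <= u + v)%nat -> INR (u + v) <= K -> Bd true d G N (F2 (monom u v))).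
  { intros u v Hn HuK. eapply Bd_le; [|apply (Bd_monom d K); auto].
    intros m. unfold G. cbv beta. apply Rmult_le_compat_r; [apply pow_le, Rdiv_le_0_compat; lra|].
    replace (u + v)%nat with (n + (u + v - n))%nat by lia. rewrite pow_add.
    assert (0 <= d ^ n) by (apply pow_le; lra).
    assert (d ^ (u + v - n) <= 1) by (rewrite <- (pow1 (u + v - n)); apply pow_incr; lra). nra. }
  assert (Z : forall c, 0 <= c -> Bd true d (fun m => c * G m) N (fun _ => 0)).
  { intros c Hc. apply Bd_const; [rewrite Rabs_R0|intros]; apply Rmult_le_pos; auto. }
  assert (IV : forall i, Rabs (/ (2 * INR (S i))) <= 1).
  { intros i. assert (1 <= INR (S i)) by (apply (le_INR 1); lia).
    rewrite Rabs_pos_eq by (left; apply Rinv_0_lt_compat; lra).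
    apply Rle_trans with (/ 1); [apply Rinv_le_contravar; lra|rewrite Rinv_1; lra]. }
  induction j as [| |j IH] using two_step; intros i q Hq Hn HiK.
  - change (Nat.div2 0) with 0%nat. assert (H1 := hbound_ge_1 k q 0 ltac:(lia)). split.
    + apply Z. lra.
    + eapply Bd_le; [|apply (Bd_ext true d N G (F2 (monom i 0)))].
      * intros m. fold (G m). specialize (GP m). nra.
      * intros p _. unfold F1, F2, monom. simpl. ring.
      * apply MN; auto. eapply Rle_trans; [|exact HiK]. apply le_INR. lia.
  - change (Nat.div2 1) with 0%nat. assert (H1 := hbound_ge_1 k q 0 ltac:(lia)).
    split; [|apply Z; lra].
    eapply Bd_le; [|apply Bd_scal, (MN (S i) 0%nat)].
    + intros m. cbv beta. fold (G m).
      apply Rmult_le_compat_r; auto. specialize (IV i). lra.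
    + lia.
    + eapply Rle_trans; [|exact HiK]. apply le_INR. lia.
  - assert (HiK' : INR (i + k + k * j) <= K) by (eapply Rle_trans; [|exact HiK]; apply le_INR; lia).
    destruct (IH (i + k)%nat (S q) ltac:(lia) ltac:(lia) HiK') as [Ih Iz].
    assert (HS := hstep_bound s k i j q Hs Hq).
    assert (ST := hbound_step k q (Nat.div2 j) ltac:(lia)).
    assert (HP := hbound_ge_1 k (S q) (Nat.div2 j) ltac:(lia)).
    change (Nat.div2 (S (S j))) with (S (Nat.div2 j)).
    set (B := hbound k (S q) (Nat.div2 j)) in *. set (B' := hbound k q (S (Nat.div2 j))) in *.
    assert (LE : Rabs (hstep s k i j) * B <= INR k * INR (S (Nat.div2 j)) / INR (S q) * B)
      by (apply Rmult_le_compat_r; auto; lra).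
    split.
    + eapply Bd_le; [|apply Bd_plus; [apply Bd_scal, (MN (S i) (S j))|apply Bd_scal, Ih]].
      * intros m. cbv beta. fold (G m).
        assert (Rabs (/ (2 * INR (S i))) * G m <= 1 * G m) by (apply Rmult_le_compat_r; auto).
        assert (Rabs (hstep s k i j) * B * G m <= (B' - 1) * G m) by (apply Rmult_le_compat_r; auto; lra).
        lra.
      * lia.
      * eapply Rle_trans; [|exact HiK]. apply le_INR. nia.
    + eapply Bd_le; [|apply Bd_scal, Iz].
      intros m. cbv beta. fold (G m).
      assert (Rabs (hstep s k i j) * B * G m <= B' * G m) by (apply Rmult_le_compat_r; auto; lra).
      lra.
Qed.

Lemma hbound_le k i j : (1 <= k)%nat -> hbound k i (Nat.div2 j) <= (4 * INR k) ^ (i + j).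
Proof.
  intros Hk. set (J := Nat.div2 j).
  assert (HJ : (J <= j)%nat) by (unfold J; apply Nat.div2_decr; lia).
  assert (K1 : 1 <= INR k) by (apply (le_INR 1); auto).
  unfold hbound. assert (F := binom_weight_le i J). assert (B := binom_weight_ge i J).
  apply Rle_trans with (2 ^ (i + j) * INR k ^ (i + j) * 2 ^ (i + j)).
  - apply Rmult_le_compat; try lra.
    + apply Rmult_le_pos; [apply pos_INR|apply pow_le, pos_INR].
    + apply Rmult_le_compat; try apply pos_INR; try (apply pow_le, pos_INR).
      * eapply Rle_trans; [apply INR_le_pow2|]. apply Rle_pow; [lra|lia].
      * apply Rle_pow; [lra|lia].
    + eapply Rle_trans; [exact F|]. apply Rle_pow; [lra|lia].
  - rewrite <- !Rpow_mult_distr. right. f_equal. ring.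
Qed.

Lemma graded_hmon_zmon s k : s = 1 \/ s = -1 -> (2 <= k)%nat ->
  graded k (4 * INR k) (fun i j => F2 (hmon s k i j)) /\
  graded k (4 * INR k) (fun i j => F1 (zmon s k i j)).
Proof.
  intros Hs Hk.
  assert (Q : forall i j d N, 0 < d <= 1 ->
    Bd true d (fun m => (4 * INR k) ^ (i + j) * d ^ (i + j) * (INR (k * (i + j)) / d) ^ m) N
      (F2 (hmon s k i j)) /\
    Bd true d (fun m => (4 * INR k) ^ (i + j) * d ^ (i + j) * (INR (k * (i + j)) / d) ^ m) N
      (F1 (zmon s k i j))).
  { intros i j d N Hd.
    assert (L : forall m, hbound k i (Nat.div2 j) * (d ^ (i + j) * (INR (k * (i + j)) / d) ^ m) <=
      (4 * INR k) ^ (i + j) * d ^ (i + j) * (INR (k * (i + j)) / d) ^ m).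
    { intros m. rewrite Rmult_assoc. apply Rmult_le_compat_r; [|apply hbound_le; lia].
      apply Rmult_le_pos; apply pow_le; [lra|apply Rdiv_le_0_compat; [apply pos_INR|lra]]. }
    destruct (Bd_hmon_zmon s k d (INR (k * (i + j))) (i + j) N Hs Hk Hd (pos_INR _) j i i)
      as [A1 A2]; auto.
    { apply le_INR. nia. }
    split; eapply Bd_le; try apply L; auto. }
  split; intros i j d N Hd; now apply Q.
Qed.

Lemma analytic_homological s k f : s = 1 \/ s = -1 -> (2 <= k)%nat -> Reg true (F2 f) ->
  exists h z, Reg true (F2 h) /\ Reg true (F1 z) /\
    near (fun p => F2 f p = z (pr X0 p) + ham s k (F2 h) p).
Proof.
  intros Hs Hk Hf.
  destruct (taylor_series _ Hf) as (a & M & Ra & d0 & Hd0 & HM & HR & Ha & HT).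
  destruct (graded_hmon_zmon s k Hs Hk) as [Gh Gz].
  assert (K1 : 1 <= INR k) by (apply (le_INR 1); lia).
  set (E := 4 * INR k) in *. assert (HE : 1 <= E) by (unfold E; lra).
  set (d := / (8 * Ra * E)).
  assert (Hk1 : (1 <= k)%nat) by lia.
  assert (Hd : 0 < d <= 1) by now apply (graded_d E Ra d HE HR eq_refl).
  assert (Gm : graded k E (fun i j => F2 (monom i j))) by now apply graded_monom.
  set (h := fun x y => Series (fun n => hsum a (fun i j => F2 (hmon s k i j)) n (x, y, 0, 0))).
  set (z := fun x => Series (fun n => hsum a (fun i j => F1 (zmon s k i j)) n (x, 0, 0, 0))).
  exists h, z. split; [|split].
  - exact (Reg_graded k E a M Ra d Hk1 HE HM HR Ha eq_refl _ Gh).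
  - exact (Reg_graded k E a M Ra d Hk1 HE HM HR Ha eq_refl _ Gz).
  - assert (Hm : 0 < Rmin d d0) by (apply Rmin_glb_lt; lra).
    exists (Rmin d d0). split; auto. intros p Hp.
    assert (Hp1 := box_le _ _ _ (Rmin_l d d0) Hp). assert (Hp2 := box_le _ _ _ (Rmin_r d d0) Hp).
    assert (Ef : F2 f p = Series (fun n => hsum a (fun i j => F2 (monom i j)) n p)).
    { symmetry. apply is_series_unique.
      assert (T := HT (pr X0 p) (pr X1 p) (Hp2 X0) (Hp2 X1)).
      revert T. apply is_series_ext. intros n. unfold hsum. apply sum_n_ext. intros i.
      unfold F2, monom. match goal with |- ?u = ?v => change (@eq R u v) end. ring. }
    destruct (D_graded k E a M Ra d Hk1 HE HM HR Ha eq_refl _ X0 p Gh Hp1) as [D0 S0].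
    destruct (D_graded k E a M Ra d Hk1 HE HM HR Ha eq_refl _ X1 p Gh Hp1) as [D1 S1].
    assert (Sz := ex_series_graded k E a M Ra d Hk1 HE HM HR Ha eq_refl _ p Gz Hp1).
    unfold ham.
    change (F2 h) with (fun p => Series (fun n => hsum a (fun i j => F2 (hmon s k i j)) n p)).
    rewrite D0, D1, Ef. change (z (pr X0 p)) with
      (Series (fun n => hsum a (fun i j => F1 (zmon s k i j)) n p)).
    rewrite <- !Series_scal_l, <- Series_minus, <- Series_plus.
    + apply Series_ext. intros n. rewrite !D_hsum by (intros; apply dif_hmon).
      unfold hsum. rewrite !sum_n_Reals.
      rewrite !scal_sum. rewrite <- minus_sum, <- sum_plus. apply sum_eq. intros i _.
      rewrite (hmon_spec s k (n - i) Hk1 i p). unfold ham, F1. ring.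
    + exact Sz.
    + apply (ex_series_minus (V := R_NormedModule)); now apply (ex_series_scal_l (V := R_NormedModule)).
    + now apply (ex_series_scal_l (V := R_NormedModule)).
    + now apply (ex_series_scal_l (V := R_NormedModule)).
Qed.

(** * Regularity of functions of one and two variables *)

Definition is_analytic (r : regularity) : bool :=
  match r with smooth => false | analytic => true end.

Definition emb (f : R * R -> R) : pt -> R := fun p => f (pr X0 p, pr X1 p).

Lemma locally_origin_box (P : R * R -> Prop) : locally origin P <->
  exists d, 0 < d /\ forall x y, Rabs x < d -> Rabs y < d -> P (x, y).
Proof.
  split.
  - intros [d H]. exists d. split; [apply cond_pos|]. intros x y Hx Hy. apply H. split.
    + change (Rabs (x - 0) < d). now rewrite Rminus_0_r.
    + change (Rabs (y - 0) < d). now rewrite Rminus_0_r.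
  - intros [d [Hd H]]. exists (mkposreal d Hd). intros [x y] [Hx Hy].
    change (Rabs (x - 0) < d) in Hx. change (Rabs (y - 0) < d) in Hy.
    rewrite Rminus_0_r in Hx, Hy. now apply H.
Qed.

Lemma near_of_locally P : locally origin P -> near (fun p => P (pr X0 p, pr X1 p)).
Proof.
  intros H. apply locally_origin_box in H. destruct H as [d [Hd H]]. exists d. split; auto.
Qed.

Lemma locally_of_near P : near (fun p => P (pr X0 p, pr X1 p)) -> locally origin P.
Proof.
  intros [d [Hd H]]. apply locally_origin_box. exists d. split; auto. intros x y Hx Hy.
  apply (H (x, y, 0, 0)). now apply box_F2.
Qed.

Lemma ex_diff_n_Bd d N : forall f, 
  (forall x y, Rabs x < d -> Rabs y < d -> forall n, ex_diff_n f n x y) ->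
  Bd false d (fun _ => 0) N (F2 f).
Proof.
  assert (CT : forall f, (forall x y, Rabs x < d -> Rabs y < d -> forall n, ex_diff_n f n x y) ->
    forall p, box d p -> continuous (F2 f) p).
  { intros f H p Hp. destruct (H (pr X0 p) (pr X1 p) (Hp X0) (Hp X1) 0%nat) as [Cf _].
    apply continuity_2d_pt_filterlim in Cf.
    apply (continuous_comp_2 (pr X0) (pr X1) f); auto using continuous_pr. }
  induction N as [|N IH]; intros f H.
  - split; auto. intros p Hp. split; auto. discriminate.
  - split; [intros p Hp; split; auto; discriminate|].
    intros i. assert (HS : forall p, box d p -> ex_diff_n f 1 (pr X0 p) (pr X1 p)).
    { intros p Hp. apply H; apply Hp. }
    destruct i.
    + split; [intros p Hp; apply (HS p Hp)|].
      apply (IH (fun u v => Derive (fun z => f z v) u)).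
      intros x y Hx Hy n. apply (H x y Hx Hy (S n)).
    + split; [intros p Hp; apply (HS p Hp)|].
      apply (IH (fun u v => Derive (fun z => f u z) v)).
      intros x y Hx Hy n. apply (H x y Hx Hy (S n)).
    + split; [intros p Hp; exists 0; apply (is_derive_ext (fun _ => F2 f p));
        [reflexivity|apply is_derive_cst]|].
      apply (Bd_ext false d N _ (fun _ => 0)); [intros; symmetry; now apply D_indep|].
      apply (Sm_const d 0).
    + split; [intros p Hp; exists 0; apply (is_derive_ext (fun _ => F2 f p));
        [reflexivity|apply is_derive_cst]|].
      apply (Bd_ext false d N _ (fun _ => 0)); [intros; symmetry; now apply D_indep|].
      apply (Sm_const d 0).
Qed.

Lemma Bd_ex_diff_n d n : forall f, Sm d (F2 f) ->
  forall x y, Rabs x < d -> Rabs y < d -> ex_diff_n f n x y.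
Proof.
  assert (CT : forall f, Sm d (F2 f) -> forall x y, Rabs x < d -> Rabs y < d ->
    continuity_2d_pt f x y).
  { intros f Hf x y Hx Hy. apply continuity_2d_pt_filterlim.
    change (continuous (fun z : R * R => F2 f (fst z, snd z, 0, 0)) (x, y)).
    apply (continuous_comp (fun z : R * R => (fst z, snd z, 0, 0)) (F2 f)).
    - apply continuous_tuple; try apply continuous_const;
        [apply continuous_fst|apply continuous_snd].
    - eapply Sm_cont; [eassumption|]. now apply box_F2. }
  induction n as [|n IH]; intros f Hf x y Hx Hy; simpl.
  - split; auto.
  - assert (B := box_F2 d x y Hx Hy). repeat split.
    + now apply CT.
    + eexists. exact (Sm_dif d (F2 f) X0 _ Hf B).
    + eexists. exact (Sm_dif d (F2 f) X1 _ Hf B).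
    + apply IH; auto. exact (Sm_D d _ X0 Hf).
    + apply IH; auto. exact (Sm_D d _ X1 Hf).
Qed.

(** The terms of a convergent positive series are bounded. *)
Lemma analytic_series_bound (a : nat -> nat -> R) r : 0 < r ->
  ex_series (fun n => sum_n (fun i => Rabs (a i (n - i)%nat * r ^ i * r ^ (n - i))) n) ->
  exists M, 0 <= M /\ forall i j, Rabs (a i j) <= M * (/ r) ^ (i + j).
Proof.
  intros Hr H. set (u := fun n => sum_n (fun i => Rabs (a i (n - i)%nat * r ^ i * r ^ (n - i))) n) in *.
  assert (U0 : forall n, 0 <= u n).
  { intros n. unfold u. rewrite sum_n_Reals. apply cond_pos_sum. intros; apply Rabs_pos. }
  assert (UM : forall n, u n <= Series u).
  { intros n. destruct n as [|n].
    - rewrite (Series_incr_1 u H). 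
      assert (0 <= Series (fun k => u (S k))); [|lra].
      rewrite <- (Rmult_0_l (Series u)), <- Series_scal_l. apply Series_le.
      + intros k. rewrite Rmult_0_l. split; [lra|apply U0].
      + now apply (ex_series_incr_1 u).
    - rewrite (Series_incr_n u (S (S n)) ltac:(lia) H). simpl pred. rewrite tech5.
      assert (0 <= sum_f_R0 u n) by (apply cond_pos_sum; auto).
      assert (0 <= Series (fun k => u (S (S n) + k)%nat)); [|lra].
      rewrite <- (Rmult_0_l (Series u)), <- Series_scal_l. apply Series_le.
      + intros k. rewrite Rmult_0_l. split; [lra|apply U0].
      + now apply (ex_series_incr_n u). }
  exists (Series u). split; [eapply Rle_trans; [apply (U0 0%nat)|apply UM]|].
  intros i j. rewrite pow_inv. apply Rle_div_r; [now apply pow_lt|].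
  apply Rle_trans with (u (i + j)%nat); auto.
  assert (K : forall (w : nat -> R) n m, (forall l, 0 <= w l) -> (m <= n)%nat -> w m <= sum_n w n).
  { intros w n m Hw Hm. rewrite sum_n_Reals. induction n as [|n IH].
    - replace m with 0%nat by lia. simpl; lra.
    - simpl. destruct (Nat.eq_dec m (S n)) as [->|N].
      + assert (0 <= sum_f_R0 w n) by (apply cond_pos_sum; auto). lra.
      + generalize (IH ltac:(lia)) (Hw (S n)). lra. }
  eapply Rle_trans; [|apply (K _ (i + j)%nat i); [intros; apply Rabs_pos|lia]].
  cbv beta. replace (i + j - i)%nat with j by lia.
  rewrite Rmult_assoc, <- pow_add, Rabs_mult, (Rabs_pos_eq (r ^ _)) by (apply pow_le; lra). lra.
Qed.

Lemma Reg_of_regular r f : regular_at2 r f origin -> Reg (is_analytic r) (emb f).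
Proof.
  destruct r; simpl.
  - intros H. apply locally_origin_box in H. destruct H as [d [Hd H]].
    apply (Reg_of_Sm d); auto. intros n. apply (ex_diff_n_Bd d n (fun x y => f (x, y))).
    intros x y Hx Hy. now apply H.
  - intros (a & r & Hr & H).
    assert (Hr2 : Rabs (r / 2) < r) by (rewrite Rabs_pos_eq; lra).
    destruct (analytic_series_bound a (r / 2)) as (M & HM & Ha); [lra|now apply H|].
    set (Ra := 1 + / (r / 2)).
    assert (Hi : 0 < / (r / 2)) by (apply Rinv_0_lt_compat; lra).
    assert (HR : 1 <= Ra) by (unfold Ra; lra).
    assert (Ha' : forall i j, Rabs (a i j) <= M * Ra ^ (i + j)).
    { intros i j. eapply Rle_trans; [apply Ha|]. apply Rmult_le_compat_l; auto.
      apply pow_incr. unfold Ra. lra. }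
    apply (Reg_ext _ (fun p => Series (fun n => hsum a (fun i j => F2 (monom i j)) n p))).
    + exists r. split; auto. intros p Hp. apply is_series_unique.
      destruct (H (pr X0 p) (pr X1 p) (Hp X0) (Hp X1)) as [_ T].
      simpl in T. rewrite !Rplus_0_l in T. change (f (pr X0 p, pr X1 p)) with (emb f p) in T.
      revert T. apply is_series_ext. intros n. unfold hsum. apply sum_n_ext. intros i.
      unfold F2, monom. match goal with |- ?u = ?v => change (@eq R u v) end.
      rewrite Rmult_assoc. reflexivity.
    + apply (Reg_graded 1 1 a M Ra (/ (8 * Ra * 1))); auto; try lra.
      apply graded_monom; auto; lra.
Qed.

Lemma regular_of_Reg r f : Reg (is_analytic r) (emb f) -> regular_at2 r f origin.
Proof.
  destruct r; simpl; intros Hf.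
  - destruct (Sm_of_Reg _ Hf) as (d & Hd & Sf). apply locally_origin_box. exists d.
    split; [lra|]. intros x y Hx Hy n. now apply (Bd_ex_diff_n d n (fun x y => f (x, y))).
  - destruct (taylor_series _ Hf) as (a & M & Ra & d & Hd & HM & HR & Ha & HT).
    exists a, (Rmin d (/ (4 * Ra))).
    assert (H4 : 0 < / (4 * Ra)) by (apply Rinv_0_lt_compat; lra).
    split; [now apply Rmin_glb_lt|]. intros x y Hx Hy.
    generalize (Rmin_l d (/ (4 * Ra))) (Rmin_r d (/ (4 * Ra))). intros L1 L2. split.
    + apply (ex_series_le (V := R_CompleteNormedModule) _ (fun n => M * (/ 2) ^ n)).
      2: { apply (ex_series_scal_l (V := R_NormedModule)). apply ex_series_geom.
           rewrite Rabs_pos_eq; lra. }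
      intros n. unfold norm; simpl; unfold abs; simpl. rewrite sum_n_Reals.
      rewrite Rabs_pos_eq by (apply cond_pos_sum; intros; apply Rabs_pos).
      apply Rle_trans with (sum_f_R0 (fun _ => M * (/ 4) ^ n) n).
      * apply sum_Rle. intros i Hi. specialize (Ha i (n - i)%nat).
        replace (i + (n - i))%nat with n in Ha by lia.
        rewrite Rmult_assoc, Rabs_mult.
        assert (Rabs (x ^ i * y ^ (n - i)) <= (/ (4 * Ra)) ^ n).
        { rewrite Rabs_mult, <- !RPow_abs. replace n with (i + (n - i))%nat at 2 by lia.
          rewrite pow_add. apply Rmult_le_compat; try (apply pow_le, Rabs_pos);
            apply pow_incr; split; try apply Rabs_pos; lra. }
        apply Rle_trans with (M * Ra ^ n * (/ (4 * Ra)) ^ n).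
        -- apply Rmult_le_compat; auto; apply Rabs_pos.
        -- rewrite Rmult_assoc, <- Rpow_mult_distr. right. do 2 f_equal. field. lra.
      * rewrite sum_cte. rewrite Rmult_assoc. apply Rmult_le_compat_l; auto.
        replace (/ 2) with (/ 4 * 2) by field. rewrite Rpow_mult_distr.
        apply Rmult_le_compat_l; [apply pow_le; lra|apply INR_le_pow2].
    + simpl. rewrite !Rplus_0_l. apply (HT x y); lra.
Qed.

Lemma regular1_of_Reg r V : Reg (is_analytic r) (F1 V) -> regular_at1 r V 0.
Proof.
  destruct r; simpl; intros HV.
  - destruct (Sm_of_Reg _ HV) as (d & Hd & SV).
    assert (S : forall n, Sm d (F1 (Derive_n V n))).
    { induction n as [|n IH]; auto. exact (Sm_D d _ X0 IH). }
    exists (mkposreal d (proj1 Hd)). intros y Hy n. change (Rabs (y - 0) < d) in Hy.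
    rewrite Rminus_0_r in Hy. destruct n as [|n]; [exact I|].
    assert (R0 : Rabs 0 < d) by (rewrite Rabs_R0; lra).
    simpl. eexists. exact (Sm_dif d _ X0 (y, 0, 0, 0) (S n) ltac:(now apply box_tuple)).
  - destruct (taylor_series _ HV) as (a & M & Ra & d & Hd & HM & HR & Ha & HT).
    exists (fun n => a n 0%nat). exists (mkposreal d Hd). intros y Hy.
    change (Rabs (y - 0) < d) in Hy. rewrite Rminus_0_r in Hy |- *.
    assert (T := HT y 0 Hy ltac:(rewrite Rabs_R0; lra)).
    change (F1 V (y, 0, 0, 0)) with (V y) in T. unfold is_pseries.
    revert T. apply is_series_ext. intros n.
    rewrite pow_n_pow. unfold scal; simpl; unfold mult; simpl.
    match goal with |- ?u = ?v => change (@eq R u v) end.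
    rewrite sum_n_Reals. destruct n as [|n].
    + simpl. ring.
    + rewrite tech5. rewrite Nat.sub_diag.
      rewrite (sum_eq _ (fun _ => 0)).
      * rewrite sum_cte. simpl. ring.
      * intros i Hi. rewrite (pow_i (S n - i)) by lia. ring.
Qed.

(** * Local changes of coordinates of the plane *)

Lemma near_comp P b g0 g1 g2 g3 : near P ->
  Reg b g0 -> Reg b g1 -> Reg b g2 -> Reg b g3 ->
  g0 orig = 0 -> g1 orig = 0 -> g2 orig = 0 -> g3 orig = 0 ->
  near (fun p => P (g0 p, g1 p, g2 p, g3 p)).
Proof.
  intros [d [Hd HP]] R0 R1 R2 R3 Z0 Z1 Z2 Z3.
  assert (L : forall g, Reg b g -> g orig = 0 -> near (fun p => Rabs (g p) < d)).
  { intros g Hg Hz. apply near_lt; [eapply Reg_cont; eauto|]. now rewrite Hz, Rabs_R0. }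
  generalize (near_and _ _ (near_and _ _ (L _ R0 Z0) (L _ R1 Z1))
    (near_and _ _ (L _ R2 Z2) (L _ R3 Z3))).
  apply near_imp. intros p [[? ?] [? ?]]. apply HP. now apply box_tuple.
Qed.

Lemma Reg_F2_comp b f g0 g1 : Reg b (F2 f) -> Reg b g0 -> Reg b g1 ->
  g0 orig = 0 -> g1 orig = 0 -> Reg b (fun p => f (g0 p) (g1 p)).
Proof.
  intros Hf H0 H1 Z0 Z1.
  apply (Reg_ext b (fun p => F2 f (g0 p, g1 p, 0, 0))).
  { exists 1. split; [lra|reflexivity]. }
  apply Reg_comp; auto; apply Reg_const.
Qed.

Lemma Reg_F1_comp b f g : Reg b (F1 f) -> Reg b g -> g orig = 0 -> Reg b (fun p => f (g p)).
Proof.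
  intros Hf Hg Z.
  apply (Reg_ext b (fun p => F1 f (g p, 0, 0, 0))).
  { exists 1. split; [lra|reflexivity]. }
  apply Reg_comp; auto; apply Reg_const.
Qed.

Lemma Reg_dif b f : Reg b f -> near (fun p => forall i, dif i f p).
Proof.
  intros H. destruct (Reg_C1 _ _ H) as (d & Hd & H' & _). exists d; split; auto.
  intros p Hp i. now apply (C1_dif d).
Qed.

Lemma dif_const i c p : dif i (fun _ => c) p.
Proof. unfold dif. rewrite D_const. apply is_derive_cst. Qed.

Lemma dif_pr i j p : dif i (pr j) p.
Proof. unfold dif. rewrite D_pr. apply is_derive_pr. Qed.

Lemma near_D_comp b f g0 g1 g2 g3 : Reg b f ->
  Reg b g0 -> Reg b g1 -> Reg b g2 -> Reg b g3 ->
  g0 orig = 0 -> g1 orig = 0 -> g2 orig = 0 -> g3 orig = 0 ->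
  near (fun p => forall i, let P := (g0 p, g1 p, g2 p, g3 p) in
    D i (fun q => f (g0 q, g1 q, g2 q, g3 q)) p =
    D X0 f P * D i g0 p + (D X1 f P * D i g1 p + (D X2 f P * D i g2 p + D X3 f P * D i g3 p))).
Proof.
  intros Hf R0 R1 R2 R3 Z0 Z1 Z2 Z3.
  destruct (Reg_C1 _ _ Hf) as (d & Hd & HC & _).
  generalize (near_and _ _ (near_comp _ b g0 g1 g2 g3 (near_box d Hd) R0 R1 R2 R3 Z0 Z1 Z2 Z3)
    (near_and _ _ (near_and _ _ (Reg_dif _ _ R0) (Reg_dif _ _ R1))
      (near_and _ _ (Reg_dif _ _ R2) (Reg_dif _ _ R3)))).
  apply near_imp. intros p [Hb [[D0 D1] [D2 D3]]] i P. apply D_val.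
  exact (D_comp d f g0 g1 g2 g3 i p HC Hb (D0 i) (D1 i) (D2 i) (D3 i)).
Qed.

Lemma near_D_F2_comp b f g0 g1 : Reg b (F2 f) -> Reg b g0 -> Reg b g1 ->
  g0 orig = 0 -> g1 orig = 0 ->
  near (fun p => forall i, let P := (g0 p, g1 p, 0, 0) in
    D i (fun q => f (g0 q) (g1 q)) p = D X0 (F2 f) P * D i g0 p + D X1 (F2 f) P * D i g1 p).
Proof.
  intros Hf R0 R1 Z0 Z1.
  generalize (near_D_comp b (F2 f) g0 g1 (fun _ => 0) (fun _ => 0) Hf R0 R1
    (Reg_const b 0) (Reg_const b 0) Z0 Z1 eq_refl eq_refl).
  apply near_imp. intros p H i P. specialize (H i). cbv zeta in H. fold P in H.
  rewrite !D_const in H.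
  change (D i (fun q => F2 f (g0 q, g1 q, 0, 0)) p) with (D i (fun q => f (g0 q) (g1 q)) p) in H.
  rewrite H. ring.
Qed.

Lemma near_D_F1_comp b f g : Reg b (F1 f) -> Reg b g -> g orig = 0 ->
  near (fun p => forall i, D i (fun q => f (g q)) p = Derive f (g p) * D i g p).
Proof.
  intros Hf R0 Z0.
  generalize (near_D_comp b (F1 f) g (fun _ => 0) (fun _ => 0) (fun _ => 0) Hf R0
    (Reg_const b 0) (Reg_const b 0) (Reg_const b 0) Z0 eq_refl eq_refl eq_refl).
  apply near_imp. intros p H i. specialize (H i). cbv zeta in H. rewrite !D_const in H.
  change (D i (fun q => F1 f (g q, 0, 0, 0)) p) with (D i (fun q => f (g q)) p) in H.
  change (D X0 (F1 f) (g p, 0, 0, 0)) with (Derive f (g p)) in H.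
  rewrite H. ring.
Qed.

Definition jac (A B : pt -> R) (p : pt) : R := D X0 A p * D X1 B p - D X1 A p * D X0 B p.

Lemma near_jac_comp b A B g0 g1 : Reg b (F2 A) -> Reg b (F2 B) -> Reg b g0 -> Reg b g1 ->
  g0 orig = 0 -> g1 orig = 0 ->
  near (fun p => jac (fun q => A (g0 q) (g1 q)) (fun q => B (g0 q) (g1 q)) p =
    jac (F2 A) (F2 B) (g0 p, g1 p, 0, 0) * jac g0 g1 p).
Proof.
  intros HA HB R0 R1 Z0 Z1.
  generalize (near_and _ _ (near_D_F2_comp b A g0 g1 HA R0 R1 Z0 Z1)
    (near_D_F2_comp b B g0 g1 HB R0 R1 Z0 Z1)).
  apply near_imp. intros p [EA EB]. unfold jac. rewrite !EA, !EB. ring.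
Qed.

Lemma jac_pr p : jac (pr X0) (pr X1) p = 1.
Proof.
  unfold jac. rewrite !D_pr. unfold delta. repeat (destruct ix_dec; try easy). ring.
Qed.

Lemma near_jac_ext A A' B B' : near (fun p => A p = A' p) -> near (fun p => B p = B' p) ->
  near (fun p => jac A B p = jac A' B' p).
Proof.
  intros HA HB.
  generalize (near_and _ _ (near_and _ _ (near_D _ _ X0 HA) (near_D _ _ X1 HA))
    (near_and _ _ (near_D _ _ X0 HB) (near_D _ _ X1 HB))).
  apply near_imp. intros p [[E1 E2] [E3 E4]]. unfold jac. now rewrite E1, E2, E3, E4.
Qed.

(** Two applications of the implicit function theorem: the first equation is
    solved for the first variable, then the second one for the second. *)
Lemma inverse_function b n1 n2 : Reg b (F2 n1) -> Reg b (F2 n2) -> n1 0 0 = 0 -> n2 0 0 = 0 ->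
  D X0 (F2 n1) orig <> 0 -> jac (F2 n1) (F2 n2) orig <> 0 ->
  exists g1 g2, Reg b (F2 g1) /\ Reg b (F2 g2) /\ g1 0 0 = 0 /\ g2 0 0 = 0 /\
    near (fun p => n1 (F2 g1 p) (F2 g2 p) = pr X0 p /\ n2 (F2 g1 p) (F2 g2 p) = pr X1 p) /\
    near (fun p => g1 (F2 n1 p) (F2 n2 p) = pr X0 p /\ g2 (F2 n1 p) (F2 n2 p) = pr X1 p).
Proof.
  intros R1 R2 Z1 Z2 HD HJ.
  set (P1 := fun p => n1 (pr X3 p) (pr X1 p) - pr X0 p).
  assert (RP1 : Reg b P1).
  { apply Reg_minus; [|apply Reg_pr]. apply Reg_F2_comp; auto using Reg_pr. }
  assert (DP1 : forall i, D i P1 orig = D X0 (F2 n1) orig * delta X3 i + D X1 (F2 n1) orig * delta X1 i - delta X0 i).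
  { intros i. unfold P1.
    assert (RC : Reg b (fun p => n1 (pr X3 p) (pr X1 p))) by (apply Reg_F2_comp; auto using Reg_pr).
    rewrite (D_minus i (fun p => n1 (pr X3 p) (pr X1 p)) (pr X0)).
    - assert (E := near_orig _ (near_D_F2_comp b n1 (pr X3) (pr X1) R1 (Reg_pr b X3) (Reg_pr b X1)
        eq_refl eq_refl) i).
      cbv zeta in E. rewrite E, !D_pr. reflexivity.
    - exact (near_orig _ (Reg_dif _ _ RC) i).
    - apply dif_pr. }
  destruct (implicit_function b P1 RP1) as (a & Ra & a0 & Ia & Na & Ua).
  { unfold P1. simpl. rewrite Z1. ring. }
  { rewrite DP1. unfold delta. repeat (destruct ix_dec; try easy). lra. }
  set (al := fun x y => a (x, y, 0, 0)).
  assert (Ral : Reg b (F2 al)).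
  { apply (Reg_comp b a (pr X0) (pr X1) (fun _ => 0) (fun _ => 0)); auto using Reg_pr, Reg_const. }
  assert (al0 : al 0 0 = 0) by exact a0.
  assert (Nal : near (fun p => n1 (F2 al p) (pr X1 p) = pr X0 p)).
  { generalize (near_comp _ b (pr X0) (pr X1) (fun _ => 0) (fun _ => 0) Na (Reg_pr b X0)
      (Reg_pr b X1) (Reg_const b 0) (Reg_const b 0) eq_refl eq_refl eq_refl eq_refl).
    apply near_imp. intros p E. unfold P1 in E. cbn in E. unfold F2, al. cbn. lra. }
  assert (Ual : near (fun p => n1 (pr X3 p) (pr X1 p) = pr X0 p -> pr X3 p = al (pr X0 p) (pr X1 p))).
  { generalize (near_comp _ b (pr X0) (pr X1) (fun _ => 0) (pr X3) Ua (Reg_pr b X0)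
      (Reg_pr b X1) (Reg_const b 0) (Reg_pr b X3) eq_refl eq_refl eq_refl eq_refl).
    apply near_imp. intros p U E. unfold al.
    rewrite <- (Ia (pr X0 p, pr X1 p, 0, 0) (pr X3 p)). apply U. unfold P1. cbn. 
    cbn in E. lra. }
  assert (Dal : D X0 (F2 n1) orig * D X1 (F2 al) orig + D X1 (F2 n1) orig = 0).
  { assert (N := near_D _ _ X1 Nal). apply near_orig in N.
    assert (E := near_orig _ (near_D_F2_comp b n1 (F2 al) (pr X1) R1 Ral (Reg_pr b X1) al0 eq_refl) X1).
    cbv zeta in E. rewrite E in N. rewrite !D_pr in N.
    change (F2 al orig) with (al 0 0) in N. rewrite al0 in N.
    change (0, pr X1 orig, 0, 0) with orig in N. revert N. unfold delta.
    repeat (destruct ix_dec; try easy). lra. }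
  set (P2 := fun p => n2 (al (pr X0 p) (pr X3 p)) (pr X3 p) - pr X1 p).
  assert (Rc : Reg b (fun p => al (pr X0 p) (pr X3 p))) by (apply Reg_F2_comp; auto using Reg_pr).
  assert (RC2 : Reg b (fun p => n2 (al (pr X0 p) (pr X3 p)) (pr X3 p))).
  { apply (Reg_F2_comp b n2 (fun p => al (pr X0 p) (pr X3 p)) (pr X3)); auto using Reg_pr. }
  assert (RP2 : Reg b P2) by (apply Reg_minus; [exact RC2|apply Reg_pr]).
  destruct (implicit_function b P2 RP2) as (c & Rc2 & c0 & Ic & Nc & Uc).
  { unfold P2. simpl. rewrite al0, Z2. ring. }
  { unfold P2. rewrite (D_minus X3 (fun p => n2 (al (pr X0 p) (pr X3 p)) (pr X3 p)) (pr X1)).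
    2: exact (near_orig _ (Reg_dif _ _ RC2) X3). 2: apply dif_pr.
    assert (E := near_orig _ (near_D_F2_comp b n2 _ (pr X3) R2 Rc (Reg_pr b X3) al0 eq_refl) X3).
    cbv zeta in E. rewrite E, !D_pr.
    assert (E2 := near_orig _ (near_D_F2_comp b al (pr X0) (pr X3) Ral (Reg_pr b X0) (Reg_pr b X3)
      eq_refl eq_refl) X3).
    cbv zeta in E2. rewrite E2, !D_pr.
    change (al (pr X0 orig) (pr X3 orig)) with (al 0 0). rewrite al0.
    change (0, pr X3 orig, 0, 0) with orig. change (pr X0 orig, pr X3 orig, 0, 0) with orig.
    unfold delta. repeat (destruct ix_dec; try easy). intros Q. apply HJ. unfold jac.
    set (A0 := D X0 (F2 n1) orig) in *. set (A1 := D X1 (F2 n1) orig) in *.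
    set (B0 := D X0 (F2 n2) orig) in *. set (B1 := D X1 (F2 n2) orig) in *.
    set (w := D X1 (F2 al) orig) in *.
    assert (EA : A1 = - (A0 * w)) by lra. rewrite EA.
    transitivity (A0 * (B0 * w + B1)); [ring|]. replace (B0 * w + B1) with 0 by lra. ring. }
  set (g2 := fun x y => c (x, y, 0, 0)). set (g1 := fun x y => al x (g2 x y)).
  assert (Rg2 : Reg b (F2 g2)).
  { apply (Reg_comp b c (pr X0) (pr X1) (fun _ => 0) (fun _ => 0)); auto using Reg_pr, Reg_const. }
  assert (g20 : g2 0 0 = 0) by exact c0.
  assert (Rg1 : Reg b (F2 g1)).
  { apply (Reg_F2_comp b al (pr X0) (F2 g2)); auto using Reg_pr. }
  exists g1, g2. split; [exact Rg1|]. split; [exact Rg2|].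
  split; [unfold g1; now rewrite g20|]. split; [exact g20|]. split.
  - generalize (near_and _ _
      (near_comp _ b (pr X0) (F2 g2) (fun _ => 0) (fun _ => 0) Nal (Reg_pr b X0) Rg2
        (Reg_const b 0) (Reg_const b 0) eq_refl g20 eq_refl eq_refl)
      (near_comp _ b (pr X0) (pr X1) (fun _ => 0) (fun _ => 0) Nc (Reg_pr b X0) (Reg_pr b X1)
        (Reg_const b 0) (Reg_const b 0) eq_refl eq_refl eq_refl eq_refl)).
    apply near_imp. intros p [E1 E2]. split; [exact E1|].
    unfold P2 in E2. cbn in E2. unfold F2, g1, g2. cbn. lra.
  - assert (R1' : F2 n1 orig = 0) by exact Z1. assert (R2' : F2 n2 orig = 0) by exact Z2.
    generalize (near_and _ _
      (near_comp _ b (F2 n1) (pr X1) (fun _ => 0) (pr X0) Ual R1 (Reg_pr b X1) (Reg_const b 0)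
        (Reg_pr b X0) R1' eq_refl eq_refl eq_refl)
      (near_comp _ b (F2 n1) (F2 n2) (fun _ => 0) (pr X1) Uc R1 R2 (Reg_const b 0)
        (Reg_pr b X1) R1' R2' eq_refl eq_refl)).
    apply near_imp. intros p [E1 E2].
    assert (Q1 : pr X0 p = al (F2 n1 p) (pr X1 p)) by (apply E1; reflexivity).
    assert (Q2 : pr X1 p = g2 (F2 n1 p) (F2 n2 p)).
    { unfold g2. rewrite <- (Ic (F2 n1 p, F2 n2 p, 0, 0) (pr X1 p)). apply E2. unfold P2.
      change (n2 (al (F2 n1 p) (pr X1 p)) (pr X1 p) - F2 n2 p = 0). rewrite <- Q1. 
      unfold F2. ring. }
    split; [unfold g1; now rewrite <- Q2, <- Q1|now rewrite <- Q2].
Qed.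

(** * Motion along the level curves *)

(** The quotient [(y^k - x^k) / (y - x)]. *)
Fixpoint dq (k : nat) (x y : R) : R :=
  match k with O => 0 | S k => y * dq k x y + x ^ k end.

Lemma dq_spec k x y : (y - x) * dq k x y = y ^ k - x ^ k.
Proof.
  induction k as [|k IH]; simpl; [ring|].
  transitivity (y * ((y - x) * dq k x y) + (y - x) * x ^ k); [ring|]. rewrite IH. ring.
Qed.

Lemma Reg_dq b k f g : Reg b f -> Reg b g -> Reg b (fun p => dq k (f p) (g p)).
Proof.
  intros Hf Hg. induction k as [|k IH]; simpl; [apply Reg_const|].
  apply Reg_plus; [now apply Reg_mult|now apply Reg_pow].
Qed.

Lemma dif_minus i f g p : dif i f p -> dif i g p -> dif i (fun q => f q - g q) p.
Proof. intros F G. apply (dif_plus f (fun q => - g q)); auto using dif_opp. Qed.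

Lemma is_derive_powR i f n p : dif i f p ->
  is_derive (fun x => f (up i p x) ^ n) (pr i p) (INR n * f p ^ (n - 1) * D i f p).
Proof.
  intros F. generalize (is_derive_compR (fun y => y ^ n) (fun x => f (up i p x)) (pr i p) _ _
    (is_derive_pow_id _ n) F).
  now rewrite up_pr.
Qed.

Lemma D_pow i f n p : dif i f p -> D i (fun q => f q ^ n) p = INR n * f p ^ (n - 1) * D i f p.
Proof. intros F. now apply D_val, is_derive_powR. Qed.

Lemma dif_pow i f n p : dif i f p -> dif i (fun q => f q ^ n) p.
Proof. intros F. red. rewrite D_pow by auto. now apply is_derive_powR. Qed.

Lemma Reg_graph b f Y : Reg b f -> Reg b Y -> Y orig = 0 ->
  Reg b (fun p => f (pr X0 p, pr X1 p, pr X2 p, Y p)).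
Proof. intros; apply Reg_comp; auto using Reg_pr. Qed.

(** The energy [E = xi^2 + s x^k] is conserved by a motion of [(x, xi)] to [(Y, W)] if
    the chord between the two points is a multiple of the discrete Hamiltonian field
    [(xi + W, - s (Y^k - x^k) / (Y - x))].  With the multiple [X2] this amounts to one
    implicit equation for [Y], so that no differential equation has to be solved; the
    velocity is [mu] times that of the Hamiltonian flow. *)
Lemma leaf_motion b s k : exists Y W mu, Reg b Y /\ Reg b W /\ Reg b mu /\
  Y orig = 0 /\ W orig = 0 /\ mu orig <> 0 /\
  near (fun p => pr X2 p = 0 -> Y p = pr X0 p /\ W p = pr X1 p) /\
  near (fun p => W p ^ 2 + s * Y p ^ k = pr X1 p ^ 2 + s * pr X0 p ^ k) /\
  near (fun p => D X2 Y p = 2 * W p * mu p) /\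
  near (fun p => D X2 W p = - (s * INR k * Y p ^ (k - 1) * mu p)).
Proof.
  set (Q := fun p => dq k (pr X0 p) (pr X3 p)).
  set (F := fun p => pr X3 p - pr X0 p - 2 * (pr X2 p * pr X1 p) + s * (pr X2 p * pr X2 p) * Q p).
  assert (RQ : Reg b Q) by (apply Reg_dq; apply Reg_pr).
  assert (RF : Reg b F).
  { unfold F. repeat first [exact RQ|apply Reg_pr|apply Reg_const|apply Reg_minus|apply Reg_plus|apply Reg_mult]. }
  assert (DF : near (fun p => D X2 F p = 2 * (s * pr X2 p * Q p - pr X1 p) /\
    D X3 F p = 1 + s * pr X2 p ^ 2 * D X3 Q p)).
  { generalize (Reg_dif _ _ RQ). apply near_imp. intros p HQ.
    assert (K : forall i, D i F p = delta X3 i - delta X0 i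
      - 2 * (delta X2 i * pr X1 p + pr X2 p * delta X1 i)
      + s * (2 * delta X2 i * pr X2 p) * Q p + s * pr X2 p ^ 2 * D i Q p).
    { intros i. apply D_val. specialize (HQ i). red in HQ.
      assert (P := fun j => is_derive_pr j i p).
      evar_last.
      - unfold F. apply is_derive_add; [apply is_derive_sub; [apply is_derive_sub; apply P|]|].
        + apply is_derive_mul; [apply is_derive_cst|apply is_derive_mul; apply P].
        + apply is_derive_mul; [|exact HQ].
          apply is_derive_mul; [apply is_derive_cst|apply is_derive_mul; apply P].
      - cbv beta. rewrite !up_pr. ring. }
    assert (Q2 : D X2 Q p = 0) by (apply D_indep; reflexivity).
    split; rewrite K, ?Q2; unfold delta; repeat (destruct ix_dec; try easy); ring. }
  assert (DQ : forall p, dif X3 Q p -> Q p + (pr X3 p - pr X0 p) * D X3 Q p = INR k * pr X3 p ^ (k - 1)).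
  { intros p HQ.
    assert (E : D X3 (fun q => (pr X3 q - pr X0 q) * Q q) p = D X3 (fun q => pr X3 q ^ k - pr X0 q ^ k) p).
    { apply Derive_ext. intros x. unfold Q. now rewrite dq_spec. }
    rewrite (D_mult X3 (fun q => pr X3 q - pr X0 q) Q), (D_minus X3 (pr X3) (pr X0)) in E;
      auto using dif_minus, dif_pr.
    rewrite (D_val X3 (fun q => pr X3 q ^ k - pr X0 q ^ k) p (INR k * pr X3 p ^ (k - 1) - 0)) in E.
    2: { apply (is_derive_sub (fun x => x ^ k) (fun _ => pr X0 p ^ k)); [apply is_derive_pow_id|apply is_derive_cst]. }
    rewrite !D_pr in E. revert E. unfold delta. repeat (destruct ix_dec; try easy). lra. }
  assert (F3 : D X3 F orig = 1).
  { destruct (near_orig _ DF) as [_ E]. rewrite E. simpl. ring. }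
  destruct (implicit_function b F RF) as (Y & RY & Y0 & IY & NY & _).
  { unfold F. simpl. ring. }
  { rewrite F3. lra. }
  set (G := fun p : pt => (pr X0 p, pr X1 p, pr X2 p, Y p)).
  set (q := fun p => Q (G p)). set (q3 := fun p => D X3 Q (G p)).
  set (d3 := fun p => D X3 F (G p)).
  assert (Rq : Reg b q) by now apply Reg_graph.
  assert (Rd3 : Reg b d3) by (apply Reg_graph; auto using Reg_D).
  assert (G0 : G orig = orig) by (unfold G; rewrite Y0; reflexivity).
  assert (d30 : d3 orig = 1) by (unfold d3; rewrite G0; exact F3).
  set (W := fun p => pr X1 p - s * pr X2 p * q p).
  set (mu := fun p => / d3 p).
  assert (RW : Reg b W).
  { unfold W. repeat first [exact Rq|apply Reg_pr|apply Reg_const|apply Reg_minus|apply Reg_mult]. }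
  assert (NG : forall P, near P -> near (fun p => P (G p))).
  { intros P HP. apply near_comp with (1 := HP) (b := b); auto using Reg_pr. }
  assert (NA : near (fun p => Y p - pr X0 p = pr X2 p * (pr X1 p + W p))).
  { revert NY. apply near_imp. intros p E.
    change (Y p - pr X0 p - 2 * (pr X2 p * pr X1 p) + s * (pr X2 p * pr X2 p) * q p = 0) in E.
    unfold W. lra. }
  assert (Nd : near (fun p => d3 p = 1 + s * pr X2 p ^ 2 * q3 p /\ d3 p <> 0)).
  { apply near_and.
    - generalize (NG _ DF). apply near_imp. intros p [_ E]. exact E.
    - apply near_neq; [eapply Reg_cont; eauto|rewrite d30; lra]. }
  assert (NC : near (fun p => D X2 Y p = 2 * W p * mu p)).
  { assert (NE : near (fun p => F (G p) = 0)).
    { revert NY. apply near_imp. intros p E. exact E. }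
    apply (near_D _ _ X2) in NE.
    generalize (near_and _ _ (near_and _ _ NE (NG _ DF)) (near_and _ _ Nd
      (near_D_comp b F (pr X0) (pr X1) (pr X2) Y RF (Reg_pr b X0) (Reg_pr b X1) (Reg_pr b X2) RY
        eq_refl eq_refl eq_refl Y0))).
    apply near_imp. intros p [[E [E2 _]] [[_ Ne] H]].
    specialize (H X2). cbv zeta in H. fold (G p) in H.
    change (D X2 (fun p => F (G p)) p = D X0 F (G p) * D X2 (pr X0) p
      + (D X1 F (G p) * D X2 (pr X1) p + (D X2 F (G p) * D X2 (pr X2) p + d3 p * D X2 Y p))) in H.
    rewrite D_const in E. rewrite E, !D_pr, E2 in H.
    unfold mu. apply Rmult_eq_reg_l with (d3 p); auto.
    transitivity (2 * W p); [|now field].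
    revert H. unfold delta, W, q. repeat (destruct ix_dec; try easy).
    change (pr X2 (G p)) with (pr X2 p). change (pr X1 (G p)) with (pr X1 p). lra. }
  exists Y, W, mu. split; [exact RY|]. split; [exact RW|].
  split; [apply Reg_inv; auto; rewrite d30; lra|]. split; [exact Y0|].
  split; [unfold W; simpl; ring|]. split; [unfold mu; rewrite d30; lra|].
  split; [|split; [|split; [exact NC|]]].
  - revert NA. apply near_imp. intros p E Z. rewrite Z in E. split; [lra|].
    unfold W. rewrite Z. ring.
  - revert NA. apply near_imp. intros p E.
    assert (E2 := dq_spec k (pr X0 p) (Y p)). change (dq k (pr X0 p) (Y p)) with (q p) in E2.
    assert (E3 : W p = pr X1 p - s * pr X2 p * q p) by reflexivity.
    assert (E4 : (W p - pr X1 p) * (pr X1 p + W p) = - s * (Y p ^ k - pr X0 p ^ k)).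
    { rewrite <- E2, E, E3. ring. }
    lra.
  - generalize (near_and _ _ (near_and _ _ NA NC) (near_and _ _ (near_and _ _ Nd
      (NG _ (Reg_dif _ _ RQ))) (near_and _ _ (Reg_dif _ _ Rq) 
      (near_D_comp b Q (pr X0) (pr X1) (pr X2) Y RQ (Reg_pr b X0) (Reg_pr b X1) (Reg_pr b X2) RY
        eq_refl eq_refl eq_refl Y0)))).
    apply near_imp. intros p [[EA EC] [[[Ed Ne] HQ] [Hq H]]].
    specialize (H X2). cbv zeta in H. fold (G p) in H.
    change (D X2 q p = D X0 Q (G p) * D X2 (pr X0) p
      + (D X1 Q (G p) * D X2 (pr X1) p + (D X2 Q (G p) * D X2 (pr X2) p + q3 p * D X2 Y p))) in H.
    assert (Q2 : D X2 Q (G p) = 0) by (apply D_indep; reflexivity).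
    rewrite !D_pr, Q2, EC in H.
    assert (EW : D X2 W p = - s * (q p + pr X2 p * D X2 q p)).
    { apply D_val. evar_last.
      - unfold W. apply is_derive_sub; [apply (is_derive_pr X1)|].
        apply is_derive_mul; [|exact (Hq X2)].
        apply is_derive_mul; [apply is_derive_cst|apply (is_derive_pr X2)].
      - cbv beta. rewrite up_pr. unfold delta. repeat (destruct ix_dec; try easy). ring. }
    assert (DQ' : q p + (Y p - pr X0 p) * q3 p = INR k * Y p ^ (k - 1)) by exact (DQ (G p) (HQ X3)).
    assert (EW' : W p = pr X1 p - s * pr X2 p * q p) by reflexivity.
    rewrite EW, H. unfold delta. repeat (destruct ix_dec; try easy).
    replace (s * INR k * Y p ^ (k - 1) * mu p) with (s * mu p * (INR k * Y p ^ (k - 1))) by ring.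
    rewrite <- DQ', EA. unfold mu.
    apply Rmult_eq_reg_l with (d3 p); auto.
    transitivity (- s * (d3 p * q p + pr X2 p * q3 p * (2 * W p))); [now field|].
    transitivity (- s * (q p + pr X2 p * (pr X1 p + W p) * q3 p)); [|now field].
    rewrite Ed, EW'. ring.
Qed.

Lemma near_D_slice f g i j : i <> j -> near (fun p => pr j p = 0 -> f p = g p) ->
  near (fun p => pr j p = 0 -> D i f p = D i g p).
Proof.
  intros N [d [Hd H]]. exists d. split; auto. intros p Hp Z. apply Derive_ext_loc.
  generalize (locally_box_up d i p Hp). apply filter_imp. intros x Hx. apply H; auto.
  now rewrite pr_up_neq.
Qed.

Lemma near_zero_of_D b E j : Reg b E -> near (fun p => pr j p = 0 -> E p = 0) ->
  near (fun p => D j E p = 0) -> near (fun p => E p = 0).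
Proof.
  intros HE N0 ND.
  destruct (near_and _ _ (Reg_dif _ _ HE) (near_and _ _ N0 ND)) as (d & Hd & H).
  assert (d0 : Rabs 0 < d) by now rewrite Rabs_R0.
  exists d. split; auto. intros p Hp.
  assert (B : forall x, Rmin 0 (pr j p) <= x <= Rmax 0 (pr j p) -> box d (up j p x)).
  { intros x Hx. apply box_up; auto. specialize (Hp j). revert Hx Hp.
    unfold Rmin, Rmax. destruct Rle_dec; unfold Rabs; repeat destruct Rcase_abs; lra. }
  assert (Dv : forall x, Rmin 0 (pr j p) <= x <= Rmax 0 (pr j p) ->
    is_derive (fun x => E (up j p x)) x 0).
  { intros x Hx. destruct (H _ (B x Hx)) as (K & _ & K0). specialize (K j). red in K.
    rewrite K0, pr_up in K. eapply is_derive_ext; [|exact K]. intros t. cbv beta.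
    now rewrite up_up. }
  destruct (MVT_gen (fun x => E (up j p x)) 0 (pr j p) (fun _ => 0)) as (c & _ & Ec).
  - intros x Hx. apply Dv. lra.
  - intros x Hx. apply continuity_pt_filterlim.
    apply (ex_derive_continuous (fun x => E (up j p x))). exists 0. now apply Dv.
  - rewrite up_pr in Ec. 
    assert (Z : E (up j p 0) = 0).
    { apply (H (up j p 0)); [now apply box_up|apply pr_up]. }
    lra.
Qed.

Lemma near_D_prim b i f : Reg b f -> near (fun p => D i (prim i f) p = f p).
Proof.
  intros Hf. destruct (Reg_C1 _ _ Hf) as (d & Hd & HC & Hc). exists d. split; auto. intros p Hp.
  apply D_val. generalize (is_derive_prim d f i i p HC Hc Hp). now destruct ix_dec.
Qed.

Lemma energy_derivative b s k Y W : Reg b Y -> Reg b W ->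
  near (fun p => W p ^ 2 + s * Y p ^ k = pr X1 p ^ 2 + s * pr X0 p ^ k) ->
  forall i, near (fun p => 2 * W p * D i W p + s * INR k * Y p ^ (k - 1) * D i Y p =
    2 * pr X1 p * delta X1 i + s * INR k * pr X0 p ^ (k - 1) * delta X0 i).
Proof.
  intros RY RW NB i.
  generalize (near_and _ _ (near_D _ _ i NB) (near_and _ _ (Reg_dif _ _ RW) (Reg_dif _ _ RY))).
  apply near_imp. intros p [K [K1 K2]]. revert K.
  rewrite (D_plus i (fun q => W q ^ 2) (fun q => s * Y q ^ k)),
    (D_plus i (fun q => pr X1 q ^ 2) (fun q => s * pr X0 q ^ k)), !D_scal, !D_pow, !D_pr;
    auto using dif_scal, dif_pr, dif_pow. simpl (INR 2). simpl (2 - 1)%nat. intros K.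
  rewrite !pow_1 in K. lra.
Qed.

(** The Lie derivative of the area form [z(x) dxi /\ dx] along [mu] times the
    Hamiltonian field of [E] is [dE /\ d(z mu)].  Hence the pull-back of the form
    under the motion up to the time [X2] exceeds it by [dE /\ dS], where [S] is the
    integral of [z(Y) mu] over time.  The proof compares the initial values and the
    derivatives in time of the two sides. *)
Lemma leaf_bracket b s k z Y W mu : Reg b (F1 z) -> Reg b Y -> Reg b W -> Reg b mu ->
  Y orig = 0 ->
  near (fun p => pr X2 p = 0 -> Y p = pr X0 p /\ W p = pr X1 p) ->
  near (fun p => W p ^ 2 + s * Y p ^ k = pr X1 p ^ 2 + s * pr X0 p ^ k) ->
  near (fun p => D X2 Y p = 2 * W p * mu p) ->
  near (fun p => D X2 W p = - (s * INR k * Y p ^ (k - 1) * mu p)) ->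
  near (fun p => z (Y p) * jac Y W p =
    z (pr X0 p) + ham s k (prim X2 (fun p => z (Y p) * mu p)) p).
Proof.
  intros Rz RY RW Rmu Y0 NI NB NC ND.
  set (zY := fun p => z (Y p)).
  assert (RzY : Reg b zY) by now apply Reg_F1_comp.
  set (g := fun p => zY p * mu p). assert (Rg : Reg b g) by now apply Reg_mult.
  set (S := prim X2 g). assert (RS : Reg b S) by now apply Reg_prim.
  assert (NS := near_D_prim b X2 g Rg : near (fun p => D X2 S p = g p)).
  assert (N0 : forall p, pr X2 p = 0 -> S p = 0).
  { intros p E. unfold S, prim. rewrite E. exact (RInt_point 0 _). }
  set (E := fun p => zY p * (D X0 Y p * D X1 W p - D X1 Y p * D X0 W p)
    - (F1 z p + (2 * pr X1 p * D X0 S p - s * INR k * pr X0 p ^ (k - 1) * D X1 S p))).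
  assert (RE : Reg b E).
  { unfold E. repeat first [exact RzY|exact Rz|apply Reg_D; solve [trivial]|apply Reg_pr|apply Reg_const
      |apply Reg_pow|apply Reg_minus|apply Reg_plus|apply Reg_mult]. }
  cut (near (fun p => E p = 0)).
  { apply near_imp. intros p K. change (zY p * jac Y W p = F1 z p + ham s k S p).
    unfold E in K. unfold jac, ham. lra. }
  apply (near_zero_of_D b E X2); auto.
  - assert (NY : near (fun p => pr X2 p = 0 -> Y p = pr X0 p))
      by (revert NI; apply near_imp; intros p K Z; now apply K).
    assert (NW : near (fun p => pr X2 p = 0 -> W p = pr X1 p))
      by (revert NI; apply near_imp; intros p K Z; now apply K).
    assert (NS0 : near (fun p => pr X2 p = 0 -> S p = (fun _ => 0) p))
      by (exists 1; split; [lra|auto]).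
    generalize (near_and _ _ (near_and _ _ NI
      (near_and _ _ (near_D_slice _ _ X0 X2 ltac:(easy) NS0) (near_D_slice _ _ X1 X2 ltac:(easy) NS0)))
      (near_and _ _
      (near_and _ _ (near_D_slice _ _ X0 X2 ltac:(easy) NY) (near_D_slice _ _ X1 X2 ltac:(easy) NY))
      (near_and _ _ (near_D_slice _ _ X0 X2 ltac:(easy) NW) (near_D_slice _ _ X1 X2 ltac:(easy) NW)))).
    apply near_imp. intros p [[K0 [K1 K2]] [[K3 K4] [K5 K6]]] Z.
    unfold E, zY, F1. rewrite K1, K2, K3, K4, K5, K6 by auto. destruct (K0 Z) as [-> _].
    rewrite !D_const, !D_pr. unfold delta. repeat (destruct ix_dec; try easy). ring.
  - (* both sides of the identity have the same derivative along the motion *)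
    assert (RD : forall i f, Reg b f -> near (fun p => dif X2 (D i f) p)).
    { intros i f Hf. generalize (Reg_dif _ _ (Reg_D _ _ i Hf)). apply near_imp. auto. }
    assert (NCi : near (fun p => forall i, D i (D X2 Y) p = 2 * (D i W p * mu p + W p * D i mu p))).
    { assert (Q : forall i, near (fun p => D i (D X2 Y) p = 2 * (D i W p * mu p + W p * D i mu p))).
      { intros i. generalize (near_and _ _ (near_D _ _ i NC) (near_and _ _ (Reg_dif _ _ RW) (Reg_dif _ _ Rmu))).
        apply near_imp. intros p [K [K1 K2]]. rewrite K.
        rewrite (D_mult i (fun q => 2 * W q) mu), D_scal; auto using dif_scal. ring. }
      generalize (near_and _ _ (near_and _ _ (Q X0) (Q X1)) (near_and _ _ (Q X2) (Q X3))).
      apply near_imp. intros p [[? ?] [? ?]] i. now destruct i. }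
    set (e := fun p => INR (k - 1) * Y p ^ (k - 1 - 1)).
    assert (NDi : near (fun p => forall i, D i (D X2 W) p =
      - (s * INR k * (e p * D i Y p * mu p + Y p ^ (k - 1) * D i mu p)))).
    { assert (Q : forall i, near (fun p => D i (D X2 W) p =
        - (s * INR k * (e p * D i Y p * mu p + Y p ^ (k - 1) * D i mu p)))).
      { intros i. generalize (near_and _ _ (near_D _ _ i ND) (near_and _ _ (Reg_dif _ _ Rmu) 
          (near_and _ _ (Reg_dif _ _ RY) (Reg_dif _ _ (Reg_pow _ _ (k - 1) RY))))).
        apply near_imp. intros p [K [K1 [K2 K3]]]. rewrite K, D_opp.
        rewrite (D_mult i (fun q => s * INR k * Y q ^ (k - 1)) mu), D_scal, D_pow; auto using dif_scal.
        unfold e. ring. }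
      generalize (near_and _ _ (near_and _ _ (Q X0) (Q X1)) (near_and _ _ (Q X2) (Q X3))).
      apply near_imp. intros p [[? ?] [? ?]] i. now destruct i. }
    assert (NSi : forall i, near (fun p => D i (D X2 S) p = D i zY p * mu p + zY p * D i mu p)).
    { intros i. generalize (near_and _ _ (near_D _ _ i NS) (near_and _ _ (Reg_dif _ _ RzY) (Reg_dif _ _ Rmu))).
      apply near_imp. intros p [K [K1 K2]]. rewrite K. now apply D_mult. }
    assert (NBi := energy_derivative b s k Y W RY RW NB).
    assert (Nz := near_D_F1_comp b z Y Rz RY Y0).
    generalize (near_and _ _ 
      (near_and _ _ (near_and _ _ (near_and _ _ (RD X0 Y RY) (RD X1 Y RY))
        (near_and _ _ (RD X0 W RW) (RD X1 W RW))) (near_and _ _ (near_and _ _ (RD X0 S RS) (RD X1 S RS)) 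
        (Reg_dif _ _ RzY)))
      (near_and _ _ (near_and _ _ (near_and _ _ (near_and _ _ (Reg_schwarz b Y X2 X0 RY) (Reg_schwarz b Y X2 X1 RY))
        (near_and _ _ (Reg_schwarz b W X2 X0 RW) (Reg_schwarz b W X2 X1 RW)))
        (near_and _ _ (Reg_schwarz b S X2 X0 RS) (Reg_schwarz b S X2 X1 RS)))
      (near_and _ _ (near_and _ _ NC (near_and _ _ NCi NDi)) (near_and _ _ (near_and _ _ (NSi X0) (NSi X1))
         (near_and _ _ (near_and _ _ (NBi X0) (NBi X1)) Nz))))).
    apply near_imp. 
    intros p [[[[A1 A2] [A3 A4]] [[A5 A6] A7]] [[[[B1 B2] [B3 B4]] [B5 B6]]
      [[C0 [C1 C2]] [[G1 G2] [[H1 H2] HZ]]]]].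
    assert (EE : D X2 E p = D X2 zY p * (D X0 Y p * D X1 W p - D X1 Y p * D X0 W p)
      + zY p * (D X2 (D X0 Y) p * D X1 W p + D X0 Y p * D X2 (D X1 W) p
         - (D X2 (D X1 Y) p * D X0 W p + D X1 Y p * D X2 (D X0 W) p))
      - (2 * pr X1 p * D X2 (D X0 S) p - s * INR k * pr X0 p ^ (k - 1) * D X2 (D X1 S) p)).
    { apply D_val. red in A1, A2, A3, A4, A5, A6. assert (A7' := A7 X2). red in A7'.
      evar_last.
      - unfold E. apply is_derive_sub.
        + apply is_derive_mul; [exact A7'|apply is_derive_sub; apply is_derive_mul; eassumption].
        + apply is_derive_add; [exact (is_derive_cst (F1 z p) _)|]. apply is_derive_sub.
          * apply is_derive_mul; [exact (is_derive_cst (2 * pr X1 p) _)|exact A5].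
          * apply is_derive_mul; [exact (is_derive_cst (s * INR k * pr X0 p ^ (k - 1)) _)|exact A6].
      - cbv beta. rewrite !up_pr. change (pr X1 (up X2 p (pr X2 p))) with (pr X1 p).
        change (pr X0 (up X2 p (pr X2 p))) with (pr X0 p). ring. }
    assert (HZ' : forall i, D i zY p = Derive z (Y p) * D i Y p) by exact HZ.
    rewrite EE, B1, B2, B3, B4, B5, B6, !C1, !C2, G1, G2, !HZ', C0.
    revert H1 H2. unfold delta. repeat (destruct ix_dec; try easy).
    unfold zY. 
    set (zz := z (Y p)). set (z' := Derive z (Y p)). set (Y0' := D X0 Y p). set (Y1 := D X1 Y p).
    set (W0 := D X0 W p). set (W1 := D X1 W p). set (m := mu p). set (m0 := D X0 mu p). set (m1 := D X1 mu p).
    set (w := W p). set (K := s * INR k * Y p ^ (k - 1)). intros E0 E1.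
    replace (2 * pr X1 p) with (2 * w * W1 + K * Y1) by lra.
    replace (s * INR k * pr X0 p ^ (k - 1)) with (2 * w * W0 + K * Y0') by lra.
    replace (- (s * INR k * (e p * Y1 * m + Y p ^ (k - 1) * m1))) with (- (s * INR k * e p * Y1 * m + K * m1))
      by (unfold K; ring).
    replace (- (s * INR k * (e p * Y0' * m + Y p ^ (k - 1) * m0))) with (- (s * INR k * e p * Y0' * m + K * m0))
      by (unfold K; ring).
    ring.
Qed.

Lemma orig_prim i f : prim i f orig = 0.
Proof. destruct i; exact (RInt_point 0 _). Qed.

(** The motion of [leaf_motion] is stopped at the time [T], depending on the point, at
    which [S] equals [h].  The formula of [leaf_bracket] survives this, since both
    sides change by [z mu dE /\ dT]; it now says that the pull-back of
    [z(x) dxi /\ dx] exceeds this form by [dE /\ dh]. *)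
Lemma leaf_map b s k z h : (2 <= k)%nat -> Reg b (F1 z) -> Reg b (F2 h) -> z 0 <> 0 -> h 0 0 = 0 ->
  exists f1 f2, Reg b (F2 f1) /\ Reg b (F2 f2) /\ f1 0 0 = 0 /\ f2 0 0 = 0 /\
    D X0 (F2 f1) orig <> 0 /\
    near (fun p => F2 f2 p ^ 2 + s * F2 f1 p ^ k = pr X1 p ^ 2 + s * pr X0 p ^ k) /\
    near (fun p => z (F2 f1 p) * jac (F2 f1) (F2 f2) p = z (pr X0 p) + ham s k (F2 h) p).
Proof.
  intros Hk Rz Rh z0 h0.
  destruct (leaf_motion b s k) as (Y & W & mu & RY & RW & Rmu & Y0 & W0 & mu0 & NI & NB & NC & ND).
  assert (NP := leaf_bracket b s k z Y W mu Rz RY RW Rmu Y0 NI NB NC ND).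
  set (g := fun p => z (Y p) * mu p) in NP. set (S := prim X2 g) in NP.
  assert (Rg : Reg b g) by (apply Reg_mult; auto; now apply Reg_F1_comp).
  assert (RS : Reg b S) by now apply Reg_prim.
  assert (S0 : S orig = 0) by apply orig_prim.
  assert (NS := near_D_prim b X2 g Rg : near (fun p => D X2 S p = g p)).
  set (S3 := fun p => S (pr X0 p, pr X1 p, pr X3 p, 0)).
  assert (RS3 : Reg b S3) by (apply Reg_comp; auto using Reg_pr, Reg_const).
  set (F := fun p => S3 p - F2 h p).
  assert (RF : Reg b F) by now apply Reg_minus.
  destruct (implicit_function b F RF) as (ta & Rta & ta0 & _ & Nta & _).
  { unfold F, S3. change (S orig - h 0 0 = 0). rewrite S0, h0. ring. }
  { unfold F. rewrite (D_minus X3 S3 (F2 h));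
      [|exact (near_orig _ (Reg_dif _ _ RS3) X3)|exact (near_orig _ (Reg_dif _ _ Rh) X3)].
    assert (E := near_orig _ (near_D_comp b S (pr X0) (pr X1) (pr X3) (fun _ => 0) RS (Reg_pr b X0)
      (Reg_pr b X1) (Reg_pr b X3) (Reg_const b 0) eq_refl eq_refl eq_refl eq_refl) X3).
    cbv zeta in E. change (D X3 S3 orig = D X0 S orig * D X3 (pr X0) orig
      + (D X1 S orig * D X3 (pr X1) orig + (D X2 S orig * D X3 (pr X3) orig
      + D X3 S orig * D X3 (fun _ => 0) orig))) in E.
    rewrite E, !D_pr, D_const, (near_orig _ NS). unfold g. rewrite Y0.
    rewrite (D_indep X3 (F2 h)) by reflexivity.
    unfold delta. repeat (destruct ix_dec; try easy). 
    replace (_ - 0) with (z 0 * mu orig) by ring. now apply Rmult_integral_contrapositive. }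
  set (T := fun p : pt => ta (pr X0 p, pr X1 p, 0, 0)).
  assert (RT : Reg b T) by (apply Reg_comp; auto using Reg_pr, Reg_const).
  assert (T0 : T orig = 0) by exact ta0.
  set (G := fun p : pt => (pr X0 p, pr X1 p, T p, 0)).
  assert (RC : forall f, Reg b f -> Reg b (fun p => f (G p))).
  { intros f Hf. apply Reg_comp; auto using Reg_pr, Reg_const. }
  assert (NG : forall P, near P -> near (fun p => P (G p))).
  { intros P HP. apply near_comp with (1 := HP) (b := b); auto using Reg_pr, Reg_const. }
  assert (G0 : G orig = orig) by (unfold G; now rewrite T0).
  assert (DG : forall f, Reg b f -> near (fun p => forall i,
    D i (fun q => f (G q)) p = D X0 f (G p) * delta X0 i + D X1 f (G p) * delta X1 i + D X2 f (G p) * D i T p)).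
  { intros f Hf. generalize (near_D_comp b f (pr X0) (pr X1) T (fun _ => 0) Hf (Reg_pr b X0)
      (Reg_pr b X1) RT (Reg_const b 0) eq_refl eq_refl T0 eq_refl).
    apply near_imp. intros p H i. specialize (H i). cbv zeta in H. rewrite !D_pr, D_const in H.
    unfold G at 1. rewrite H. fold (G p). ring. }
  set (f1 := fun x y => Y (G (x, y, 0, 0))). set (f2 := fun x y => W (G (x, y, 0, 0))).
  assert (E1 : F2 f1 = fun p => Y (G p)) by reflexivity.
  assert (E2 : F2 f2 = fun p => W (G p)) by reflexivity.
  assert (Nh : near (fun p => S (G p) = F2 h p)).
  { generalize (near_comp _ b (pr X0) (pr X1) (fun _ => 0) (fun _ => 0) Nta (Reg_pr b X0)
      (Reg_pr b X1) (Reg_const b 0) (Reg_const b 0) eq_refl eq_refl eq_refl eq_refl).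
    apply near_imp. intros p E. change (S (G p) - F2 h p = 0) in E. lra. }
  exists f1, f2. rewrite E1, E2. split; [now apply RC|]. split; [now apply RC|].
  split; [change (Y (G orig) = 0); now rewrite G0|].
  split; [change (W (G orig) = 0); now rewrite G0|].
  split; [|split].
  - rewrite (near_orig _ (DG Y RY)), G0, (near_orig _ NC), W0.
    assert (NY : near (fun p => pr X2 p = 0 -> Y p = pr X0 p))
      by (revert NI; apply near_imp; intros p K Z; now apply K).
    assert (K := near_orig _ (near_D_slice _ _ X0 X2 ltac:(easy) NY) eq_refl).
    rewrite K, D_pr. unfold delta. repeat (destruct ix_dec; try easy). lra.
  - generalize (NG _ NB). apply near_imp. intros p E. exact E.
  - assert (NBi := energy_derivative b s k Y W RY RW NB).
    generalize (near_and _ _ (near_and _ _ (NG _ (near_and _ _ NP (near_and _ _ NC ND)))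
        (NG _ (near_and _ _ NS (near_and _ _ (NBi X0) (NBi X1)))))
      (near_and _ _ (near_and _ _ (DG Y RY) (DG W RW))
        (near_and _ _ (DG S RS) (near_and _ _ (near_D _ _ X0 Nh) (near_D _ _ X1 Nh))))).
    apply near_imp. intros p [[[P1 [P2 P3]] [P4 [P5 P6]]] [[Q1 Q2] [Q3 [Q4 Q5]]]].
    revert P1 P5 P6. unfold jac, ham. rewrite <- Q4, <- Q5, !Q1, !Q2, !Q3, P2, P3, P4. unfold g.
    change (pr X0 (G p)) with (pr X0 p). change (pr X1 (G p)) with (pr X1 p).
    unfold delta. repeat (destruct ix_dec; try easy). intros P1 P5 P6.
    set (K := s * INR k * pr X0 p ^ (k - 1)) in *. set (zz := z (Y (G p))) in *.
    transitivity (zz * (D X0 Y (G p) * D X1 W (G p) - D X1 Y (G p) * D X0 W (G p))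
      + zz * mu (G p) * (D X0 T p * (2 * W (G p) * D X1 W (G p) + s * INR k * Y (G p) ^ (k - 1) * D X1 Y (G p))
        - D X1 T p * (2 * W (G p) * D X0 W (G p) + s * INR k * Y (G p) ^ (k - 1) * D X0 Y (G p)))).
    + ring.
    + rewrite P1, P5, P6. ring.
Qed.

(** The abscissa [Z] in which [z(x) dx] becomes [dZ]. *)
Lemma antiderivative_inverse b z : Reg b (F1 z) -> z 0 <> 0 ->
  exists Z Zi, Reg b (F1 Z) /\ Reg b (F1 Zi) /\ Z 0 = 0 /\
    near (fun p => Derive Z (pr X0 p) = z (pr X0 p)) /\ near (fun p => Zi (Z (pr X0 p)) = pr X0 p).
Proof.
  intros Rz z0. set (P := prim X0 (F1 z)). assert (RP : Reg b P) by now apply Reg_prim.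
  set (Z := fun x => P (x, 0, 0, 0)).
  assert (RZ : Reg b (F1 Z)) by (apply (Reg_comp b P (pr X0)); auto using Reg_pr, Reg_const).
  assert (Z0 : Z 0 = 0) by apply orig_prim.
  assert (NP := near_D_prim b X0 (F1 z) Rz).
  assert (NZ : near (fun p => Derive Z (pr X0 p) = z (pr X0 p))).
  { generalize (near_comp _ b (pr X0) (fun _ => 0) (fun _ => 0) (fun _ => 0) NP (Reg_pr b X0)
      (Reg_const b 0) (Reg_const b 0) (Reg_const b 0) eq_refl eq_refl eq_refl eq_refl).
    apply near_imp. intros p E. exact E. }
  assert (RZ3 : Reg b (fun p => Z (pr X3 p))) by (apply Reg_F1_comp; auto using Reg_pr).
  set (F := fun p => Z (pr X3 p) - pr X0 p).
  assert (RF : Reg b F) by (apply Reg_minus; auto using Reg_pr).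
  destruct (implicit_function b F RF) as (a & Ra & a0 & Ia & _ & Ua).
  { unfold F. simpl. rewrite Z0. ring. }
  { unfold F. rewrite (D_minus X3 (fun p => Z (pr X3 p)) (pr X0));
      [|exact (near_orig _ (Reg_dif _ _ RZ3) X3)|apply dif_pr].
    rewrite (near_orig _ (near_D_F1_comp b Z (pr X3) RZ (Reg_pr b X3) eq_refl)), !D_pr.
    change (pr X3 orig) with (pr X0 orig). rewrite (near_orig _ NZ). simpl.
    unfold delta. repeat (destruct ix_dec; try easy). lra. }
  exists Z, (fun x => a (x, 0, 0, 0)). split; [exact RZ|]. split.
  { apply (Reg_comp b a (pr X0)); auto using Reg_pr, Reg_const. }
  split; [exact Z0|]. split; [exact NZ|].
  generalize (near_comp _ b (F1 Z) (fun _ => 0) (fun _ => 0) (pr X0) Ua RZ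
    (Reg_const b 0) (Reg_const b 0) (Reg_pr b X0) Z0 eq_refl eq_refl eq_refl).
  apply near_imp. intros p E. rewrite <- (Ia (Z (pr X0 p), 0, 0, 0) (pr X0 p)). symmetry. apply E.
  unfold F, F1. cbn. ring.
Qed.

(** By [leaf_map] the area form [f dxi /\ dx] is the pull-back of [z(x) dxi /\ dx]
    under a map that preserves the energy, and the substitution of [Z] for [x] turns
    the latter form into the canonical one. *)
Lemma leaf_coordinates b s k f z h : (2 <= k)%nat -> Reg b (F1 z) -> Reg b (F2 h) ->
  near (fun p => F2 f p = z (pr X0 p) + ham s k (F2 h) p) -> f 0 0 <> 0 ->
  exists n1 n2 V, Reg b (F2 n1) /\ Reg b (F2 n2) /\ Reg b (F1 V) /\ n1 0 0 = 0 /\ n2 0 0 = 0 /\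
    D X0 (F2 n1) orig <> 0 /\ near (fun p => jac (F2 n1) (F2 n2) p = F2 f p) /\
    near (fun p => F2 n2 p ^ 2 + V (F2 n1 p) = pr X1 p ^ 2 + s * pr X0 p ^ k).
Proof.
  intros Hk Rz Rh Nf f0.
  assert (z0 : z 0 <> 0).
  { intros E. apply f0. change (F2 f orig = 0). rewrite (near_orig _ Nf). unfold ham.
    simpl. rewrite E, pow_i by lia. ring. }
  set (h' := fun x y => h x y - h 0 0).
  assert (Rh' : Reg b (F2 h')) by (apply (Reg_minus b (F2 h)); auto using Reg_const).
  assert (Nh : near (fun p => ham s k (F2 h') p = ham s k (F2 h) p)).
  { generalize (Reg_dif _ _ Rh). apply near_imp. intros p Hp. unfold ham.
    change (F2 h') with (fun q => F2 h q - h 0 0).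
    rewrite !(D_minus _ (F2 h) (fun _ => h 0 0)), !D_const; auto using dif_const. ring. }
  destruct (leaf_map b s k z h' Hk Rz Rh' z0 ltac:(unfold h'; ring))
    as (f1 & f2 & R1 & R2 & f10 & f20 & D1 & NE & NJ).
  destruct (antiderivative_inverse b z Rz z0) as (Z & Zi & RZ & RZi & Z0 & NZ & NZi).
  assert (f10' : F2 f1 orig = 0) by exact f10.
  assert (C1 : forall P, near (fun p => P (pr X0 p)) -> near (fun p => P (F2 f1 p))).
  { intros P HP. generalize (near_comp _ b (F2 f1) (fun _ => 0) (fun _ => 0) (fun _ => 0) HP R1
      (Reg_const b 0) (Reg_const b 0) (Reg_const b 0) f10 eq_refl eq_refl eq_refl).
    apply near_imp. intros p E. exact E. }
  assert (DZ : near (fun p => forall i, D i (F2 (fun x y => Z (f1 x y))) p = z (F2 f1 p) * D i (F2 f1) p)).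
  { generalize (near_and _ _ (near_D_F1_comp b Z (F2 f1) RZ R1 f10) (C1 (fun x => Derive Z x = z x) NZ)).
    apply near_imp. intros p [E1 E2] i. rewrite <- E2. apply E1. }
  exists (fun x y => Z (f1 x y)), f2, (fun X => s * Zi X ^ k).
  split; [exact (Reg_F1_comp b Z (F2 f1) RZ R1 f10)|]. split; [exact R2|].
  split; [apply (Reg_mult b (fun _ => s)); [apply Reg_const|now apply (Reg_pow b (F1 Zi))]|].
  split; [now rewrite f10|]. split; [exact f20|]. split; [|split].
  - rewrite (near_orig _ DZ), f10'. now apply Rmult_integral_contrapositive.
  - generalize (near_and _ _ (near_and _ _ DZ NJ) (near_and _ _ Nf Nh)).
    apply near_imp. intros p [[E1 E2] [E3 E4]]. rewrite E3, <- E4, <- E2.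
    unfold jac. rewrite !E1. ring.
  - generalize (near_and _ _ NE (C1 (fun x => Zi (Z x) = x) NZi)). apply near_imp. intros p [E1 E2].
    rewrite <- E1. change (F2 (fun x y => Z (f1 x y)) p) with (Z (F2 f1 p)). now rewrite E2.
Qed.

(** * The normal form *)

Lemma homological r s k f : s = 1 \/ s = -1 -> (2 <= k)%nat -> Reg (is_analytic r) (F2 f) ->
  exists h z, Reg (is_analytic r) (F2 h) /\ Reg (is_analytic r) (F1 z) /\
    near (fun p => F2 f p = z (pr X0 p) + ham s k (F2 h) p).
Proof.
  destruct r; intros; [apply smooth_homological|apply analytic_homological]; auto; lia.
Qed.

(** [omega] is an area form, hence multiplied by the Jacobian determinant. *)
Lemma symplectic_of_jac phi q : jac (emb (fun q => fst (phi q))) (emb (fun q => snd (phi q)))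
  (fst q, snd q, 0, 0) = 1 -> symplectic_at phi q.
Proof.
  destruct q as [x y]. intros J v w. unfold jac in J.
  unfold omega, tangent_map, differential2. cbn [fst snd] in *.
  change (Derive (fun x0 => fst (phi (x0, y))) x) with (D X0 (emb (fun q => fst (phi q))) (x, y, 0, 0)).
  change (Derive (fun y0 => fst (phi (x, y0))) y) with (D X1 (emb (fun q => fst (phi q))) (x, y, 0, 0)).
  change (Derive (fun x0 => snd (phi (x0, y))) x) with (D X0 (emb (fun q => snd (phi q))) (x, y, 0, 0)).
  change (Derive (fun y0 => snd (phi (x, y0))) y) with (D X1 (emb (fun q => snd (phi q))) (x, y, 0, 0)).
  transitivity ((snd v * fst w - fst v * snd w) * 1); [rewrite <- J|]; ring.
Qed.

Theorem theorem1p1 :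
  forall (r : regularity) (k : nat) (H : R * R -> R),
    (2 <= k)%nat ->
    (forall p : R * R, regular_at2 r H p) ->
    has_A_singularity r k H ->
    exists (phi : R * R -> R * R) (V : R -> R),
      local_diffeo r phi /\
      locally origin (symplectic_at phi) /\
      regular_at1 r V 0 /\
      locally origin (fun p => H (phi p) = snd p ^ 2 + V (fst p)).
Proof.
  intros r k H Hk _ (chi & s & (chi0 & [Rc1 Rc2] & psi & psi0 & [Rp1 Rp2] & Npc & Ncp) & Hs & NH).
  set (b := is_analytic r).
  set (c1 := fun x y => fst (chi (x, y))). set (c2 := fun x y => snd (chi (x, y))).
  set (p1 := fun x y => fst (psi (x, y))). set (p2 := fun x y => snd (psi (x, y))).
  assert (C1 : Reg b (F2 c1)) by exact (Reg_of_regular _ _ Rc1).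
  assert (C2 : Reg b (F2 c2)) by exact (Reg_of_regular _ _ Rc2).
  assert (P1 : Reg b (F2 p1)) by exact (Reg_of_regular _ _ Rp1).
  assert (P2 : Reg b (F2 p2)) by exact (Reg_of_regular _ _ Rp2).
  assert (c10 : c1 0 0 = 0) by (unfold c1; change (0, 0) with origin; now rewrite chi0).
  assert (c20 : c2 0 0 = 0) by (unfold c2; change (0, 0) with origin; now rewrite chi0).
  assert (p10 : p1 0 0 = 0) by (unfold p1; change (0, 0) with origin; now rewrite psi0).
  assert (p20 : p2 0 0 = 0) by (unfold p2; change (0, 0) with origin; now rewrite psi0).
  assert (Npc' : near (fun p => p1 (F2 c1 p) (F2 c2 p) = pr X0 p /\ p2 (F2 c1 p) (F2 c2 p) = pr X1 p)).
  { apply near_of_locally in Npc. revert Npc. apply near_imp. intros p E.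
    unfold p1, p2, F2, c1, c2. now rewrite <- surjective_pairing, E. }
  assert (Ncp' : near (fun p => c1 (F2 p1 p) (F2 p2 p) = pr X0 p /\ c2 (F2 p1 p) (F2 p2 p) = pr X1 p)).
  { apply near_of_locally in Ncp. revert Ncp. apply near_imp. intros p E.
    unfold p1, p2, F2, c1, c2. now rewrite <- surjective_pairing, E. }
  assert (NH' : near (fun p => H (pr X0 p, pr X1 p) = F2 c2 p ^ 2 + s * F2 c1 p ^ k)).
  { exact (near_of_locally _ NH). }
  (* the canonical area form in the coordinates given by [chi], whose inverse is [psi],
     is [f dxi /\ dx] *)
  set (f := fun x y => jac (F2 p1) (F2 p2) (x, y, 0, 0)).
  assert (Rf : Reg b (F2 f)).
  { change (F2 f) with (jac (F2 p1) (F2 p2)). 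
    apply Reg_minus; apply Reg_mult; now apply Reg_D. }
  assert (f0 : f 0 0 <> 0).
  { assert (J1 := near_orig _ (near_jac_comp b c1 c2 (F2 p1) (F2 p2) C1 C2 P1 P2 p10 p20)).
    assert (J2 := near_orig _ (near_jac_ext _ _ _ _ 
      (near_imp _ _ (fun p => @proj1 _ _) Ncp') (near_imp _ _ (fun p => @proj2 _ _) Ncp'))).
    cbv beta in J1, J2. rewrite J1 in J2. intros E.
    change (f 0 0) with (jac (F2 p1) (F2 p2) orig) in E. rewrite E, jac_pr in J2. lra. }
  destruct (homological r s k f Hs Hk Rf) as (h & z & Rh & Rz & Nf).
  destruct (leaf_coordinates b s k f z h Hk Rz Rh Nf f0)
    as (n1 & n2 & V & N1 & N2 & RV & n10 & n20 & Dn & Jn & En).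
  destruct (inverse_function b n1 n2 N1 N2 n10 n20 Dn) as (g1 & g2 & G1 & G2 & g10 & g20 & Ing & Ign).
  { rewrite (near_orig _ Jn). exact f0. }
  assert (AtG : forall P, near P -> near (fun p => P (F2 g1 p, F2 g2 p, 0, 0))).
  { intros P HP. apply near_comp with (1 := HP) (b := b); auto using Reg_const. }
  (* [psi] transports [f dxi /\ dx] to the canonical form, and so does the map with
     inverse [(g1, g2)] *)
  exists (fun q => psi (g1 (fst q) (snd q), g2 (fst q) (snd q))), V.
  assert (Fm1 : Reg b (fun p => p1 (F2 g1 p) (F2 g2 p))) by now apply Reg_F2_comp.
  assert (Fm2 : Reg b (fun p => p2 (F2 g1 p) (F2 g2 p))) by now apply Reg_F2_comp.
  assert (F10 : p1 (F2 g1 orig) (F2 g2 orig) = 0).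
  { change (p1 (g1 0 0) (g2 0 0) = 0). now rewrite g10, g20. }
  assert (F20 : p2 (F2 g1 orig) (F2 g2 orig) = 0).
  { change (p2 (g1 0 0) (g2 0 0) = 0). now rewrite g10, g20. }
  split; [|split; [|split]].
  - split; [cbn; rewrite g10, g20; exact psi0|]. split; [split; apply regular_of_Reg; assumption|].
    exists (fun q => (n1 (fst (chi q)) (snd (chi q)), n2 (fst (chi q)) (snd (chi q)))).
    split; [rewrite chi0; cbn; now rewrite n10, n20|].
    split; [split; apply regular_of_Reg; now apply (Reg_F2_comp b _ (F2 c1) (F2 c2))|]. split.
    + apply locally_of_near. generalize (near_and _ _ (AtG _ Ncp') Ing).
      apply near_imp. intros p [[E1 E2] [E3 E4]]. cbn [fst snd].
      change (c1 (p1 (F2 g1 p) (F2 g2 p)) (p2 (F2 g1 p) (F2 g2 p)) = F2 g1 p) in E1.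
      change (c2 (p1 (F2 g1 p) (F2 g2 p)) (p2 (F2 g1 p) (F2 g2 p)) = F2 g2 p) in E2.
      unfold c1, p1, p2 in E1. unfold c2, p1, p2 in E2. rewrite <- surjective_pairing in E1, E2.
      change (g1 (pr X0 p) (pr X1 p)) with (F2 g1 p). change (g2 (pr X0 p) (pr X1 p)) with (F2 g2 p).
      now rewrite E1, E2, E3, E4.
    + apply locally_of_near. generalize (near_and _ _ Npc'
        (near_comp _ b (F2 c1) (F2 c2) (fun _ => 0) (fun _ => 0) Ign C1 C2 (Reg_const b 0)
          (Reg_const b 0) c10 c20 eq_refl eq_refl)).
      apply near_imp. intros p [[E1 E2] [E3 E4]]. cbn [fst snd].
      change (g1 (n1 (F2 c1 p) (F2 c2 p)) (n2 (F2 c1 p) (F2 c2 p)) = F2 c1 p) in E3.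
      change (g2 (n1 (F2 c1 p) (F2 c2 p)) (n2 (F2 c1 p) (F2 c2 p)) = F2 c2 p) in E4.
      change (fst (chi (pr X0 p, pr X1 p))) with (F2 c1 p).
      change (snd (chi (pr X0 p, pr X1 p))) with (F2 c2 p).
      rewrite E3, E4, (surjective_pairing (psi _)). f_equal; assumption.
  - apply locally_of_near.
    generalize (near_and _ _ (near_and _ _ 
      (near_jac_comp b p1 p2 (F2 g1) (F2 g2) P1 P2 G1 G2 g10 g20)
      (near_jac_comp b n1 n2 (F2 g1) (F2 g2) N1 N2 G1 G2 g10 g20)) (near_and _ _ (AtG _ Jn)
      (near_jac_ext _ _ _ _ (near_imp _ _ (fun p => @proj1 _ _) Ing) 
        (near_imp _ _ (fun p => @proj2 _ _) Ing)))).
    apply near_imp. intros p [[J1 J2] [J3 J4]]. apply symplectic_of_jac.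
    change (jac (fun p => p1 (F2 g1 p) (F2 g2 p)) (fun p => p2 (F2 g1 p) (F2 g2 p)) p = 1).
    rewrite J1, <- (jac_pr p), <- J4, J2, J3. reflexivity.
  - now apply regular1_of_Reg.
  - apply locally_of_near. generalize (near_and _ _ 
      (near_and _ _ (near_comp _ b (fun p => p1 (F2 g1 p) (F2 g2 p)) (fun p => p2 (F2 g1 p) (F2 g2 p))
        (fun _ => 0) (fun _ => 0) NH' Fm1 Fm2 (Reg_const b 0) (Reg_const b 0)
        F10 F20 eq_refl eq_refl)
        (AtG _ Ncp')) (near_and _ _ (AtG _ En) Ing)).
    apply near_imp. intros p [[E1 [E2 E3]] [E4 [E5 E6]]]. cbn [fst snd].
    change (H (p1 (F2 g1 p) (F2 g2 p), p2 (F2 g1 p) (F2 g2 p)) =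
      c2 (p1 (F2 g1 p) (F2 g2 p)) (p2 (F2 g1 p) (F2 g2 p)) ^ 2 +
      s * c1 (p1 (F2 g1 p) (F2 g2 p)) (p2 (F2 g1 p) (F2 g2 p)) ^ k) in E1.
    change (c1 (p1 (F2 g1 p) (F2 g2 p)) (p2 (F2 g1 p) (F2 g2 p)) = F2 g1 p) in E2.
    change (c2 (p1 (F2 g1 p) (F2 g2 p)) (p2 (F2 g1 p) (F2 g2 p)) = F2 g2 p) in E3.
    change (n2 (F2 g1 p) (F2 g2 p) ^ 2 + V (n1 (F2 g1 p) (F2 g2 p)) = F2 g2 p ^ 2 + s * F2 g1 p ^ k) in E4.
    rewrite (surjective_pairing (psi _)).
    change (H (p1 (F2 g1 p) (F2 g2 p), p2 (F2 g1 p) (F2 g2 p)) = pr X1 p ^ 2 + V (pr X0 p)).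
    rewrite E1, E2, E3, <- E4, E5, E6. reflexivity.
Qed.
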